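(* Let $1\le i<j\le n$ with $j-i\le p+1$. Then for every integer $R>R_{i,j}$ prime to $p$, \[ v_{K_R}(s_{R,i,j})=v_{K_R}\big(s^{[1]}_{R,i,j}\big)=-q\,r_{i,j}+R . \]
   Context: Let $p$ be a prime and $K$ a complete discrete valuation field of characteristic $p$ with algebraically closed residue field $k$, normalized valuation $v_K$. Fix $t\in K$ with $v_K(t)=-1$. Every $x\in K$ has a unique expansion $x=\sum_{l\ge v_K(x)}x_lt^{-l}$ with $x_l\in k$; put $\mathrm{coef}_{K,l}(x)=x_l$ (and $0$ for $l<v_K(x)$). For a field $F$ of characteristic $p$, $UT_n(F)$ (resp. $NT_n(F)$) denotes the upper triangular $n\times n$ matrices over $F$ with all diagonal entries $1$ (resp. $0$); for a matrix $X$, $X^{(p^m)}$ is obtained by raising every entry to the $p^m$-th power. For $X=(x_{i,j})$ upper triangular with constant diagonal in $\mathbb F_p$ over a field with valuation $v$, set $v(X)=\min_{1\le i<j\le n}v(x_{i,j})/(j-i)$. Let $n\ge2$ and $L/K$ a totally wildly ramified finite Galois extension with $\mathrm{Gal}(L/K)\cong UT_n(\mathbb F_p)$. Fix $A=(a_{i,j})\in UT_n(K)$ such that $\mathrm{coef}_{K,l}(a_{i,j})=0$ for all $1\le i<j\le n$ and all $l\in p\mathbb Z\cup\mathbb Z_{\ge0}$, and such that the equation $X^{(p)}A=X$ has a solution $\Theta=(\theta_{i,j})\in UT_n(L)$ with $L=K(\theta_{i,j}:1\le i<j\le n)$; fix such $\Theta$. Put $m_A=-v_K(A)$. For $1\le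 i<j\le n$ let $L_{i,j}=K(\theta_{l,m}: i\le l<m\le j)$ (a Galois extension of $K$) and $r_{i,j}$ the largest upper ramification break of $L_{i,j}/K$; set $r_{i,i}=-1$. Fix an integer $N>\log_p\big(n(p^{n(n-1)/2}+1)m_A+p\big)+\frac{n(n-1)}2$ and let $q=p^N$. For a positive integer $R$ prime to $p$ let $K_R=K(T)$ with $T^q+T^{q-1}=t^R$ (a totally ramified separable extension of degree $q$), with normalized valuation $v_{K_R}$. Let $t_R\in\overline K$ be the $qR$-th root of $t^R(1+T^{-1})^{-1}$ congruent to $t^{1/q}$ modulo $t^{1/q}\mathfrak m_{\overline K}$; then $t_R\in K_R$, $t_R^R=T$, $v_{K_R}(t_R)=-1$. Let $\iota_R:K\to K_R$ be the ring isomorphism $\sum_l x_lt^{-l}\mapsto\sum_l x_l^{1/q}t_R^{-l}$, applied entrywise to matrices. Put $A_R=\iota_R(A)$, $W_{R,0}=I$, $W_{R,e}=A_R^{(p^{e-1})}W_{R,e-1}$ for $1\le e\le N$, with entries $w_{R,e,i,j}$, and let $w^*_{R,e,i,j}$ be the entries of $W_{R,e}^{-1}$. Let $S_R=(W_{R,N}^{(p)})^{-1}AW_{R,N-1}^{(p)}-I=(s_{R,i,j})\in NT_n(K_R)$. For $1\le i<j\le n$ put $m_{i,j}=-v_K(a_{i,j})$ ($=-\infty$ if $a_{i,j}=0$), $m_{A,i,j}=-\min_{i\le l<m\le j}v_K(a_{l,m})/(m-l)$ and $R_{i,j}=q\max(r_{i,j-1},r_{i+1,j})+(j-i)m_{A,i,j}$.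 Further let $a^{[1]}_{i,j}=\sum_{l\ge-m_{i,j}}\mathrm{coef}_{K,l}(a_{i,j})\,(-l/R)\,t_R^{-ql-R}\in K_R$, where $-l/R$ is read as an element of $\mathbb F_p\subset k$, and $s^{[1]}_{R,i,j}=\sum_{i\le i'<j'\le j}(w^*_{R,N,i,i'})^p\,a^{[1]}_{i',j'}\,(w_{R,N-1,j',j})^p$. *)

(* Defs.v *)
From HB Require Import structures.
From mathcomp Require Import all_boot all_order all_algebra all_fingroup all_field.
From Stdlib Require Import ClassicalEpsilon.
Set Implicit Arguments. Unset Strict Implicit. Unset Printing Implicit Defensive.
Import Order.TTheory GRing.Theory Num.Theory.
Local Open Scope ring_scope.

Definition choose_prop {T : Type} (x0 : T) (P : T -> Prop) : T :=
  epsilon (inhabits x0) P.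
Definition asbool (P : Prop) : bool :=
  if excluded_middle_informative P then true else false.

(* Rational-valued (Krull) valuations on a field, recorded on nonzero   *)
(* elements; v 0 is irrelevant (all uses are guarded).                  *)
Section Valuation.
Variables (F : fieldType) (v : F -> rat).

Definition is_valuation : Prop :=
  (forall x y : F, x != 0 -> y != 0 -> v (x * y) = v x + v y) /\
  (forall x y : F, x != 0 -> y != 0 -> x + y != 0 ->
     Num.min (v x) (v y) <= v (x + y)).

(* "v(x) >= r", with the convention v(0) = +oo *)
Definition vge (x : F) (r : rat) : Prop := x = 0 \/ r <= v x.

Definition is_vgen (S : F -> Prop) (d : rat) : Prop :=
  0 < d /\ (forall x, S x -> x != 0 -> exists z : int, v x = z%:~R * d) /\
  (exists x, S x /\ x != 0 /\ v x = d).
Definition vgen (S : F -> Prop) : rat := choose_prop 1 (is_vgen S).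

Definition nval (S : F -> Prop) (x : F) : rat := v x / vgen S.

Definition slim (f : nat -> F) : F :=
  choose_prop 0 (fun y => forall M : rat, exists N0 : nat,
     forall N : nat, (N0 <= N)%N -> vge (y - \sum_(i < N) f i) M).

Definition v_complete (S : F -> Prop) : Prop :=
  forall u : nat -> F, (forall m, S (u m)) ->
  (forall M : rat, exists N0 : nat, forall a b : nat,
      (N0 <= a)%N -> (N0 <= b)%N -> vge (u a - u b) M) ->
  exists x, S x /\ forall M : rat, exists N0 : nat, forall a : nat,
      (N0 <= a)%N -> vge (u a - x) M.

Definition is_subfield (S : F -> Prop) : Prop :=
  S 0 /\ S 1 /\ (forall x y, S x -> S y -> S (x - y) /\ S (x * y)) /\
  (forall x, S x -> S x^-1).
End Valuation.

Definition gen_subfield (K F : fieldType) (f : K -> F) (T : F) (x : F) : Prop :=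
  forall S : F -> Prop, is_subfield S -> (forall a, S (f a)) -> S T -> S x.

(* t-adic expansions in K = k((1/t)), with k embedded in K by embk     *)
Section Expansion.
Variables (k K : fieldType) (embk : k -> K) (v : K -> rat) (t : K).

Definition expands (x : K) (c : int -> k) : Prop :=
  exists l0 : int, (forall l : int, l < l0 -> c l = 0) /\
  forall M : nat,
    vge v (x - \sum_(i < M) embk (c (l0 + i%:Z)) * t ^ (- (l0 + i%:Z)))
          (l0 + M%:Z)%:~R.

Definition coef (x : K) : int -> k := choose_prop (fun _ => 0) (expands x).
End Expansion.

Definition UTb (R : nzRingType) (n : nat) (X : 'M[R]_n) : bool :=
  [forall i : 'I_n, forall j : 'I_n,
     ((j < i)%N ==> (X i j == 0)) && ((i == j) ==> (X i j == 1))].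

Definition frobmx (R : nzRingType) (n : nat) (pm : nat) (X : 'M[R]_n) : 'M[R]_n :=
  map_mx (fun x => x ^+ pm) X.

Definition UTset (n p : nat) : {set {'GL_n['F_p]}} :=
  [set g : {'GL_n['F_p]} | UTb (GLval g)].

Definition pairs_in (n a b : nat) : seq ('I_n * 'I_n) :=
  filter (fun lm : 'I_n * 'I_n =>
     (a <= lm.1)%N && (lm.1 < lm.2)%N && (lm.2 <= b)%N) (enum {: 'I_n * 'I_n}).

Section Ramification.
Variables (K : fieldType) (L : splittingFieldType K) (w : L -> rat).

Definition ramgrp (E : {vspace L}) (m : nat) : {set gal_of E} :=
  [set s in ('Gal(E / 1%VS))%g | asbool (forall x, x \in E -> 0 <= w x ->
      vge w (s x - x) ((m.+1)%:R * vgen w (fun y => y \in E)))].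

Definition lbreak (E : {vspace L}) : nat :=
  choose_prop 0%N (fun b => (1 < #|ramgrp E b|)%N /\
                           forall m, (b < m)%N -> #|ramgrp E m| = 1%N).

Definition herbrand (E : {vspace L}) (m : nat) : rat :=
  (\sum_(1 <= i < m.+1) (#|ramgrp E i|)%:R) / (#|ramgrp E 0|)%:R.

Definition ubreak (E : {vspace L}) : rat := herbrand E (lbreak E).
End Ramification.

Section Setup.
Variables (k K : fieldType) (embk : k -> K) (v : K -> rat) (t : K).
Variables (L : splittingFieldType K) (w : L -> rat).
Variables (Om : fieldType) (emb0 : K -> Om) (vO : Om -> rat).
Variables (p n : nat) (A : 'M[K]_n) (Theta : 'M[L]_n).

(* L_{a,b} = K(theta_{l,m} : a <= l < m <= b)  (0-based indices) *)
Definition Lsub (a b : nat) : {vspace L} :=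
  <<1%VS & [seq Theta lm.1 lm.2 | lm <- pairs_in n a b]>>%VS.

Definition rbr (a b : nat) : rat := if (a < b)%N then ubreak w (Lsub a b) else -1.

(* max of a finite list of rationals (0 for the empty list, never used) *)
Definition maxl (s : seq rat) : rat := foldr Num.max (head 0 s) s.

(* m_{A,a,b} = - min_{a<=l<m<=b} v_K(a_{l,m})/(m-l) (entries 0 have v = +oo) *)
Definition mAab (a b : nat) : rat :=
  maxl [seq - v (A lm.1 lm.2) / ((lm.2 : nat) - lm.1)%:R
       | lm <- pairs_in n a b & A lm.1 lm.2 != 0].

Definition mA : rat := mAab 0 n.-1.

Definition Rij (q : nat) (i j : nat) : rat :=
  q%:R * Num.max (rbr i j.-1) (rbr i.+1 j) + (j - i)%:R * mAab i j.

Variables (q R : nat) (tR : Om).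

Definition qroot (a : k) : k := choose_prop 0 (fun b => b ^+ q = a).

(* iota_R : sum_l x_l t^{-l} |-> sum_l x_l^{1/q} t_R^{-l} *)
Definition iotaR (x : K) : Om :=
  if x == 0 then 0 else
  slim vO (fun i : nat => let l := Num.floor (v x) + i%:Z in
     emb0 (embk (qroot (coef embk v t x l))) * tR ^ (- l)).

Definition AR : 'M[Om]_n := map_mx iotaR A.

Fixpoint Wmx (e : nat) : 'M[Om]_n :=
  match e with
  | 0 => 1%:M
  | e'.+1 => frobmx (p ^ e') AR *m Wmx e'
  end.

Definition SR (N : nat) : 'M[Om]_n :=
  invmx (frobmx p (Wmx N)) *m map_mx emb0 A *m frobmx p (Wmx N.-1) - 1%:M.

Definition a1 (a : K) : Om :=
  if a == 0 then 0 else
  slim vO (fun i : nat => let l := Num.floor (v a) + i%:Z in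
     emb0 (embk (coef embk v t a l * ((- l)%:~R / R%:R))) *
     tR ^ (- (q%:Z * l) - R%:Z)).

Definition s1 (N : nat) (i j : 'I_n) : Om :=
  \sum_(i' : 'I_n | (i <= i')%N) \sum_(j' : 'I_n | (i' < j')%N && (j' <= j)%N)
     (invmx (Wmx N) i i') ^+ p * a1 (A i' j') * (Wmx N.-1 j' j) ^+ p.
End Setup.

(* Main.v *)
Require Import Defs.
From HB Require Import structures.
From mathcomp Require Import all_boot all_order all_algebra all_fingroup all_field.
From mathcomp Require Import ring lra zify.
From Stdlib Require Import Classical ClassicalEpsilon.
Set Implicit Arguments. Unset Strict Implicit. Unset Printing Implicit Defensive.
Import Order.TTheory GRing.Theory Num.Theory.
Local Open Scope ring_scope.
Import AEnd_FinGroup.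

(* Write d for the derivation t d/dt of K and of L, and Omega = (d Theta) Theta^-1.

   The isomorphism iota_R turns the inclusion of K in K_R into an endomorphism j of K,
   a separable perturbation of the q-Frobenius with d j = lam j d and v(lam) = R. Hence S_R
   comes from a matrix S over K, d S is lam times a conjugate of j(Omega), and s^[1]
   is the corresponding conjugate of Omega^(q). Both statements follow from the identity
   w(Omega_ij) = - r_ij, because the conjugating matrices only contribute lower
   entries, which are negligible since R > R_ij.

   The part of S_ij killed by d (exponents divisible by p) is bounded by the maximal weight
   of a path from i to j, where the edge (a, b) has weight -v(a_ab). If that maximum is not
   reached by the edge (i, j) alone, it is at most p times the lower breaks; this is where
   j - i <= p + 1 enters, through a pigeonhole argument modulo p.

   For w(Omega_ij) = - r_ij, take an auxiliary R and the best approximation f of theta_ij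
   modulo the field M generated by the lower entries. Then al = f - f^p lies in M,
   w(d al) = - r_ij, and J(al) - al^q differs from S_ij by a small element and some
   y - y^p, for an extension J of j close to the q-Frobenius. Comparing the valuations of
   the derivatives forces the equality. *)

(** Conjugations and differents cost multiples of m_A that do not depend on q: (j-i) m_A for the
    conjugating matrices, and at most [L:K] (j-i) m_A for twice the different of M. On the other
    side, the last ramification group of a block is central and acts through the corner only, so the
    breaks of proper sub-blocks stay at least 1/[L:K] below r_ij, and q multiplies this gap. The
    lower bound on N says that q/[L:K] exceeds the total loss n([L:K]+1) m_A plus p; the term p
    leaves room for an integer prime to p.

    That integer is the auxiliary R. It must exceed q rho + (j-i) m_A, where rho bounds the lower
    breaks, so that lower entries are harmless. It must also stay so far below q r_ij that d S_ij
    keeps a pole: if y - y^p has a pole of order m, then y has one of order m/p only, and d y cannot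
    disturb the leading term. The R of the theorem may violate the second condition, which is why
    the identity for Omega, where no R occurs, is settled separately, by induction on j - i. *)

Definition vgt (F : fieldType) (v : F -> rat) (x : F) (r : rat) : Prop :=
  x = 0 \/ r < v x.

(** * Valuations *)

Section ValuationTheory.
Variables (F : fieldType) (v : F -> rat) (Hv : is_valuation v).

Lemma valM x y : x != 0 -> y != 0 -> v (x * y) = v x + v y.
Proof. exact: Hv.1. Qed.

Lemma val1 : v 1 = 0.
Proof.
have := valM (oner_neq0 F) (oner_neq0 F); rewrite mulr1 => H.
by apply: (@addrI _ (v 1)); rewrite -H addr0.
Qed.

Lemma valN x : v (- x) = v x.
Proof.
have [->|x0] := eqVneq x 0; first by rewrite oppr0.
have n1 : (-1 : F) != 0 by rewrite oppr_eq0 oner_neq0.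
have h : v (-1) = 0.
  have := valM n1 n1; rewrite mulrNN mulr1 val1; lra.
by rewrite -mulN1r valM // h add0r.
Qed.

Lemma valV x : x != 0 -> v x^-1 = - v x.
Proof.
move=> x0; have := @valM x x^-1 x0; rewrite invr_eq0 mulfV // val1 => /(_ x0).
lra.
Qed.

Lemma val_div x y : x != 0 -> y != 0 -> v (x / y) = v x - v y.
Proof. by move=> x0 y0; rewrite valM ?invr_eq0 // valV. Qed.

Lemma valX x n : x != 0 -> v (x ^+ n) = n%:R * v x.
Proof.
move=> x0; elim: n => [|n IH]; first by rewrite expr0 val1 mul0r.
by rewrite exprS valM ?expf_neq0 // IH -[in RHS]natr1 mulrDl mul1r addrC.
Qed.

Lemma valXz x (z : int) : x != 0 -> v (x ^ z) = z%:~R * v x.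
Proof.
move=> x0; case: z => n; first by rewrite -exprnP valX.
by rewrite NegzE -exprnN valV ?expf_neq0 // valX // rmorphN mulNr.
Qed.

Lemma vge0 r : vge v 0 r. Proof. by left. Qed.
Lemma vgt0 r : vgt v 0 r. Proof. by left. Qed.
Hint Resolve vge0 vgt0 : core.

Lemma vge_val x : vge v x (v x). Proof. by right. Qed.

Lemma vgeE x r : x != 0 -> vge v x r -> r <= v x.
Proof. by move=> /eqP x0 []. Qed.

Lemma vgtE x r : x != 0 -> vgt v x r -> r < v x.
Proof. by move=> /eqP x0 []. Qed.

Lemma vge_le x r s : r <= s -> vge v x s -> vge v x r.
Proof. by move=> rs [->|h]; [left|right; apply: le_trans h]. Qed.

Lemma vgeW x r : vgt v x r -> vge v x r.
Proof. by case=> [->|h]; [left|right; apply: ltW]. Qed.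

Lemma vgt_lt x r s : r < s -> vge v x s -> vgt v x r.
Proof. by move=> rs [->|h]; [left|right; apply: lt_le_trans h]. Qed.

Lemma vgeNt x r : ~ vge v x r -> x != 0 /\ v x < r.
Proof.
move=> h; split; first by apply/eqP => x0; apply: h; left.
by rewrite ltNge; apply/negP => h'; apply: h; right.
Qed.

Lemma vgeD x y r : vge v x r -> vge v y r -> vge v (x + y) r.
Proof.
case=> [->|hx]; first by rewrite add0r.
case=> [->|hy]; first by rewrite addr0; right.
have [->|x0] := eqVneq x 0; first by rewrite add0r; right.
have [->|y0] := eqVneq y 0; first by rewrite addr0; right.
have [->|s0] := eqVneq (x + y) 0; first by left.
by right; apply: le_trans (Hv.2 _ _ x0 y0 s0); rewrite le_min hx.
Qed.

Lemma vgtD x y r : vgt v x r -> vgt v y r -> vgt v (x + y) r.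
Proof.
case=> [->|hx]; first by rewrite add0r.
case=> [->|hy]; first by rewrite addr0; right.
have [->|x0] := eqVneq x 0; first by rewrite add0r; right.
have [->|y0] := eqVneq y 0; first by rewrite addr0; right.
have [->|s0] := eqVneq (x + y) 0; first by left.
by right; apply: lt_le_trans (Hv.2 _ _ x0 y0 s0); rewrite lt_min hx.
Qed.

Lemma vgeN x r : vge v x r -> vge v (- x) r.
Proof. by case=> [->|h]; [rewrite oppr0|right; rewrite valN]. Qed.

Lemma vgtN x r : vgt v x r -> vgt v (- x) r.
Proof. by case=> [->|h]; [rewrite oppr0|right; rewrite valN]. Qed.

Lemma vgeB x y r : vge v x r -> vge v y r -> vge v (x - y) r.
Proof. by move=> hx hy; apply: vgeD => //; apply: vgeN. Qed.

Lemma vgtB x y r : vgt v x r -> vgt v y r -> vgt v (x - y) r.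
Proof. by move=> hx hy; apply: vgtD => //; apply: vgtN. Qed.

Lemma vgeM x y r s : vge v x r -> vge v y s -> vge v (x * y) (r + s).
Proof.
have [->|x0] := eqVneq x 0; first by rewrite mul0r.
have [->|y0] := eqVneq y 0; first by rewrite mulr0.
move=> /(vgeE x0) hx /(vgeE y0) hy; right; rewrite valM //; exact: lerD.
Qed.

Lemma vgtMr x y r s : vge v x r -> vgt v y s -> vgt v (x * y) (r + s).
Proof.
have [->|x0] := eqVneq x 0; first by rewrite mul0r.
have [->|y0] := eqVneq y 0; first by rewrite mulr0.
move=> /(vgeE x0) hx /(vgtE y0) hy; right; rewrite valM //; exact: ler_ltD.
Qed.

Lemma vgtMl x y r s : vgt v x r -> vge v y s -> vgt v (x * y) (r + s).
Proof. by move=> hx hy; rewrite mulrC addrC; apply: vgtMr. Qed.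

Lemma vgeX x r n : vge v x r -> vge v (x ^+ n) (n%:R * r).
Proof.
move=> h; elim: n => [|n IH]; first by rewrite mul0r expr0; right; rewrite val1.
by rewrite exprS -natr1 mulrDl mul1r addrC; apply: vgeM.
Qed.

Lemma vgeX0 x n : vge v x 0 -> vge v (x ^+ n) 0.
Proof. by move=> h; have := vgeX n h; rewrite mulr0. Qed.

Lemma vgtX x r n : (0 < n)%N -> vgt v x r -> vgt v (x ^+ n) (n%:R * r).
Proof.
case: n => // n _ h; rewrite exprS -natr1 mulrDl mul1r addrC.
by apply: vgtMl => //; apply: vgeX; apply: vgeW.
Qed.

Lemma vge_sum (I : Type) (s : seq I) (P : pred I) (G : I -> F) r :
  (forall i, P i -> vge v (G i) r) -> vge v (\sum_(i <- s | P i) G i) r.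
Proof. by move=> h; apply: (big_ind (fun x => vge v x r)) => // x y; apply: vgeD. Qed.

Lemma vgt_sum (I : Type) (s : seq I) (P : pred I) (G : I -> F) r :
  (forall i, P i -> vgt v (G i) r) -> vgt v (\sum_(i <- s | P i) G i) r.
Proof. by move=> h; apply: (big_ind (fun x => vgt v x r)) => // x y; apply: vgtD. Qed.

Lemma val_prod (I : eqType) (s : seq I) (G : I -> F) :
  (forall i, i \in s -> G i != 0) ->
  v (\prod_(i <- s) G i) = \sum_(i <- s) v (G i).
Proof.
elim: s => [|a s IH] h; first by rewrite !big_nil val1.
rewrite !big_cons valM ?IH //; last 2 first.
- by apply: h; rewrite mem_head.
- rewrite prodf_seq_neq0; apply/allP => i is_; apply/implyP => _.
  by apply: h; rewrite inE is_ orbT.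
by move=> i is_; apply: h; rewrite inE is_ orbT.
Qed.

Lemma val_addl x y : x != 0 -> vgt v y (v x) -> x + y != 0 /\ v (x + y) = v x.
Proof.
move=> x0 hy; have s0 : x + y != 0.
  apply/eqP => /eqP; rewrite addr_eq0 => /eqP xy.
  case: hy => [y0|]; first by rewrite y0 oppr0 in xy; rewrite xy eqxx in x0.
  by rewrite xy valN ltxx.
split => //; apply/eqP; rewrite eq_le.
have ge : vge v (x + y) (v x).
  by apply: vgeD; [right|apply: vgeW].
rewrite (vgeE s0 ge) andbT leNgt; apply/negP => h.
have : vgt v (x + y - y) (v x) by apply: vgtB => //; right.
by rewrite addrK => /(vgtE x0); rewrite ltxx.
Qed.

Lemma val_subl x y : x != 0 -> vgt v (x - y) (v x) -> y != 0 /\ v y = v x.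
Proof.
move=> x0 h; have := @val_addl x (y - x) x0; rewrite [x + _]addrC subrK; apply.
by rewrite -opprB; apply: vgtN.
Qed.

Lemma vge_all_eq0 x : (forall M : rat, vge v x M) -> x = 0.
Proof.
move=> h; apply/eqP; apply: contraT => x0.
have := vgeE x0 (h (v x + 1)); lra.
Qed.

Lemma vge_natr n : vge v n%:R 0.
Proof.
elim: n => [|n IH]; first by left.
by rewrite -natr1; apply: vgeD => //; right; rewrite val1.
Qed.

Lemma vgeZl x y r : vge v x 0 -> vge v y r -> vge v (x * y) r.
Proof. by move=> hx hy; rewrite -[r]add0r; apply: vgeM. Qed.

Lemma vgeZr x y r : vge v x r -> vge v y 0 -> vge v (x * y) r.
Proof. by move=> hx hy; rewrite -[r]addr0; apply: vgeM. Qed.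

Lemma vge_natl n x r : vge v x r -> vge v (n%:R * x) r.
Proof. by move=> h; apply: vgeZl => //; apply: vge_natr. Qed.

Lemma vge_unit1D e n : vge v e 0 -> vge v ((1 + e) ^+ n) 0.
Proof.
move=> he; rewrite -[0](mulr0 n%:R); apply: vgeX; apply: vgeD => //.
by right; rewrite val1.
Qed.

Lemma vge_expr1D e n r : 0 <= r -> vge v e r -> vge v ((1 + e) ^+ n - 1) r.
Proof.
move=> r0 he; elim: n => [|n IH]; first by rewrite expr0 subrr.
have -> : (1 + e) ^+ n.+1 - 1 = ((1 + e) ^+ n - 1) + (1 + e) ^+ n * e.
  by rewrite exprSr; ring.
apply: vgeD => //; apply: vgeZl => //; apply: vge_unit1D.
exact: vge_le he.
Qed.

Lemma expr1D_lin e n r : 0 <= r -> vge v e r ->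
  vge v ((1 + e) ^+ n - 1 - n%:R * e) (r + r).
Proof.
move=> r0 he; elim: n => [|n IH]; first by rewrite expr0 mul0r subr0 subrr.
have -> : (1 + e) ^+ n.+1 - 1 - n.+1%:R * e =
  ((1 + e) ^+ n - 1 - n%:R * e) + ((1 + e) ^+ n - 1) * e.
  by rewrite exprSr -natr1; ring.
by apply: vgeD => //; apply: vgeM => //; apply: vge_expr1D.
Qed.

(** A larger pole of [x] would make [x ^+ p] dominate [x], and the difference would inherit the pole
    of [x ^+ p], of order beyond [m]. *)
Lemma wp_bound x m (p : nat) : (1 < p)%N -> 0 <= m ->
  vge v (x - x ^+ p) (- m) -> vge v x (- (m / p%:R)).
Proof.
move=> p1 m0 h; have [->|x0] := eqVneq x 0; first by left.
right; rewrite leNgt; apply/negP => lt.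
have p0 : 0 < p%:R :> rat by rewrite ltr0n; lia.
have p1' : 1 < p%:R :> rat by rewrite ltr1n.
have lt2 : p%:R * v x < - m.
  by rewrite -ltr_pdivlMl // mulrC mulNr.
have vx0 : v x < 0.
  apply: lt_le_trans lt _; rewrite oppr_le0 divr_ge0 //; exact: ltW.
have := @val_addl (- x ^+ p) x.
rewrite oppr_eq0 expf_neq0 // valN valX // => -[] //.
  by right; nra.
rewrite addrC => n0 e; have := vgeE n0 h; rewrite e; lra.
Qed.

Lemma wp_bound0 x (p : nat) : (1 < p)%N ->
  vge v (x - x ^+ p) 0 -> vge v x 0.
Proof.
by move=> p1 h; have := @wp_bound x 0 p p1 (lexx _); rewrite mul0r oppr0; apply.
Qed.

End ValuationTheory.
#[global] Hint Resolve vge0 vgt0 : core.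

Lemma int_le_addn (l1 l0 : int) : l1 <= l0 -> exists D : nat, l0 = l1 + D%:Z.
Proof. by move=> le; exists `|l0 - l1|%N; lia. Qed.

(** * Families whose valuations are distinct modulo the integers *)

Section OrthogonalBasis.
Variables (K F : fieldType) (v : K -> rat) (w : F -> rat).
Hypothesis Hw : is_valuation w.
Hypothesis v_int : forall x : K, x != 0 -> exists z : int, v x = z%:~R.
Variable f : {rmorphism K -> F}.
Hypothesis f_val : forall a, a != 0 -> w (f a) = v a.
Variables (d : nat) (e : 'I_d -> F).
Hypothesis e_neq0 : forall i, e i != 0.
Hypothesis e_dist : forall i j, i != j -> forall z : int, w (e i) - w (e j) != z%:~R.

Definition comb (x : 'I_d -> K) : F := \sum_i f (x i) * e i.

Lemma combB x y : comb x - comb y = comb (fun i => x i - y i).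
Proof.
by rewrite /comb -sumrB; apply: eq_bigr => i _; rewrite rmorphB mulrBl.
Qed.

(** Coefficients contribute integers to the valuation, so the nonzero terms have pairwise distinct
    valuations; one is strictly smallest and nothing cancels. *)
Lemma comb_lead x k0 : x k0 != 0 ->
  exists k, [/\ x k != 0, comb x != 0, w (comb x) = w (f (x k) * e k) &
     forall i, i != k -> vgt w (f (x i) * e i) (w (comb x))].
Proof.
move=> xk0; case: (@Order.TotalTheory.arg_minP _ _ _ k0 (fun i => x i != 0)
  (fun i => w (f (x i) * e i)) xk0) => k xk kmin.
have tn i : x i != 0 -> f (x i) * e i != 0.
  by move=> xi; rewrite mulf_neq0 // fmorph_eq0.
have gt i : i != k -> vgt w (f (x i) * e i) (w (f (x k) * e k)).
  move=> ik; have [xi0|xi] := eqVneq (x i) 0.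
    by left; rewrite xi0 rmorph0 mul0r.
  right; rewrite lt_neqAle kmin // andbT eq_sym.
  have [z1 h1] := v_int xi; have [z2 h2] := v_int xk.
  rewrite !valM ?fmorph_eq0 // !f_val // h1 h2.
  have := e_dist ik (z2 - z1); apply: contra => /eqP h.
  by rewrite rmorphB /=; apply/eqP; lra.
have [n0 E] : comb x != 0 /\ w (comb x) = w (f (x k) * e k).
  rewrite /comb (bigD1 k) //=; apply: val_addl => //; first exact: tn.
  by apply: vgt_sum.
by exists k; split=> // i ik; rewrite E; apply: gt.
Qed.

Lemma comb_eq0 x : comb x = 0 -> forall i, x i = 0.
Proof.
move=> h i; apply/eqP; apply: contraT => xi.
by have [k [_]] := comb_lead xi; rewrite h eqxx.
Qed.

Lemma comb_ge x r : vge w (comb x) r -> forall i, vge w (f (x i) * e i) r.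
Proof.
move=> h i; have [xi0|xi] := eqVneq (x i) 0.
  by left; rewrite xi0 rmorph0 mul0r.
have [k [_ n0 E gt]] := comb_lead xi.
have hr := vgeE n0 h.
have [->|ik] := eqVneq i k; first by right; rewrite -E.
by apply: (vge_le hr); apply/vgeW/gt.
Qed.

(** By [comb_ge] a Cauchy sequence of combinations is Cauchy in each coordinate, and [K] is
    complete. *)
Lemma comb_complete : v_complete v (fun _ => True) ->
  v_complete w (fun y => exists x, y = comb x).
Proof.
move=> Kc u uS uC.
have [xs xsP] : exists xs : nat -> 'I_d -> K, forall m, u m = comb (xs m).
  exists (fun m => sval (constructive_indefinite_description _ (uS m))) => m.
  by case: constructive_indefinite_description.
have lim i : exists y, forall M : rat, exists N0 : nat, forall a : nat,
      (N0 <= a)%N -> vge v (xs a i - y) M.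
  have [//||y [_ yP]] := Kc (fun m => xs m i); last by exists y.
  move=> M; have [N0 N0P] := uC (M + w (e i)).
  exists N0 => a b Na Nb; have := N0P a b Na Nb.
  rewrite !xsP combB => /comb_ge /(_ i).
  have [->//|n0] := eqVneq (xs a i - xs b i) 0.
  move/vgeE; rewrite mulf_neq0 ?fmorph_eq0 // valM ?fmorph_eq0 // f_val //.
  by move=> /(_ isT); rewrite lerD2r; right.
have [y yP] : exists y : 'I_d -> K, forall i (M : rat), exists N0 : nat,
    forall a : nat, (N0 <= a)%N -> vge v (xs a i - y i) M.
  exists (fun i => sval (constructive_indefinite_description _ (lim i))) => i.
  by case: constructive_indefinite_description.
exists (comb y); split; first by exists y.
move=> M.
have [Ns NsP] : exists Ns : 'I_d -> nat, forall i a, (Ns i <= a)%N ->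
    vge v (xs a i - y i) (M - w (e i)).
  exists (fun i => sval (constructive_indefinite_description _ (yP i (M - w (e i))))).
  by move=> i a; case: constructive_indefinite_description => /= N0; apply.
exists (\max_i Ns i) => a Na; rewrite xsP combB; apply: vge_sum => // i _.
have := NsP i a (leq_trans (leq_bigmax i) Na).
have [->|n0] := eqVneq (xs a i - y i) 0; first by rewrite rmorph0 mul0r.
move/(vgeE n0) => h; right; rewrite valM ?fmorph_eq0 // f_val //; lra.
Qed.

End OrthogonalBasis.

Record laurent_field (p : nat) (k K : fieldType) (embk : {rmorphism k -> K})
    (v : K -> rat) (t : K) : Prop := LaurentField {
  lf_prime : prime p;
  lf_pchar : p \in [pchar k];
  lf_val : is_valuation v;
  lf_int : forall x : K, x != 0 -> exists z : int, v x = z%:~R;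
  lf_complete : v_complete v (fun _ => True);
  lf_unit : forall a : k, a != 0 -> v (embk a) = 0;
  lf_t_neq0 : t != 0;
  lf_vt : v t = -1;
  lf_exp : forall x : K, exists c : int -> k, expands embk v t x c }.

(** * Laurent expansions *)

Section Laurent.
Variables (p : nat) (k K : fieldType) (embk : {rmorphism k -> K}).
Variables (v : K -> rat) (t : K).
Hypothesis HK : laurent_field p embk v t.

Let Hv : is_valuation v := lf_val HK.
Let v_int := lf_int HK.
Let embk_unit := lf_unit HK.
Let t_neq0 := lf_t_neq0 HK.
Let vt := lf_vt HK.
Let K_exp := lf_exp HK.

Local Notation cf := (coef embk v t).

Definition lmono (a : k) (l : int) : K := embk a * t ^ (- l).

Lemma val_lmono a l : a != 0 -> lmono a l != 0 /\ v (lmono a l) = l%:~R.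
Proof.
move=> a0; have e0 : embk a != 0 by rewrite fmorph_eq0.
split; first by rewrite mulf_neq0 // expfz_neq0.
by rewrite valM ?expfz_neq0 // embk_unit // valXz // vt rmorphN /=; lra.
Qed.

Lemma vge_lmono a l : vge v (lmono a l) l%:~R.
Proof.
have [->|a0] := eqVneq a 0; first by left; rewrite /lmono rmorph0 mul0r.
by right; rewrite (val_lmono l a0).2.
Qed.

Lemma lmono_ge_eq0 a l r : l%:~R < r -> vge v (lmono a l) r -> a = 0.
Proof.
move=> lr h; apply/eqP; apply: contraT => a0.
by have [n0 E] := val_lmono l a0; have := vgeE n0 h; rewrite E leNgt lr.
Qed.

Definition ltrunc (c : int -> k) (l0 : int) (M : nat) : K :=
  \sum_(i < M) lmono (c (l0 + i%:Z)) (l0 + i%:Z).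

(** The starting index is exposed as a parameter, so that two expansions can be compared from a
    common start. *)
Definition expands_at (x : K) (c : int -> k) (l0 : int) : Prop :=
  (forall l : int, l < l0 -> c l = 0) /\
  forall M : nat, vge v (x - ltrunc c l0 M) (l0 + M%:Z)%:~R.

Lemma ltrunc_add c l0 D M :
  ltrunc c l0 (D + M) = ltrunc c l0 D + ltrunc c (l0 + D%:Z) M.
Proof.
rewrite /ltrunc big_split_ord /=; congr (_ + _); apply: eq_bigr => i _.
by rewrite PoszD addrA.
Qed.

Lemma ltrunc_eq0 c l0 M :
  (forall l, l < l0 + M%:Z -> c l = 0) -> ltrunc c l0 M = 0.
Proof.
move=> h; apply: big1 => i _; rewrite h; first by rewrite /lmono rmorph0 mul0r.
by rewrite ltrD2l ltz_nat.
Qed.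

Lemma expands_shift x c l0 l1 : l1 <= l0 -> expands_at x c l0 -> expands_at x c l1.
Proof.
move=> le [c0 cM]; split=> [l lt|M]; first by apply: c0; apply: lt_le_trans le.
have [D ED] := int_le_addn le.
rewrite ED in c0 cM *.
have [MD|DM] := leqP M D.
  rewrite ltrunc_eq0 ?subr0.
    have := cM 0%N; rewrite /ltrunc big_ord0 subr0 addr0; apply: vge_le.
    by rewrite ler_int lerD2l lez_nat.
  by move=> l lt; apply: c0; apply: lt_le_trans lt _; rewrite lerD2l lez_nat.
have -> : M = (D + (M - D))%N by rewrite subnKC // ltnW.
rewrite ltrunc_add [ltrunc c l1 D]ltrunc_eq0 // add0r PoszD addrA.
exact: cM.
Qed.

Lemma expands_uniq x c c' l0 :
  expands_at x c l0 -> expands_at x c' l0 -> c =1 c'.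
Proof.
move=> [c0 cM] [c0' cM'] l; have [lt|ge] := ltP l l0; first by rewrite c0 ?c0'.
have [D ->] := int_le_addn ge.
elim/ltn_ind: D {l ge} => D IH.
have : vge v (ltrunc c l0 D.+1 - ltrunc c' l0 D.+1) (l0 + D.+1%:Z)%:~R.
  have -> : ltrunc c l0 D.+1 - ltrunc c' l0 D.+1 =
    (x - ltrunc c' l0 D.+1) - (x - ltrunc c l0 D.+1) by ring.
  exact: vgeB.
have E : ltrunc c l0 D = ltrunc c' l0 D.
  by apply: eq_bigr => i _; rewrite IH.
rewrite -addn1 !ltrunc_add E opprD addrACA subrr add0r /ltrunc !big_ord1 addr0.
have -> : forall a b l, lmono a l - lmono b l = lmono (a - b) l.
  by move=> a b l; rewrite /lmono rmorphB mulrBl.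
move/lmono_ge_eq0 => h; apply/eqP; rewrite -subr_eq0; apply/eqP/h.
by rewrite ltr_int ltrD2l ltz_nat addn1.
Qed.

Lemma vge_floor x : vge v x (Num.floor (v x))%:~R.
Proof. by right; apply: Num.Theory.floor_le. Qed.

Lemma val_floor x : x != 0 -> v x = (Num.floor (v x))%:~R.
Proof. by move=> /v_int [z ->]; rewrite intrKfloor. Qed.

(** The start hidden in [coef] may lie below [l0]. The coefficients in between vanish one after the
    other: once the earlier ones are zero, the next truncation is a single monomial whose valuation
    would be too small. *)
Lemma lcoef_at x l0 : vge v x l0%:~R -> expands_at x (cf x) l0.
Proof.
move=> xl0; have : expands embk v t x (cf x).
  by rewrite /coef /choose_prop; apply: epsilon_spec; apply: K_exp.
case=> l1 h1; have {}h1 : expands_at x (cf x) l1 by [].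
have [le|lt] := leP l0 l1; first exact: expands_shift h1.
have [D ED] := int_le_addn (ltW lt).
case: h1 => c0 cM.
have z i : (i < D)%N -> cf x (l1 + i%:Z) = 0.
  elim/ltn_ind: i => i IH iD; apply: (@lmono_ge_eq0 _ (l1 + i%:Z) (l1 + i.+1%:Z)%:~R).
    by rewrite ltr_int ltrD2l ltz_nat.
  have : vge v (x - (x - ltrunc (cf x) l1 i.+1)) (l1 + i.+1%:Z)%:~R.
    apply: vgeB => //; apply: vge_le xl0.
    by rewrite ED ler_int lerD2l lez_nat.
  rewrite opprD opprK addrA subrr add0r /ltrunc big_ord_recr /= big1 ?add0r //.
  by move=> j _; rewrite IH ?(ltn_trans _ iD) // /lmono rmorph0 mul0r.
split=> [l ll|M].
  have [|ge] := ltP l l1; first exact: c0.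
  have [i Ei] := int_le_addn ge.
  by rewrite Ei z //; move: ll; rewrite Ei ED ltrD2l ltz_nat.
have := cM (D + M)%N; rewrite ltrunc_add -ED PoszD addrA -ED.
rewrite [ltrunc _ l1 D]big1 ?add0r // => i _.
by rewrite z // /lmono rmorph0 mul0r.
Qed.

Lemma lcoef_eq x c l0 : expands_at x c l0 -> cf x =1 c.
Proof.
move=> h; apply: (@expands_uniq x _ _ (Num.min l0 (Num.floor (v x)))).
  by apply: expands_shift (lcoef_at (vge_floor x)); rewrite ge_min lexx orbT.
by apply: expands_shift h; rewrite ge_min lexx.
Qed.

Lemma lcoef_lt x (l : int) : vge v x (l + 1)%:~R -> cf x l = 0.
Proof. by move/lcoef_at => [h _]; apply: h; rewrite ltrDl. Qed.

Lemma lcoefD x y l : cf (x + y) l = cf x l + cf y l.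
Proof.
set l0 := Num.min (Num.floor (v x)) (Num.floor (v y)).
have hx : vge v x l0%:~R by apply: vge_le (vge_floor x); rewrite ler_int ge_min lexx.
have hy : vge v y l0%:~R.
  by apply: vge_le (vge_floor y); rewrite ler_int ge_min lexx orbT.
have [x0 xM] := lcoef_at hx; have [y0 yM] := lcoef_at hy.
apply: (@lcoef_eq _ (fun l => cf x l + cf y l) l0); split=> [l' ll|M].
  by rewrite x0 // y0 // addr0.
have -> : ltrunc (fun l => cf x l + cf y l) l0 M =
   ltrunc (cf x) l0 M + ltrunc (cf y) l0 M.
  rewrite /ltrunc -big_split; apply: eq_bigr => i _.
  by rewrite /lmono rmorphD mulrDl.
by rewrite opprD addrACA; apply: vgeD.
Qed.

Lemma lcoef0 l : cf 0 l = 0.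
Proof. by apply: lcoef_lt; left. Qed.

Lemma lcoef_lmono a l l' : cf (lmono a l) l' = if l' == l then a else 0.
Proof.
apply: (@lcoef_eq _ (fun l' => if l' == l then a else 0) l); split=> [i il|M].
  by rewrite lt_eqF.
case: M => [|M]; first by rewrite /ltrunc big_ord0 subr0 addr0; apply: vge_lmono.
rewrite /ltrunc big_ord_recl /= addr0 eqxx big1 ?addr0 ?subrr // => i _.
rewrite -[X in _ == X]addr0 (inj_eq (addrI _)) /=.
by rewrite /lmono rmorph0 mul0r.
Qed.

Section LaurentMaps.
Variables (F : fieldType) (w : F -> rat) (Hw : is_valuation w).

(** An additive map with linear growth is controlled by its values on monomials: a sufficiently long
    truncation leaves a remainder whose image already satisfies the bound [B]. *)
Lemma laurent_bound (h : K -> F) (kap C B : rat) (x : K) (l0 : int) :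
  (forall x y, h (x + y) = h x + h y) -> 0 < kap ->
  (forall x r, vge v x r -> vge w (h x) (kap * r + C)) ->
  (forall a l, l0 <= l -> vge w (h (lmono a l)) B) ->
  vge v x l0%:~R -> vge w (h x) B.
Proof.
move=> hD kp hg hm /lcoef_at [_ cM].
have h0 : h 0 = 0 by apply: (@addrI _ (h 0)); rewrite -hD !addr0.
have hS (I : Type) (s : seq I) (G : I -> K) :
    h (\sum_(i <- s) G i) = \sum_(i <- s) h (G i).
  by elim: s => [|a s IH]; rewrite ?big_nil // !big_cons hD IH.
set M := `|(Num.floor ((B - C) / kap - l0%:~R) + 1)%R|%N.
have hM : B <= kap * (l0 + M%:Z)%:~R + C.
  have : (B - C) / kap - l0%:~R <= M%:~R.
    apply: le_trans (ltW (floorD1_gt _)) _.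
    by rewrite ler_int; apply: lez_abs.
  rewrite rmorphD /= => h1; rewrite -lerBlDr mulrC -ler_pdivrMr //; lra.
rewrite -[x](subrK (ltrunc (cf x) l0 M)) hD; apply: vgeD => //.
  by apply: vge_le hM _; apply: hg.
by rewrite hS; apply: vge_sum => // i _; apply: hm; rewrite lerDl.
Qed.

Lemma laurent_eq0 (h : K -> F) (kap C : rat) :
  (forall x y, h (x + y) = h x + h y) -> 0 < kap ->
  (forall x r, vge v x r -> vge w (h x) (kap * r + C)) ->
  (forall a l, h (lmono a l) = 0) -> forall x, h x = 0.
Proof.
move=> hD kp hg hm x; apply: (vge_all_eq0 (v := w)) => M.
by apply: (laurent_bound hD kp hg _ (vge_floor x)) => a l _; rewrite hm.
Qed.

Variables (S : F -> Prop) (S_sub : is_subfield S) (S_complete : v_complete w S).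
Variables (g : int -> k -> F) (kap C : rat).
Hypothesis kap_gt0 : 0 < kap.
Hypothesis gS : forall l a, S (g l a).
Hypothesis gD : forall l a b, g l (a + b) = g l a + g l b.
Hypothesis g_ge : forall l a, vge w (g l a) (kap * l%:~R + C).

(** The common shape of [iotaR], of [a1] and of the derivation: apply [g] to each term of the
    expansion and sum. The case split at 0 mirrors those definitions. *)
Definition lsum (x : K) : F :=
  if x == 0 then 0 else
  slim w (fun i : nat => let l := Num.floor (v x) + i%:Z in g l (cf x l)).

Let psum (x : K) (l0 : int) (M : nat) : F := \sum_(i < M) g (l0 + i%:Z) (cf x (l0 + i%:Z)).

Let g0 l : g l 0 = 0.
Proof. by apply: (@addrI _ (g l 0)); rewrite -gD !addr0. Qed.

Let psum_add x l0 D M : psum x l0 (D + M) = psum x l0 D + psum x (l0 + D%:Z) M.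
Proof.
rewrite /psum big_split_ord /=; congr (_ + _); apply: eq_bigr => i _.
by rewrite PoszD addrA.
Qed.

Let psum_ge x l0 M : vge w (psum x l0 M) (kap * l0%:~R + C).
Proof.
apply: vge_sum => // i _; apply: vge_le (g_ge _ _).
by rewrite lerD2r ler_pM2l // ler_int lerDl.
Qed.

Let S_sum (I : Type) (s : seq I) (G : I -> F) :
  (forall i, S (G i)) -> S (\sum_(i <- s) G i).
Proof.
case: S_sub => S0 [S1 [SB _]] SG.
have SD a b : S a -> S b -> S (a + b).
  move=> Sa Sb; rewrite -[b]opprK; apply: (SB a (- b) _ _).1 => //.
  by rewrite -[- b]add0r; apply: (SB 0 b _ _).1.
by elim: s => [|a s IH]; rewrite ?big_nil // big_cons; apply: SD.
Qed.

Let psum_tail x l0 D M : (D <= M)%N ->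
  vge w (psum x l0 M - psum x l0 D) (kap * (l0 + D%:Z)%:~R + C).
Proof.
by move=> DM; rewrite -(subnKC DM) psum_add addrC addKr; apply: psum_ge.
Qed.

Let nat_large (r : rat) (l0 : int) : exists M : nat, r <= kap * (l0 + M%:Z)%:~R + C.
Proof.
exists `|(Num.floor ((r - C) / kap - l0%:~R) + 1)%R|%N.
set M := absz _; have : (r - C) / kap - l0%:~R <= M%:~R.
  apply: le_trans (ltW (floorD1_gt _)) _.
  by rewrite ler_int; apply: lez_abs.
rewrite rmorphD /= => h1; rewrite -lerBlDr mulrC -ler_pdivrMr //; lra.
Qed.

(** The terms grow linearly, so the partial sums converge inside [S]; the limit selected by [slim]
    is this one, because two limits differ by an element of arbitrarily large valuation. *)
Lemma lsum_approx x l0 M : vge v x l0%:~R ->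
  S (lsum x) /\ vge w (lsum x - psum x l0 M) (kap * (l0 + M%:Z)%:~R + C).
Proof.
rewrite /lsum; case: eqP => [-> _|/eqP x0 xl0].
  rewrite sub0r /psum big1 ?oppr0 => [|i _]; last by rewrite lcoef0 g0.
  by split; [case: S_sub | left].
set l1 := Num.floor (v x).
have [//||y [Sy yP]] := S_complete (u := psum x l1).
- by move=> m; apply: S_sum.
- move=> r; have [D DP] := nat_large r l1; exists D => a b Da Db.
  have -> : psum x l1 a - psum x l1 b =
    (psum x l1 a - psum x l1 D) - (psum x l1 b - psum x l1 D) by ring.
  by apply: vge_le DP _; apply: vgeB => //; apply: psum_tail.
set P := (fun y => forall M : rat, exists N0 : nat,
     forall N : nat, (N0 <= N)%N -> vge w (y - psum x l1 N) M).
have yP' : P y.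
  move=> r; have [N0 h] := yP r; exists N0 => N hN; rewrite -opprB.
  by apply: vgeN => //; apply: h.
have sP : P (slim w (fun i : nat => let l := l1 + i%:Z in g l (cf x l))).
  by rewrite /slim /choose_prop; apply: epsilon_spec; exists y.
have -> : slim w (fun i : nat => let l := l1 + i%:Z in g l (cf x l)) = y.
  apply/eqP; rewrite -subr_eq0; apply/eqP; apply: (vge_all_eq0 (v := w)) => r.
  have [N1 h1] := sP r; have [N2 h2] := yP' r.
  set z := slim _ _ in h1 *.
  have -> : z - y = (z - psum x l1 (maxn N1 N2)) - (y - psum x l1 (maxn N1 N2)).
    by ring.
  by apply: vgeB => //; [apply: h1; apply: leq_maxl|apply: h2; apply: leq_maxr].
split=> //.
have main M' : vge w (y - psum x l1 M') (kap * (l1 + M'%:Z)%:~R + C).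
  have [N2 h2] := yP' (kap * (l1 + M'%:Z)%:~R + C).
  have -> : y - psum x l1 M' = (y - psum x l1 (maxn M' N2)) +
      (psum x l1 (maxn M' N2) - psum x l1 M') by ring.
  apply: vgeD => //; first by apply: h2; apply: leq_maxr.
  by apply: psum_tail; apply: leq_maxl.
have le : l0 <= l1.
  by rewrite -(ler_int rat) -val_floor //; apply: vgeE xl0.
have [D ED] := int_le_addn le.
have pz M' : (M' <= D)%N -> psum x l0 M' = 0.
  move=> MD; apply: big1 => i _; rewrite (lcoef_lt (x := x)) ?g0 //.
  apply: vge_le (vge_floor x); rewrite ler_int -/l1 ED -addrA lerD2l -PoszD lez_nat.
  by rewrite addn1; apply: leq_trans (ltn_ord i) MD.
have [MD|DM] := leqP M D.
  rewrite pz // subr0; have := main 0%N; rewrite /psum big_ord0 subr0 addr0.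
  by apply: vge_le; rewrite lerD2r ler_pM2l // ler_int ED lerD2l lez_nat.
have -> : M = (D + (M - D))%N by rewrite subnKC // ltnW.
by rewrite psum_add pz // add0r PoszD addrA -ED.
Qed.

Lemma lsumD x y : lsum (x + y) = lsum x + lsum y.
Proof.
set l0 := Num.min (Num.floor (v x)) (Num.floor (v y)).
have hx : vge v x l0%:~R by apply: vge_le (vge_floor x); rewrite ler_int ge_min lexx.
have hy : vge v y l0%:~R.
  by apply: vge_le (vge_floor y); rewrite ler_int ge_min lexx orbT.
apply/eqP; rewrite -subr_eq0; apply/eqP; apply: (vge_all_eq0 (v := w)) => r.
have [M hM] := nat_large r l0; apply: vge_le hM _.
have -> : lsum (x + y) - (lsum x + lsum y) = (lsum (x + y) - psum (x + y) l0 M)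
   - (lsum x - psum x l0 M) - (lsum y - psum y l0 M).
  have -> : psum (x + y) l0 M = psum x l0 M + psum y l0 M; last by ring.
  rewrite /psum -big_split; apply: eq_bigr => i _.
  by rewrite lcoefD gD.
have ap z (hz : vge v z l0%:~R) := (lsum_approx M hz).2.
by apply: vgeB => //; [apply: vgeB => //|]; apply: ap => //; apply: vgeD.
Qed.

Lemma lsum_ge x r : vge v x r -> vge w (lsum x) (kap * r + C).
Proof.
have [->|x0] := eqVneq x 0; first by rewrite /lsum eqxx.
move/(vgeE x0) => rx; have := (lsum_approx 0 (vge_floor x)).2.
rewrite /psum big_ord0 subr0 addr0 -val_floor //; apply: vge_le.
by rewrite lerD2r ler_pM2l.
Qed.

Lemma lsum_lmono a l : lsum (lmono a l) = g l a.
Proof.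
apply/eqP; rewrite -subr_eq0; apply/eqP; apply: (vge_all_eq0 (v := w)) => r.
have [M hM] := nat_large r l; have := (lsum_approx M.+1 (vge_lmono a l)).2.
rewrite /psum big_ord_recl addr0 lcoef_lmono eqxx big1 ?addr0 => [|i _].
  apply: vge_le; apply: le_trans hM _.
  by rewrite lerD2r ler_pM2l // ler_int lerD2l lez_nat.
rewrite lcoef_lmono -[X in _ == X]addr0 (inj_eq (addrI _)) /=.
by rewrite g0.
Qed.

End LaurentMaps.
End Laurent.

(** * Frobenius powers, roots of 1-units, homomorphisms out of a Laurent field *)

Definition mk_rmorph (A B : nzRingType) (f : A -> B)
    (fB : {morph f : x y / x - y}) (f1 : f 1 = 1)
    (fM : {morph f : x y / x * y}) : {rmorphism A -> B} :=
  HB.pack f (GRing.isZmodMorphism.Build _ _ f fB)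
            (GRing.isMonoidMorphism.Build _ _ f (f1, fM)).

Section FrobeniusPower.
Variables (p : nat) (F : comNzRingType) (chp : p \in [pchar F]).

Lemma pX_nat N : [pchar F].-nat (p ^ N)%N.
Proof.
apply/pnatP; first by rewrite expn_gt0 (prime_gt0 (pcharf_prime chp)).
move=> r rp; rewrite Euclid_dvdX // => /andP[+ _].
by rewrite dvdn_prime2 ?(pcharf_prime chp) // => /eqP ->.
Qed.

Lemma exprpD N (x y : F) : (x + y) ^+ (p ^ N) = x ^+ (p ^ N) + y ^+ (p ^ N).
Proof. exact/exprDn_pchar/pX_nat. Qed.

Lemma exprpB N : {morph (fun x : F => x ^+ (p ^ N)) : x y / x - y}.
Proof. by move=> x y; apply: (@addIr _ (y ^+ (p ^ N))); rewrite subrK -exprpD subrK. Qed.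

Definition frobq N : {rmorphism F -> F} :=
  mk_rmorph (exprpB N) (expr1n F _) (fun x y => exprMn (p ^ N) x y).

Lemma frobqE N x : frobq N x = x ^+ (p ^ N). Proof. by []. Qed.

End FrobeniusPower.

Lemma exprp_inj (p : nat) (F : fieldType) (chp : p \in [pchar F]) N :
  injective (fun x : F => x ^+ (p ^ N)).
Proof. exact: fmorph_inj (frobq chp N). Qed.

Section RootExtraction.
Variables (p : nat) (F : fieldType) (w : F -> rat) (S : F -> Prop).
Hypotheses (chp : p \in [pchar F]) (Hw : is_valuation w).
Hypotheses (S_sub : is_subfield S) (S_complete : v_complete w S).

Lemma subX x n : S x -> S (x ^+ n).
Proof.
case: S_sub => S0 [S1 [SB _]] Sx.
elim: n => [|n IH]; rewrite ?expr0 // exprS; exact: (SB x _ Sx IH).2.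
Qed.

Lemma subD x y : S x -> S y -> S (x + y).
Proof.
case: S_sub => S0 [S1 [SB _]] Sx Sy.
rewrite -[y]opprK; apply: (SB x (- y) _ _).1 => //.
by rewrite -[- y]add0r; apply: (SB 0 y _ _).1.
Qed.

Lemma subM x y : S x -> S y -> S (x * y).
Proof. by case: S_sub => S0 [S1 [SB _]] Sx Sy; apply: (SB x y Sx Sy).2. Qed.

Lemma vge_subX a b s n : vge w a 0 -> vge w b 0 -> vge w (a - b) s ->
  vge w (a ^+ n - b ^+ n) s.
Proof.
move=> ha hb h; rewrite subrXX; apply: vgeZr => //; apply: vge_sum => // i _.
by rewrite -[0]addr0; apply: vgeM => //; apply: vgeX0.
Qed.

(** Choose exponents [a_n] with [R a_n] congruent to 1 modulo [p ^ n]. Since [(1 + x) ^+ (p ^ n)]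
    tends to 1, the powers [(1 + x) ^+ a_n] form a Cauchy sequence, and their limit is the root. *)
Lemma root1D_exists R x r : coprime R p -> (0 < R)%N -> 0 < r -> S x -> vge w x r ->
  exists z, [/\ S z, z ^+ R = 1 + x & vge w (z - 1) r].
Proof.
move=> Rp R0 r0 Sx hx.
have pp := pcharf_prime chp.
have aP n : exists ac : nat * nat, (R * ac.1 = 1 + ac.2 * p ^ n)%N.
  have /(coprimeP _ R0) [u hu] : coprime R (p ^ n) by rewrite coprimeXr.
  by exists u; rewrite mulnC; lia.
have [ac acP] : exists ac : nat -> nat * nat,
    forall n, (R * (ac n).1 = 1 + (ac n).2 * p ^ n)%N.
  exists (fun n => sval (constructive_indefinite_description _ (aP n))) => n.
  by case: constructive_indefinite_description.
pose z n := (1 + x) ^+ (ac n).1.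
have x0 : vge w x 0 by apply: vge_le hx; apply: ltW.
have one0 : vge w (1 : F) 0 by right; rewrite val1.
have u0 : vge w (1 + x) 0 by apply: vgeD.
have z0 n : vge w (z n) 0 by apply: vge_unit1D.
have En m c : vge w ((1 + x) ^+ (c * p ^ m) - 1) (m%:R * r).
  rewrite mulnC exprM exprpD // expr1n; apply: vge_expr1D => //.
    by rewrite mulr_ge0 // ltW.
  have := vgeX Hw (p ^ m) hx; apply: vge_le.
  by rewrite ler_pM2r // ler_nat ltnW // ltn_expl // prime_gt1.
have zz n m : (n <= m)%N -> vge w (z n - z m) (n%:R * r).
  move=> nm.
  have E : z n * (1 + x) ^+ ((ac n).1 * (ac m).2 * p ^ m) =
           z m * (1 + x) ^+ ((ac m).1 * (ac n).2 * p ^ n).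
    rewrite -!exprD; congr (_ ^+ _).
    have := acP n; have := acP m; move: (ac n) (ac m) => [a c] [b d] /= hb ha.
    have : (a * (R * b) = b * (R * a))%N by rewrite mulnCA mulnA mulnC mulnA.
    by rewrite hb ha; lia.
  have -> : z n - z m = z m * ((1 + x) ^+ ((ac m).1 * (ac n).2 * p ^ n) - 1)
     - z n * ((1 + x) ^+ ((ac n).1 * (ac m).2 * p ^ m) - 1).
    by rewrite !mulrBr E !mulr1; ring.
  apply: vgeB => //; apply: vgeZl => //.
  by apply: vge_le (En m _); rewrite ler_pM2r // ler_nat.
have large (M : rat) : exists n : nat, M <= n%:R * r.
  exists `|(Num.floor (M / r) + 1)%R|%N; rewrite -ler_pdivrMr //.
  apply: le_trans (ltW (floorD1_gt _)) _.
  by rewrite -[X in _ <= X]/((Posz _)%:~R); rewrite ler_int; apply: lez_abs.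
have [||y [Sy yP]] := S_complete (u := z).
- move=> m; apply: subX; apply: subD => //.
  by case: S_sub => _ [].
- move=> M; have [n hn] := large M; exists n => a b na nb.
  have -> : z a - z b = (z n - z b) - (z n - z a) by ring.
  by apply: vge_le hn _; apply: vgeB => //; apply: zz.
have y0 : vge w y 0.
  have [N0 h] := yP 0; have -> : y = z N0 - (z N0 - y) by ring.
  by apply: vgeB => //; apply: h.
exists y; split=> //.
  apply/eqP; rewrite -subr_eq0; apply/eqP; apply: (vge_all_eq0 (v := w)) => M.
  have [n hn] := large M; have [N0 h] := yP M.
  set m := maxn n N0.
  have -> : y ^+ R - (1 + x) = (1 + x) * ((1 + x) ^+ ((ac m).2 * p ^ m) - 1)
     - (z m ^+ R - y ^+ R).
    rewrite mulrBr -exprS -add1n -acP mulnC exprM -/(z m); ring.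
  apply: vgeB => //.
    apply: vgeZl => //; apply: vge_le (En _ _); apply: le_trans hn _.
    by rewrite ler_pM2r // ler_nat leq_maxl.
  by apply: vge_subX => //; apply: h; apply: leq_maxr.
have [N0 h] := yP r; have -> : y - 1 = (z N0 - 1) - (z N0 - y) by ring.
by apply: vgeB => //; [apply: vge_expr1D => //; apply: ltW|apply: h].
Qed.

(** Factor [x ^+ R - y ^+ R]: the cofactor of [x - y] is a sum of [R] terms congruent to 1, hence
    congruent to [R], which is a unit. *)
Lemma root1D_uniq R x y : coprime R p -> (0 < R)%N -> vgt w (x - 1) 0 ->
  vgt w (y - 1) 0 -> x ^+ R = y ^+ R -> x = y.
Proof.
move=> Rp R0 hx hy E.
have one0 : vge w (1 : F) 0 by right; rewrite val1.
have int z : vgt w (z - 1) 0 -> vge w z 0.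
  by move=> h; rewrite -[z](subrK 1); apply: vgeD => //; apply: vgeW.
have /eqP := subrXX x y R; rewrite E subrr eq_sym mulf_eq0 subr_eq0 => /orP[/eqP //|].
move/eqP => s0; suff : vgt w (R%:R : F) 0.
  move/vgtE; have Rn0 : (R%:R : F) != 0.
    rewrite -(dvdn_pcharf chp) -prime_coprime 1?coprime_sym //.
    exact: pcharf_prime chp.
  have [c hc] : exists c : nat, (R * c)%:R = 1 :> F.
    have /(coprimeP _ R0) [u hu] : coprime R p by [].
    exists u.1; have -> : (R * u.1 = 1 + u.2 * p)%N by rewrite mulnC; lia.
    by rewrite natrD natrM (pcharf0 chp) mulr0 addr0.
  move=> /(_ Rn0) gt; have := val1 Hw; rewrite -hc natrM.
  have cn0 : (c%:R : F) != 0.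
    by apply/eqP => c0; move/eqP: hc; rewrite natrM c0 mulr0 eq_sym oner_eq0.
  rewrite valM //; have := vgeE cn0 (vge_natr Hw c); move: gt; clear => *; exfalso; lra.
have -> : (R%:R : F) = - \sum_(i < R) (x ^+ (R.-1 - i) * y ^+ i - 1).
  rewrite sumrB /= sumr_const card_ord.
  by rewrite s0 sub0r opprK.
apply: vgtN => //; apply: vgt_sum => // i _.
have X1 z m : vgt w (z - 1) 0 -> vgt w (z ^+ m - 1) 0.
  move=> [/subr0_eq ->|gt]; first by rewrite expr1n subrr.
  apply: (vgt_lt gt); have := @vge_subX z 1 (w (z - 1)) m; rewrite expr1n; apply=> //.
  - by apply: int; right.
  - by right.
have -> : x ^+ (R.-1 - i) * y ^+ i - 1 =
   x ^+ (R.-1 - i) * (y ^+ i - 1) + (x ^+ (R.-1 - i) - 1) by ring.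
apply: vgtD => //; last exact: X1.
rewrite -[0]addr0; apply: vgtMr => //; last exact: X1.
by apply: vgeX0 => //; apply: int.
Qed.

End RootExtraction.

Lemma subfield_total (F : fieldType) : is_subfield (fun _ : F => True).
Proof. by []. Qed.

Section LaurentHom.
Variables (p : nat) (k K : fieldType) (embk : {rmorphism k -> K}).
Variables (v : K -> rat) (t : K).
Hypothesis HK : laurent_field p embk v t.
Variables (F : fieldType) (w : F -> rat) (Hw : is_valuation w).
Variables (S : F -> Prop) (S_sub : is_subfield S) (S_complete : v_complete w S).
Variables (phi : {rmorphism k -> F}) (tau : F).
Hypotheses (phiS : forall a, S (phi a)) (phi_ge : forall a, vge w (phi a) 0).
Hypotheses (tauS : S tau) (tau_neq0 : tau != 0) (wtau : w tau < 0).

Let g (l : int) (a : k) : F := phi a * tau ^ (- l).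
Definition lhom_fun : K -> F := lsum embk v t w g.

Let kap := - w tau.
Let kap_gt0 : 0 < kap. Proof. by rewrite oppr_gt0. Qed.

Let gS l a : S (g l a).
Proof.
case: S_sub => S0 [S1 [SB SV]]; apply: (subM S_sub) => //.
case: (- l) => n; first exact: (subX S_sub).
by rewrite NegzE -exprnN; apply: SV; apply: (subX S_sub).
Qed.

Let gD l a b : g l (a + b) = g l a + g l b.
Proof. by rewrite /g rmorphD mulrDl. Qed.

Let g_ge l a : vge w (g l a) (kap * l%:~R + 0).
Proof.
rewrite addr0 -[_ * _]add0r; apply: vgeM => //; right.
by rewrite valXz // rmorphN /= mulrC /kap !mulrN mulNr.
Qed.

Lemma lhom_funD x y : lhom_fun (x + y) = lhom_fun x + lhom_fun y.
Proof. exact: (lsumD HK Hw S_sub S_complete kap_gt0 gS gD g_ge). Qed.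

Lemma lhom_ge x r : vge v x r -> vge w (lhom_fun x) (kap * r).
Proof.
by move/(lsum_ge HK Hw S_sub S_complete kap_gt0 gS gD g_ge); rewrite addr0.
Qed.

Lemma lhom_lmono a l : lhom_fun (lmono embk t a l) = phi a * tau ^ (- l).
Proof. exact: (lsum_lmono HK Hw S_sub S_complete kap_gt0 gS gD g_ge). Qed.

Lemma lmonoM a b l l' :
  lmono embk t a l * lmono embk t b l' = lmono embk t (a * b) (l + l').
Proof.
rewrite /lmono rmorphM opprD expfzDr ?(lf_t_neq0 HK) //; ring.
Qed.

Lemma lmono10 : lmono embk t 1 0 = 1.
Proof. by rewrite /lmono rmorph1 oppr0 expr0z mulr1. Qed.

Lemma lhom_fun1 : lhom_fun 1 = 1.
Proof. by rewrite -lmono10 lhom_lmono rmorph1 oppr0 expr0z mulr1. Qed.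

Lemma lhom_funM : {morph lhom_fun : x y / x * y}.
Proof.
have gen x y : (forall a l, lhom_fun (lmono embk t a l * y) =
    lhom_fun (lmono embk t a l) * lhom_fun y) ->
    lhom_fun (x * y) = lhom_fun x * lhom_fun y.
  move=> hm; apply/eqP; rewrite -subr_eq0; apply/eqP.
  pose h x := lhom_fun (x * y) - lhom_fun x * lhom_fun y.
  apply: (laurent_eq0 HK Hw (h := h) (C := kap * v y) _ kap_gt0) => [x1 x2|x1 r hr|a l].
  - by rewrite /h mulrDl !lhom_funD mulrDl; ring.
  - have hy := vge_val v y.
    apply: vgeB => //; last by apply: vgeM => //; apply: lhom_ge.
    by rewrite -mulrDr; apply: lhom_ge; apply: (vgeM (lf_val HK)).
  - by rewrite /h hm subrr.
move=> x y; apply: (gen) => a l; rewrite mulrC [RHS]mulrC; apply: (gen) => b l'.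
rewrite lmonoM !lhom_lmono rmorphM opprD expfzDr //; ring.
Qed.

Lemma lhom_funB : {morph lhom_fun : x y / x - y}.
Proof. by move=> x y; apply: (@addIr _ (lhom_fun y)); rewrite -lhom_funD !subrK. Qed.

Definition lhom : {rmorphism K -> F} := mk_rmorph lhom_funB lhom_fun1 lhom_funM.

(** The inequality [lhom_ge], applied to [x] and to its inverse, is an equality. *)
Lemma val_lhom x : x != 0 -> w (lhom x) = - w tau * v x.
Proof.
move=> x0; have hx0 : lhom x != 0 by rewrite fmorph_eq0.
have h1 := vgeE hx0 (lhom_ge (vge_val v x)).
have hV0 : lhom x^-1 != 0 by rewrite fmorph_eq0 invr_eq0.
have := vgeE hV0 (lhom_ge (vge_val v x^-1)).
rewrite fmorphV !valV ?(lf_val HK) //; last exact: (lf_val HK).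
by rewrite -/(lhom x) /kap in h1 *; move: h1; clear; lra.
Qed.

End LaurentHom.

(** * The derivation t d/dt *)

Section LaurentDerivation.
Variables (p : nat) (k K : fieldType) (embk : {rmorphism k -> K}).
Variables (v : K -> rat) (t : K).
Hypothesis HK : laurent_field p embk v t.

Local Notation mono := (lmono embk t).

Lemma pcharK : p \in [pchar K].
Proof. exact: (rmorph_pchar embk (lf_pchar HK)). Qed.

Definition dK : K -> K := lsum embk v t v (fun l a => mono (a * (- l)%:~R) l).

Let gD l a b : mono ((a + b) * (- l)%:~R) l =
  mono (a * (- l)%:~R) l + mono (b * (- l)%:~R) l.
Proof. by rewrite mulrDl /lmono rmorphD mulrDl. Qed.

Let g_ge l a : vge v (mono (a * (- l)%:~R) l) (1 * l%:~R + 0).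
Proof. by rewrite mul1r addr0; apply: (vge_lmono HK). Qed.

Let Hv := lf_val HK.

Lemma dKD x y : dK (x + y) = dK x + dK y.
Proof.
exact: (lsumD HK Hv (@subfield_total K) (lf_complete HK) ltr01 (fun _ _ => I) gD g_ge).
Qed.

Lemma dK_ge x r : vge v x r -> vge v (dK x) r.
Proof.
move/(lsum_ge HK Hv (@subfield_total K) (lf_complete HK) ltr01 (fun _ _ => I) gD g_ge).
by rewrite mul1r addr0.
Qed.

Lemma dK_lmono a l : dK (mono a l) = mono (a * (- l)%:~R) l.
Proof.
exact: (lsum_lmono HK Hv (@subfield_total K) (lf_complete HK) ltr01 (fun _ _ => I) gD g_ge).
Qed.

Lemma dK0 : dK 0 = 0.
Proof. by apply: (@addrI _ (dK 0)); rewrite -dKD !addr0. Qed.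

Lemma dKN x : dK (- x) = - dK x.
Proof. by apply: (@addIr _ (dK x)); rewrite -dKD !addNr dK0. Qed.

Lemma dKB x y : dK (x - y) = dK x - dK y.
Proof. by rewrite dKD dKN. Qed.

Lemma dKM x y : dK (x * y) = dK x * y + x * dK y.
Proof.
have gen x1 y1 : (forall a l, dK (mono a l * y1) = dK (mono a l) * y1 + mono a l * dK y1) ->
    dK (x1 * y1) = dK x1 * y1 + x1 * dK y1.
  move=> hm; apply/eqP; rewrite -subr_eq0; apply/eqP.
  pose h x := dK (x * y1) - (dK x * y1 + x * dK y1).
  apply: (laurent_eq0 HK Hv (h := h) (kap := 1) (C := v y1) _ ltr01) => [x2 x3|x2 r hr|a l].
  - by rewrite /h mulrDl !dKD; ring.
  - rewrite mul1r; apply: vgeB => //.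
      by apply: dK_ge; apply: vgeM => //; apply: vge_val.
    by apply: vgeD => //; apply: vgeM => //; try apply: dK_ge => //; apply: vge_val.
  - by rewrite /h hm subrr.
apply: (gen) => a l; rewrite mulrC addrC ![_ * y in RHS]mulrC ![_ * dK y]mulrC.
apply: (gen) => b l'.
rewrite (lmonoM HK) !dK_lmono !(lmonoM HK) [(_ + l)%R]addrC.
rewrite /lmono -mulrDl -rmorphD; congr (embk _ * _).
by rewrite opprD rmorphD /=; ring.
Qed.

Lemma dK1 : dK 1 = 0.
Proof. by have := dKM 1 1; rewrite !mulr1 mul1r => h; apply: (@addrI _ (dK 1)); rewrite -h addr0. Qed.

Lemma dKX x n : dK (x ^+ n) = n%:R * x ^+ n.-1 * dK x.
Proof.
elim: n => [|n IH]; first by rewrite expr0 dK1 !mul0r.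
rewrite exprS dKM IH; case: n {IH} => [|n]; first by rewrite expr0; ring.
by rewrite /= exprS -!natr1; ring.
Qed.

Lemma dKXp x : dK (x ^+ p) = 0.
Proof. by rewrite dKX (pcharf0 pcharK) !mul0r. Qed.

Lemma dK_t : dK t = t.
Proof.
have -> : t = mono 1 (-1) by rewrite /lmono rmorph1 mul1r opprK expr1z.
by rewrite dK_lmono opprK mul1r.
Qed.

(** The coefficient field consists of constants, so the term of exponent 0 disappears. *)
Lemma vge1_dK x : vge v x 0 -> vge v (dK x) 1.
Proof.
apply: (laurent_bound (l0 := 0) HK Hv dKD ltr01 (C := 0)) => [y r|a l].
  by rewrite mul1r addr0; apply: dK_ge.
rewrite dK_lmono; case: (ltrgtP 0 l) => // [l0|<-] _; last first.
  by rewrite oppr0 mulr0 /lmono rmorph0 mul0r.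
by apply: vge_le (vge_lmono HK _ _); rewrite -[1]/(1%:~R) ler_int.
Qed.

Lemma lead_lmono x : x != 0 -> exists a l, [/\ a != 0, v x = l%:~R &
  vge v (x - mono a l) (l + 1)%:~R].
Proof.
move=> x0; have [l hl] := lf_int HK x0.
have hx : vge v x l%:~R by right; rewrite hl.
have [_ /(_ 1%N)] := lcoef_at HK hx.
rewrite /ltrunc big_ord1 addr0 => h; exists (coef embk v t x l), l; split=> //.
apply/eqP => c0; move: h; rewrite c0 /lmono rmorph0 mul0r subr0.
by move/(vgeE x0); rewrite hl ler_int gerDl.
Qed.

Lemma intr_neq0 (l : int) : ~~ (p%:Z %| l)%Z -> (l%:~R : k) != 0.
Proof.
move=> pl; have chk := lf_pchar HK.
have : (`|l|%N%:R : k) != 0 by rewrite -(dvdn_pcharf chk); move: pl; rewrite dvdzE.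
by case: l {pl} => n //; rewrite NegzE /= rmorphN oppr_eq0.
Qed.

Lemma val_dK x (l : int) : x != 0 -> v x = l%:~R -> ~~ (p%:Z %| l)%Z ->
  dK x != 0 /\ v (dK x) = l%:~R.
Proof.
move=> x0 hl pl; have [a [l' [a0 hl' h]]] := lead_lmono x0.
have {l' hl' h} h : vge v (x - mono a l) (l + 1)%:~R.
  by move: h; rewrite (_ : l' = l) //; apply: (@intr_inj rat); rewrite -hl -hl'.
have c0 : a * (- l)%:~R != 0 by rewrite mulf_neq0 // rmorphN oppr_eq0 intr_neq0.
have [m0 mv] := val_lmono HK l c0.
have := val_addl Hv m0; rewrite mv -dK_lmono => /(_ (dK (x - mono a l))).
rewrite -dKD [_ + (_ - _)]addrC subrK; apply; apply: vgt_lt (dK_ge h).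
by rewrite ltr_int ltrDl.
Qed.

Lemma residue_exists x : vge v x 0 -> exists c, vgt v (x - embk c) 0.
Proof.
move=> h; have [_ /(_ 1%N)] := lcoef_at HK (h : vge v x 0%:~R).
rewrite /ltrunc big_ord1 addr0 /lmono oppr0 expr0z mulr1 add0r => h1.
by exists (coef embk v t x 0); apply: vgt_lt h1.
Qed.

(* Projection onto the exponents divisible by p. *)
Definition pr0 (x : K) : K := x - iter p.-1 dK x.

Lemma iter_dKD m x y : iter m dK (x + y) = iter m dK x + iter m dK y.
Proof. by elim: m => //= m ->; rewrite dKD. Qed.

Lemma iter_dK_ge m x r : vge v x r -> vge v (iter m dK x) r.
Proof. by move=> h; elim: m => //= m; apply: dK_ge. Qed.

Lemma iter_dK_lmono m a l : iter m dK (mono a l) = mono (a * (- l)%:~R ^+ m) l.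
Proof.
elim: m => [|m IH] /=; first by rewrite expr0 mulr1.
by rewrite IH dK_lmono exprSr mulrA.
Qed.

Lemma pr0D x y : pr0 (x + y) = pr0 x + pr0 y.
Proof. by rewrite /pr0 iter_dKD; ring. Qed.

Lemma pr0_ge x r : vge v x r -> vge v (pr0 x) r.
Proof. by move=> h; apply: vgeB => //; apply: iter_dK_ge. Qed.

Lemma pr0_Xp y x : pr0 (y ^+ p * x) = y ^+ p * pr0 x.
Proof.
rewrite /pr0 mulrBr; congr (_ - _); elim: p.-1 => //= m ->.
by rewrite dKM dKXp mul0r add0r.
Qed.

Lemma pr0_sum (I : Type) (s : seq I) (P : pred I) (G : I -> K) :
  pr0 (\sum_(i <- s | P i) G i) = \sum_(i <- s | P i) pr0 (G i).
Proof.
have h0 : pr0 0 = 0 by apply: (@addrI _ (pr0 0)); rewrite -pr0D !addr0.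
by elim/big_rec2: _ => // i a b _ <-; rewrite pr0D.
Qed.

Lemma prime_gt0p : (0 < p)%N. Proof. exact: prime_gt0 (lf_prime HK). Qed.

(** By Fermat, [iter p.-1 dK] is the identity on exponents prime to [p]. So [x] is the sum of
    [pr0 x] and of a part recovered from [dK x] by further derivations. *)
Lemma vge_pr0_dK x r : vge v (pr0 x) r -> vge v (dK x) r -> vge v x r.
Proof.
move=> h0 h1; have -> : x = pr0 x + iter p.-1 dK x by rewrite /pr0 subrK.
apply: vgeD => //; case: p (lf_prime HK) => [|[|m]] // _ /=.
by rewrite -iterS iterSr; apply: iter_dK_ge.
Qed.

Lemma val_dK_pr0 x : dK x != 0 -> vgt v (pr0 x) (v (dK x)) ->
  x != 0 /\ v x = v (dK x).
Proof.
move=> d0 h; have x0 : x != 0 by apply: contraNneq d0 => ->; rewrite dK0.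
split=> //; apply/eqP; rewrite eq_le; apply/andP; split.
  by apply: vgeE d0 _; apply: dK_ge; apply: vge_val.
by apply: (vgeE x0); apply: vge_pr0_dK; [apply: vgeW|apply: vge_val].
Qed.

Lemma dK_sum (I : Type) (s : seq I) (P : pred I) (G : I -> K) :
  dK (\sum_(i <- s | P i) G i) = \sum_(i <- s | P i) dK (G i).
Proof. by elim/big_rec2: _ => [|i a b _ <-]; rewrite ?dK0 ?dKD. Qed.

End LaurentDerivation.

(** * The perturbed Frobenius *)

Section PerturbedFrobenius.
Variables (p : nat) (k K : fieldType) (embk : {rmorphism k -> K}).
Variables (v : K -> rat) (t : K).
Hypothesis HK : laurent_field p embk v t.
Variables (N R : nat).
Hypotheses (N_gt0 : (0 < N)%N) (R_gt0 : (0 < R)%N) (R_cop : coprime R p).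

Local Notation mono := (lmono embk t).
Local Notation d := (dK embk v t).
Local Notation pr := (pr0 p embk v t).
Local Notation q := (p ^ N)%N.
Let Hv := lf_val HK.
Let chK := pcharK HK.
Let t0 := lf_t_neq0 HK.
Let u := t ^- R.

(* j is the k-semilinear continuous endomorphism t |-> t^q (1 + t^-R)^(1/R), a
   separable perturbation of the q-Frobenius. *)
Record jmap_spec (j : K -> K) (z lam : K) : Prop := JmapSpec {
  jm_z : z ^+ R = 1 + t ^- R;
  jm_z1 : vge v (z - 1) R%:R;
  jm_mono : forall a l, j (mono a l) = embk (a ^+ q) * (t ^+ q * z) ^ (- l);
  jm_val : forall x, x != 0 -> v (j x) = q%:R * v x;
  jm_close : forall x r, vge v x r -> vge v (j x - x ^+ q) (q%:R * r + R%:R);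
  jm_lam0 : lam != 0;
  jm_lam : v lam = R%:R;
  jm_d : forall x, d (j x) = lam * j (d x);
  jm_pr0 : forall x r, vge v x r -> vge v (pr (j x - x ^+ q)) (q%:R * r + (p * R)%:R) }.

Lemma val_tXn n : v (t ^- n) = n%:R.
Proof. by rewrite valV ?expf_neq0 // valX // (lf_vt HK); lra. Qed.

Lemma dKXz x (n : int) : x != 0 -> d (x ^ n) = n%:~R * x ^ n * (d x / x).
Proof.
move=> x0; have nat m : d (x ^+ m) = m%:R * x ^+ m * (d x / x).
  rewrite (dKX HK); case: m => [|m]; first by rewrite !mul0r.
  by rewrite /= exprSr; field.
case: n => m; first exact: nat.
rewrite NegzE -exprnN rmorphN /=.
have y0 : x ^+ m.+1 != 0 by rewrite expf_neq0.
have := dK1 HK; rewrite -(mulfV y0) (dKM HK) nat => h.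
have {}h : x ^+ m.+1 * d (x ^- m.+1) = - (m.+1%:R * x ^+ m.+1 * (d x / x) / x ^+ m.+1).
  by apply/eqP; rewrite -addr_eq0 addrC h.
apply: (mulfI y0); rewrite h; field.
by rewrite x0 y0.
Qed.

Let Rneq0 : (R%:R : K) != 0.
Proof.
rewrite -(dvdn_pcharf chK) -prime_coprime ?(lf_prime HK) //.
by rewrite coprime_sym.
Qed.

Lemma vge_exprz1 x (n : int) r : 0 < r -> vge v (x - 1) r -> vge v (x ^ n - 1) r.
Proof.
move=> r0 h.
have nat m : vge v (x ^+ m - 1) r.
  have -> : x = 1 + (x - 1) by ring.
  by apply: vge_expr1D => //; apply: ltW.
have gt m : vgt v (x ^+ m - 1) (v 1) by rewrite val1 //; apply: vgt_lt (nat m).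
case: n => m; first exact: nat.
have [n0 E] := val_addl Hv (oner_neq0 K) (gt m.+1).
have E2 : 1 + (x ^+ m.+1 - 1) = x ^+ m.+1 by ring.
rewrite E2 val1 // in n0 E.
rewrite NegzE -exprnN.
have -> : x ^- m.+1 - 1 = - (x ^+ m.+1 - 1) * x ^- m.+1 by field.
apply: vgeZr => //; first by apply: vgeN.
by right; rewrite valV // E oppr0.
Qed.

Let pp := lf_prime HK.
Let one_ge0 : vge v (1 : K) 0. Proof. by right; rewrite val1. Qed.

Lemma pr0_lmono a l : ~~ (p%:Z %| l)%Z -> pr (mono a l) = 0.
Proof.
move=> pl; rewrite /pr0 (iter_dK_lmono HK).
have l0 : ((- l)%:~R : k) != 0 by rewrite rmorphN oppr_eq0 (intr_neq0 HK).
suff -> : ((- l)%:~R : k) ^+ p.-1 = 1 by rewrite mulr1 subrr.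
apply: (mulfI l0); rewrite -exprS prednK ?prime_gt0 // mulr1.
by have := pFrobenius_aut_int (lf_pchar HK) (- l); rewrite pFrobenius_autE.
Qed.

Lemma pr01 : pr 1 = 1.
Proof.
rewrite /pr0; case: p pp => [|[|m]] // _ /=; rewrite -iterS iterSr (dK1 HK).
by rewrite (_ : iter m d 0 = 0) ?subr0 //; elim: m => //= m ->; rewrite (dK0 HK).
Qed.

(** The power [z ^ n] is a [p]-th power [h ^+ p] times a power of [1 + u] with exponent below [p],
    and [pr0] sees only the constant term of the latter. What remains is
    [h ^+ p - 1 = (h - 1) ^+ p], whence the gain from [R] to [p R]. *)
Lemma pr0_root (z : K) (n : int) : z ^+ R = 1 + u -> vge v (z - 1) R%:R ->
  vge v (pr (z ^ n - 1)) (p * R)%:R.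
Proof.
move=> zR z1; have R0 : 0 < R%:R :> rat by rewrite ltr0n.
have uR : vge v u R%:R by right; rewrite val_tXn.
have neq0 x : vge v (x - 1) R%:R -> x != 0.
  move=> h; apply/eqP => x0; move: h; rewrite x0 sub0r => /(vgeE _).
  by rewrite oppr_eq0 oner_eq0 valN // val1 // => /(_ isT); rewrite leNgt R0.
have z0 := neq0 _ z1.
have u1 : vge v (1 + u - 1) R%:R by rewrite addrC addKr.
have w0 := neq0 _ u1.
have [[a c] /= ac] : exists ac : nat * nat, (R * ac.1 = 1 + ac.2 * p)%N.
  have /(coprimeP _ R_gt0) [w hw] : coprime R p by [].
  by exists w; rewrite mulnC; lia.
have zE : z = (1 + u) ^+ a * (z ^ (- c%:Z)) ^+ p.
  rewrite -zR -exprM ac exprD expr1 mulnC mulnC exprM -exprnN exprVn -mulrA.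
  by rewrite -!exprM mulnC mulfV ?mulr1 // expf_neq0.
pose s := (a%:Z * n %/ p)%Z; pose m := (a%:Z * n %% p)%Z.
have p0 : p%:Z != 0 by rewrite eqz_nat -lt0n prime_gt0.
have m0 : 0 <= m by rewrite modz_ge0.
have mp : m < p%:Z by rewrite ltz_pmod // ltz_nat prime_gt0.
have [mm mmE] : exists mm : nat, m = mm%:Z by exists `|m|%N; rewrite gez0_abs.
pose h := (1 + u) ^ s * z ^ (- (c%:Z * n)).
have E : z ^ n = (1 + u) ^+ mm * h ^+ p.
  have an : a%:Z * n = s * p%:Z + mm%:Z by rewrite -mmE; apply: divz_eq.
  rewrite {1}zE /h expfzMl exprMn !exprnP !exprz_exp an expfzDr //.
  have -> : - c%:Z * (p%:Z * n) = - (c%:Z * n) * p%:Z by ring.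
  ring.
have h1 : vge v (h - 1) R%:R.
  have -> : h - 1 = (1 + u) ^ s * (z ^ (- (c%:Z * n)) - 1) + ((1 + u) ^ s - 1).
    by rewrite /h; ring.
  apply: vgeD => //; last exact: vge_exprz1.
  apply: vgeZl => //; last exact: vge_exprz1.
  rewrite -[_ ^ s](subrK 1); apply: vgeD => //.
  by apply: vge_le (vge_exprz1 s R0 u1); apply: ltW.
have hp : vge v (h ^+ p - 1) (p * R)%:R.
  rewrite natrM; have := exprpB chK 1 h 1; rewrite /= expn1 expr1n => <-.
  exact: vgeX.
(* The nonconstant terms are monomials with exponents [R i], where [0 < i <= mm < p]; these are
   prime to [p]. *)
have pru : pr ((1 + u) ^+ mm) = 1.
  rewrite exprDn (pr0_sum HK) big_ord_recl /= subn0 expr1n mul1r expr0 bin0 mulr1n.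
  rewrite pr01 big1 ?addr0 // => i _; rewrite /bump /= add1n expr1n mul1r.
  rewrite -mulr_natl.
  have -> : ('C(mm, i.+1))%:R * u ^+ i.+1 = mono ('C(mm, i.+1))%:R (R * i.+1)%:Z.
    by rewrite /lmono rmorph_nat /u exprVn -exprM exprnN.
  apply: pr0_lmono; rewrite dvdzE /= Euclid_dvdM //.
  rewrite negb_or -prime_coprime // coprime_sym R_cop /=.
  by rewrite gtnNdvd //; have := ltn_ord i; move: mp; rewrite mmE ltz_nat; lia.
have -> : pr (z ^ n - 1) = h ^+ p - 1.
  have e1 : pr (z ^ n) = h ^+ p by rewrite E mulrC (pr0_Xp HK) pru mulr1.
  by have := pr0D HK (z ^ n - 1) 1; rewrite subrK pr01 e1 => ->; rewrite addrK.
exact: hp.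
Qed.

(** All bounds are checked on monomials [m], where [j m - m ^+ q] equals [m ^+ q * (z ^ (- l) - 1)];
    [vge_exprz1] and [pr0_root] then give [jm_close] and [jm_pr0]. *)
Lemma jmap_exists : exists (j : {rmorphism K -> K}) (z lam : K), jmap_spec j z lam.
Proof.
have R0 : 0 < R%:R :> rat by rewrite ltr0n.
have q0 : 0 < q%:R :> rat by rewrite ltr0n expn_gt0 prime_gt0.
have uR : vge v u R%:R by right; rewrite val_tXn.
have [z [_ zR z1]] := root1D_exists chK Hv (@subfield_total K) (lf_complete HK)
  R_cop R_gt0 R0 I uR.
have [z0 vz] : z != 0 /\ v z = 0.
  have := val_addl Hv (oner_neq0 K) (y := z - 1); rewrite val1 // [1 + _]addrC subrK.
  by apply; apply: vgt_lt z1.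
pose tau := t ^+ q * z.
have tau0 : tau != 0 by rewrite mulf_neq0 // expf_neq0.
have vtau : v tau = - q%:R.
  by rewrite valM ?expf_neq0 // valX // (lf_vt HK) vz addr0 mulrN1.
pose phi : {rmorphism k -> K} := embk \o frobq (lf_pchar HK) N.
have phi_ge a : vge v (phi a) 0.
  have [->|a0] := eqVneq a 0; first by rewrite rmorph0.
  by right; rewrite /phi /= (lf_unit HK) // expf_neq0.
have wtau : v tau < 0 by rewrite vtau oppr_lt0.
pose j := lhom HK Hv (@subfield_total K) (lf_complete HK) (fun _ => I) phi_ge I tau0 wtau.
have jm a l : j (mono a l) = embk (a ^+ q) * tau ^ (- l).
  exact: (lhom_lmono HK Hv (@subfield_total K) (lf_complete HK) (fun _ => I) phi_ge I tau0 wtau).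
have jge x r : vge v x r -> vge v (j x) (q%:R * r).
  move/(lhom_ge HK Hv (@subfield_total K) (lf_complete HK) (fun _ => I) phi_ge I tau0 wtau).
  by rewrite vtau opprK.
have jv x : x != 0 -> v (j x) = q%:R * v x.
  by move=> x0; rewrite val_lhom // vtau opprK.
pose h x := j x - x ^+ q.
have hD x y : h (x + y) = h x + h y by rewrite /h rmorphD exprpD //; ring.
have hg x r : vge v x r -> vge v (h x) (q%:R * r + 0).
  by move=> hx; rewrite addr0; apply: vgeB => //; [apply: jge|apply: vgeX].
have hm a l : h (mono a l) = (mono a l) ^+ q * (z ^ (- l) - 1).
  rewrite /h jm /lmono /tau expfzMl exprMn rmorphXn /= !exprnP !exprz_exp.
  by rewrite [- l * _]mulrC; ring.
have hb (B : rat) x r : (forall n, vge v (z ^ n - 1) B) ->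
   vge v x r -> vge v (h x) (q%:R * r + B).
  move=> hB; have [->|x0] := eqVneq x 0.
    by rewrite /h rmorph0 expr0n expn_eq0 (gtn_eqF (prime_gt0 pp)) subr0; left.
  move/(vgeE x0) => rx.
  apply: vge_le (laurent_bound (B := q%:R * (Num.floor (v x))%:~R + B) HK Hv hD q0 hg _ (vge_floor v x)).
    by rewrite lerD2r ler_pM2l // -(val_floor HK).
  move=> a l le; rewrite hm; apply: vgeM => //; apply: (vge_le _ (vgeX Hv q (vge_lmono HK a l))).
  by rewrite ler_pM2l // ler_int.
have prD x y : pr (h (x + y)) = pr (h x) + pr (h y) by rewrite hD (pr0D HK).
have prg x r : vge v x r -> vge v (pr (h x)) (q%:R * r + 0).
  by move/hg; apply: (pr0_ge HK).
have prb x r : vge v x r -> vge v (pr (h x)) (q%:R * r + (p * R)%:R).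
  have [->|x0] := eqVneq x 0.
    rewrite /h rmorph0 expr0n expn_eq0 (gtn_eqF (prime_gt0 pp)) subr0.
    by move=> _; rewrite (_ : pr 0 = 0) //; apply: (@addrI _ (pr 0)); rewrite -(pr0D HK) !addr0.
  move/(vgeE x0) => rx.
  apply: vge_le (laurent_bound (B := q%:R * (Num.floor (v x))%:~R + (p * R)%:R) HK Hv prD q0 prg _ (vge_floor v x)).
    by rewrite lerD2r ler_pM2l // -(val_floor HK).
  move=> a l le; rewrite hm; have -> : q = (p ^ N.-1 * p)%N by rewrite -expnSr prednK.
  rewrite exprM (pr0_Xp HK) -exprM; apply: vgeM => //; last exact: pr0_root.
  apply: (vge_le _ (vgeX Hv _ (vge_lmono HK a l))).
  by rewrite ler_pM2l ?ltr0n ?muln_gt0 ?expn_gt0 ?prime_gt0 // ler_int.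
(* The chain rule forces [lam] to be the logarithmic derivative of [tau = t ^+ q * z]. The factor
   [t ^+ q] is a constant for [d], and that of [z] is read off by differentiating
   [z ^+ R = 1 + u]. *)
pose lam := d tau / tau.
have lamE : lam = - (u / (1 + u)).
  have dtq : d (t ^+ q) = 0.
    have -> : q = (p ^ N.-1 * p)%N by rewrite -expnSr prednK.
    by rewrite exprM (dKXp HK).
  have -> : lam = d z / z.
    rewrite /lam /tau (dKM HK) dtq mul0r add0r; field.
    by rewrite expf_neq0 ?z0 ?t0.
  have du : d u = - R%:R * u.
    rewrite /u exprnN dKXz // (dK_t HK) divff // rmorphN /=; ring.
  have := congr1 d zR; rewrite (dKD HK) (dK1 HK) add0r du (dKX HK) => dz.
  have zR' : z ^+ R = z ^+ R.-1 * z by rewrite -exprSr prednK.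
  have {}dz : z ^+ R.-1 * d z = - u.
    by apply: (mulfI Rneq0); rewrite mulrA dz; ring.
  have z1R : z ^+ R.-1 != 0 by rewrite expf_neq0.
  rewrite -zR zR' -mulNr -dz; field.
  by rewrite z0 z1R.
have [uu1 vu1] : 1 + u != 0 /\ v (1 + u) = 0.
  by have := val_addl Hv (oner_neq0 K) (y := u); rewrite val1 //; apply; apply: vgt_lt uR.
have u0 : u != 0 by rewrite invr_neq0 // expf_neq0.
exists j, z, lam; split=> //.
- by move=> x r; apply: hb => n; apply: vge_exprz1.
- by rewrite lamE oppr_eq0 mulf_neq0 // invr_neq0.
- by rewrite lamE valN // val_div // vu1 subr0 val_tXn.
- move=> x; apply/eqP; rewrite -subr_eq0; apply/eqP.
  pose f x := d (j x) - lam * j (d x).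
  apply: (laurent_eq0 HK Hv (h := f) (kap := q%:R) (C := Num.min 0 (v lam)) _ q0).
  + by move=> x1 x2; rewrite /f rmorphD !(dKD HK) rmorphD mulrDr opprD addrACA.
  + move=> x1 r hr; apply: vgeB => //.
      apply: vge_le (dK_ge HK (jge _ _ hr)); rewrite gerDl ge_min lexx; by [].
    rewrite addrC; apply: vgeM => //; last by apply: jge; apply: (dK_ge HK).
    by apply: vge_le (vge_val v lam); rewrite ge_min lexx orbT.
  move=> a l; rewrite /f (dK_lmono HK) !jm (dKM HK) dKXz // -/lam.
  have -> : d (embk (a ^+ q)) = 0.
    have -> : q = (p ^ N.-1 * p)%N by rewrite -expnSr prednK.
    by rewrite exprM rmorphXn /= (dKXp HK).
  rewrite exprMn rmorphM mul0r add0r.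
  have -> : embk ((- l)%:~R ^+ q) = (- l)%:~R.
    rewrite -[LHS]/(embk (frobq (lf_pchar HK) N _)) !rmorph_int; by [].
  ring.
Qed.

End PerturbedFrobenius.

(** * Totally ramified extensions *)

Section TotallyRamified.
Variables (p : nat) (k K : fieldType) (embk : {rmorphism k -> K}).
Variables (v : K -> rat) (t : K).
Hypothesis HK : laurent_field p embk v t.
Variables (L : splittingFieldType K) (w : L -> rat).
Hypotheses (Hw : is_valuation w) (w_ext : forall a : K, a != 0 -> w a%:A = v a).

(** The valuation [w] is not renormalised on subfields: it extends that of [K], and a totally
    ramified [F] has value group generated by [1 / \dim F]. *)
Definition uniformizer (F : {subfield L}) (pi : L) : Prop :=
  [/\ pi \in F, pi != 0 & w pi = (\dim F)%:R^-1].

Lemma dim_gt0 (F : {subfield L}) : 0 < (\dim F)%:R :> rat.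
Proof. by rewrite ltr0n adim_gt0. Qed.

Lemma alg_eq0 (a : K) : ((a%:A : L) == 0) = (a == 0).
Proof. by rewrite scaler_eq0 oner_eq0 orbF. Qed.

Section Uniformizer.
Variables (F : {subfield L}) (pi : L) (Fpi : uniformizer F pi).
Let e := \dim F.
Let pi0 : pi != 0. Proof. by case: Fpi. Qed.
Let wpi : w pi = e%:R^-1. Proof. by case: Fpi. Qed.
Let e0 : 0 < e%:R :> rat. Proof. exact: dim_gt0. Qed.

Lemma unif_dist (i j : 'I_e) : i != j -> forall z : int,
  w (pi ^+ i) - w (pi ^+ j) != z%:~R.
Proof.
move=> ij z; rewrite !valX // wpi -mulrBl; apply/eqP => h.
have {}h : i%:R - j%:R = (z * e%:Z)%:~R :> rat.
  rewrite rmorphM /= -h; field; by rewrite gt_eqF.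
have {}h : (i%:Z - j%:Z) = z * e%:Z.
  by apply: (@intr_inj rat); rewrite -h rmorphB.
have ie := ltn_ord i; have je := ltn_ord j.
have z0 : z = 0 by nia.
by move: ij; rewrite -val_eqE /=; move: h; rewrite z0 mul0r; lia.
Qed.

Let pw (i : 'I_e) : L := pi ^+ i.
Let pw0 i : pw i != 0. Proof. by rewrite expf_neq0. Qed.
Let vint := lf_int HK.

Definition ucomb (c : 'I_e -> K) : L := comb (in_alg L) pw c.

Lemma ucombE c : ucomb c = \sum_i (c i)%:A * pi ^+ i. Proof. by []. Qed.

Lemma ucomb_in c : ucomb c \in F.
Proof.
case: Fpi => Fp _ _; rewrite /ucomb /comb; apply: rpred_sum => i _.
by rewrite -scalerAl mul1r rpredZ // rpredX.
Qed.

(** The powers of [pi] below the degree are free over [K] because their valuations are distinct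
    modulo the integers; counting dimensions, they span [F]. *)
Lemma ucomb_exists x : x \in F -> exists c, x = ucomb c.
Proof.
pose X := [tuple pi ^+ i | i < e].
have Xi (i : 'I_e) : X`_i = pi ^+ i by rewrite -tnth_nth tnth_mktuple.
have frX : free X.
  apply/freeP => c h; apply: (@comb_eq0 K L v w Hw vint (in_alg L) w_ext e pw pw0 unif_dist).
  rewrite -[RHS]h; apply: eq_bigr => j _.
  by rewrite /pw Xi /= -scalerAl mul1r.
have sX : (<<X>> <= F)%VS.
  apply/span_subvP => y /tnthP[i ->]; rewrite tnth_mktuple.
  by case: Fpi => Fp _ _; rewrite rpredX.
have EX : <<X>>%VS = F.
  apply/eqP; rewrite eqEdim sX /=; move: frX; rewrite /free size_tuple => /eqP ->.
  exact: leqnn.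
rewrite -EX => /coord_span ->; exists (fun i => coord X i x).
by apply: eq_bigr => i _; rewrite Xi /pw /= -scalerAl mul1r.
Qed.

Lemma ucomb_lead c k0 : c k0 != 0 ->
  exists k, [/\ c k != 0, ucomb c != 0, w (ucomb c) = w ((c k)%:A * pi ^+ k) &
     forall i, i != k -> vgt w ((c i)%:A * pi ^+ i) (w (ucomb c))].
Proof. exact: (@comb_lead K L v w Hw vint (in_alg L) w_ext e pw pw0 unif_dist). Qed.

Lemma ucomb_ge c r : vge w (ucomb c) r -> forall i, vge w ((c i)%:A * pi ^+ i) r.
Proof. exact: (@comb_ge K L v w Hw vint (in_alg L) w_ext e pw pw0 unif_dist). Qed.

Lemma ucomb_neq0 c : ucomb c != 0 -> exists k, c k != 0.
Proof.
move=> h; case: (pickP (fun i => c i != 0)) => [i ci|z]; first by exists i.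
case/negP: h; apply/eqP; apply: big1 => i _.
by have /negbFE/eqP -> := z i; rewrite rmorph0 mul0r.
Qed.

Lemma unif_complete : v_complete w (fun x => x \in F).
Proof.
move=> u uF uC.
have [||y [[c ->] yP]] :=
  @comb_complete K L v w Hw vint (in_alg L) w_ext e pw pw0 unif_dist (lf_complete HK) u.
- by move=> m; apply: ucomb_exists.
- exact: uC.
- by exists (ucomb c); split=> //; apply: ucomb_in.
Qed.

Lemma val_term (a : K) (i : nat) (z : int) : a != 0 -> v a = z%:~R ->
  (a%:A * pi ^+ i != 0) /\ w (a%:A * pi ^+ i) = (z * e%:Z + i%:Z)%:~R / e%:R.
Proof.
move=> a0 hz; have A0 : (a%:A : L) != 0 by rewrite alg_eq0.
split; first by rewrite mulf_neq0 // expf_neq0.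
rewrite valM ?expf_neq0 // w_ext // valX // wpi hz rmorphD rmorphM /=.
by field; rewrite gt_eqF.
Qed.

Lemma unif_val_int x : x \in F -> x != 0 -> exists z : int, w x = z%:~R / e%:R.
Proof.
move=> /ucomb_exists [c ->] /ucomb_neq0 [k0 /ucomb_lead [i [ci _ -> _]]].
have [z hz] := vint ci; have [_ ->] := val_term i ci hz.
by eexists.
Qed.

(* An additive operator is controlled by its values on the monomials a * pi^i;
   the bound is attained at elements of valuation prime to p. *)
Section Operators.
Variables (F' : fieldType) (w' : F' -> rat) (Hw' : is_valuation w').
Variables (D : L -> F') (kap C : rat).
Hypotheses (DD : {in F &, forall x y, D (x + y) = D x + D y}) (kap0 : 0 < kap).
Hypothesis D_mono : forall (a : K) (i : nat), a != 0 -> (i < e)%N ->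
  vge w' (D (a%:A * pi ^+ i)) (kap * w (a%:A * pi ^+ i) + C).

Let D0 : D 0 = 0.
Proof. by apply: (@addrI _ (D 0)); rewrite -DD ?rpred0 // !addr0. Qed.

Let term_in (a : K) i : a%:A * pi ^+ i \in F.
Proof. by case: Fpi => Fp _ _; rewrite -scalerAl mul1r rpredZ // rpredX. Qed.

Let D_sum (I : Type) (s : seq I) (G : I -> L) : (forall i, G i \in F) ->
  D (\sum_(i <- s) G i) = \sum_(i <- s) D (G i).
Proof.
move=> GF; elim: s => [|a s IH]; rewrite ?big_nil // !big_cons DD ?IH //.
exact: rpred_sum.
Qed.

Lemma unif_op_ge x : x \in F -> vge w' (D x) (kap * w x + C).
Proof.
move=> xF; have [->|x0] := eqVneq x 0; first by rewrite D0.
have [c Ec] := ucomb_exists xF.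
have ge := ucomb_ge (c := c) (r := w x); rewrite -Ec in ge.
rewrite {1}Ec ucombE D_sum => [|i]; last exact: term_in.
apply: vge_sum => // i _; have [->|ci] := eqVneq (c i) 0.
  by rewrite scale0r mul0r D0.
apply: vge_le (D_mono ci (ltn_ord i)); rewrite lerD2r ler_pM2l //.
apply: (vgeE (v := w)) (ge (vge_val w x) i).
by rewrite mulf_neq0 ?alg_eq0 // expf_neq0.
Qed.

Lemma unif_op_eq (Q : pred int) x (z : int) :
  (forall (a : K) (i : nat) (y : int), a != 0 -> (i < e)%N -> v a = y%:~R ->
     Q (y * e%:Z + i%:Z) -> D (a%:A * pi ^+ i) != 0 /\
     w' (D (a%:A * pi ^+ i)) = kap * w (a%:A * pi ^+ i) + C) ->
  x \in F -> x != 0 -> w x = z%:~R / e%:R -> Q z ->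
  D x != 0 /\ w' (D x) = kap * w x + C.
Proof.
move=> DQ xF x0 xz Qz; have [c Ec] := ucomb_exists xF.
have [k0 ck0] : exists k, c k != 0 by apply: ucomb_neq0; rewrite -Ec.
have [i [ci _ wi gt]] := ucomb_lead ck0; rewrite -Ec in wi gt.
have [y hy] := vint ci; have [_ E] := val_term i ci hy.
have yz : y * e%:Z + i%:Z = z.
  apply: (@intr_inj rat); apply: (@mulIf _ e%:R^-1); first by rewrite invr_neq0 // gt_eqF.
  by rewrite -E -wi.
have [//|n0 E'] := DQ _ _ y ci (ltn_ord i) hy; first by rewrite yz.
rewrite {1 2}Ec ucombE D_sum => [|m]; last exact: term_in.
rewrite (bigD1 i) //= wi -E'.
apply: val_addl => //; apply: vgt_sum => // m mi.
have [->|cm] := eqVneq (c m) 0; first by rewrite scale0r mul0r D0.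
apply: vgt_lt (D_mono cm (ltn_ord m)); rewrite E' ltrD2r ltr_pM2l // -wi.
by apply: (vgtE (v := w)) (gt m mi); rewrite mulf_neq0 ?alg_eq0 // expf_neq0.
Qed.

End Operators.

(** Total ramification: a term with positive power of [pi] has non-integral valuation, so only the
    coordinate in [K] contributes to the residue, which lies in [k]. *)
Lemma unif_residue x : x \in F -> vge w x 0 ->
  exists c : k, vgt w (x - (embk c)%:A) 0.
Proof.
move=> /ucomb_exists [c ->] h0; have ge := ucomb_ge h0.
have epos : (0 < e)%N by rewrite -(ltr0n rat).
pose o := Ordinal epos.
have c0 : vge v (c o) 0.
  have := ge o; rewrite expr0 mulr1.
  have [->//|co] := eqVneq (c o) 0; move/vgeE; rewrite alg_eq0 w_ext // => /(_ co).
  by right.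
have [r hr] := residue_exists HK c0; exists r.
rewrite ucombE (bigD1 o) //= expr0 mulr1 addrAC; apply: vgtD => //.
  rewrite -scalerBl; case: hr => [->|hr]; first by rewrite scale0r.
  have [->|n0] := eqVneq (c o - embk r) 0; first by rewrite scale0r.
  by right; rewrite w_ext.
apply: vgt_sum => // i io; have [->|ci] := eqVneq (c i) 0.
  by rewrite scale0r mul0r.
have [z hz] := vint ci; have [n0 E] := val_term i ci hz.
right; rewrite lt_neqAle (vgeE n0 (ge i)) andbT E eq_sym mulf_neq0 //.
  rewrite intr_eq0; apply/eqP => h.
  have ie := ltn_ord i; have i0 : (0 < i)%N by rewrite lt0n.
  have z0 : z = 0 by nia.
  by move: h; rewrite z0; lia.
by rewrite invr_neq0 // gt_eqF.
Qed.

End Uniformizer.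
End TotallyRamified.

(** * Uniqueness of the extended valuation, extension of embeddings and of the derivation *)

Record totram_galois (K : fieldType) (v : K -> rat) (L : splittingFieldType K)
    (w : L -> rat) : Prop := TotramGalois {
  tg_val : is_valuation w;
  tg_ext : forall a : K, a != 0 -> w a%:A = v a;
  tg_gal : galois 1%VS {:L};
  tg_unif : exists x : L, x != 0 /\ w x * (\dim {:L})%:R = 1 }.

Record alg_derivation (K : fieldType) (d : K -> K) (L : splittingFieldType K)
    (D : L -> L) : Prop := AlgDerivation {
  adD : forall x y, D (x + y) = D x + D y;
  adM : forall x y, D (x * y) = D x * y + x * D y;
  adK : forall a : K, D a%:A = (d a)%:A }.

Section Extension.
Variables (p : nat) (k K : fieldType) (embk : {rmorphism k -> K}).
Variables (v : K -> rat) (t : K).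
Hypothesis HK : laurent_field p embk v t.
Variables (L : splittingFieldType K) (w : L -> rat).
Hypothesis HL : totram_galois v w.

Let Hw := tg_val HL.
Let w_ext := tg_ext HL.

Lemma unifL_exists : exists pi, uniformizer w {:L}%AS pi.
Proof.
have [x [x0 wx]] := tg_unif HL; exists x; split=> //; first exact: memvf.
have d0 := dim_gt0 {:L}%AS.
by apply: (mulIf (lt0r_neq0 d0)); rewrite wx mulVf // lt0r_neq0.
Qed.

(** Write [x ^+ n] in the basis of powers of a uniformizer. On each basis term the two valuations
    differ by an amount bounded independently of [n]; dividing by a large [n] removes the defect. *)
Lemma val_ext_ge (w' : L -> rat) : is_valuation w' ->
  (forall a : K, a != 0 -> w' a%:A = v a) -> forall x, x != 0 -> w x <= w' x.
Proof.
move=> Hw' ext' x x0; have [pi Upi] := unifL_exists.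
have [_ pi0 wpi] := Upi; set e := \dim _ in wpi.
have e0 : 0 < e%:R :> rat by apply: dim_gt0.
pose C := e%:R * `|w' pi| + 1.
have C0 : 0 < C by rewrite /C ltr_wpDl ?ltr01 // mulr_ge0 // ltW.
have main n : n%:R * w x - C <= n%:R * w' x.
  have [c Ec] := ucomb_exists HK Hw w_ext Upi (memvf (x ^+ n)).
  have xn0 : x ^+ n != 0 by rewrite expf_neq0.
  have ge := ucomb_ge HK Hw w_ext Upi (c := c) (r := n%:R * w x).
  rewrite -Ec -valX // in ge; have {}ge := ge (vge_val _ _).
  rewrite -(valX Hw') //; apply: (vgeE (v := w')) => //.
  rewrite {1}Ec ucombE; apply: vge_sum => // i _.
  have [->|ci] := eqVneq (c i) 0; first by rewrite scale0r mul0r.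
  right; have A0 : ((c i)%:A : L) != 0 by rewrite alg_eq0.
  have := vgeE _ (ge i); rewrite mulf_neq0 ?expf_neq0 // => /(_ isT).
  rewrite !valM ?expf_neq0 // w_ext // ext' // !valX // wpi.
  have ie : (i%:R : rat) < e%:R by rewrite ltr_nat.
  have i0 : 0 <= i%:R :> rat by [].
  have ie1 : i%:R / e%:R < 1 :> rat by rewrite ltr_pdivrMr // mul1r.
  have ab := ler_norm (- w' pi); rewrite normrN in ab.
  have ab0 := normr_ge0 (w' pi).
  have : - (i%:R * w' pi) <= e%:R * `|w' pi| by nra.
  rewrite /C; lra.
rewrite leNgt; apply/negP => lt.
have gap : 0 < w x - w' x by rewrite subr_gt0.
set n := (`|(Num.floor (C / (w x - w' x)) + 1)%R|)%N.
have : C / (w x - w' x) < n%:R.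
  apply: lt_le_trans (floorD1_gt _) _.
  by rewrite -[X in _ <= X]/((Posz _)%:~R) ler_int; apply: lez_abs.
rewrite ltr_pdivrMr // mulrBr; have := main n; lra.
Qed.

Lemma val_ext_uniq (w' : L -> rat) : is_valuation w' ->
  (forall a : K, a != 0 -> w' a%:A = v a) -> forall x, x != 0 -> w' x = w x.
Proof.
move=> Hw' ext' x x0; apply/eqP; rewrite eq_le (val_ext_ge Hw' ext') // andbT.
have := val_ext_ge Hw' ext' (x := x^-1); rewrite invr_eq0 !valV // => /(_ x0).
by rewrite lerN2.
Qed.

Lemma val_aut (s : 'AEnd(L)) x : w (s x) = w x.
Proof.
have [->|x0] := eqVneq x 0; first by rewrite linear0.
apply: (val_ext_uniq (w' := fun x => w (s x))) => //.
  split=> [a b a0 b0|a b a0 b0 ab0].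
    by rewrite rmorphM valM // fmorph_eq0.
  by rewrite rmorphD; apply: Hw.2; rewrite -?rmorphD fmorph_eq0.
by move=> a a0; rewrite linearZ /= rmorph1 w_ext.
Qed.

(** Automorphisms preserve [w], so the norm to [F] of a uniformizer of [L] is a uniformizer of
    [F]. *)
Lemma unif_exists (F : {subfield L}) : exists pi, uniformizer w F pi.
Proof.
have [x [_ x0 wx]] := unifL_exists.
have gF : galois F {:L}.
  by apply: galoisS (tg_gal HL); rewrite sub1v subvf.
exists (galNorm F {:L} x); split.
- by apply: mem_galNorm => //; apply: memvf.
- by rewrite galNorm_eq0.
rewrite /galNorm -big_enum val_prod //; last by move=> i _; rewrite fmorph_eq0.
rewrite (eq_bigr (fun _ => w x)) => [|s _]; last exact: val_aut.
rewrite big_const_seq count_predT iter_addr_0 -cardE -(galois_dim gF) wx.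
have dd : (\dim F %| \dim {:L})%N by apply: field_dimS; apply: subvf.
have m0 : 0 < (\dim_F {:L})%:R :> rat.
  by rewrite ltr0n divn_gt0 ?adim_gt0 // dvdn_leq // adim_gt0.
rewrite -mulr_natl -{1}(divnK dd) natrM; field.
by rewrite !lt0r_neq0 // dim_gt0.
Qed.

Lemma minpolK x : exists Q : {poly K},
  [/\ Q \is monic, (map_poly (in_alg L) Q).[x] = 0,
   forall h : {poly K}, (map_poly (in_alg L) h).[x] = 0 -> Q %| h &
   (map_poly (in_alg L) Q^`()).[x] != 0].
Proof.
have /polyOver1P [Q EQ] := minPolyOver 1%AS x.
exists Q; split.
- by have := monic_minPoly 1%AS x; rewrite EQ map_monic.
- by rewrite -EQ; apply/eqP; apply: root_minPoly.
- move=> h h0; rewrite -(dvdp_map (in_alg L)) -EQ; apply: minPoly_dvdp.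
    by apply/polyOver1P; exists h.
  by apply/eqP.
have sep : separable_element 1 x.
  by have /and3P[_ /separableP h _] := tg_gal HL; apply: h; apply: memvf.
rewrite -deriv_map -EQ; apply: coprimep_root (root_minPoly 1%AS x).
by move: sep; rewrite /separable_element unlock.
Qed.

(** A uniformizer generates [L]; it is sent to a root of the transported minimal polynomial, and
    every element is evaluated through a polynomial representative. *)
Lemma hom_extends (Om : closedFieldType) (f : {rmorphism K -> Om}) :
  exists Phi : {rmorphism L -> Om}, forall a : K, Phi a%:A = f a.
Proof.
have [pi Upi] := unifL_exists.
have [Q [Qm Q0 Qd _]] := minpolK pi.
have rep x : exists h : {poly K}, x = (map_poly (in_alg L) h).[pi].
  have [c ->] := ucomb_exists HK Hw w_ext Upi (memvf x).
  exists (\sum_i (c i)%:P * 'X^i); rewrite rmorph_sum horner_sum ucombE.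
  by apply: eq_bigr => i _; rewrite rmorphM /= map_polyC map_polyXn hornerM hornerC hornerXn.
have [rho rho0] : exists rho, root (map_poly f Q) rho.
  apply: closed_rootP; rewrite size_map_poly.
  apply/eqP => /eqP/size_poly1P [c c0 Ec].
  move: Q0; rewrite Ec map_polyC hornerC /= => /eqP.
  by rewrite alg_eq0 (negPf c0).
pose rp x := sval (constructive_indefinite_description _ (rep x)).
have rpE x : x = (map_poly (in_alg L) (rp x)).[pi].
  by rewrite /rp; case: constructive_indefinite_description.
pose ev (h : {poly K}) := (map_poly f h).[rho].
have evE h x : x = (map_poly (in_alg L) h).[pi] -> ev (rp x) = ev h.
  move=> xh; have : (map_poly (in_alg L) (rp x - h)).[pi] = 0.
    by rewrite rmorphB hornerD hornerN -rpE -xh subrr.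
  move/Qd => /dvdpP [g Eg].
  apply/eqP; rewrite -subr_eq0 /ev -hornerN -hornerD -rmorphB Eg rmorphM hornerM.
  by move/eqP: rho0 => ->; rewrite mulr0.
have FB : {morph (fun x => ev (rp x)) : x y / x - y}.
  move=> x y; rewrite (evE (rp x - rp y)) /ev ?rmorphB ?hornerD ?hornerN //.
  by rewrite -!rpE.
have F1 : ev (rp 1) = 1.
  by rewrite (evE 1) /ev ?rmorph1 ?hornerC.
have FM : {morph (fun x => ev (rp x)) : x y / x * y}.
  move=> x y; rewrite (evE (rp x * rp y)) /ev ?rmorphM ?hornerM //.
  by rewrite -!rpE.
exists (mk_rmorph FB F1 FM) => a /=; rewrite (evE a%:P) /ev ?map_polyC ?hornerC //.
Qed.

(** The value [dpi] at the generator is forced by differentiating [Q.[pi] = 0], and separability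
    makes the denominator nonzero. The operator [E] on polynomials then kills [Q], which makes it
    independent of the representative. *)
Lemma deriv_extends : exists D : L -> L, alg_derivation (dK embk v t) D.
Proof.
pose d := dK embk v t.
have [pi Upi] := unifL_exists.
have [Q [Qm Q0 Qd Q1]] := minpolK pi.
have rep x : exists h : {poly K}, x = (map_poly (in_alg L) h).[pi].
  have [c ->] := ucomb_exists HK Hw w_ext Upi (memvf x).
  exists (\sum_i (c i)%:P * 'X^i); rewrite rmorph_sum horner_sum ucombE.
  by apply: eq_bigr => i _; rewrite rmorphM /= map_polyC map_polyXn hornerM hornerC hornerXn.
pose rp x := sval (constructive_indefinite_description _ (rep x)).
have rpE x : x = (map_poly (in_alg L) (rp x)).[pi].
  by rewrite /rp; case: constructive_indefinite_description.
pose dc (h : {poly K}) := map_poly d h.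
have d0 : d 0 = 0 by apply: (dK0 HK).
have dcE h i : (dc h)`_i = d h`_i by rewrite coef_map_id0.
have dcB g h : dc (g - h) = dc g - dc h.
  by apply/polyP => i; rewrite dcE !coefB !dcE /d (dKB HK).
have dcM g h : dc (g * h) = dc g * h + g * dc h.
  apply/polyP => i; rewrite dcE coefD !coefM /d (dK_sum HK) -big_split.
  by apply: eq_bigr => j _; rewrite (dKM HK) /= !dcE.
pose hp (h : {poly K}) := (map_poly (in_alg L) h).[pi].
have hpB g h : hp (g - h) = hp g - hp h by rewrite /hp rmorphB hornerD hornerN.
have hpD g h : hp (g + h) = hp g + hp h by rewrite /hp rmorphD hornerD.
have hpM g h : hp (g * h) = hp g * hp h by rewrite /hp rmorphM hornerM.
have hpr x : hp (rp x) = x by rewrite /hp -rpE.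
have hp0 : hp 0 = 0 by rewrite /hp rmorph0 hornerC.
pose dpi := - hp (dc Q) / hp Q^`().
pose E h := hp (dc h) + hp h^`() * dpi.
have EB g h : E (g - h) = E g - E h.
  by rewrite /E dcB derivB !hpB; ring.
have EM g h : E (g * h) = E g * hp h + hp g * E h.
  by rewrite /E dcM derivM !hpD !hpM; ring.
have EQ : E Q = 0.
  rewrite /E /dpi; field; exact: Q1.
have Ewd h x : x = hp h -> E (rp x) = E h.
  move=> xh; have : hp (rp x - h) = 0 by rewrite hpB -xh hpr subrr.
  move/Qd => /dvdpP [g Eg].
  apply/eqP; rewrite -subr_eq0 -EB Eg EM EQ mulr0 addr0.
  by rewrite [hp Q]Q0 mulr0.
exists (fun x => E (rp x)); split.
- move=> x y; have -> : x + y = x - (0 - y) by ring.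
  rewrite (Ewd (rp x - (0 - rp y))); last by rewrite !hpB !hpr hp0.
  by rewrite !EB {2}/E /dc map_poly0 deriv0 hp0; ring.
- move=> x y; rewrite (Ewd (rp x * rp y)); last by rewrite hpM !hpr.
  by rewrite EM !hpr.
- move=> a; rewrite (Ewd a%:P); last by rewrite /hp map_polyC hornerC.
  have -> : E a%:P = hp (d a)%:P + hp 0 * dpi.
    rewrite /E derivC; congr (hp _ + _).
    by apply/polyP => i; rewrite dcE !coefC; case: ifP.
  by rewrite hp0 mul0r addr0 /hp map_polyC hornerC.
Qed.

End Extension.

(** * Ramification breaks and differents *)

Section RamificationTheory.
Variables (p : nat) (k K : fieldType) (embk : {rmorphism k -> K}).
Variables (v : K -> rat) (t : K).
Hypothesis HK : laurent_field p embk v t.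
Variables (L : splittingFieldType K) (w : L -> rat).
Hypothesis HL : totram_galois v w.
Hypothesis dim_p : p.-nat (\dim {:L}).
Variables (D : L -> L) (HD : alg_derivation (dK embk v t) D).

Let Hw := tg_val HL.
Let w_ext := tg_ext HL.
Let pp := lf_prime HK.

Lemma pcharL : p \in [pchar L].
Proof. exact: (rmorph_pchar (in_alg L) (pcharK HK)). Qed.

Lemma w_embk (c : k) : c != 0 -> w (embk c)%:A = 0.
Proof. by move=> c0; rewrite w_ext ?fmorph_eq0 // (lf_unit HK). Qed.

Lemma w_natr i : ~~ (p %| i)%N -> w (i%:R : L) = 0.
Proof.
move=> pi; have -> : (i%:R : L) = (embk i%:R)%:A by rewrite rmorph_nat scaler_nat.
by rewrite w_embk // -(dvdn_pcharf (lf_pchar HK)).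
Qed.

Lemma AEndM (f g : 'AEnd(L)) x : (f * g)%g x = g (f x).
Proof. by rewrite -comp_lfunE. Qed.

Lemma dim_pnat (F : {subfield L}) : p.-nat (\dim F).
Proof. by apply: pnat_dvd dim_p; apply: field_dimS; apply: subvf. Qed.

Lemma p_dvd_dim (F : {subfield L}) : \dim F != 1%N -> (p %| \dim F)%N.
Proof.
move=> n1; have /p_natP [m E] := dim_pnat F; rewrite E in n1 *.
by case: m n1 {E} => [|m]; rewrite ?expn0 // expnS dvdn_mulr.
Qed.

(** Let [c] be the residue of [s x / x]. The residue for the [m]-th iterate is [c ^+ m], and
    iterating [\dim {:L}] times gives the identity. This dimension is a power of [p], hence
    [c = 1]. *)
Lemma aut_wild (s : 'AEnd(L)) x : x != 0 -> vgt w (s x - x) (w x).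
Proof.
move=> x0; have sx0 y : y != 0 -> s y != 0 by rewrite fmorph_eq0.
pose y := s x / x.
have y0 : y != 0 by rewrite mulf_neq0 ?invr_neq0 ?sx0.
have wy : w y = 0 by rewrite val_div ?sx0 // (val_aut HK HL) subrr.
have [pi Upi] := unifL_exists HL.
have yge : vge w y 0 by right; rewrite wy.
have [c hc] := unif_residue HK Hw w_ext Upi (memvf y) yge.
have alg1 : vge w (1 : L) 0 by right; rewrite val1.
have sc a : s (a%:A : L) = a%:A by rewrite linearZ /= rmorph1.
have it m : vgt w (iter m s x / x - (embk c)%:A ^+ m) 0.
  elim: m => [|m IH]; first by rewrite /= divff // expr0 subrr.
  have -> : iter m.+1 s x / x - (embk c)%:A ^+ m.+1 =
    s (iter m s x / x - (embk c)%:A ^+ m) * y +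
    (embk c)%:A ^+ m * (y - (embk c)%:A).
    rewrite rmorphB rmorphXn /= sc rmorphM fmorphV exprSr /y; field.
    by rewrite x0 sx0.
  apply: vgtD => //.
    rewrite -[0]addr0; apply: vgtMl => //.
    by case: IH => [->|h]; [rewrite linear0|right; rewrite (val_aut HK HL)].
  rewrite -[0]addr0; apply: vgtMr => //; apply: vgeX0 => //.
  rewrite -[(embk c)%:A](subKr y); apply: vgeB => //; exact: vgeW.
have sord : iter (\dim {:L}) s x = x.
  have gs : gal {:L} s \in 'Gal({:L} / 1)%g by rewrite gal_kHom ?sub1v // k1AHom.
  have := cyclic.expg_cardG gs; rewrite -(galois_dim (tg_gal HL)) dimv1 divn1 => h.
  have itg m : (gal {:L} s ^+ m)%g x = iter m s x.
    elim: m => [|m IH]; first by rewrite expg0 gal_id.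
    by rewrite expgSr galM ?memvf // IH galK ?memvf ?subvf.
  by rewrite -itg h gal_id.
have c1 : c = 1.
  have /p_natP [m E] := dim_p.
  have := it (\dim {:L}); rewrite sord divff //.
  have -> : 1 - (embk c)%:A ^+ \dim {:L} = (embk (1 - c ^+ \dim {:L}))%:A :> L.
    by rewrite -[RHS]/(in_alg L _) !rmorphB !rmorph1 !rmorphXn.
  have [e0 _|n0] := eqVneq (1 - c ^+ \dim {:L}) 0.
    apply: (exprp_inj (lf_pchar HK) (N := m)); rewrite -E expr1n.
    by apply/eqP; rewrite eq_sym -subr_eq0 e0.
  move/vgtE; rewrite alg_eq0 fmorph_eq0 => /(_ n0).
  by rewrite w_ext ?fmorph_eq0 // (lf_unit HK) // ltxx.
have -> : s x - x = x * (y - 1) by rewrite /y; field.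
rewrite -[X in vgt _ _ X]addr0; apply: vgtMr => //; first exact: vge_val.
by move: hc; rewrite c1 rmorph1 scale1r.
Qed.

(** Fixing one uniformizer per field turns [ibr] and [del] into functions of the field alone. *)
Definition pif (F : {vspace L}) : L :=
  choose_prop 0 (fun x => [/\ x \in F, x != 0 & w x = (\dim F)%:R^-1]).

Lemma pifP (F : {subfield L}) : uniformizer w F (pif F).
Proof. by rewrite /pif /choose_prop; apply: epsilon_spec; apply: (unif_exists HK HL). Qed.

Lemma pif_in (F : {subfield L}) : pif F \in F. Proof. by case: (pifP F). Qed.
Lemma pif_neq0 (F : {subfield L}) : pif F != 0. Proof. by case: (pifP F). Qed.
Lemma w_pif (F : {subfield L}) : w (pif F) = (\dim F)%:R^-1. Proof. by case: (pifP F). Qed.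

(** The lower ramification number of [s] (the largest [m] with [s] in the group of index [m])
    divided by the degree of [F]. *)
Definition ibr (F : {vspace L}) (s : L -> L) : rat := w (s (pif F) - pif F) - w (pif F).

Lemma pif_gen (F : {subfield L}) (s : 'AEnd(L)) :
  s (pif F) = pif F -> {in F, forall x, s x = x}.
Proof.
move=> sp x /(ucomb_exists HK Hw w_ext (pifP F)) [c ->].
rewrite ucombE rmorph_sum; apply: eq_bigr => i _.
by rewrite rmorphM rmorphXn /= sp linearZ /= rmorph1.
Qed.

Section OneField.
Variable (F : {subfield L}).
Let e := \dim F.
Let pi := pif F.
Let pi0 : pi != 0 := pif_neq0 F.
Let e0 : 0 < e%:R :> rat := dim_gt0 F.

Section Aut.
Variables (s : 'AEnd(L)) (s_moves : s pi != pi).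

Lemma ibr_gt0 : 0 < ibr F s.
Proof.
have := aut_wild s pi0; rewrite /ibr subr_gt0 => /vgtE; apply.
by rewrite subr_eq0.
Qed.

Lemma ibr_int : s pi \in F -> exists m : nat, ibr F s = m%:R / e%:R.
Proof.
move=> spF; have n0 : s pi - pi != 0 by rewrite subr_eq0.
have [z hz] := unif_val_int HK Hw w_ext (pifP F) (rpredB spF (pif_in F)) n0.
have gt := ibr_gt0; have E : ibr F s = (z - 1)%:~R / e%:R.
  by rewrite /ibr hz w_pif rmorphB /= -/e; field; rewrite gt_eqF.
have z1 : 0 < z - 1.
  by move: gt; rewrite E pmulr_lgt0 ?invr_gt0 // ltr0z.
by exists `|(z - 1)%R|%N; rewrite E natr_absz gtr0_norm.
Qed.

Let eps := s pi / pi - 1.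
Let eps_eq : s pi = pi * (1 + eps). Proof. by rewrite /eps; field. Qed.
Let eps_neq0 : eps != 0.
Proof.
rewrite /eps subr_eq0; apply: contra s_moves => /eqP h.
by rewrite -[s pi](divfK pi0) h mul1r.
Qed.
Let w_eps : w eps = ibr F s.
Proof.
have -> : eps = (s pi - pi) / pi by rewrite /eps; field.
by rewrite val_div // subr_eq0.
Qed.

Let aut_mono (a : K) i :
  s (a%:A * pi ^+ i) - a%:A * pi ^+ i = a%:A * pi ^+ i * ((1 + eps) ^+ i - 1).
Proof.
rewrite rmorphM rmorphXn /= linearZ /= rmorph1 eps_eq exprMn; ring.
Qed.

Lemma aut_sub_ge x : x \in F -> vge w (s x - x) (w x + ibr F s).
Proof.
move=> xF; have := unif_op_ge HK Hw w_ext (pifP F) Hw (D := fun x => s x - x)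
  (kap := 1) (C := ibr F s); rewrite -[w x]mul1r; apply=> //.
  by move=> y z _ _; rewrite rmorphD /=; ring.
move=> a i a0 _; rewrite aut_mono mul1r; apply: vgeM => //; first exact: vge_val.
apply: vge_expr1D => //; first exact: ltW ibr_gt0.
by right; rewrite w_eps.
Qed.

(** On [a * pi ^+ i] with [i] prime to [p], the difference [(1 + eps) ^+ i - 1] has leading term
    [i * eps] and the general bound is attained. *)
Lemma aut_sub_eq x (z : int) : x \in F -> x != 0 -> w x = z%:~R / e%:R ->
  ~~ (p%:Z %| z)%Z -> s x - x != 0 /\ w (s x - x) = w x + ibr F s.
Proof.
move=> xF x0 wx pz.
have e1 : e != 1%N.
  apply: contra s_moves => /eqP e1; apply/eqP.
  have : F = 1%AS :> {vspace L}.
    by apply/eqP; rewrite eq_sym eqEdim sub1v dimv1 -/e e1.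
  move=> F1; have := pif_in F; rewrite -/pi {1}F1 => /vlineP [a ->].
  by rewrite linearZ /= rmorph1.
have pe := p_dvd_dim e1.
have := unif_op_eq HK Hw w_ext (pifP F) Hw (D := fun x => s x - x)
  (kap := 1) (C := ibr F s) _ _ _ (Q := fun z => ~~ (p%:Z %| z)%Z) _ xF x0 wx pz.
rewrite mul1r; apply => //.
- by move=> y y' _ _; rewrite rmorphD /=; ring.
- move=> a i a0 ie; rewrite aut_mono mul1r; apply: vgeM => //; first exact: vge_val.
  apply: vge_expr1D => //; first exact: ltW ibr_gt0.
  by right; rewrite w_eps.
move=> a i y a0 ie hy; rewrite rpredDl; last by rewrite dvdz_mull // dvdzE.
rewrite dvdzE /= => pi'; rewrite aut_mono mul1r.
have i0 : (i%:R : L) != 0 by rewrite -(dvdn_pcharf pcharL).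
have wi : w (i%:R : L) = 0 by rewrite w_natr.
have ige : 0 <= ibr F s by apply: ltW ibr_gt0.
have lin := expr1D_lin Hw i ige (or_intror (eq_ind_r (fun r => is_true (_ <= r)) (lexx _) w_eps) : vge w eps (ibr F s)).
have [n1 E1] : (1 + eps) ^+ i - 1 != 0 /\ w ((1 + eps) ^+ i - 1) = ibr F s.
  have n0 : i%:R * eps != 0 by rewrite mulf_neq0.
  have wn : w (i%:R * eps) = ibr F s by rewrite valM // wi add0r.
  have := val_addl Hw n0 (y := (1 + eps) ^+ i - 1 - i%:R * eps).
  rewrite wn [i%:R * _ + _]addrC subrK; apply.
  by apply: vgt_lt lin; rewrite ltrDl ibr_gt0.
have t0 : a%:A * pi ^+ i != 0 by rewrite mulf_neq0 ?alg_eq0 // expf_neq0.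
by split; [rewrite mulf_neq0|rewrite valM // E1].
Qed.

(** Integrality gains one step over [aut_sub_ge]: the coordinate with [i = 0] is fixed by [s], and
    every other term has valuation at least [1 / e]. *)
Lemma aut_sub_O x : x \in F -> vge w x 0 -> vge w (s x - x) (ibr F s + e%:R^-1).
Proof.
move=> xF x0; have [c Ec] := ucomb_exists HK Hw w_ext (pifP F) xF.
rewrite Ec in x0; have ge := ucomb_ge HK Hw w_ext (pifP F) x0.
rewrite Ec ucombE rmorph_sum -sumrB; apply: vge_sum => // i _ /=.
rewrite -/pi aut_mono.
have [->|ci] := eqVneq (c i) 0; first by rewrite scale0r !mul0r.
case: (posnP i) => [->|i0]; first by rewrite !expr0 subrr mulr0.
have [z hz] := lf_int HK ci; have [n0 E] := val_term Hw w_ext (pifP F) i ci hz.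
rewrite [ibr _ _ + _]addrC; apply: vgeM => //.
  right; rewrite E -/e ler_pdivlMr // mulVf ?gt_eqF //.
  have := vgeE n0 (ge i); rewrite E -/e pmulr_lge0 ?invr_gt0 // ler0z => h.
  rewrite -[1]/(1%:~R) ler_int; have ie := ltn_ord i; rewrite -/e in ie.
  have z0 : 0 <= z by nia.
  by rewrite ler_wpDl // mulr_ge0.
apply: vge_expr1D => //; first exact: ltW ibr_gt0.
by right; rewrite w_eps.
Qed.

End Aut.

Lemma D0 : D 0 = 0.
Proof. by apply: (@addrI _ (D 0)); rewrite -(adD HD) !addr0. Qed.

Lemma D1 : D 1 = 0.
Proof. by have := adK HD 1; rewrite (dK1 HK) scale1r scale0r. Qed.

Lemma DX x n : D (x ^+ n) = n%:R * x ^+ n.-1 * D x.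
Proof.
elim: n => [|n IH]; first by rewrite expr0 D1 !mul0r.
rewrite exprS (adM HD) IH; case: n {IH} => [|n]; first by rewrite expr0; ring.
by rewrite /= exprS -!natr1; ring.
Qed.

Lemma DXp x : D (x ^+ p) = 0.
Proof. by rewrite DX (pcharf0 pcharL) !mul0r. Qed.

Lemma D_sum (I : Type) (r : seq I) (P : pred I) (G : I -> L) :
  D (\sum_(i <- r | P i) G i) = \sum_(i <- r | P i) D (G i).
Proof. by elim/big_rec2: _ => [|i a b _ <-]; rewrite ?D0 ?(adD HD). Qed.

(* del F = v(different of F/K) - 1 + 1/e for the valuation w, which is normalised on K. *)
Definition del (F : {vspace L}) : rat := w (pif F) - w (D (pif F)).

(** The facts on the different that [D_ge], [D_eq] and [D_O] rely on. Strict positivity makes the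
    derivative of [pi] outweigh that of the coefficients; over [K] itself the different is
    trivial. *)
Definition del_ok (F : {subfield L}) : Prop :=
  [/\ D (pif F) != 0, 0 <= del F & \dim F = 1%N \/ 0 < del F].

Lemma dim1_alg x : e = 1%N -> x \in F -> exists b : K, x = b%:A.
Proof.
move=> e1; have -> : F = 1%AS :> {vspace L}.
  by apply/eqP; rewrite eq_sym eqEdim sub1v dimv1 -/e e1.
by move=> /vlineP [b ->]; exists b.
Qed.

Lemma D_alg_eq (b : K) (z : int) : b != 0 -> v b = z%:~R -> ~~ (p%:Z %| z)%Z ->
  D b%:A != 0 /\ w (D b%:A) = w b%:A.
Proof.
move=> b0 bz pz; have [n0 E] := val_dK HK b0 bz pz.
by rewrite (adK HD) alg_eq0 !w_ext // E bz.
Qed.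

Lemma del1 : e = 1%N -> D pi != 0 /\ del F = 0.
Proof.
move=> e1; have [b Eb] := dim1_alg e1 (pif_in F).
have b0 : b != 0 by have := pi0; rewrite /pi Eb alg_eq0.
have vb : v b = 1%:~R by have := w_pif F; rewrite Eb w_ext // -/e e1 invr1.
have [] := D_alg_eq b0 vb _; first by rewrite dvdzE /= dvdn1 (gtn_eqF (prime_gt1 pp)).
by rewrite -Eb => n0 E; split=> //; rewrite /del E subrr.
Qed.

Section Der.
Hypothesis Fok : del_ok F.

Let D_mono (a : K) i :
  D (a%:A * pi ^+ i) = (dK embk v t a)%:A * pi ^+ i + a%:A * pi ^+ i * (i%:R * (D pi / pi)).
Proof.
rewrite (adM HD) (adK HD) DX; congr (_ + _).
by case: i => [|i]; [rewrite !mul0r !mulr0|rewrite /= exprS; field].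
Qed.

Let w_Dpi : w (D pi / pi) = - del F.
Proof. by case: Fok => n0 _ _; rewrite val_div // /del opprB. Qed.

Let D_term1 (a : K) i : a != 0 ->
  vge w ((dK embk v t a)%:A * pi ^+ i) (w (a%:A * pi ^+ i)).
Proof.
move=> a0; rewrite valM ?alg_eq0 ?expf_neq0 // w_ext //; apply: vgeM => //.
  have := dK_ge HK (vge_val v a); have [->|n0] := eqVneq (dK embk v t a) 0.
    by rewrite scale0r.
  by move/(vgeE n0); right; rewrite w_ext.
exact: vge_val.
Qed.

Let D_term2 (a : K) i :
  vge w (a%:A * pi ^+ i * (i%:R * (D pi / pi))) (w (a%:A * pi ^+ i) - del F).
Proof.
apply: vgeM => //; first exact: vge_val.
by apply: vge_natl => //; right; rewrite w_Dpi.
Qed.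

Let D_mono_ge (a : K) i : a != 0 -> (i < \dim F)%N ->
  vge w (D (a%:A * pi ^+ i)) (1 * w (a%:A * pi ^+ i) + - del F).
Proof.
move=> a0 _; rewrite D_mono mul1r; apply: vgeD => //.
by case: Fok => _ d0 _; apply: vge_le (D_term1 _ a0); rewrite gerBl.
Qed.

Lemma D_ge x : x \in F -> vge w (D x) (w x - del F).
Proof.
move=> xF; have := unif_op_ge HK Hw w_ext (pifP F) Hw (D := D) (kap := 1) (C := - del F).
rewrite -[w x]mul1r; apply=> //.
by move=> y z _ _; apply: (adD HD).
Qed.

Lemma D_eq x (z : int) : x \in F -> x != 0 -> w x = z%:~R / e%:R ->
  ~~ (p%:Z %| z)%Z -> D x != 0 /\ w (D x) = w x - del F.
Proof.
move=> xF x0 wx pz.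
have [e1|e1] := eqVneq e 1%N.
  have [b Eb] := dim1_alg e1 xF; have [_ dz] := del1 e1.
  have b0 : b != 0 by have := x0; rewrite Eb alg_eq0.
  rewrite dz subr0 Eb; apply: (D_alg_eq b0 _ pz).
  by have := wx; rewrite Eb w_ext // e1 divr1.
have := unif_op_eq HK Hw w_ext (pifP F) Hw (D := D) (kap := 1) (C := - del F) _ _ _
  (Q := fun z => ~~ (p%:Z %| z)%Z) _ xF x0 wx pz.
rewrite mul1r; apply=> //; first by move=> y y' _ _; apply: (adD HD).
move=> a i y a0 ie hy pyi; rewrite D_mono mul1r.
have n0 : a%:A * pi ^+ i != 0 by rewrite mulf_neq0 ?alg_eq0 // expf_neq0.
case: Fok => Dn0 d0 d1.
have pe := p_dvd_dim e1.
have dgt : 0 < del F by case: d1 => // /eqP; rewrite (negPf e1).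
move: pyi; rewrite rpredDl; last by rewrite dvdz_mull // dvdzE.
rewrite dvdzE /= => pi'.
have i0 : (i%:R : L) != 0 by rewrite -(dvdn_pcharf pcharL).
have wi : w (i%:R : L) = 0 by rewrite w_natr.
have q0 : D pi / pi != 0 by rewrite mulf_neq0 // invr_neq0.
have iq0 : i%:R * (D pi / pi) != 0 by rewrite mulf_neq0.
have n1 : a%:A * pi ^+ i * (i%:R * (D pi / pi)) != 0 by rewrite mulf_neq0.
have E1 : w (a%:A * pi ^+ i * (i%:R * (D pi / pi))) = w (a%:A * pi ^+ i) - del F.
  by rewrite (valM Hw n0) // (valM Hw i0) // wi w_Dpi add0r.
rewrite addrC -E1; apply: val_addl => //.
by apply: vgt_lt (D_term1 _ a0); rewrite E1 gtrBl.
Qed.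

Lemma D_O x : x \in F -> vge w x 0 -> vge w (D x) (e%:R^-1 - del F).
Proof.
move=> xF x0; have [c Ec] := ucomb_exists HK Hw w_ext (pifP F) xF.
rewrite Ec in x0; have ge := ucomb_ge HK Hw w_ext (pifP F) x0.
case: Fok => Dn0 d0 d1.
rewrite Ec ucombE D_sum; apply: vge_sum => // i _ /=; rewrite -/pi.
have [->|ci] := eqVneq (c i) 0; first by rewrite scale0r !mul0r D0.
have [z hz] := lf_int HK ci; have [n0 E] := val_term Hw w_ext (pifP F) i ci hz.
have h := vgeE n0 (ge i).
case: (posnP i) => [i0|i0].
  rewrite i0 expr0 mulr1 (adK HD).
  have : vge v (c i) 0.
    by right; move: h; rewrite i0 expr0 mulr1 w_ext.
  move/(vge1_dK HK); have [->|n1] := eqVneq (dK embk v t (c i)) 0.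
    by rewrite scale0r.
  move/(vgeE n1) => h1; right; rewrite w_ext //; apply: le_trans h1.
  have : e%:R^-1 <= 1 :> rat by rewrite invf_le1 // ler1n -(ltr0n rat).
  lra.
have := D_mono_ge ci (ltn_ord i); rewrite mul1r; apply: vge_le.
rewrite lerD2r E -/e ler_pdivlMr // mulVf ?gt_eqF //.
move: h; rewrite E -/e pmulr_lge0 ?invr_gt0 // ler0z => h.
rewrite -[1]/(1%:~R) ler_int; have ie := ltn_ord i; rewrite -/e in ie.
have z0 : 0 <= z by nia.
by rewrite ler_wpDl // mulr_ge0.
Qed.

End Der.
End OneField.
End RamificationTheory.

(** * Towers, differents and the largest upper break *)

Fact int_unit_gt0 (a b : int) : 0 < b -> 1 = a * b -> b = 1.
Proof.
move=> b0 h; have : (b %| 1)%Z by apply/dvdzP; exists a.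
by rewrite dvdz1 => /eqP; lia.
Qed.

Fact del_tower_arith (a b c d e : rat) : a + b - c + d = b - e -> c - d = e + a.
Proof. lra. Qed.

Fact ubreak_lt_arith (iF iE s S ei dF dE : rat) : iF <= S -> S <= s + (dE - dF) ->
  s + ei <= iE -> iF + dF + ei <= iE + dE.
Proof. lra. Qed.

Section RelativeRamification.
Variables (p : nat) (k K : fieldType) (embk : {rmorphism k -> K}).
Variables (v : K -> rat) (t : K).
Hypothesis HK : laurent_field p embk v t.
Variables (L : splittingFieldType K) (w : L -> rat).
Hypothesis HL : totram_galois v w.
Hypothesis dim_p : p.-nat (\dim {:L}).
Variables (D : L -> L) (HD : alg_derivation (dK embk v t) D).

Let Hw := tg_val HL.
Let w_ext := tg_ext HL.
Let pp := lf_prime HK.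
Local Notation pi := (pif w).
Local Notation ib := (ibr w).
Local Notation dl := (del w D).

Section Tower.
Variables (F E : {subfield L}) (gFE : galois F E).
Let G := 'Gal(E / F)%g.
Let sFE : (F <= E)%VS. Proof. by case/and3P: gFE. Qed.

(** The minimal polynomial over [F] of the uniformizer of [E], an Eisenstein polynomial. *)
Definition relpol : {poly L} := \prod_(h in G) ('X - (h (pi E))%:P).

Lemma pif_conj_in (h : gal_of E) : h (pi E) \in E.
Proof. by apply: memv_gal; apply: (pif_in HK HL). Qed.

Lemma relpol_monic : relpol \is monic.
Proof. exact: monic_prod_XsubC. Qed.

Lemma relpol_in i : relpol`_i \in F.
Proof.
have <- : fixedField G = F by apply/galois_fixedField.
have Eco : relpol`_i \in E.
  have : relpol \is a polyOver E.
    apply: rpred_prod => h _; rewrite polyOverXsubC; exact: pif_conj_in.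
  by move/polyOverP; apply.
apply/fixedFieldP => // s sG.
have Es : map_poly (gal_repr s) relpol = relpol.
  rewrite /relpol rmorph_prod [RHS](reindex_inj (mulIg s)) /=.
  apply: eq_big => [h|h _]; first by rewrite groupMr.
  by rewrite map_polyXsubC /= galM // (pif_in HK HL).
by rewrite -{2}Es coef_map.
Qed.

Lemma relpol_ge i : vge w relpol`_i 0.
Proof.
move: i; apply: (big_ind (fun q : {poly L} => forall i, vge w q`_i 0)).
- by move=> i; rewrite coef1; case: eqP => _; [right; rewrite val1|left].
- move=> q1 q2 h1 h2 i; rewrite coefM; apply: vge_sum => // j _.
  by apply: vgeZl.
move=> h _ i; rewrite coefB coefX coefC; apply: vgeB => //.
  by case: eqP => _; [right; rewrite val1|left].
case: eqP => _; last by left.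
by right; rewrite (val_aut HK HL) (w_pif HK HL) invr_ge0 ltW ?dim_gt0.
Qed.

Lemma card_relgal : #|G|%:R / (\dim E)%:R = (\dim F)%:R^-1 :> rat.
Proof.
rewrite -(galois_dim gFE); have dd : (\dim F %| \dim E)%N by apply: field_dimS.
have m0 : 0 < (\dim_F E)%:R :> rat.
  by rewrite ltr0n divn_gt0 ?adim_gt0 // dvdn_leq // adim_gt0.
rewrite -{2}(divnK dd) natrM; field.
by rewrite !lt0r_neq0 // dim_gt0.
Qed.

Lemma gal_moves (h : gal_of E) : h != 1%g -> h (pi E) != pi E.
Proof.
apply: contra => /eqP h1; apply/gal_eqP => x xE.
by rewrite gal_id; apply: (pif_gen HK HL h1).
Qed.

Lemma D_horner (g : {poly L}) x :
  D g.[x] = \sum_(i < size g) D g`_i * x ^+ i + g^`().[x] * D x.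
Proof.
have -> : g^`().[x] * D x = \sum_(i < size g) g`_i * D (x ^+ i).
  rewrite -{1}(coefK g) poly_def raddf_sum horner_sum mulr_suml.
  apply: eq_bigr => i _; rewrite /= derivZ derivXn hornerZ hornerMn hornerXn (DX HK HD).
  by rewrite -mulr_natl; ring.
rewrite horner_coef (D_sum HD) -big_split; apply: eq_bigr => i _.
by rewrite (adM HD).
Qed.

Lemma relpol_root : relpol.[pi E] = 0.
Proof.
rewrite /relpol (bigD1 1%g) ?group1 //= hornerM hornerXsubC gal_id subrr mul0r.
by [].
Qed.

Lemma relpol_deriv : relpol^`().[pi E] = \prod_(h in G | h != 1%g) (pi E - h (pi E)).
Proof.
rewrite /relpol (bigD1 1%g) ?group1 //= derivM derivXsubC mul1r hornerD hornerM.
rewrite hornerXsubC gal_id subrr mul0r addr0 horner_prod.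
by apply: eq_bigr => h _; rewrite hornerXsubC.
Qed.

Lemma w_relpol_deriv : relpol^`().[pi E] != 0 /\
  w relpol^`().[pi E] = \sum_(h in G | h != 1%g) ib E h + (\dim F)%:R^-1 - (\dim E)%:R^-1.
Proof.
have n0 (h : gal_of E) : h != 1%g -> pi E - h (pi E) != 0.
  by move=> h1; rewrite subr_eq0 eq_sym gal_moves.
rewrite relpol_deriv; split.
  by apply/prodf_neq0 => h /andP[_]; apply: n0.
rewrite -big_filter val_prod //; last first.
  by move=> h; rewrite mem_filter => /andP[/andP[_ h1] _]; apply: n0.
rewrite big_filter (eq_bigr (fun h : gal_of E => ib E h + (\dim E)%:R^-1)); last first.
  move=> h /andP[_ h1]; rewrite /ibr (w_pif HK HL) subrK -valN // opprB.
  by [].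
rewrite big_split /= -addrA; congr (_ + _).
have : \sum_(h in G) (\dim E)%:R^-1 = (\dim E)%:R^-1 +
    \sum_(h in G | h != 1%g) (\dim E)%:R^-1 :> rat by rewrite (bigD1 1%g).
rewrite sumr_const -[_^-1 *+ _]mulr_natl card_relgal => ->.
by rewrite addrAC subrr add0r.
Qed.

Lemma relpol_size : size relpol = #|G|.+1.
Proof. by rewrite /relpol -big_enum size_prod_XsubC cardE. Qed.

Lemma relpol0 : relpol`_0 != 0 /\ w relpol`_0 = (\dim F)%:R^-1.
Proof.
have -> : relpol`_0 = \prod_(h in G) (- h (pi E)).
  rewrite -horner_coef0 /relpol horner_prod; apply: eq_bigr => h _.
  by rewrite hornerXsubC sub0r.
have n0 (h : gal_of E) : - h (pi E) != 0.
  by rewrite oppr_eq0 fmorph_eq0 (pif_neq0 HK HL).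
split; first by apply/prodf_neq0 => h _; apply: n0.
rewrite -big_enum val_prod // (eq_bigr (fun _ => (\dim E)%:R^-1)); last first.
  by move=> h _; rewrite valN // (val_aut HK HL) (w_pif HK HL).
by rewrite big_enum sumr_const -card_relgal mulr_natl.
Qed.

Lemma del_tower : del_ok w D F -> D (pi E) != 0 /\
  dl E = dl F + \sum_(h in G | h != 1%g) ib E h.
Proof.
move=> Fok; have piE0 := pif_neq0 HK HL E.
have := D_horner relpol (pi E); rewrite relpol_root (D0 HD) => /esym/eqP.
have [r0 wr0] := relpol0; have [g0 wg] := w_relpol_deriv.
have p1 : ~~ (p%:Z %| 1)%Z by rewrite dvdzE /= dvdn1 (gtn_eqF (prime_gt1 pp)).
have wr0' : w relpol`_0 = 1%:~R / (\dim F)%:R by rewrite wr0 mul1r.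
have [Dr0 wDr0] := D_eq HK HL dim_p HD Fok (relpol_in 0) r0 wr0' p1.
rewrite relpol_size big_ord_recl expr0 mulr1 -addrA addr_eq0 => /eqP Eq.
pose rest := \sum_(i < #|G|) D relpol`_(bump 0 i) * pi E ^+ bump 0 i.
have rest_gt : vgt w rest (w (D relpol`_0)).
  apply: vgt_sum => // i _; rewrite wDr0 wr0.
  rewrite -[X in vgt _ _ X]addr0; apply: vgtMr => //.
    apply: (D_O HK HL dim_p HD Fok) => //; [exact: relpol_in|exact: relpol_ge].
  right; rewrite valX // (w_pif HK HL) mulr_gt0 ?invr_gt0 ?dim_gt0 //.
have [s0 ws] := val_addl Hw Dr0 rest_gt.
have Eq2 : D relpol`_0 + rest = - (relpol^`().[pi E] * D (pi E)).
  by apply/eqP; rewrite Eq -/rest; apply/eqP; ring.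
have Dp0 : D (pi E) != 0.
  by apply: contraNneq s0 => h; rewrite Eq2 h mulr0 oppr0.
split=> //; move: ws; rewrite Eq2 valN // valM // wg wDr0 wr0 /del !(w_pif HK HL).
exact: del_tower_arith.
Qed.

(** One half of the formula for ramification numbers in a quotient. Apply [s] to the coefficients of
    [relpol] and evaluate at [pi E]: the product runs over the lifts of [s], while the differences
    of coefficients are bounded by [aut_sub_O]. *)
Lemma ibr_tower (s : 'AEnd(L)) : (forall x, x \in F -> s x \in F) -> s (pi F) != pi F ->
  ib F s <= \sum_(h in G) ib E (fun x => s (h x)).
Proof.
move=> sF sm; have ie0 : 0 < (\dim E)%:R^-1 :> rat by rewrite invr_gt0 dim_gt0.
have ev : \prod_(h in G) (pi E - s (h (pi E))) =
    \sum_(i < size relpol) (s relpol`_i - relpol`_i) * pi E ^+ i.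
  have -> : \prod_(h in G) (pi E - s (h (pi E))) = (map_poly s relpol).[pi E].
    rewrite /relpol rmorph_prod horner_prod; apply: eq_bigr => h _ /=.
    by rewrite map_polyXsubC hornerXsubC.
  have -> : (map_poly s relpol).[pi E] = \sum_(i < size relpol) s relpol`_i * pi E ^+ i.
    rewrite horner_coef size_map_poly; apply: eq_bigr => i _.
    by rewrite coef_map.
  have r0 := relpol_root; rewrite horner_coef in r0.
  rewrite -[LHS]subr0 -[X in _ - X = _]r0 -sumrB.
  by apply: eq_bigr => i _; rewrite mulrBl.
have n0 (h : gal_of E) : h \in G -> pi E - s (h (pi E)) != 0.
  move=> hG; apply: contra sm; rewrite subr_eq0 => /eqP hs; apply/eqP.
  have := pif_gen HK HL (s := (gal_repr h * s)%g) (F := E).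
  rewrite AEndM => /(_ (esym hs)) /(_ (pi F)) /=; rewrite AEndM.
  rewrite (subvP sFE) ?(pif_in HK HL) // => /(_ isT).
  by rewrite (fixed_gal sFE hG) // (pif_in HK HL).
have ge : vge w (\prod_(h in G) (pi E - s (h (pi E)))) (ib F s + (\dim F)%:R^-1).
  rewrite ev; apply: vge_sum => // i _; apply: vgeZr => //.
    by apply: (aut_sub_O HK HL dim_p sm); [exact: relpol_in|exact: relpol_ge].
  by apply: vgeX0 => //; right; rewrite (w_pif HK HL) ltW.
have p0 : \prod_(h in G) (pi E - s (h (pi E))) != 0.
  by apply/prodf_neq0 => h; apply: n0.
have := vgeE p0 ge; rewrite -big_enum val_prod; last by move=> h; rewrite mem_enum; apply: n0.
  rewrite big_enum (eq_bigr (fun h : gal_of E => ib E (fun x => s (h x)) + (\dim E)%:R^-1)).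
    by rewrite big_split /= sumr_const -[_^-1 *+ _]mulr_natl card_relgal lerD2r.
  by move=> h _; rewrite /ibr (w_pif HK HL) subrK -valN // opprB.
exact: Hw.
Qed.

End Tower.

Lemma del_ok1 : del_ok w D 1%AS.
Proof.
have [n0 d0] := del1 HK HL HD (F := 1%AS) (dimv1 _).
by split=> //; [rewrite d0|left; rewrite dimv1].
Qed.

Section GaloisField.
Variables (E : {subfield L}) (gE : galois 1 E).
Let G := 'Gal(E / 1)%g.
Let e := \dim E.
Let e0 : 0 < e%:R :> rat := dim_gt0 E.

Lemma del_gal : D (pi E) != 0 /\ dl E = \sum_(h in G | h != 1%g) ib E h.
Proof.
have [n0 ->] := @del_tower 1%AS E gE del_ok1.
by have [_ ->] := del1 HK HL HD (F := 1%AS) (dimv1 _); rewrite add0r.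
Qed.

Lemma card_galE : #|G| = e.
Proof. by rewrite -(galois_dim gE) dimv1 divn1. Qed.

Lemma gal_nontrivial : e != 1%N -> exists2 h : gal_of E, h \in G & h != 1%g.
Proof.
move=> e1; apply/trivgPn; apply: contra e1 => /eqP G1.
by rewrite -card_galE /G G1 cards1.
Qed.

Lemma del_ok_gal : del_ok w D E.
Proof.
have [n0 dE] := del_gal.
have ge (h : gal_of E) : h != 1%g -> 0 < ib E h by move/gal_moves; apply: (ibr_gt0 HK HL dim_p).
split=> //; first by rewrite dE sumr_ge0 // => h /andP[_ /ge/ltW].
have [e1|e1] := eqVneq (\dim E) 1%N; [by left|right].
have [h hG h1] := gal_nontrivial e1.
rewrite dE (bigD1 h) ?hG //= ltr_pwDl ?ge //.
by rewrite sumr_ge0 // => h' /andP[/andP[_ /ge/ltW]].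
Qed.

Lemma vgen_field : vgen w (fun y => y \in E) = e%:R^-1.
Proof.
have U := pifP HK HL E; have gen : is_vgen w (fun y => y \in E) e%:R^-1.
  split; first by rewrite invr_gt0.
  split; last by exists (pi E); case: U.
  by move=> x xE x0; apply: (unif_val_int HK Hw w_ext U).
have : is_vgen w (fun y => y \in E) (vgen w (fun y => y \in E)).
  by rewrite /vgen /choose_prop; apply: epsilon_spec; exists e%:R^-1.
set d := vgen _ _ => -[d0 [dall [x [xE [x0 xd]]]]].
have [_ [eall [y [yE [y0 ye]]]]] := gen.
have [z1 h1] := eall x xE x0; have [z2 h2] := dall y yE y0.
rewrite xd in h1; rewrite ye h1 in h2.
have ei0 : 0 < e%:R^-1 :> rat by rewrite invr_gt0.
have z1p : 0 < z1 by move: d0; rewrite h1 pmulr_lgt0 // ltr0z.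
have : 1 = z2 * z1.
  apply: (@intr_inj rat); apply: (mulIf (lt0r_neq0 ei0)).
  by rewrite mul1r rmorphM /= -mulrA.
move=> h; have z11 := int_unit_gt0 z1p h.
by rewrite h1 z11 mul1r.
Qed.

Lemma mem_ramgrp (s : gal_of E) m : (s \in ramgrp w E m) =
  (s \in G) && ((s == 1%g) || (m%:R / e%:R <= ib E s)).
Proof.
rewrite inE; congr andb; rewrite /asbool vgen_field.
have wpi := w_pif HK HL E.
case: excluded_middle_informative => h; apply/esym.
  have [//|s1] := eqVneq s 1%g.
  have := h (pi E) (pif_in HK HL E); rewrite wpi invr_ge0 ltW // => /(_ isT) /vgeE.
  rewrite subr_eq0 gal_moves // => /(_ isT).
  by rewrite /ibr wpi -natr1 mulrDl mul1r -lerBrDr.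
apply/negP => h2; apply: h => x xE x0.
case/orP: h2 => [/eqP->|h2]; first by rewrite gal_id subrr; left.
have [sp|sm] := eqVneq (s (pi E)) (pi E).
  by left; rewrite (pif_gen HK HL sp) // subrr.
have xge : vge w x 0 by right.
have := aut_sub_O HK HL dim_p sm xE xge; apply: vge_le.
by rewrite -natr1 mulrDl mul1r lerD2r.
Qed.

(** Exchange the order of summation: the orders of the groups of index 1 to [b] add up to [b], from
    the identity, plus the ramification numbers of the other automorphisms. After division by [e]
    the latter sum is the different. *)
Lemma ubreakE : e != 1%N -> exists s : gal_of E, [/\ s \in G, s (pi E) != pi E,
  forall h : gal_of E, h (pi E) != pi E -> ib E h <= ib E s &
  ubreak w E = ib E s + dl E].
Proof.
move=> e1.
have [h0 h0G h01] := gal_nontrivial e1.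
case: (@Order.TotalTheory.arg_maxP _ _ _ h0 (fun h : gal_of E => h != 1%g)
   (fun h : gal_of E => ib E h) h01) => s s1 smax.
have inG (h : gal_of E) : h \in G by rewrite gal_kHom ?sub1v // k1AHom.
have sm := gal_moves s1.
have nP (h : gal_of E) : exists m : nat, h != 1%g -> ib E h = m%:R / e%:R.
  have [->|h1] := eqVneq h 1%g; first by exists 0%N.
  have [m hm] := ibr_int HK HL dim_p (gal_moves h1) (pif_conj_in h).
  by exists m.
pose n (h : gal_of E) : nat := sval (constructive_indefinite_description _ (nP h)).
have nE (h : gal_of E) : h != 1%g -> ib E h = (n h)%:R / e%:R.
  by rewrite /n; case: constructive_indefinite_description.
have memE (h : gal_of E) m : (h \in ramgrp w E m) = (h == 1%g) || (m <= n h)%N.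
  rewrite mem_ramgrp inG /=; have [//|h1] := eqVneq h 1%g.
  by rewrite nE // ler_pM2r ?invr_gt0 // ler_nat.
pose b := n s.
have nb (h : gal_of E) : h != 1%g -> (n h <= b)%N.
  move=> h1; have le : ib E h <= ib E s := smax h h1.
  by move: le; rewrite (nE h h1) (nE s s1) ler_pM2r ?invr_gt0 // ler_nat.
have ramb m : (b < m)%N -> #|ramgrp w E m| = 1%N.
  move=> bm; rewrite -(cards1 (1%g : gal_of E)); apply: eq_card => h.
  rewrite memE !inE; have [//|h1] := eqVneq h 1%g.
  by rewrite leqNgt (leq_ltn_trans (nb h h1)).
have lb : lbreak w E = b.
  have bP : (1 < #|ramgrp w E b|)%N /\ forall m, (b < m)%N -> #|ramgrp w E m| = 1%N.
    split=> //; have sub : [set 1%g; s] \subset ramgrp w E b.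
      by apply/subsetP => h; rewrite memE !inE => /orP[->//|/eqP->]; rewrite leqnn orbT.
    by apply: leq_trans (subset_leq_card sub); rewrite cards2 eq_sym s1.
  have : (1 < #|ramgrp w E (lbreak w E)|)%N /\
     forall m, (lbreak w E < m)%N -> #|ramgrp w E m| = 1%N.
    exact: (@epsilon_spec nat (inhabits 0%N) (fun b => (1 < #|ramgrp w E b|)%N /\
      forall m, (b < m)%N -> #|ramgrp w E m| = 1%N) (ex_intro _ b bP)).
  case=> c1 call; apply/eqP; rewrite eqn_leq; apply/andP; split.
    by rewrite leqNgt; apply/negP => h; rewrite ramb in c1.
  by rewrite leqNgt; apply/negP => h; have [] := bP; rewrite call.
exists s; split=> //.
  by move=> h hm; apply: smax; apply: contraNneq hm => ->; rewrite gal_id.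
rewrite /ubreak lb /herbrand.
have -> : #|ramgrp w E 0| = e.
  by rewrite -card_galE; apply: eq_card => h; rewrite memE leq0n orbT inG.
have [_ ->] := del_gal.
have -> : (\sum_(1 <= i < b.+1) (#|ramgrp w E i|)%:R : rat) =
   b%:R + \sum_(h in G | h != 1%g) (n h)%:R.
  rewrite -natr_sum; have -> : (\sum_(1 <= i < b.+1) #|ramgrp w E i|)%N =
     (b + \sum_(h in G | h != 1%g) n h)%N; last by rewrite natrD natr_sum.
  under eq_bigr => i _.
    rewrite (_ : #|_| = \sum_(h : gal_of E) (h \in ramgrp w E i))%N; last first.
      by rewrite -sum1_card big_mkcond; apply: eq_bigr => h _; case: (h \in _).
    over.
  rewrite exchange_big /= (bigD1 1%g) //=; congr (_ + _)%N.
    under eq_bigr => i _ do rewrite memE eqxx.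
    by rewrite sum_nat_const_nat subn1 muln1.
  rewrite [RHS](eq_bigl (fun h => h != 1%g)); last by move=> h; rewrite inG.
  apply: eq_bigr => h h1.
  under eq_bigr => i _ do rewrite memE (negPf h1) /=.
  rewrite -(subnKC (nb h h1)) -addnS (@big_cat_nat _ _ _ (n h).+1) //=; last first.
    by rewrite addnS ltnS leq_addr.
  rewrite (eq_big_nat _ _ (F2 := fun _ => 1%N)); last by move=> i /andP[_]; rewrite ltnS => ->.
  rewrite [X in (_ + X)%N]big_nat_cond [X in (_ + X)%N]big1 ?addn0.
    by rewrite sum_nat_const_nat subn1 muln1.
  by move=> i /andP[/andP[hi _] _]; rewrite leqNgt hi.
rewrite mulrDl mulr_suml nE //; congr (_ + _).
by apply: eq_bigr => h /andP[_ h1]; rewrite nE.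
Qed.

End GaloisField.

Lemma gal_stable (F : {subfield L}) (s : 'AEnd(L)) x : galois 1 F -> x \in F -> s x \in F.
Proof.
case/and3P=> _ _ /forall_inP nF xF; have := nF s.
rewrite inE kAutfE k1AHom => /(_ isT) /eqP <-.
exact: memv_img.
Qed.

(** Take an automorphism with the largest number on [F] and, among its extensions, one [s] with the
    largest number on [E]. By [ibr_tower] the number on [F] is at most that of [s] plus
    [dl E - dl F]. As [s] moves [F], it is not last on [E], which costs one more step
    [1 / \dim E]. *)
Lemma ubreak_lt (F E : {subfield L}) : galois 1 F -> galois 1 E -> (F <= E)%VS ->
  \dim F != 1%N -> \dim E != 1%N ->
  (forall s : 'AEnd(L), s (pi E) != pi E ->
    (forall h : gal_of E, h (pi E) != pi E -> ib E h <= ib E s) -> s (pi F) = pi F) ->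
  ubreak w F + (\dim E)%:R^-1 <= ubreak w E.
Proof.
move=> gF gE FE F1 E1 last_triv.
have gFE : galois F E by apply: galoisS gE; rewrite sub1v.
have [sF [_ sFm sFmax ->]] := ubreakE gF F1.
have [sE [_ sEm sEmax ->]] := ubreakE gE E1.
pose P (s : 'AEnd(L)) := s (pi F) == sF (pi F).
have P0 : P (gal_repr sF) by rewrite /P.
case: (@Order.TotalTheory.arg_maxP _ _ _ (gal_repr sF) P
   (fun s : 'AEnd(L) => ib E s) P0) => s Ps smax.
have sm : s (pi F) != pi F by move/eqP: Ps => ->.
have moves (h : 'AEnd(L)) : h (pi F) != pi F -> h (pi E) != pi E.
  apply: contra => /eqP hE; apply/eqP; apply: (pif_gen HK HL hE).
  by apply: (subvP FE); apply: (pif_in HK HL).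
have smE := moves _ sm.
have le1 : ib F sF <= \sum_(h in 'Gal(E / F)%g) ib E (fun x => s (h x)).
  have -> : ib F sF = ib F s by rewrite /ibr (eqP Ps).
  by apply: ibr_tower => // x xF; apply: gal_stable.
have le2 : \sum_(h in 'Gal(E / F)%g) ib E (fun x => s (h x)) <=
    ib E s + \sum_(h in 'Gal(E / F)%g | h != 1%g) ib E h.
  rewrite (bigD1 1%g) ?group1 //= {1}/ibr gal_id lerD2l.
  apply: ler_sum => h /andP[hG h1].
  have hF : h (pi F) = pi F by rewrite (fixed_gal FE hG) // (pif_in HK HL).
  have Phs : P (gal_repr h * s)%g by rewrite /P AEndM hF.
  have hsm : s (h (pi E)) - pi E != 0.
    rewrite subr_eq0 -AEndM; apply: moves; by rewrite (eqP Phs).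
  (* Maximality of [s] among the extensions. The ultrametric inequality then bounds the number of
     the composite with [h] by that of [h]. *)
  have le : w (s (h (pi E)) - pi E) <= w (s (pi E) - pi E).
    have le : ib E (gal_repr h * s)%g <= ib E s := smax _ Phs.
    by move: le; rewrite /ibr lerD2r AEndM.
  rewrite /ibr lerD2r -(val_aut HK HL s (h _ - _)) rmorphB /=.
  apply: (vgeE (v := w)); first by rewrite -rmorphB fmorph_eq0 subr_eq0 gal_moves.
  have -> : s (h (pi E)) - s (pi E) = (s (h (pi E)) - pi E) - (s (pi E) - pi E).
    by ring.
  by apply: vgeB => //; [exact: vge_val|right].
have [_ dE] := del_tower gFE (del_ok_gal gF).
have spE : s (pi E) \in E by apply: gal_stable => //; apply: (pif_in HK HL).
have [a ha] := ibr_int HK HL dim_p smE spE.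
have [b hb] := ibr_int HK HL dim_p sEm (pif_conj_in sE).
have e0 : 0 < (\dim E)%:R :> rat := dim_gt0 E.
have lt : ib E s < ib E sE.
  rewrite ltNge; apply/negP => ge; case/negP: sm; apply/eqP; apply: last_triv => // h hm.
  exact: le_trans (sEmax h hm) ge.
have ab : ib E s + (\dim E)%:R^-1 <= ib E sE.
  move: lt; rewrite ha hb ltr_pM2r ?invr_gt0 // ltr_nat => ab.
  by rewrite -[X in _ + X]mul1r -mulrDl ler_pM2r ?invr_gt0 // natr1 ler_nat.
apply: ubreak_lt_arith le1 _ ab; apply: le_trans le2 _.
by rewrite dE [dl F + _]addrC addrK.
Qed.

End RelativeRamification.

(** * Upper unitriangular matrices *)

Fact ne_left n (i j l : 'I_n) : (l < j)%N -> (i, l) != (i, j).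
Proof. by move=> lj; rewrite xpair_eqE eqxx -val_eqE /= ltn_eqF. Qed.

Fact ne_right n (i j l : 'I_n) : (i < l)%N -> (l, j) != (i, j).
Proof. by move=> il; rewrite xpair_eqE -val_eqE /= gtn_eqF. Qed.

Fact sub_ne n (i j c e a b : 'I_n) : (i <= c)%N -> (e <= j)%N -> (c, e) != (i, j) ->
  (c <= a)%N -> (b <= e)%N -> (a, b) != (i, j).
Proof.
move=> ic ej ne ca be; apply: contraNN ne; rewrite !xpair_eqE -!val_eqE /= => /andP[/eqP E1 /eqP E2].
by apply/andP; split; apply/eqP; lia.
Qed.

Fact range_ne_left (i j l : nat) : (i <= l < j)%N && (l != i) = (i < l < j)%N.
Proof. lia. Qed.

Fact subn_chain (i l l' j : nat) : (i <= l)%N -> (l < l')%N -> (l' <= j)%N ->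
  (l - i + (l' - l) + (j - l') = j - i)%N.
Proof. lia. Qed.

Fact leq_sub_chain (i a b j : nat) : (i <= a)%N -> (b <= j)%N -> (b - a <= j - i)%N.
Proof. lia. Qed.

Fact pred_lt (b e : nat) : (0 < e)%N -> (b <= e.-1)%N -> (b < e)%N.
Proof. lia. Qed.

Fact proper_gap n (i j a b : 'I_n) : (i <= a)%N -> (a < b)%N -> (b <= j)%N -> (a, b) != (i, j) ->
  (i.+1 < j)%N.
Proof. by rewrite xpair_eqE -!val_eqE /=; lia. Qed.

Fact sub_lt n (c e a b : 'I_n) : (c <= a)%N -> (a <= b)%N -> (b <= e)%N -> (a, b) != (c, e) ->
  (b - a < e - c)%N.
Proof. by move=> ca ab be; rewrite xpair_eqE -!val_eqE /=; lia. Qed.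

Section Unitriangular.
Variables (n : nat) (F : fieldType).
Implicit Types X Y : 'M[F]_n.

Definition UT X : Prop :=
  (forall a b : 'I_n, (b < a)%N -> X a b = 0) /\ (forall a, X a a = 1).

Lemma UTbP X : UTb X -> UT X.
Proof.
move=> /forallP h; split=> [a b ba|a].
  by have /forallP/(_ b)/andP[/implyP/(_ ba)/eqP] := h a.
by have /forallP/(_ a)/andP[_ /implyP/(_ (eqxx _))/eqP] := h a.
Qed.

Lemma UT_b X : UT X -> UTb X.
Proof.
move=> [h0 h1]; apply/forallP => a; apply/forallP => b; apply/andP; split.
  by apply/implyP => /h0 ->.
by apply/implyP => /eqP ->; rewrite h1.
Qed.

Lemma UT_unit X : UT X -> X \in unitmx.
Proof.
move=> [h0 h1]; rewrite unitmxE -det_tr det_trig.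
  rewrite big1 ?unitr1 // => i _; by rewrite mxE h1.
by apply/is_trig_mxP => a b ab; rewrite mxE h0.
Qed.

Lemma UT1 : UT 1%:M.
Proof.
split=> [a b ba|a]; rewrite mxE; last by rewrite eqxx.
by rewrite -val_eqE gtn_eqF.
Qed.

Lemma UT_mul X Y : UT X -> UT Y -> UT (X *m Y).
Proof.
move=> [x0 x1] [y0 y1]; split=> [a b ba|a]; rewrite mxE.
  apply: big1 => c _; have [ca|ac] := ltnP c a; first by rewrite x0 // mul0r.
  by rewrite y0 ?mulr0 //; apply: leq_trans ac.
rewrite (bigD1 a) //= x1 y1 mulr1 big1 ?addr0 // => c ca.
have [lt|le] := ltnP c a; first by rewrite x0 // mul0r.
by rewrite y0 ?mulr0 // ltn_neqAle le andbT eq_sym.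
Qed.

Lemma UT_inv X : UT X -> UT (invmx X).
Proof.
move=> UX; have [x0 x1] := UX; set Y := invmx X.
have XY : X *m Y = 1%:M by rewrite mulmxV // UT_unit.
have rec (a b : 'I_n) : (a == b)%:R = Y a b + \sum_(c : 'I_n | (a < c)%N) X a c * Y c b.
  have := congr1 (fun M : 'M_n => M a b) XY; rewrite !mxE => <-.
  rewrite (bigD1 a) //= x1 mul1r; congr (_ + _).
  rewrite [LHS](bigID (fun c : 'I_n => (a < c)%N)) /= [Z in _ + Z]big1 ?addr0.
    by apply: eq_bigl => c; rewrite -val_eqE /=; case: ltngtP.
  move=> c /andP[ca]; rewrite -leqNgt => le.
  by rewrite x0 ?mul0r // ltn_neqAle le andbT val_eqE.
have low (a b : 'I_n) : (b < a)%N -> Y a b = 0.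
  have [m] := ubnP (n - a); elim: m a => // m IH a am ba.
  have := rec a b; rewrite -val_eqE gtn_eqF //= big1 ?addr0 // => c ac.
  rewrite IH ?mulr0 //; last exact: ltn_trans ac.
  by have := ltn_ord c; lia.
split=> // a; have := rec a a; rewrite eqxx big1 ?addr0 // => c ac.
by rewrite low // mulr0.
Qed.

Lemma UT_inv_rec X (a b : 'I_n) : UT X -> (a < b)%N ->
  invmx X a b = - \sum_(c : 'I_n | (a < c <= b)%N) X a c * invmx X c b.
Proof.
move=> UX ab; have [x0 x1] := UX; have [y0 y1] := UT_inv UX; set Y := invmx X in y0 y1 *.
have XY : X *m Y = 1%:M by rewrite mulmxV // UT_unit.
have := congr1 (fun M : 'M_n => M a b) XY; rewrite !mxE -val_eqE ltn_eqF //=.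
rewrite (bigD1 a) //= x1 mul1r => /eqP; rewrite addr_eq0 => /eqP ->; congr (- _).
rewrite (bigID (fun c : 'I_n => (a < c <= b)%N)) /= [Z in _ + Z]big1 ?addr0.
  by apply: eq_bigl => c; rewrite -val_eqE /=; case: ltngtP.
move=> c /andP[ca]; rewrite negb_and -!ltnNge ltnS => /orP[le|bc].
  by rewrite x0 ?mul0r // ltn_neqAle le andbT val_eqE.
by rewrite y0 ?mulr0.
Qed.

(* A family of predicates, multiplicative along the chains a <= c <= b, is
   inherited by products and inverses of upper triangular matrices. *)
Record graded (Q : 'I_n -> 'I_n -> F -> Prop) : Prop := Graded {
  gr1 : forall a, Q a a 1;
  gr0 : forall a b, Q a b 0;
  grD : forall a b x y, Q a b x -> Q a b y -> Q a b (x + y);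
  grN : forall a b x, Q a b x -> Q a b (- x);
  grM : forall (a c b : 'I_n) x y, (a <= c)%N -> (c <= b)%N -> Q a c x -> Q c b y -> Q a b (x * y) }.

Definition mxgr (Q : 'I_n -> 'I_n -> F -> Prop) X : Prop :=
  forall a b : 'I_n, (a <= b)%N -> Q a b (X a b).

Lemma gr_sum Q (I : Type) (s : seq I) (P : pred I) (G : I -> F) a b : graded Q ->
  (forall i, P i -> Q a b (G i)) -> Q a b (\sum_(i <- s | P i) G i).
Proof.
by move=> gQ h; apply: (big_ind (Q a b)) => //; [exact: gr0|move=> x y; apply: (grD gQ)].
Qed.

Lemma mxgr_mul Q X Y : graded Q -> (forall a b : 'I_n, (b < a)%N -> X a b = 0) ->
  (forall a b : 'I_n, (b < a)%N -> Y a b = 0) -> mxgr Q X -> mxgr Q Y -> mxgr Q (X *m Y).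
Proof.
move=> gQ x0 y0 qx qy a b ab; rewrite mxE; apply: gr_sum => // c _.
have [ca|ac] := ltnP c a; first by rewrite x0 // mul0r; apply: gr0.
have [bc|cb] := ltnP b c; first by rewrite y0 // mulr0; apply: gr0.
by apply: (grM gQ ac cb); [apply: qx|apply: qy].
Qed.

Lemma mxgr_inv Q X : graded Q -> UT X -> mxgr Q X -> mxgr Q (invmx X).
Proof.
move=> gQ UX qx a b; have [m] := ubnP (b - a); elim: m a => // m IH a am ab.
have [y0 y1] := UT_inv UX.
have [lt|ge] := ltnP a b; last first.
  have -> : a = b by apply/val_inj/eqP; rewrite eqn_leq ab.
  by rewrite y1; apply: gr1.
rewrite UT_inv_rec //; apply: (grN gQ); apply: gr_sum => // c /andP[ac cb].
apply: (grM gQ (ltnW ac) cb); first exact: qx (ltnW ac).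
by apply: IH => //; lia.
Qed.

Lemma sandwich_low (U Q V : 'M[F]_n) (a b : 'I_n) : UT U -> UT V ->
  (forall a b : 'I_n, (b <= a)%N -> Q a b = 0) -> (b <= a)%N -> (U *m Q *m V) a b = 0.
Proof.
move=> [u0 u1] [v0 v1] q0 ba; rewrite mxE big1 // => c _.
have [bc|cb] := ltnP b c; first by rewrite v0 // mulr0.
rewrite mxE big1 ?mul0r // => e _.
have [ea|ae] := ltnP e a; first by rewrite u0 // mul0r.
by rewrite q0 ?mulr0 // (leq_trans cb) // (leq_trans ba).
Qed.

(** The unit diagonals of [U] and [V] isolate [Q i j] in the double sum. The predicate [Z] is left
    abstract because it is used for valuation bounds, for membership in a subfield and for
    vanishing. *)
Lemma conj_diff (Z : F -> Prop) (U Q V : 'M[F]_n) (i j : 'I_n) :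
  Z 0 -> (forall x y, Z x -> Z y -> Z (x + y)) ->
  UT U -> UT V -> (forall a b : 'I_n, (b <= a)%N -> Q a b = 0) ->
  (forall l l' : 'I_n, (i <= l)%N -> (l < l')%N -> (l' <= j)%N -> (l, l') != (i, j) ->
     Z (U i l * Q l l' * V l' j)) ->
  Z ((U *m Q *m V) i j - Q i j).
Proof.
move=> Z0 ZD [u0 u1] [v0 v1] q0 h.
have -> : (U *m Q *m V) i j = \sum_(x : 'I_n * 'I_n) U i x.1 * Q x.1 x.2 * V x.2 j.
  rewrite mxE -(pair_bigA _ (fun l l' => U i l * Q l l' * V l' j)) /=.
  rewrite exchange_big; apply: eq_bigr => l' _; rewrite mxE mulr_suml.
  by [].
rewrite (bigD1 (i, j)) //= u1 v1 mul1r mulr1 [Q i j + _]addrC addrK.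
apply: big_ind => // -[l l'] /= ne.
have [li|il] := ltnP l i; first by rewrite u0 // !mul0r.
have [l'l|ll'] := leqP l' l; first by rewrite q0 // mulr0 mul0r.
have [jl'|l'j] := ltnP j l'; first by rewrite v0 // mulr0.
exact: h.
Qed.

Lemma conj_lead (w : F -> rat) (U Q V : 'M[F]_n) (i j : 'I_n) c :
  is_valuation w -> UT U -> UT V -> (forall a b : 'I_n, (b <= a)%N -> Q a b = 0) ->
  (forall l l' : 'I_n, (i <= l)%N -> (l < l')%N -> (l' <= j)%N -> (l, l') != (i, j) ->
     vgt w (U i l * Q l l' * V l' j) c) ->
  vgt w ((U *m Q *m V) i j - Q i j) c.
Proof.
by move=> Hw; apply: (@conj_diff (fun x => vgt w x c)) => [|x y]; [left|apply: vgtD].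
Qed.

Lemma conj_lead_ge (w : F -> rat) (U Q V : 'M[F]_n) (i j : 'I_n) c :
  is_valuation w -> UT U -> UT V -> (forall a b : 'I_n, (b <= a)%N -> Q a b = 0) ->
  (forall l l' : 'I_n, (i <= l)%N -> (l < l')%N -> (l' <= j)%N -> (l, l') != (i, j) ->
     vge w (U i l * Q l l' * V l' j) c) ->
  vge w ((U *m Q *m V) i j - Q i j) c.
Proof.
by move=> Hw; apply: (@conj_diff (fun x => vge w x c)) => [|x y]; [left|apply: vgeD].
Qed.

End Unitriangular.

Lemma UT_map (n : nat) (F F' : fieldType) (f : {rmorphism F -> F'}) (X : 'M[F]_n) :
  UT X -> UT (map_mx f X).
Proof.
case=> x0 x1; split=> [a b ba|a]; rewrite mxE; first by rewrite x0 // rmorph0.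
by rewrite x1 rmorph1.
Qed.

Section FrobeniusMatrix.
Variables (p n : nat) (F : fieldType) (chp : p \in [pchar F]).
Implicit Types X Y : 'M[F]_n.

Lemma frobmxE e X : frobmx (p ^ e) X = map_mx (frobq chp e) X.
Proof. by []. Qed.

Lemma frobmx1E X : frobmx p X = frobmx (p ^ 1) X.
Proof. by rewrite expn1. Qed.

Lemma frobmxM e X Y : frobmx (p ^ e) (X *m Y) = frobmx (p ^ e) X *m frobmx (p ^ e) Y.
Proof. by rewrite !frobmxE map_mxM. Qed.

Lemma frobmxMp X Y : frobmx p (X *m Y) = frobmx p X *m frobmx p Y.
Proof. by rewrite !frobmx1E frobmxM. Qed.

Lemma frobmxV e X : frobmx (p ^ e) (invmx X) = invmx (frobmx (p ^ e) X).
Proof. by rewrite !frobmxE map_invmx. Qed.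

Lemma frobmxVp X : frobmx p (invmx X) = invmx (frobmx p X).
Proof. by rewrite !frobmx1E frobmxV. Qed.

Lemma frobmx_comp m m' X : frobmx m (frobmx m' X) = frobmx (m' * m) X.
Proof. by apply/matrixP => a b; rewrite !mxE exprM. Qed.

Lemma frobmx_UT m X : (0 < m)%N -> UT X -> UT (frobmx m X).
Proof.
move=> m0 [x0 x1]; split=> [a b ba|a]; rewrite mxE; last by rewrite x1 expr1n.
by rewrite x0 // expr0n gtn_eqF.
Qed.

Lemma frob_fixed (x : F) : x ^+ p = x -> exists m : nat, x = m%:R.
Proof.
move=> xp; have pr := pcharf_prime chp.
pose P : {poly F} := 'X^p - 'X.
have sP : size P = p.+1.
  by rewrite /P size_polyDl ?size_polyXn // size_polyN size_polyX ltnS prime_gt1.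
have P0 : P != 0 by rewrite -size_poly_eq0 sP.
pose r := [seq (m%:R : F) | m <- iota 0 p].
have [/mapP [m _ ->]|xr] := boolP (x \in r); first by exists m.
have : (size (x :: r) < size P)%N.
  apply: max_poly_roots => //.
    rewrite /= /root !hornerE xp subrr eqxx /=; apply/allP => y /mapP [m _ ->].
    by rewrite /root !hornerE -pFrobenius_autE pFrobenius_aut_nat subrr.
  rewrite /= xr map_inj_in_uniq ?iota_uniq // => a b.
  have aux c d : (c <= d)%N -> (d < p)%N -> (c%:R : F) = d%:R -> c = d.
    move=> cd dp h; have : ((d - c)%:R : F) == 0 by rewrite natrB // h subrr.
    rewrite -(dvdn_pcharf chp) => /dvdnP [[|z] hz]; first by lia.
    by nia.
  rewrite !mem_iota !add0n => /andP[_ ap] /andP[_ bp] h.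
  have [ab|/ltnW ba] := leqP a b; first exact: aux.
  by apply/esym/aux.
by rewrite /= size_map size_iota sP ltnn.
Qed.

End FrobeniusMatrix.

Lemma card_UTset (p n : nat) : prime p ->
  #|UTset n.+1 p| = (p ^ (n.+1 * n)./2)%N.
Proof.
move=> pp; pose T := {x : 'I_n.+1 * 'I_n.+1 | (x.1 < x.2)%N}.
pose mat (f : {ffun T -> 'F_p}) : 'M['F_p]_n.+1 :=
  \matrix_(a, b) if insub (a, b) is Some x then f x else (a == b)%:R.
have matUT f : UT (mat f).
  split=> [a b ba|a]; rewrite mxE.
    by rewrite insubN /= -?leqNgt 1?ltnW // -val_eqE gtn_eqF.
  by rewrite insubN ?ltnn // eqxx.
pose gl f : {'GL_n.+1['F_p]} := FinRing.Unit (UT_unit (matUT f) : mat f \is a GRing.unit).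
have glE f : GLval (gl f) = mat f by [].
have inj : injective gl.
  move=> f g fg; have /matrixP h : mat f = mat g by rewrite -!glE fg.
  apply/ffunP => -[[a b] ab]; have := h a b; rewrite !mxE.
  by rewrite insubT //=.
have -> : UTset n.+1 p = gl @: setT.
  apply/setP => g; rewrite inE; apply/idP/imsetP => [/UTbP [g0 g1]|[f _ ->]].
    exists [ffun x : T => GLval g (val x).1 (val x).2] => //.
    apply: val_inj; rewrite -[RHS]/(GLval _) glE; apply/matrixP => a b; rewrite mxE.
    case: insubP => [x _ xE|]; first by rewrite ffunE xE.
    rewrite /= -leqNgt leq_eqVlt => /orP[/eqP /val_inj ->|ba].
      by rewrite eqxx; apply: g1.
    by rewrite -val_eqE gtn_eqF //; apply: g0.
  by rewrite glE; apply: UT_b; apply: matUT.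
rewrite card_imset // cardsT card_ffun card_Fp //; congr (p ^ _)%N.
have -> : (n.+1 * n)./2 = 'C(n.+1, 2) by rewrite bin2.
rewrite -bin2_sum card_sig.
rewrite -sum1_card (eq_bigl (fun x : 'I_n.+1 * 'I_n.+1 => true && (x.1 < x.2)%N)) //.
rewrite -(pair_big_dep predT (fun a b : 'I_n.+1 => (a < b)%N) (fun _ _ => 1%N)) /=.
rewrite (exchange_big_dep predT) //= big_mkord; apply: eq_bigr => b _.
rewrite sum1_card -[RHS]card_ord -[RHS](card_image (f := widen_ord (ltnW (ltn_ord b)))).
  apply: eq_card => a; apply/idP/imageP => [ab|[c _ ->]].
    by exists (Ordinal (ab : (a < b)%N)) => //; apply: val_inj.
  by rewrite unfold_in /=; apply: ltn_ord.
by move=> c d /(congr1 val) /= /val_inj.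
Qed.

(** * The Galois action on Theta *)

Section ThetaAction.
Variables (p : nat) (k K : fieldType) (embk : {rmorphism k -> K}).
Variables (v : K -> rat) (t : K).
Hypothesis HK : laurent_field p embk v t.
Variables (L : splittingFieldType K) (w : L -> rat).
Hypothesis HL : totram_galois v w.
Variables (n0 : nat).
Local Notation n := n0.+1.
Hypothesis L_gal_UT : ('Gal({:L} / 1%VS) \isog UTset n p)%g.
Variables (A : 'M[K]_n) (Theta : 'M[L]_n).
Hypotheses (A_UT : UT A) (T_UT : UT Theta).
Hypothesis T_sol : frobmx p Theta *m map_mx (in_alg L) A = Theta.
Hypothesis L_gen : Lsub Theta 0 n.-1 = fullv.

Let Hw := tg_val HL.
Let w_ext := tg_ext HL.
Let pp := lf_prime HK.
Let chL := pcharL HK L.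

Lemma UTset_group_set : group_set (UTset n p).
Proof.
apply/group_setP; split; first by rewrite inE GL_1E; apply: UT_b; apply: UT1.
move=> x y; rewrite !inE => /UTbP ux /UTbP uy; rewrite GL_ME; apply: UT_b.
exact: UT_mul.
Qed.

Lemma card_gal_UT : #|'Gal({:L} / 1%VS)%g| = #|UTset n p|.
Proof. exact: (@card_isog _ _ _ (group UTset_group_set) L_gal_UT). Qed.

Lemma dimL : \dim {:L} = (p ^ (n * n.-1)./2)%N.
Proof.
by rewrite -(card_UTset n0 pp) -card_gal_UT -(galois_dim (tg_gal HL)) dimv1 divn1.
Qed.

Lemma dimL_p : p.-nat (\dim {:L}).
Proof. by rewrite dimL pnatX pnat_id. Qed.

(** The matrix by which [s] acts on [Theta] from the left. Both [Theta] and its image solve the same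
    equation, so this matrix is fixed by Frobenius and has entries in the prime field. *)
Definition gm (s : 'AEnd(L)) : 'M[L]_n := map_mx s Theta *m invmx Theta.

Lemma gm_mul s : gm s *m Theta = map_mx s Theta.
Proof. by rewrite /gm mulmxKV // UT_unit. Qed.

Lemma gmE (s : 'AEnd(L)) a b : s (Theta a b) = \sum_c gm s a c * Theta c b.
Proof. by have := congr1 (fun M : 'M_n => M a b) (gm_mul s); rewrite !mxE => <-. Qed.

Lemma gm_UT s : UT (gm s).
Proof.
apply: UT_mul; last exact: UT_inv.
exact: UT_map.
Qed.

Lemma gm_frob s : frobmx p (gm s) = gm s.
Proof.
have sA : map_mx s (map_mx (in_alg L) A) = map_mx (in_alg L) A.
  by apply/matrixP => a b; rewrite !mxE linearZ /= rmorph1.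
have sT : frobmx p (map_mx s Theta) *m map_mx (in_alg L) A = map_mx s Theta.
  rewrite -{2}T_sol map_mxM sA; congr (_ *m _).
  by apply/matrixP => a b; rewrite !mxE rmorphXn.
have AU : UT (map_mx (in_alg L) A).
  exact: UT_map.
rewrite {1}/gm (frobmxMp chL) (frobmxVp chL).
have TU : frobmx p Theta \in unitmx by apply: UT_unit; apply: frobmx_UT => //; apply: prime_gt0.
have -> : invmx (frobmx p Theta) = map_mx (in_alg L) A *m invmx Theta.
  rewrite -[RHS](mulKmx TU); set Z := frobmx p Theta *m _.
  have -> : Z = 1%:M by rewrite /Z mulmxA T_sol mulmxV // UT_unit.
  by rewrite mulmx1.
by rewrite mulmxA sT.
Qed.

Lemma gm_nat s a b : exists m : nat, gm s a b = m%:R.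
Proof.
apply: (frob_fixed chL).
by have := congr1 (fun M : 'M_n => M a b) (gm_frob s); rewrite mxE.
Qed.

Definition fgen (r : seq ('I_n * 'I_n)) : {subfield L} :=
  <<1%VS & [seq Theta x.1 x.2 | x <- r]>>%AS.

Lemma LsubE a b : Lsub Theta a b = fgen (pairs_in n a b). Proof. by []. Qed.

Lemma fgen_sub r (F : {subfield L}) :
  (forall a b, (a, b) \in r -> Theta a b \in F) -> (fgen r <= F)%VS.
Proof.
move=> h; apply/(@Fadjoin_seqP _ _ 1%AS); split; first exact: sub1v.
by move=> x /mapP [[a b] ab ->]; apply: h.
Qed.

Lemma fgen_in r a b : (a, b) \in r -> Theta a b \in fgen r.
Proof.
move=> ab; have /(@Fadjoin_seqP _ _ 1%AS) [_ h] := subvv (fgen r).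
by apply: h; apply/mapP; exists (a, b).
Qed.

Lemma fgen_fix r (s : 'AEnd(L)) : (forall a b, (a, b) \in r -> s (Theta a b) = Theta a b) ->
  forall x, x \in fgen r -> s x = x.
Proof.
move=> h x xr; apply/fixedSpaceP; move: x xr; apply/subvP.
apply: (@fgen_sub r (fixedSpace_aspace s)) => a b ab /=.
by apply/fixedSpaceP; apply: h.
Qed.

Lemma mem_pairs_in (a b : nat) (c d : 'I_n) :
  ((c, d) \in pairs_in n a b) = [&& (a <= c)%N, (c < d)%N & (d <= b)%N].
Proof. by rewrite mem_filter mem_enum /= andbT -andbA. Qed.

(** An automorphism sends [Theta a b] to a combination of entries [Theta c b] with [a <= c], so
    closure of the index set under moving down a column makes the field normal. *)
Lemma fgen_galois r : (forall a c b : 'I_n, (a, b) \in r -> (a <= c < b)%N -> (c, b) \in r) ->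
  galois 1 (fgen r).
Proof.
move=> cl; apply: (normalField_galois (tg_gal HL)).
  by rewrite sub1v subvf.
apply/forall_inP => s _; have : kAut 1 (fgen r) s.
  rewrite kAut1E (aimg_adjoin_seq s 1%AS); apply/(@Fadjoin_seqP _ _ (s @: 1%AS)%AS); split.
    by rewrite /= aimg1 sub1v.
  move=> x /mapP [y /mapP [[a b] ab ->] ->] /=.
  have [g0 g1] := gm_UT s; have [t0 t1] := T_UT.
  rewrite gmE; apply: rpred_sum => c _.
  have [ca|ac] := ltnP c a; first by rewrite g0 // mul0r rpred0.
  have [m ->] := gm_nat s a c; rewrite mulr_natl rpredMn //.
  have [cb|] := ltnP c b; first by apply/fgen_in/(cl a) => //; rewrite ac.
  rewrite leq_eqVlt => /orP[/eqP/val_inj <-|bc]; first by rewrite t1 rpred1.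
  by rewrite t0 // rpred0.
by case/andP.
Qed.

Lemma Lsub_galois a b : galois 1 (fgen (pairs_in n a b)).
Proof.
apply: fgen_galois => x c y; rewrite !mem_pairs_in => /and3P[h1 h2 h3] /andP[h4 h5].
by rewrite (leq_trans h1 h4) h5.
Qed.

Lemma aut_eq (s s' : 'AEnd(L)) : (forall a b, s (Theta a b) = s' (Theta a b)) -> s =1 s'.
Proof.
move=> h x.
have fx : forall y, y \in fgen (pairs_in n 0 n.-1) -> (s * s'^-1)%g y = y.
  apply: fgen_fix => a b _; rewrite AEndM h -AEndM mulgV.
  by rewrite /= id_lfunE.
have := fx x; rewrite -LsubE L_gen memvf => /(_ isT) => {2}<-.
by rewrite -AEndM mulgKV.
Qed.

Lemma natr_Fp (m : nat) : (((m%:R : 'F_p) : nat)%:R : L) = m%:R.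
Proof.
by rewrite val_Fp_nat // [in RHS](divn_eq m p) natrD natrM (pcharf0 chL) mulr0 add0r.
Qed.

(** An automorphism is determined by its matrix, so the Galois group embeds into the unitriangular
    matrices over the prime field; the cardinalities agree, hence every such matrix occurs. *)
Lemma aut_exists (M : 'M['F_p]_n) : UT M ->
  exists s : 'AEnd(L), forall a b, gm s a b = (M a b : nat)%:R.
Proof.
move=> UM.
have natF := natr_Fp.
have repF (s : 'AEnd(L)) a b : exists y : 'F_p, gm s a b = (y : nat)%:R.
  by have [m ->] := gm_nat s a b; exists m%:R; rewrite natF.
pose psi (s : 'AEnd(L)) : 'M['F_p]_n := \matrix_(a, b)
  sval (constructive_indefinite_description _ (repF s a b)).
have psiE s a b : gm s a b = (psi s a b : nat)%:R.
  by rewrite [in RHS]mxE; apply: (svalP (constructive_indefinite_description _ (repF s a b))).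
have natinj (y z : 'F_p) : ((y : nat)%:R : L) = (z : nat)%:R -> y = z.
  have lt (u : 'F_p) : (u < p)%N.
    by have := ltn_ord u; rewrite [X in (_ < X)%N]Fp_cast.
  have aux (c d : 'F_p) : (c <= d)%N -> ((c : nat)%:R : L) = (d : nat)%:R -> c = d.
    move=> cd h; apply: val_inj => /=.
    have : ((d - c)%:R : L) == 0 by rewrite natrB // h subrr.
    rewrite -(dvdn_pcharf chL) => /dvdnP [[|x] hx]; first by lia.
    by have := lt d; nia.
  move=> h; have [yz|/ltnW zy] := leqP y z; first exact: aux.
  by apply/esym/aux.
have psiUT s : UT (psi s).
  have [g0 g1] := gm_UT s; split=> [a b ba|a]; apply: natinj; rewrite -psiE.
    by rewrite g0.
  by rewrite g1; apply/esym; apply: (natF 1%N).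
pose gl (g : gal_of {:L}) : {'GL_n['F_p]} :=
  FinRing.Unit (UT_unit (psiUT g) : psi g \is a GRing.unit).
have glE g : GLval (gl g) = psi g by [].
have inj : injective gl.
  move=> g h gh; have /matrixP E : psi g = psi h by rewrite -!glE gh.
  apply/eqP/gal_eqP => x _; apply: aut_eq => a b.
  by rewrite !gmE; apply: eq_bigr => c _; rewrite !psiE E.
have sub : [set gl g | g in 'Gal({:L} / 1)%g] \subset UTset n p.
  apply/subsetP => _ /imsetP [g _ ->]; rewrite inE glE; apply: UT_b; exact: psiUT.
have /eqP E : [set gl g | g in 'Gal({:L} / 1)%g] == UTset n p.
  by rewrite eqEcard sub card_imset ?card_gal_UT /=.
pose gM : {'GL_n['F_p]} := FinRing.Unit (UT_unit UM : M \is a GRing.unit).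
have : gM \in UTset n p by rewrite inE; apply: UT_b.
rewrite -E => /imsetP [g _ gE]; exists (gal_repr g) => a b.
by rewrite psiE -glE -gE.
Qed.

Lemma elem_aut (c d : 'I_n) : (c < d)%N -> exists s : 'AEnd(L), forall a b,
  s (Theta a b) = Theta a b + (if a == c then Theta d b else 0).
Proof.
move=> cd; pose M : 'M['F_p]_n := \matrix_(a, b) ((a == b) || (a == c) && (b == d))%:R.
have UM : UT M.
  split=> [a b ba|a]; rewrite mxE; last by rewrite eqxx.
  have -> : (a == b) = false by rewrite -val_eqE gtn_eqF.
  case: eqP => [ac|] //=; case: eqP => [bd|] //=.
  by move: ba; rewrite ac bd ltnNge ltnW.
have [s sE] := aut_exists UM; exists s => a b; rewrite gmE.
have MN x y : gm s x y = ((x == y) || (x == c) && (y == d))%:R.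
  by rewrite sE mxE natr_Fp.
rewrite (bigD1 a) //= MN eqxx mul1r; congr (_ + _).
case: eqP => [->|/eqP ac]; last first.
  by apply: big1 => e ea; rewrite MN eq_sym (negPf ea) (negPf ac) mul0r.
rewrite (bigD1 d) /=; last by rewrite -val_eqE gtn_eqF.
rewrite MN !eqxx orbT mul1r big1 ?addr0 // => e /andP[ec ed].
by rewrite MN eq_sym (negPf ec) (negPf ed) andbF mul0r.
Qed.

End ThetaAction.

(** * The last ramification group of a block *)

Section ThetaRamification.
Variables (p : nat) (k K : fieldType) (embk : {rmorphism k -> K}).
Variables (v : K -> rat) (t : K).
Hypothesis HK : laurent_field p embk v t.
Variables (L : splittingFieldType K) (w : L -> rat).
Hypothesis HL : totram_galois v w.
Variables (n0 : nat).
Local Notation n := n0.+1.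
Hypothesis L_gal_UT : ('Gal({:L} / 1%VS) \isog UTset n p)%g.
Variables (A : 'M[K]_n) (Theta : 'M[L]_n).
Hypotheses (A_UT : UT A) (T_UT : UT Theta).
Hypothesis T_sol : frobmx p Theta *m map_mx (in_alg L) A = Theta.
Hypothesis L_gen : Lsub Theta 0 n.-1 = fullv.
Variables (D : L -> L) (HD : alg_derivation (dK embk v t) D).

Let Hw := tg_val HL.
Let w_ext := tg_ext HL.
Let pp := lf_prime HK.
Let chL := pcharL HK L.
Let dim_p := dimL_p HK HL L_gal_UT.
Local Notation pi := (pif w).
Local Notation ib := (ibr w).
Local Notation g_ := (gm Theta).
Local Notation fg := (fgen Theta).
Local Notation blk i j := (fgen Theta (pairs_in n i j)).

(** Wild ramification makes the commutator of [s] with any [s'] move [pi E] by strictly less, in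
    absolute value, than [s] does. Its ramification number would exceed the maximum, so it acts
    trivially on [E]. *)
Lemma last_commute (E : {subfield L}) (s s' : 'AEnd(L)) : galois 1 E ->
  s (pi E) != pi E ->
  (forall h : gal_of E, h (pi E) != pi E -> ib E h <= ib E s) ->
  forall x, x \in E -> s (s' x) = s' (s x).
Proof.
move=> gE sm smax.
have st (h : 'AEnd(L)) x : x \in E -> h x \in E by apply: gal_stable.
have p0 := pif_neq0 HK HL E; have pE := pif_in HK HL E.
pose al := s (pi E) / pi E - 1; pose be := s' (pi E) / pi E - 1.
have i0 := ibr_gt0 HK HL dim_p sm.
have hs : s (pi E) = pi E * (1 + al) by rewrite /al; field.
have hs' : s' (pi E) = pi E * (1 + be) by rewrite /be; field.
have alE : al \in E by rewrite rpredB ?rpred1 // rpredM ?rpredV // st.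
have beE : be \in E by rewrite rpredB ?rpred1 // rpredM ?rpredV // st.
have al_eq : al = (s (pi E) - pi E) / pi E by rewrite /al; field.
have al0 : al != 0 by rewrite al_eq mulf_neq0 ?subr_eq0 ?invr_neq0.
have wal : w al = ib E s by rewrite al_eq val_div ?subr_eq0.
have wbe : vgt w be 0.
  have -> : be = (s' (pi E) - pi E) * (pi E)^-1 by rewrite /be; field.
  have -> : 0 = w (pi E) + - w (pi E) by rewrite subrr.
  apply: vgtMl => //; first exact: (aut_wild HK HL dim_p).
  by right; rewrite valV.
have diff : s (s' (pi E)) - s' (s (pi E)) =
   pi E * ((s be - be) + (al - s' al) + al * s be - be * s' al).
  have -> : s (s' (pi E)) = pi E * (1 + al) * (1 + s be).
    by rewrite hs' rmorphM rmorphD rmorph1 /= hs.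
  have -> : s' (s (pi E)) = pi E * (1 + be) * (1 + s' al).
    by rewrite hs rmorphM rmorphD rmorph1 /= hs'.
  ring.
have gt : vgt w (s (s' (pi E)) - s' (s (pi E))) (w (pi E) + ib E s).
  rewrite diff; apply: vgtMr => //; first exact: vge_val.
  have sbe : vgt w (s be) 0.
    by case: wbe => [->|h]; [rewrite linear0|right; rewrite (val_aut HK HL)].
  have s'al : vge w (s' al) (ib E s) by right; rewrite (val_aut HK HL) wal.
  have alge : vge w al (ib E s) by right; rewrite wal.
  apply: vgtB => //; last by rewrite -[ib E s]add0r; apply: vgtMl.
  apply: vgtD => //; last by rewrite -[ib E s]addr0; apply: vgtMr.
  apply: vgtD => //.
    have [->|be0] := eqVneq be 0; first by rewrite linear0 subrr.
    apply: vgt_lt (aut_sub_ge HK HL dim_p sm beE).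
    by rewrite ltrDr; apply: (vgtE (v := w)).
  by rewrite -opprB; apply: vgtN => //; rewrite -wal; apply: (aut_wild HK HL dim_p).
pose ka := ((s' * s) * (s * s')^-1)%g : 'AEnd(L).
have kaE x : s' (s (ka x)) = s (s' x).
  by rewrite -!AEndM /ka mulgKV.
have kapi : ka (pi E) = pi E.
  apply/eqP; apply: contraT => km.
  have hka : gal E ka (pi E) = ka (pi E).
    by rewrite galK //; apply/subvP => _ /memv_imgP [x xE ->]; apply: st.
  have := smax (gal E ka); rewrite {1}/ibr hka => /(_ km).
  have E1 : w (ka (pi E) - pi E) = w (s (s' (pi E)) - s' (s (pi E))).
    by rewrite -kaE -!rmorphB /= !(val_aut HK HL).
  have n0' : s (s' (pi E)) - s' (s (pi E)) != 0.
    by rewrite -kaE -!rmorphB /= !fmorph_eq0 subr_eq0.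
  rewrite E1 lerBlDr leNgt addrC; case/negP.
  exact: (vgtE (v := w)).
move=> x xE; rewrite -kaE; congr (s' (s _)).
exact: (pif_gen HK HL kapi).
Qed.

Lemma Theta_in_blk (i j a b : 'I_n) : (i <= a)%N -> (a <= b)%N -> (b <= j)%N ->
  Theta a b \in blk i j.
Proof.
move=> ia ab bj; case: T_UT => t0 t1; move: ab; rewrite leq_eqVlt => /orP[/eqP/val_inj->|ab].
  by rewrite t1 rpred1.
by apply: fgen_in; rewrite mem_pairs_in ia ab.
Qed.

(** Commutation with the automorphisms that add row [l + 1] to row [l] kills every off-diagonal
    entry of the matrix of [s] in the block except the corner. The corner survives because [s] moves
    the block. *)
Lemma last_central (i j : 'I_n) (s : 'AEnd(L)) : (i < j)%N ->
  s (pi (blk i j)) != pi (blk i j) ->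
  (forall h : gal_of (blk i j), h (pi (blk i j)) != pi (blk i j) ->
     ib (blk i j) h <= ib (blk i j) s) ->
  (forall a b : 'I_n, (i <= a)%N -> (a <= b)%N -> (b <= j)%N -> (a, b) != (i, j) ->
     s (Theta a b) = Theta a b) /\
  exists c : nat, ~~ (p %| c)%N /\ s (Theta i j) = Theta i j + c%:R.
Proof.
move=> ij sm smax.
have com s' := last_commute s' (Lsub_galois HK HL A_UT T_UT T_sol i j) sm smax.
have [t0 t1] := T_UT; have [g0 g1] := gm_UT T_UT s.
have sg (s' : 'AEnd(L)) a c : s' (g_ s a c) = g_ s a c.
  by have [m ->] := gm_nat HK A_UT T_UT T_sol s a c; rewrite rmorph_nat.
have succ (l : 'I_n) : (l < j)%N -> exists l' : 'I_n, l' = l.+1 :> nat.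
  by move=> lj; exists (Ordinal (leq_ltn_trans lj (ltn_ord j))).
have step (l l' a b : 'I_n) : (i <= l)%N -> l' = l.+1 :> nat -> (i <= a)%N ->
    (a <= b)%N -> (b <= j)%N -> (l' <= j)%N ->
    (if a == l then s (Theta l' b) else 0) = g_ s a l * Theta l' b.
  move=> il l'E ia ab bj l'j.
  have [s' s'E] : exists s' : 'AEnd(L), forall a b,
      s' (Theta a b) = Theta a b + (if a == l then Theta l' b else 0).
    by apply: (elem_aut HK L_gal_UT A_UT T_UT T_sol L_gen); rewrite l'E.
  have := com s' (Theta a b) (Theta_in_blk ia ab bj).
  have -> : s' (s (Theta a b)) = s (Theta a b) + g_ s a l * Theta l' b.
    rewrite (gmE T_UT s a b) rmorph_sum /=.
    under eq_bigr => c _ do rewrite rmorphM /= sg s'E mulrDr.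
    rewrite big_split /=; congr (_ + _).
    rewrite (bigD1 l) //= eqxx big1 ?addr0 // => c cl.
    by rewrite (negPf cl) mulr0.
  rewrite s'E rmorphD /= => /addrI <-.
  by case: ifP => _; rewrite ?rmorph0.
have fix1 (a b : 'I_n) : (i < a)%N -> (a <= b)%N -> (b <= j)%N -> s (Theta a b) = Theta a b.
  move=> ia ab bj; have a0 : (0 < a)%N by apply: leq_ltn_trans ia.
  have la : (a.-1 < n)%N by rewrite (leq_ltn_trans (leq_pred _)).
  have := step (Ordinal la) a (Ordinal la) b; rewrite /= eqxx g1 mul1r; apply => //.
  - by rewrite -ltnS prednK.
  - by rewrite prednK.
  - by rewrite -ltnS prednK.
  - exact: leq_trans (leq_pred _) ab.
  - exact: leq_trans ab bj.
have g_al (a l : 'I_n) : (i <= a)%N -> (a < l)%N -> (l < j)%N -> g_ s a l = 0.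
  move=> ia al lj; have [l' l'E] := succ l lj.
  have al' : (a <= l')%N by rewrite l'E ltnW // ltnW.
  have l'j : (l' <= j)%N by rewrite l'E.
  have := step l l' a l' (leq_trans ia (ltnW al)) l'E ia al' l'j l'j.
  by rewrite -val_eqE ltn_eqF //= t1 mulr1.
have fix2 (a b : 'I_n) : (i <= a)%N -> (a <= b)%N -> (b < j)%N -> s (Theta a b) = Theta a b.
  move=> ia ab bj; rewrite (gmE T_UT) (bigD1 a) //= g1 mul1r big1 ?addr0 // => c ca.
  have [lt|ge] := ltnP c a; first by rewrite g0 // mul0r.
  have [bc|cb] := ltnP b c; first by rewrite t0 // mulr0.
  rewrite g_al ?mul0r //; last exact: leq_ltn_trans bj.
  by rewrite ltn_neqAle ge andbT eq_sym val_eqE.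
have fixl (a b : 'I_n) : (i <= a)%N -> (a <= b)%N -> (b <= j)%N -> (a, b) != (i, j) ->
     s (Theta a b) = Theta a b.
  move=> ia ab bj; have [lt _|ge] := ltnP i a; first exact: fix1.
  have [lt _|ge2] := ltnP b j; first exact: fix2.
  case/negP; apply/eqP; congr (_, _); apply/val_inj/eqP; rewrite eqn_leq; exact/andP.
have sij : s (Theta i j) = Theta i j + g_ s i j.
  rewrite (gmE T_UT) (bigD1 i) //= g1 mul1r; congr (_ + _).
  rewrite (bigD1 j) /=; last by rewrite -val_eqE gtn_eqF.
  rewrite t1 mulr1 big1 ?addr0 // => c /andP[ci cj].
  have [lt|ge] := ltnP c i; first by rewrite g0 // mul0r.
  have [jc|cj'] := ltnP j c; first by rewrite t0 // mulr0.
  by rewrite g_al ?mul0r // ltn_neqAle ?ge ?cj' andbT ?val_eqE // eq_sym.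
split=> //; have [c gc] := gm_nat HK A_UT T_UT T_sol s i j.
exists c; rewrite sij gc; split=> //; apply/negP => pc.
case/negP: sm; apply/eqP.
apply: (fgen_fix (r := pairs_in n i j)); last exact: (pif_in HK HL).
move=> a b; rewrite mem_pairs_in => /and3P[h1 h2 h3].
have [[-> ->]|ne] := eqVneq (a, b) (i, j); last exact: fixl (ltnW h2) h3 ne.
by rewrite sij gc; move: pc; rewrite (dvdn_pcharf chL) => /eqP ->; rewrite addr0.
Qed.

Lemma blk_dim_neq1 (i j : 'I_n) : (i < j)%N -> \dim (blk i j) != 1%N.
Proof.
move=> ij; apply/eqP => d1.
have [s sE] := elem_aut HK L_gal_UT A_UT T_UT T_sol L_gen ij.
have [b Eb] := dim1_alg d1 (Theta_in_blk (leqnn i) (ltnW ij) (leqnn j)).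
have := sE i j; rewrite eqxx Eb linearZ /= rmorph1; case: T_UT => _ ->.
by move/eqP; rewrite -subr_eq0 opprD addrA subrr sub0r oppr_eq0 oner_eq0.
Qed.

Lemma blk_sub (i j a b : 'I_n) : (i <= a)%N -> (b <= j)%N -> (blk a b <= blk i j)%VS.
Proof.
move=> ia bj; apply: fgen_sub => c d; rewrite mem_pairs_in => /and3P[h1 h2 h3].
by apply: Theta_in_blk (ltnW h2) (leq_trans h3 bj); apply: leq_trans h1.
Qed.

(** By [last_central] the last automorphisms of the block [(i, j)] fix all of its entries except the
    corner, hence every proper sub-block, and [ubreak_lt] applies. *)
Lemma rbr_lt (i j a b : 'I_n) : (i <= a)%N -> (a < b)%N -> (b <= j)%N -> (a, b) != (i, j) ->
  rbr w Theta a b + (\dim (blk i j))%:R^-1 <= rbr w Theta i j.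
Proof.
move=> ia ab bj ne; have ij : (i < j)%N by apply: leq_ltn_trans ia (leq_trans ab bj).
rewrite /rbr ab ij !LsubE; apply: (ubreak_lt HK HL dim_p HD).
- exact: (Lsub_galois HK HL A_UT T_UT T_sol).
- exact: (Lsub_galois HK HL A_UT T_UT T_sol).
- exact: blk_sub.
- exact: blk_dim_neq1.
- exact: blk_dim_neq1.
move=> s sm smax; have [fx _] := last_central ij sm smax.
apply: (fgen_fix (r := pairs_in n a b)); last exact: (pif_in HK HL).
move=> c d; rewrite mem_pairs_in => /and3P[h1 h2 h3].
apply: fx; [exact: leq_trans h1|exact: ltnW|exact: leq_trans h3 bj|].
apply: contra ne => /eqP [ci dj]; subst c d; apply/eqP; congr (_, _).
  by apply/val_inj/eqP; rewrite eqn_leq ia h1.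
by apply/val_inj/eqP; rewrite eqn_leq bj h3.
Qed.

Lemma rbr_ge0 (a b : 'I_n) : (a < b)%N -> 0 <= rbr w Theta a b.
Proof.
move=> ab; rewrite /rbr ab /ubreak /herbrand divr_ge0 //.
by apply: sumr_ge0.
Qed.

Definition lowpairs (i j : 'I_n) : seq ('I_n * 'I_n) :=
  [seq x <- pairs_in n i j | x != (i, j)].
Local Notation low i j := (fgen Theta (lowpairs i j)).

Lemma mem_lowpairs (i j a b : 'I_n) : ((a, b) \in lowpairs i j) =
  [&& (i <= a)%N, (a < b)%N, (b <= j)%N & (a, b) != (i, j)].
Proof. by rewrite mem_filter mem_pairs_in andbC !andbA. Qed.

Lemma low_galois (i j : 'I_n) : galois 1 (low i j).
Proof.
apply: (fgen_galois HK HL A_UT T_UT T_sol) => a c b.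
rewrite !mem_lowpairs => /and4P[ia ab bj ne] /andP[ac cb].
rewrite (leq_trans ia ac) cb bj /=; apply: contra ne => /eqP [ci bj'].
subst c b; apply/eqP; congr (_, _); apply/val_inj/eqP; by rewrite eqn_leq ia ac.
Qed.

Lemma Theta_in_low (i j a b : 'I_n) : (i <= a)%N -> (a <= b)%N -> (b <= j)%N ->
  (a, b) != (i, j) -> Theta a b \in low i j.
Proof.
move=> ia ab bj ne; case: T_UT => t0 t1; move: ab; rewrite leq_eqVlt => /orP[/eqP/val_inj E|ab].
  by rewrite E t1 rpred1.
by apply: fgen_in; rewrite mem_lowpairs ia ab bj.
Qed.

Lemma low_sub_blk (i j : 'I_n) : (low i j <= blk i j)%VS.
Proof.
apply: fgen_sub => c d; rewrite mem_lowpairs => /and4P[h1 h2 h3 _].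
exact: Theta_in_blk (ltnW h2) h3.
Qed.

End ThetaRamification.

(** * Best approximation of a corner entry *)

Fact bezout_int_mul (p d : nat) (x : rat) (a b : int) : coprime d p -> (0 < d)%N ->
  d%:R * x = a%:~R -> p%:R * x = b%:~R -> exists c : int, x = c%:~R.
Proof.
move=> cop d0 hd hp; have [u hu] := coprimeP _ d0 cop.
have E : (u.1 * d = 1 + u.2 * p)%N by lia.
exists (u.1%:Z * a - u.2%:Z * b).
have h : (u.1 * d)%:R * x = (1 + u.2 * p)%:R * x by rewrite E.
rewrite natrD !natrM mulrDl mul1r -!mulrA hd hp in h.
by rewrite rmorphB !rmorphM /=; lra.
Qed.

Section BestApproximation.
Variables (p : nat) (k K : fieldType) (embk : {rmorphism k -> K}).
Variables (v : K -> rat) (t : K).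
Hypothesis HK : laurent_field p embk v t.
Variables (L : splittingFieldType K) (w : L -> rat).
Hypothesis HL : totram_galois v w.
Variables (n0 : nat).
Local Notation n := n0.+1.
Hypothesis L_gal_UT : ('Gal({:L} / 1%VS) \isog UTset n p)%g.
Variables (A : 'M[K]_n) (Theta : 'M[L]_n).
Hypotheses (A_UT : UT A) (T_UT : UT Theta).
Hypothesis T_sol : frobmx p Theta *m map_mx (in_alg L) A = Theta.
Hypothesis L_gen : Lsub Theta 0 n.-1 = fullv.
Variables (D : L -> L) (HD : alg_derivation (dK embk v t) D).

Let Hw := tg_val HL.
Let w_ext := tg_ext HL.
Let pp := lf_prime HK.
Let chL := pcharL HK L.
Let dim_p := dimL_p HK HL L_gal_UT.
Local Notation pi := (pif w).
Local Notation ib := (ibr w).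
Local Notation blk i j := (fgen Theta (pairs_in n i j)).
Local Notation low i j := (fgen Theta (lowpairs i j)).

Lemma Theta_rec (i j : 'I_n) :
  Theta i j - Theta i j ^+ p = \sum_(l | l != j) Theta i l ^+ p * (A l j)%:A.
Proof.
have := congr1 (fun M : 'M_n => M i j) T_sol; rewrite mxE (bigD1 j) //= !mxE.
case: A_UT => _ ->; rewrite rmorph1 mulr1 => E.
apply/eqP; rewrite subr_eq addrC -{1}E; apply/eqP; congr (_ + _).
by apply: eq_bigr => l _; rewrite !mxE.
Qed.

(** The residue field of [E] is [k], so an element of [M] with the same leading term as [f] exists
    as soon as [w f] is a value of [M]; valuations in [E] then jump by at least [1 / \dim E]. *)
Lemma approx_step (E M : {subfield L}) f z : (M <= E)%VS -> f \in E -> f != 0 ->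
  w f = z%:~R / (\dim M)%:R ->
  exists y, y \in M /\ (f - y = 0 \/ w f + (\dim E)%:R^-1 <= w (f - y)).
Proof.
move=> ME fE f0 wf.
have e0 := dim_gt0 E; have pM0 := pif_neq0 HK HL M.
pose x := pi M ^ z.
have xM : x \in M by rewrite /x; case: (z) => m; rewrite ?NegzE -?exprnN ?rpredV rpredX ?(pif_in HK HL).
have x0 : x != 0 by rewrite expfz_neq0.
have wx : w x = w f by rewrite valXz // (w_pif HK HL) wf.
have fxE : f / x \in E by rewrite rpredM ?rpredV // (subvP ME).
have fx0 : vge w (f / x) 0 by right; rewrite val_div // wx subrr.
have [c hc] := unif_residue HK Hw w_ext (pifP HK HL E) fxE fx0.
pose y := (embk c)%:A * x.
have yM : y \in M by rewrite rpredM // rpredZ // rpred1.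
exists y; split=> //; have [->|n1] := eqVneq (f - y) 0; [by left|right].
have E1 : f - y = x * (f / x - (embk c)%:A) by rewrite /y; field.
have gt : w f < w (f - y).
  apply: (vgtE (v := w)) => //; rewrite E1 -wx -[w x]addr0; apply: vgtMr => //.
  exact: vge_val.
have fyE : f - y \in E by rewrite rpredB // (subvP ME).
have [a ha] := unif_val_int HK Hw w_ext (pifP HK HL E) fE f0.
have [b hb] := unif_val_int HK Hw w_ext (pifP HK HL E) fyE n1.
move: gt; rewrite ha hb ltr_pM2r ?invr_gt0 // ltr_int => ab.
rewrite -[X in _ + X]mul1r -mulrDl ler_pM2r ?invr_gt0 //.
by rewrite -[1]/(1%:~R) -rmorphD ler_int lezD1.
Qed.

(** The last automorphism [s] changes [f] by a nonzero constant [c], so [w f] is negative by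
    [aut_wild] and the improvements must stop, at a value outside the value group of [M]. Then [E]
    has degree [p] over [M], and [w f] has numerator prime to [p]. Now [aut_sub_eq] gives
    [w f = - ib E s], and [D_eq] subtracts the different: together this is minus the upper break. *)
Lemma best_approx (i j : 'I_n) : (i < j)%N ->
  exists y al z, [/\ y \in low i j, al \in low i j,
    al = (Theta i j - y) - (Theta i j - y) ^+ p,
    [/\ al != 0, w al = z%:~R / (\dim (low i j))%:R & ~~ (p%:Z %| z)%Z] &
    D al != 0 /\ w (D al) = - rbr w Theta i j].
Proof.
move=> ij; set E := blk i j; set M := low i j; set th := Theta i j.
have gE : galois 1 E := Lsub_galois HK HL A_UT T_UT T_sol i j.
have ME : (M <= E)%VS := low_sub_blk T_UT i j.
have e0 : 0 < (\dim E)%:R :> rat := dim_gt0 E.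
have m0 : 0 < (\dim M)%:R :> rat := dim_gt0 M.
have thE : th \in E by apply: Theta_in_blk => //; apply: ltnW.
have E1 := blk_dim_neq1 HK L_gal_UT A_UT T_UT T_sol L_gen ij.
have [s [_ sm smax ub]] := ubreakE HK HL dim_p HD gE E1.
have [fx [c [pc sth]]] := last_central HK HL L_gal_UT A_UT T_UT T_sol L_gen ij sm smax.
rewrite -/th in sth.
have c0 : (c%:R : L) != 0 by rewrite -(dvdn_pcharf chL).
have wc : w (c%:R : L) = 0 by apply: (w_natr HK HL).
have sM y : y \in M -> s y = y.
  apply: fgen_fix => a b; rewrite mem_lowpairs => /and4P[h1 h2 h3 h4].
  by apply: fx => //; apply: ltnW.
have sf y : y \in M -> s (th - y) - (th - y) = c%:R.
  by move=> yM; rewrite rmorphB /= (sM y) // sth; move: (c%:R : L) => x; ring.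
have f0 y : y \in M -> th - y != 0.
  move=> yM; apply: contraNneq c0 => h.
  by rewrite -(sf y yM) h linear0 subrr.
have fneg y : y \in M -> w (th - y) < 0.
  move=> yM; have := aut_wild HK HL dim_p s (f0 y yM); rewrite sf //.
  by move/(vgtE c0); rewrite wc.
have [y [yM yz]] : exists y, y \in M /\ forall z : int, w (th - y) != z%:~R / (\dim M)%:R.
  apply: NNPP => no.
  have impr (m : nat) : exists y, y \in M /\ w th + m%:R / (\dim E)%:R <= w (th - y).
    elim: m => [|m [y [yM le]]].
      by exists 0; rewrite rpred0 mul0r addr0 subr0.
    have [z hz] : exists z : int, w (th - y) = z%:~R / (\dim M)%:R.
      apply: NNPP => no2; apply: no; exists y; split=> // z; apply/eqP => hz.
      by apply: no2; exists z.
    have fE : th - y \in E by rewrite rpredB // (subvP ME).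
    have [y' [y'M [h|h]]] := approx_step ME fE (f0 y yM) hz.
      have yy'M : y + y' \in M by rewrite rpredD.
      by have := f0 _ yy'M; rewrite opprD addrA h eqxx.
    exists (y + y'); split; first by rewrite rpredD.
    rewrite opprD addrA -natr1 mulrDl mul1r addrA; apply: le_trans h.
    by rewrite lerD2r.
  have [y [yM le]] := impr `|(Num.floor (- w th * (\dim E)%:R) + 1)%R|%N.
  set m := absz _ in le; have := fneg y yM; apply/negP; rewrite -leNgt.
  apply: le_trans le; rewrite -lerBlDl sub0r ler_pdivlMr //.
  apply: le_trans (ltW (floorD1_gt _)) _.
  by rewrite -[X in _ <= X]/((Posz _)%:~R) ler_int; apply: lez_abs.
set f := th - y; pose al := f - f ^+ p.
have fn0 : f != 0 := f0 y yM; have wf0 : w f < 0 := fneg y yM.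
have fE : f \in E by rewrite rpredB // (subvP ME).
have alM : al \in M.
  have -> : al = (th - th ^+ p) - (y - y ^+ p).
    have := exprpB chL 1 th y; rewrite expn1 => /= h.
    by rewrite /al /f h; ring.
  rewrite rpredB //; last by rewrite rpredB // rpredX.
  rewrite /th Theta_rec; apply: rpred_sum => l lj.
  have [lj'|jl] := ltnP l j; last first.
    have jl' : (j < l)%N by rewrite ltn_neqAle jl andbT eq_sym val_eqE.
    by case: A_UT => a0 _; rewrite a0 // scale0r mulr0 rpred0.
  rewrite rpredM ?rpredZ ?rpred1 // rpredX //.
  have [li|il] := ltnP l i.
    by case: T_UT => t0 _; rewrite t0 // rpred0.
  apply: (Theta_in_low T_UT) => //; first exact: ltnW.
  by apply: contraNneq lj => -[->].
have p1 := prime_gt1 pp.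
have [aln0 wal] : al != 0 /\ w al = p%:R * w f.
  have := val_addl Hw (x := - f ^+ p) (y := f); rewrite valN // valX // [_ + f]addrC.
  apply; first by rewrite oppr_eq0 expf_neq0.
  by right; rewrite gtr_nMl // ltr1n.
have dvd : (\dim M %| \dim E)%N by apply: field_dimS.
pose d := (\dim E %/ \dim M)%N.
have dE : \dim E = (d * \dim M)%N by rewrite divnK.
have d_gt0 : (0 < d)%N by rewrite divn_gt0 ?adim_gt0 // dvdn_leq // adim_gt0.
have dp : (d <= p)%N.
  rewrite /d -(leq_pmul2r (adim_gt0 M)) -dE.
  have sub : (E <= <<M; th>>)%VS.
    apply: fgen_sub => a b; rewrite mem_pairs_in => /and3P[h1 h2 h3].
    have [[-> ->]|ne] := eqVneq (a, b) (i, j); first exact: memv_adjoin.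
    apply: (subvP (subv_adjoin _ _)); apply: (Theta_in_low T_UT) => //; exact: ltnW.
  apply: leq_trans (dimvS sub) _; rewrite dim_Fadjoin leq_pmul2r ?adim_gt0 //.
  have P_over : ('X^p - 'X + (th - th ^+ p)%:P) \is a polyOver M.
    rewrite rpredD ?rpredB ?polyOverXn ?polyOverX // polyOverC.
    have -> : th - th ^+ p = al + (y - y ^+ p).
      have := exprpB chL 1 th y; rewrite expn1 => /= h.
      by rewrite /al /f h; ring.
    by rewrite rpredD // rpredB // rpredX.
  have P_root : root ('X^p - 'X + (th - th ^+ p)%:P) th.
    by rewrite /root 2!hornerD hornerN hornerXn hornerX hornerC -[X in _ + X]opprB subrr.
  have P_size : size ('X^p - 'X + (th - th ^+ p)%:P : {poly L}) = p.+1.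
    rewrite -addrA size_polyDl size_polyXn // ltnS.
    apply: leq_trans (size_polyD _ _) _.
    by rewrite size_polyN size_polyX geq_max p1 (leq_trans (size_polyC_leq1 _)) // ltnW.
  have Pn0 : ('X^p - 'X + (th - th ^+ p)%:P : {poly L}) != 0.
    by rewrite -size_poly_eq0 P_size.
  have := dvdp_leq Pn0 (minPoly_dvdp P_over P_root).
  by rewrite size_minPoly P_size ltnS.
have [zf hzf] := unif_val_int HK Hw w_ext (pifP HK HL E) fE fn0.
have [za hza] := unif_val_int HK Hw w_ext (pifP HK HL M) alM aln0.
(* Multiplying [w f * \dim M] by [d] or by [p] gives an integer. If [d < p], Bezout would make it an
   integer itself, against the choice of [y]. *)
have dpE : d = p.
  apply/eqP; move: dp; rewrite leq_eqVlt => /orP[//|lt].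
  have cop : coprime d p by rewrite coprime_sym prime_coprime // gtnNdvd.
  have hd : d%:R * (w f * (\dim M)%:R) = zf%:~R.
    rewrite hzf dE natrM; field; by rewrite !gt_eqF // ltr0n.
  have hp : p%:R * (w f * (\dim M)%:R) = za%:~R.
    by rewrite mulrA -wal hza divfK // gt_eqF.
  have [x hx] := bezout_int_mul cop d_gt0 hd hp.
  by have := yz x; rewrite -/f -hx mulfK ?eqxx // gt_eqF.
have pz : ~~ (p%:Z %| zf)%Z.
  apply/negP => /dvdzP [z' hz']; have := yz z'; rewrite -/f hzf hz' dE dpE natrM rmorphM.
  move/negP; apply; apply/eqP => /=; field.
  by rewrite !gt_eqF // ltr0n prime_gt0.
have walE : w al = zf%:~R / (\dim M)%:R.
  rewrite wal hzf dE dpE natrM; field.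
  by rewrite !gt_eqF // ltr0n prime_gt0.
have [_ wsf] := aut_sub_eq HK HL dim_p sm fE fn0 hzf pz.
have [Df0 wDf] := D_eq HK HL dim_p HD (del_ok_gal HK HL dim_p HD gE) fE fn0 hzf pz.
have Dal : D al = D f.
  have -> : f = al + f ^+ p by rewrite /al subrK.
  by rewrite (adD HD al) (DXp HK HD) addr0 /al -/al.
exists y, al, zf; split; [exact: yM|exact: alM|by []|by []|]; rewrite Dal; split=> //.
have E2 : w f = - ib E s.
  by move: wsf; rewrite sf // wc => /eqP; rewrite eq_sym addr_eq0 => /eqP.
by rewrite wDf /rbr ij LsubE -/E ub [RHS]opprD E2.
Qed.

(** Every [h] other than 1 moves some entry of the block. For one with [b - a] minimal, [h] changes
    [Theta a b] by a nonzero element of the prime field, of valuation 0, so [aut_sub_ge] bounds the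
    number of [h] by [- w (Theta a b)]. The different is the sum of these numbers. *)
Lemma del_low_le (i j : 'I_n) C :
  (forall a b : 'I_n, (i <= a)%N -> (a < b)%N -> (b <= j)%N -> - C <= w (Theta a b)) ->
  0 <= C -> del w D (low i j) <= (\dim (low i j))%:R * C.
Proof.
move=> hC C0; set M := low i j; have gM : galois 1 M := low_galois HK HL A_UT T_UT T_sol i j.
have [_ ->] := del_gal HK HL dim_p HD gM.
rewrite -(card_galE gM) mulr_natl -sumr_const [leRHS](bigD1 1%g) ?group1 //=.
apply: ler_wpDl => //; apply: ler_sum => h /andP[_ h1].
have hm := gal_moves HK HL h1.
have [t0 t1] := T_UT; have [g0 g1] := gm_UT T_UT h.
have [m hP] : exists m, [exists x : 'I_n * 'I_n,
    [&& x \in lowpairs i j, h (Theta x.1 x.2) != Theta x.1 x.2 & (x.2 - x.1 == m)%N]].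
  apply: NNPP => no; case/negP: hm; apply/eqP.
  apply: (fgen_fix (r := lowpairs i j)); last exact: (pif_in HK HL).
  move=> a b ab; apply/eqP; apply: contraT => ne; case: no.
  by exists (b - a)%N; apply/existsP; exists (a, b); rewrite ab ne /=.
have exP : exists m, [exists x : 'I_n * 'I_n,
    [&& x \in lowpairs i j, h (Theta x.1 x.2) != Theta x.1 x.2 & (x.2 - x.1 == m)%N]].
  by exists m.
case: (ex_minnP exP) => m1 /existsP [[a b] /= /and3P[+ ne /eqP mE]] mmin.
rewrite mem_lowpairs => /and4P[ia ab bj nij].
have gz (c : 'I_n) : (a < c)%N -> (c < b)%N -> gm Theta h a c = 0.
  elim/ltn_ind: {c}(c : nat) {-2}c (erefl (c : nat)) => m2 IH c cE ac cb.
  have fixc : h (Theta a c) = Theta a c.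
    apply/eqP; apply: contraT => nec; have := mmin (c - a)%N.
    rewrite leqNgt -mE ltn_sub2r // => h3.
    suff : false by []; apply: h3; apply/existsP; exists (a, c).
    rewrite /= nec eqxx mem_lowpairs ia ac (leq_trans (ltnW cb)) //= andbT.
    by apply: contraTneq cb => -[_ ->]; rewrite -leqNgt.
  have := gmE T_UT h a c; rewrite fixc (bigD1 a) //= g1 mul1r (bigD1 c) /=; last first.
    by rewrite -val_eqE gtn_eqF.
  rewrite t1 mulr1 big1 ?addr0 => [/eqP|e /andP[ea ec]].
    by rewrite -subr_eq0 opprD addrA subrr sub0r oppr_eq0 => /eqP.
  have [lt|ge] := ltnP e a; first by rewrite g0 // mul0r.
  have [ce|ec'] := ltnP c e; first by rewrite t0 // mulr0.
  have lt1 : (a < e)%N by rewrite ltn_neqAle ge andbT eq_sym val_eqE.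
  have lt2 : (e < c)%N by rewrite ltn_neqAle ec' andbT val_eqE.
  by rewrite (IH e _ e erefl lt1 (ltn_trans lt2 cb)) ?mul0r // -cE.
have hab : h (Theta a b) - Theta a b = gm Theta h a b.
  rewrite (gmE T_UT) (bigD1 a) //= g1 mul1r (bigD1 b) /=; last by rewrite -val_eqE gtn_eqF.
  rewrite t1 mulr1 big1 ?addr0 => [|e /andP[ea eb]]; first by rewrite addrAC subrr add0r.
  have [lt|ge] := ltnP e a; first by rewrite g0 // mul0r.
  have [ce|ec'] := ltnP b e; first by rewrite t0 // mulr0.
  have lt1 : (a < e)%N by rewrite ltn_neqAle ge andbT eq_sym val_eqE.
  have lt2 : (e < b)%N by rewrite ltn_neqAle ec' andbT val_eqE.
  by rewrite gz // mul0r.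
have [m2 gm2] := gm_nat HK A_UT T_UT T_sol h a b.
have g_neq0 : gm Theta h a b != 0 by rewrite -hab subr_eq0.
have w0 : w (gm Theta h a b) = 0.
  by move: g_neq0; rewrite gm2 => nz; rewrite (w_natr HK HL) // (dvdn_pcharf chL).
have inM : Theta a b \in M by apply: (Theta_in_low T_UT) => //; apply: ltnW.
have := aut_sub_ge HK HL dim_p hm inM; rewrite hab => /(vgeE g_neq0); rewrite w0.
rewrite -lerBrDl sub0r => le; apply: le_trans le _.
by rewrite lerNl; apply: hC.
Qed.

End BestApproximation.

(** * Pole bounds for Theta and its logarithmic derivative Omega *)

Section OmegaBounds.
Variables (p : nat) (k K : fieldType) (embk : {rmorphism k -> K}).
Variables (v : K -> rat) (t : K).
Hypothesis HK : laurent_field p embk v t.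
Variables (L : splittingFieldType K) (w : L -> rat).
Hypothesis HL : totram_galois v w.
Variables (n : nat) (A : 'M[K]_n) (Theta : 'M[L]_n).
Hypotheses (A_UT : UT A) (T_UT : UT Theta).
Hypothesis T_sol : frobmx p Theta *m map_mx (in_alg L) A = Theta.
Variables (D : L -> L) (HD : alg_derivation (dK embk v t) D).

Let Hw := tg_val HL.
Let w_ext := tg_ext HL.
Let pp := lf_prime HK.
Let chL := pcharL HK L.
Local Notation AL := (map_mx (in_alg L) A).
Local Notation dA := (map_mx (in_alg L) (map_mx (dK embk v t) A)).

Definition Omega : 'M[L]_n := map_mx D Theta *m invmx Theta.

Lemma AL_UT : UT AL. Proof. exact: UT_map. Qed.

Lemma dA_low (a b : 'I_n) : (b <= a)%N -> dA a b = 0.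
Proof.
move=> ba; rewrite !mxE; case: A_UT => a0 a1.
move: ba; rewrite leq_eqVlt => /orP[/eqP/val_inj->|ba].
  by rewrite a1 (dK1 HK) rmorph0.
by rewrite a0 // (dK0 HK) rmorph0.
Qed.

Lemma Theta_p_UT : UT (frobmx p Theta).
Proof. by apply: frobmx_UT => //; apply: prime_gt0. Qed.

Lemma dTheta : map_mx D Theta = frobmx p Theta *m dA.
Proof.
apply/matrixP => a b; rewrite mxE -{1}T_sol !mxE (D_sum HD).
apply: eq_bigr => c _; rewrite !mxE (adM HD) (DXp HK HD) mul0r add0r.
by rewrite (adK HD).
Qed.

Lemma OmegaE : Omega = frobmx p Theta *m dA *m invmx Theta.
Proof. by rewrite /Omega dTheta. Qed.

Lemma Theta_pE : frobmx p Theta = Theta *m invmx AL.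
Proof. by rewrite -{2}T_sol mulmxK //; apply: UT_unit; exact: AL_UT. Qed.

Lemma OmegaE2 : Omega = Theta *m (invmx AL *m dA) *m invmx Theta.
Proof. by rewrite OmegaE Theta_pE mulmxA. Qed.

Lemma dAE : dA = invmx (frobmx p Theta) *m Omega *m Theta.
Proof.
by rewrite OmegaE !mulmxA mulVmx ?mul1mx ?mulmxKV ?UT_unit //; apply: Theta_p_UT.
Qed.

Lemma kappaE : invmx AL *m dA = invmx Theta *m Omega *m Theta.
Proof. by rewrite OmegaE2 !mulmxA mulVmx ?mul1mx ?mulmxKV ?UT_unit. Qed.

Lemma Omega_low (a b : 'I_n) : (b <= a)%N -> Omega a b = 0.
Proof.
move=> ba; rewrite OmegaE; apply: sandwich_low => //.
- exact: Theta_p_UT.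
- exact: UT_inv.
exact: dA_low.
Qed.

(** Superadditivity makes the bounds [- mu a b] multiplicative along chains, so that products and
    inverses inherit them. Two families are used: [lmu], linear in [b - a], and [pmu], the path
    weights. *)
Definition superadd (i j : nat) (mu : 'I_n -> 'I_n -> rat) : Prop :=
  [/\ forall a, mu a a = 0,
      forall a b : 'I_n, (i <= a)%N -> (a <= b)%N -> (b <= j)%N -> 0 <= mu a b &
      forall a c b : 'I_n, (i <= a)%N -> (a <= c)%N -> (c <= b)%N -> (b <= j)%N ->
        mu a c + mu c b <= mu a b].

Definition bndQ (F : fieldType) (x : F -> rat) (i j : nat) (mu : 'I_n -> 'I_n -> rat)
    (a b : 'I_n) (y : F) : Prop :=
  (i <= a)%N -> (b <= j)%N -> vge x y (- mu a b).

Lemma bndQ_graded (F : fieldType) (x : F -> rat) i j mu : is_valuation x ->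
  superadd i j mu -> graded (bndQ x i j mu).
Proof.
move=> Hx [m0 mge msup]; split.
- by move=> a _ _; rewrite m0 oppr0; right; rewrite val1.
- by move=> a b _ _; left.
- by move=> a b y z hy hz ia bj; apply: vgeD => //; [apply: hy|apply: hz].
- by move=> a b y hy ia bj; apply: vgeN => //; apply: hy.
move=> a c b y z ac cb hy hz ia bj.
apply: (@vge_le _ _ _ _ (- mu a c - mu c b)); last first.
  by apply: vgeM => //; [apply: hy => //; apply: leq_trans bj|apply: hz => //; apply: leq_trans ac].
by rewrite -opprD lerN2 msup.
Qed.

Lemma superadd_scale i j mu c : 0 <= c -> superadd i j mu ->
  superadd i j (fun a b => mu a b * c).
Proof.
move=> c0 [m0 mge msup]; split=> [a|a b ia ab bj|a d b ia ad db bj].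
- by rewrite m0 mul0r.
- by rewrite mulr_ge0 // mge.
- by rewrite -mulrDl ler_wpM2r // msup.
Qed.

Section Block.
Variables (i j : nat) (mu : 'I_n -> 'I_n -> rat) (mu_sup : superadd i j mu).
Hypothesis A_bnd : forall a b : 'I_n, (i <= a)%N -> (a < b)%N -> (b <= j)%N ->
  vge v (A a b) (- mu a b).

Let pinv0 : 0 <= p%:R^-1 :> rat. Proof. by rewrite invr_ge0. Qed.
Let sup_p := superadd_scale pinv0 mu_sup.

Lemma vge_algA x r : vge v x r -> vge w (x%:A : L) r.
Proof.
have [->|x0] := eqVneq x 0; first by rewrite scale0r; left.
by move/(vgeE x0) => h; right; rewrite w_ext.
Qed.

(** The right side of the Artin-Schreier equation for [Theta a b] contains [p]-th powers of shorter
    entries, which uses up the factor [1 / p] of the induction; [wp_bound] restores it. *)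
Lemma Theta_bnd (a b : 'I_n) : (i <= a)%N -> (a <= b)%N -> (b <= j)%N ->
  vge w (Theta a b) (- (mu a b / p%:R)).
Proof.
have [m0 mge msup] := mu_sup; have [t0 t1] := T_UT; have [a0 a1] := A_UT.
have p1 := prime_gt1 pp; have p0 : 0 < p%:R :> rat by rewrite ltr0n prime_gt0.
have [m] := ubnP (b - a); elim: m a b => // m IH a b bam ia ab bj.
move: ab; rewrite leq_eqVlt => /orP[/eqP/val_inj->|ab].
  by rewrite t1 m0 mul0r oppr0; right; rewrite val1.
apply: (wp_bound Hw p1); first exact: mge (ltnW ab) bj.
have -> : Theta a b - Theta a b ^+ p = \sum_(l | l != b) Theta a l ^+ p * (A l b)%:A.
  have := congr1 (fun M : 'M_n => M a b) T_sol; rewrite mxE (bigD1 b) //= !mxE.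
  rewrite a1 rmorph1 mulr1 => E; apply/eqP; rewrite subr_eq addrC -{1}E; apply/eqP; congr (_ + _).
  by apply: eq_bigr => l _; rewrite !mxE.
apply: vge_sum => // l lb.
have [la|al] := ltnP l a.
  by rewrite t0 // expr0n gtn_eqF ?prime_gt0 // mul0r.
have [bl|lb'] := ltnP b l; first by rewrite a0 // scale0r mulr0.
have lb2 : (l < b)%N by rewrite ltn_neqAle lb' andbT val_eqE.
apply: (@vge_le _ _ _ _ (p%:R * - (mu a l / p%:R) - mu l b)).
  rewrite mulrN mulrCA divff ?gt_eqF // mulr1 -opprD lerN2; apply: msup => //; exact: ltnW.
apply: vgeM => //.
  apply: vgeX => //; apply: IH => //; last exact: leq_trans (ltnW lb2) bj.
  by lia.
by apply: vge_algA; apply: A_bnd => //; apply: leq_trans al.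
Qed.

Lemma Theta_gr_p : mxgr (bndQ w i j (fun a b => mu a b / p%:R)) Theta.
Proof. by move=> a b ab ia bj; apply: Theta_bnd. Qed.

Lemma Theta_inv_gr_p : mxgr (bndQ w i j (fun a b => mu a b / p%:R)) (invmx Theta).
Proof. apply: mxgr_inv => //; [exact: bndQ_graded|exact: Theta_gr_p]. Qed.

Lemma Theta_p_gr : mxgr (bndQ w i j mu) (frobmx p Theta).
Proof.
move=> a b ab ia bj; rewrite mxE.
have p0 : 0 < p%:R :> rat by rewrite ltr0n prime_gt0.
have := vgeX Hw p (Theta_bnd ia ab bj).
by rewrite mulrN mulrCA divff ?gt_eqF // mulr1.
Qed.

Lemma Theta_p_inv_gr : mxgr (bndQ w i j mu) (invmx (frobmx p Theta)).
Proof.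
apply: mxgr_inv => //; [exact: bndQ_graded|exact: Theta_p_UT|exact: Theta_p_gr].
Qed.

Lemma weaken_p (a b : 'I_n) : (i <= a)%N -> (a <= b)%N -> (b <= j)%N -> - mu a b <= - (mu a b / p%:R).
Proof.
move=> ia ab bj; have [_ mge _] := mu_sup; rewrite lerN2 ler_piMr ?mge //.
by rewrite invf_le1 ?ler1n ?ltr0n prime_gt0.
Qed.

Lemma Theta_gr : mxgr (bndQ w i j mu) Theta.
Proof.
by move=> a b ab ia bj; apply: vge_le (Theta_bnd ia ab bj); apply: weaken_p.
Qed.

Lemma Theta_inv_gr : mxgr (bndQ w i j mu) (invmx Theta).
Proof. by apply: mxgr_inv => //; [exact: bndQ_graded|exact: Theta_gr]. Qed.

Lemma dA_bnd (a b : 'I_n) : (i <= a)%N -> (a < b)%N -> (b <= j)%N -> vge w (dA a b) (- mu a b).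
Proof. by move=> ia ab bj; rewrite !mxE; apply: vge_algA; apply: (dK_ge HK); apply: A_bnd. Qed.

End Block.
End OmegaBounds.

(** * Maximal path weights *)

Section PathMax.
Variable m : nat -> nat -> nat.

(** The first argument is fuel for structural recursion; by [pathmax_recE] any amount at least
    [b - a] gives the same maximum. *)
Fixpoint pathmax_rec (f a b : nat) : nat :=
  if f is f'.+1 then
    maxn (if (a < b)%N then m a b else 0)
      (\max_(c < b | (a < c)%N) (pathmax_rec f' a c + pathmax_rec f' c b))
  else 0.
Definition pathmax (a b : nat) : nat := pathmax_rec (b - a) a b.

Lemma pathmax_recE f a b : (b - a <= f)%N -> pathmax_rec f a b = pathmax a b.
Proof.
rewrite /pathmax; have [g] := ubnP f; elim: g a b f => // g IH a b f fg baf.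
case: f baf fg => [|f] baf fg.
  by move: baf; rewrite leqn0 => /eqP->.
case E : (b - a)%N => [|e] /=.
  have -> : (a < b)%N = false by lia.
  by rewrite max0n big_pred0 // => c; have := ltn_ord c; lia.
congr (maxn _ _); apply: eq_bigr => c ac; have cb := ltn_ord c.
by rewrite !(IH _ _ f) ?(IH _ _ e) //; lia.
Qed.

Lemma pathmaxE a b : pathmax a b =
  maxn (if (a < b)%N then m a b else 0) (\max_(c < b | (a < c)%N) (pathmax a c + pathmax c b)).
Proof.
rewrite -(@pathmax_recE (b - a).+1) //=; congr (maxn _ _); apply: eq_bigr => c ac.
by have := ltn_ord c => cb; rewrite !pathmax_recE //; lia.
Qed.

Lemma pathmax0 a b : (b <= a)%N -> pathmax a b = 0.
Proof. by move=> ba; rewrite /pathmax; have -> : (b - a = 0)%N by lia. Qed.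

Lemma pathmax_ge a b : (a < b)%N -> (m a b <= pathmax a b)%N.
Proof. by move=> ab; rewrite pathmaxE ab leq_maxl. Qed.

Lemma pathmax_split a c b : (a <= c)%N -> (c <= b)%N ->
  (pathmax a c + pathmax c b <= pathmax a b)%N.
Proof.
rewrite leq_eqVlt => /orP[/eqP->|ac]; first by rewrite (@pathmax0 c c).
rewrite leq_eqVlt => /orP[/eqP->|cb]; first by rewrite (@pathmax0 b b) ?addn0.
rewrite [X in (_ <= X)%N]pathmaxE leq_max; apply/orP; right.
exact: (leq_bigmax_cond (F := fun c : 'I_b => (pathmax a c + pathmax c b)%N) (Ordinal cb)).
Qed.

Lemma pathmax_cases a b : (a < b)%N -> pathmax a b = m a b \/
  exists2 c, (a < c < b)%N & pathmax a b = (pathmax a c + pathmax c b)%N.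
Proof.
move=> ab; rewrite {1 2}pathmaxE ab; set M := \max_(c < _ | _) _.
have [le|lt] := leqP M (m a b); first by left.
right; have [c ac E] : exists2 c : 'I_b, (a < c)%N & M = (pathmax a c + pathmax c b)%N.
  have ne : (0 < #|[pred c : 'I_b | (a < c)%N]|)%N.
    rewrite lt0n; apply: contraL lt => /eqP/card0_eq z.
    have -> : M = 0%N by apply: big_pred0 => c; have := z c; rewrite inE.
    by rewrite ltn0.
  by have [c ac E] := eq_bigmax_cond (fun c : 'I_b => pathmax a c + pathmax c b)%N ne; exists c.
by exists c; rewrite ?ac ?ltn_ord.
Qed.

(** The path consisting of one edge is the only maximal one. *)
Definition single a b : Prop := pathmax a b = m a b /\
  forall c, (a < c < b)%N -> (pathmax a c + pathmax c b < pathmax a b)%N.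

Lemma single_or_split a b : (a < b)%N -> single a b \/
  exists2 c, (a < c < b)%N & pathmax a b = (pathmax a c + pathmax c b)%N.
Proof.
move=> ab; case: (excluded_middle_informative (exists2 c, (a < c < b)%N &
   pathmax a b = (pathmax a c + pathmax c b)%N)) => [|no]; first by right.
left; case: (pathmax_cases ab) => [E|//]; split=> // c acb.
rewrite ltn_neqAle pathmax_split ?andbT; try lia.
by apply/eqP => E'; apply: no; exists c.
Qed.

Lemma single_step x : single x x.+1.
Proof.
by have [//|[c]] := single_or_split (ltnSn x); lia.
Qed.

Definition usum a b := (\sum_(a <= x < b) pathmax x x.+1)%N.

Lemma usum_cat a c b : (a <= c)%N -> (c <= b)%N -> usum a b = (usum a c + usum c b)%N.
Proof. by move=> ac cb; rewrite /usum (big_cat_nat ac cb). Qed.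

Lemma usum1 x : usum x x.+1 = pathmax x x.+1.
Proof. by rewrite /usum big_nat1. Qed.

Lemma usum_le a b : (a <= b)%N -> (usum a b <= pathmax a b)%N.
Proof.
elim: b => [|b IH]; first by rewrite leqn0 => /eqP->; rewrite /usum big_geq.
rewrite leq_eqVlt => /orP[/eqP->|ab]; first by rewrite /usum big_geq.
rewrite (@usum_cat a b b.+1) // usum1; apply: leq_trans (pathmax_split (c := b) _ _) => //.
by rewrite leq_add2r IH.
Qed.

Lemma usum_sub i j a b : (i <= a)%N -> (a <= b)%N -> (b <= j)%N ->
  pathmax i j = usum i j -> pathmax a b = usum a b.
Proof.
move=> ia ab bj E; apply/eqP; rewrite eqn_leq usum_le // andbT.
have := pathmax_split ia (leq_trans ab bj); have := pathmax_split ab bj.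
have := usum_le ia; have := usum_le bj; rewrite E.
rewrite (@usum_cat i a j) ?(@usum_cat a b j); lia.
Qed.

(** Two of the [p + 1] partial sums from [i] agree modulo [p]. The stretch between them has at least
    two steps, since a single step is not divisible by [p]. *)
Lemma usum_pigeonhole p i : (0 < p)%N -> (forall x, (i <= x < i + p)%N -> ~~ (p %| pathmax x x.+1)%N) ->
  exists c d, [/\ (i <= c)%N, (c.+1 < d)%N, (d <= i + p)%N, (d - c <= p)%N & (p %| usum c d)%N].
Proof.
move=> p0 ndiv; pose f (x : 'I_p.+1) : 'I_p := Ordinal (ltn_pmod (usum i (i + x)) p0).
have /injectivePn[x [y xy fxy]] : ~~ injectiveb f.
  apply/negP => /injectiveP /leq_card; rewrite !card_ord; lia.
wlog lt : x y xy fxy / (x < y)%N => [H|].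
  have [|ge] := ltnP x y; first exact: H.
  apply: (H y x) => //; rewrite ?[y == x]eq_sym // ltn_neqAle ge andbT.
  by rewrite val_eqE eq_sym.
have div : (p %| usum (i + x) (i + y))%N.
  have := congr1 val fxy => /= /eqP; rewrite eq_sym eqn_mod_dvd; last first.
    by rewrite (@usum_cat i (i + x) (i + y)) ?leq_addr ?leq_add2l 1?ltnW.
  by rewrite (@usum_cat i (i + x) (i + y)) ?leq_addr ?leq_add2l 1?ltnW // addKn.
exists (i + x)%N, (i + y)%N; have := ltn_ord y; have := ltn_ord x; split=> //; try lia.
have [//|le] := ltnP (i + x).+1 (i + y)%N.
have E : (i + y)%N = (i + x).+1 by lia.
by move: div; rewrite E usum1 (negPf (ndiv _ _)) //; lia.
Qed.

Section Bound.
Variables (i j : nat) (rho : rat).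
Hypothesis rho_ge0 : 0 <= rho.
Hypothesis single_le : forall a b, (i <= a)%N -> (a < b)%N -> (b <= j)%N -> (a, b) != (i, j) ->
  single a b -> (pathmax a b)%:R <= rho.

Lemma usum_bound a b : (i <= a)%N -> (a <= b)%N -> (b <= j)%N -> (a, b) != (i, j) ->
  (usum a b)%:R <= (b - a)%:R * rho.
Proof.
move=> ia; elim: b => [|b IH] ab bj ne.
  by rewrite /usum big_geq // mulr_ge0.
move: ab; rewrite leq_eqVlt => /orP[/eqP->|ab]; first by rewrite /usum big_geq // subnn mul0r.
rewrite (@usum_cat a b b.+1) // usum1 natrD subSn // -natr1 mulrDl mul1r; apply: lerD.
  by apply: IH; rewrite ?(ltnW bj) // xpair_eqE negb_and; apply/orP; right; lia.
have [E|ne'] := eqVneq (b, b.+1) (i, j); last by apply: single_le => //; [lia|exact: single_step].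
move: ne; rewrite !xpair_eqE; case: E => E1 E2; rewrite -E2 eqxx andbT.
by move: ab ia; rewrite -E1; lia.
Qed.

(** A maximal path can be refined until its edges are unsplittable, each of weight at most [rho].
    Either all edges have length one, or some edge is longer and at most [b - a - 1] edges are
    needed. *)
Lemma pathmax_dich a b : (i <= a)%N -> (a < b)%N -> (b <= j)%N -> (a, b) != (i, j) ->
  (pathmax a b)%:R <= (b - a).-1%:R * rho \/ pathmax a b = usum a b.
Proof.
have [g] := ubnP (b - a); elim: g a b => // g IH a b bag ia ab bj ne.
have [E|lt] := leqP b a.+1.
  right; have -> : b = a.+1 by lia.
  by rewrite usum1.
have [S|[c acb E]] := single_or_split ab.
  left; apply: le_trans (single_le ia ab bj ne S) _.
  by rewrite ler_peMl // ler1n; lia.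
have ne1 : (a, c) != (i, j) by rewrite xpair_eqE; lia.
have ne2 : (c, b) != (i, j) by rewrite xpair_eqE; lia.
have bnd x y : (i <= x)%N -> (x < y)%N -> (y <= j)%N -> (x, y) != (i, j) ->
    (pathmax x y)%:R <= (y - x).-1%:R * rho \/ pathmax x y = usum x y ->
    (pathmax x y)%:R <= (y - x)%:R * rho.
  move=> ix xy yj nxy [h|->]; last by apply: usum_bound => //; apply: ltnW.
  by apply: le_trans h _; rewrite ler_wpM2r // ler_nat; lia.
have H1 : (pathmax a c)%:R <= (c - a).-1%:R * rho \/ pathmax a c = usum a c.
  by apply: IH => //; lia.
have H2 : (pathmax c b)%:R <= (b - c).-1%:R * rho \/ pathmax c b = usum c b.
  by apply: IH => //; lia.
have B1 : (pathmax a c)%:R <= (c - a)%:R * rho by apply: bnd => //; lia.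
have B2 : (pathmax c b)%:R <= (b - c)%:R * rho by apply: bnd => //; lia.
case: H1 => H1.
  left; rewrite E natrD; apply: le_trans (lerD H1 B2) _.
  by rewrite -mulrDl -natrD ler_wpM2r // ler_nat; lia.
case: H2 => H2.
  left; rewrite E natrD; apply: le_trans (lerD B1 H2) _.
  by rewrite -mulrDl -natrD ler_wpM2r // ler_nat; lia.
by right; rewrite E H1 H2 -usum_cat //; lia.
Qed.

Lemma pathmax_trich : (i < j)%N ->
  [\/ single i j, (pathmax i j)%:R <= (j - i).-1%:R * rho |
      pathmax i j = usum i j /\ (i.+1 < j)%N].
Proof.
move=> ij; have [S|[c icj E]] := single_or_split ij; first by constructor 1.
have ne1 : (i, c) != (i, j) by rewrite xpair_eqE; lia.
have ne2 : (c, j) != (i, j) by rewrite xpair_eqE; lia.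
have H1 : (pathmax i c)%:R <= (c - i).-1%:R * rho \/ pathmax i c = usum i c.
  by apply: pathmax_dich => //; lia.
have H2 : (pathmax c j)%:R <= (j - c).-1%:R * rho \/ pathmax c j = usum c j.
  by apply: pathmax_dich => //; lia.
have B1 : (usum i c)%:R <= (c - i)%:R * rho by apply: usum_bound => //; lia.
have B2 : (usum c j)%:R <= (j - c)%:R * rho by apply: usum_bound => //; lia.
have W x y : (x%:R : rat) <= y.-1%:R * rho -> x%:R <= y%:R * rho.
  by move=> h; apply: le_trans h _; rewrite ler_wpM2r // ler_nat leq_pred.
case: H1 H2 => H1 [] H2.
- constructor 2; rewrite E natrD; apply: le_trans (lerD H1 (W _ _ H2)) _.
  by rewrite -mulrDl -natrD ler_wpM2r // ler_nat; lia.
- constructor 2; rewrite E natrD; rewrite -H2 in B2; apply: le_trans (lerD H1 B2) _.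
  by rewrite -mulrDl -natrD ler_wpM2r // ler_nat; lia.
- constructor 2; rewrite E natrD; rewrite -H1 in B1; apply: le_trans (lerD B1 H2) _.
  by rewrite -mulrDl -natrD ler_wpM2r // ler_nat; lia.
by constructor 3; rewrite E H1 H2 -usum_cat //; lia.
Qed.

End Bound.
End PathMax.

(** * Path weights and the entries of Omega *)

Section OmegaPathMax.
Variables (p : nat) (k K : fieldType) (embk : {rmorphism k -> K}).
Variables (v : K -> rat) (t : K).
Hypothesis HK : laurent_field p embk v t.
Variables (L : splittingFieldType K) (w : L -> rat).
Hypothesis HL : totram_galois v w.
Variables (n : nat) (A : 'M[K]_n) (Theta : 'M[L]_n).
Hypotheses (A_UT : UT A) (T_UT : UT Theta).
Hypothesis T_sol : frobmx p Theta *m map_mx (in_alg L) A = Theta.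
Variables (D : L -> L) (HD : alg_derivation (dK embk v t) D).
Variable m : nat -> nat -> nat.

(** Pole orders prime to [p] are what makes [dK] preserve the valuation of every nonzero entry of
    [A] above the diagonal. *)
Definition pole_orders : Prop := forall a b : 'I_n, (a < b)%N ->
  (A a b = 0 /\ m a b = 0%N) \/
  [/\ A a b != 0, v (A a b) = - (m a b)%:R & ~~ (p %| m a b)%N].
Hypothesis A_pole : pole_orders.
Hypothesis A_super : forall a b : 'I_n, b = a.+1 :> nat -> A a b != 0.

Let Hv := lf_val HK.
Let Hw := tg_val HL.
Let pp := lf_prime HK.
Local Notation AL := (map_mx (in_alg L) A).
Local Notation dA := (map_mx (in_alg L) (map_mx (dK embk v t) A)).
Local Notation Om := (Omega Theta D).

Definition pmu (a b : 'I_n) : rat := (pathmax m a b)%:R.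

Lemma pmu_sup i j : superadd i j pmu.
Proof.
split=> [a|a b _ _ _|a c b _ ac cb _]; rewrite /pmu ?ler0n //; first by rewrite pathmax0.
by rewrite -natrD ler_nat pathmax_split.
Qed.

Lemma A_pmu (i j : nat) (a b : 'I_n) : (i <= a)%N -> (a < b)%N -> (b <= j)%N -> vge v (A a b) (- pmu a b).
Proof.
move=> _ ab _; have [[-> _]|[_ E _]] := A_pole ab; first by left.
by right; rewrite E lerN2 ler_nat pathmax_ge.
Qed.

Let Tp_gr i j := Theta_p_gr HK HL A_UT T_UT T_sol (pmu_sup i j) (@A_pmu i j).
Let Ti_gr i j := Theta_inv_gr HK HL A_UT T_UT T_sol (pmu_sup i j) (@A_pmu i j).
Let T_grp i j := Theta_gr_p HK HL A_UT T_UT T_sol (pmu_sup i j) (@A_pmu i j).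
Let Ti_grp i j := Theta_inv_gr_p HK HL A_UT T_UT T_sol (pmu_sup i j) (@A_pmu i j).
Let dA_gr i j := dA_bnd HK HL (@A_pmu i j).

Lemma dA_val (a b : 'I_n) : (a < b)%N -> A a b != 0 -> dA a b != 0 /\ w (dA a b) = - (m a b)%:R.
Proof.
move=> ab Aab; have [[E _]|[_ vA nd]] := A_pole ab; first by rewrite E eqxx in Aab.
have [] := val_dK HK Aab (l := - (m a b)%:Z); first by rewrite vA rmorphN.
  by rewrite rpredN.
rewrite !mxE => d0 vd; rewrite (tg_ext HL) // vd rmorphN; split=> //.
by rewrite scaler_eq0 negb_or d0 oner_neq0.
Qed.

Lemma Omega_gr (i j : nat) (a b : 'I_n) : (i <= a)%N -> (a <= b)%N -> (b <= j)%N -> vge w (Om a b) (- pmu a b).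
Proof.
move=> ia ab bj; rewrite (OmegaE HK T_sol HD).
have gQ := bndQ_graded Hw (pmu_sup i j).
have [t0 t1] := UT_inv T_UT; have [p0 p1] := Theta_p_UT HK T_UT.
have d0 (x y : 'I_n) : (y < x)%N -> dA x y = 0.
  by move=> yx; apply: (dA_low HK) => //; apply: ltnW.
suff H : mxgr (bndQ w i j pmu) (frobmx p Theta *m dA *m invmx Theta) by apply: H.
apply: (mxgr_mul gQ) => //.
  move=> x y yx; rewrite mxE big1 // => c _.
  have [cx|xc] := ltnP c x; first by rewrite p0 // mul0r.
  by rewrite d0 ?mulr0 //; apply: leq_trans xc.
apply: (mxgr_mul gQ) => // x y xy ix yj.
have [lt|ge] := ltnP x y; first exact: dA_gr ix lt yj.
by rewrite (dA_low HK) //; left.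
Qed.

Lemma Omega_single (a b : 'I_n) : (a < b)%N -> A a b != 0 -> single m a b ->
  Om a b != 0 /\ w (Om a b) = - (pathmax m a b)%:R.
Proof.
move=> ab Aab [Pm Ps]; have [d0 vd] := dA_val ab Aab.
rewrite Pm -vd (OmegaE HK T_sol HD).
suff h : vgt w ((frobmx p Theta *m dA *m invmx Theta) a b - dA a b) (w (dA a b)).
  by apply: (val_subl Hw d0); rewrite -opprB; apply: vgtN.
apply: conj_lead => //; [exact: (Theta_p_UT HK)|exact: UT_inv|by move=> x y yx; apply: (dA_low HK)|].
move=> l l' al ll' l'b ne; rewrite vd -Pm.
apply: (@vgt_lt _ _ _ _ (- pmu a l - pmu l l' - pmu l' b)).
  rewrite -!opprD ltrN2 /pmu -!natrD ltr_nat.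
  have [alt|] := ltnP a l.
    apply: leq_ltn_trans (Ps l _); last by lia.
    by rewrite -addnA leq_add2l pathmax_split // ltnW.
  move=> la; have E : l = a by apply/val_inj/eqP; rewrite /= eqn_leq la al.
  move: ne; rewrite {}E in ll' * => ne.
  rewrite pathmax0 // add0n; apply: Ps; rewrite ll' ltn_neqAle l'b andbT.
  by apply: contraNN ne => /eqP/val_inj->.
apply: vgeM => //; last by apply: (@Ti_gr a b _ _ l'b) => //; lia.
apply: vgeM => //; first by apply: (@Tp_gr a b _ _ al) => //; lia.
by apply: (dA_gr (i := a) (j := b)).
Qed.

Lemma step_pole (a b : 'I_n) : b = a.+1 :> nat -> A a b != 0 /\
  [/\ v (A a b) = - pmu a b, ~~ (p %| pathmax m a b)%N & (0 < pathmax m a b)%N].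
Proof.
move=> E; have ab : (a < b)%N by rewrite E.
have A0 := A_super E; split=> //; have [[E0 _]|[_ vA nd]] := A_pole ab.
  by rewrite E0 eqxx in A0.
have PE : pathmax m a b = m a b by rewrite E; case: (single_step m a).
rewrite /pmu PE; split=> //.
by rewrite lt0n; apply: contraNN nd => /eqP->; rewrite dvdn0.
Qed.

Lemma pathmax_gt0 (a b : 'I_n) : (a < b)%N -> (0 < pathmax m a b)%N.
Proof.
move=> ab; have an : (a.+1 < n)%N by apply: leq_ltn_trans (ltn_ord b).
have [_ [_ _ h]] := @step_pole a (Ordinal an) erefl.
by apply: leq_trans (@pathmax_split m a a.+1 b _ _) => //; apply: leq_trans h (leq_addr _ _).
Qed.

Section Additive.
Variables c d : 'I_n.
Hypotheses (cd : (c.+1 < d)%N) (P_add : pathmax m c d = usum m c d).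
Hypothesis p_dvd : (p %| pathmax m c d)%N.
Hypothesis Om_small : forall a b : 'I_n, (c <= a)%N -> (a.+1 < b)%N -> (b <= d)%N ->
  vgt w (Om a b) (- pmu a b).

Lemma pmu_add (a e b : 'I_n) : (c <= a)%N -> (a <= e)%N -> (e <= b)%N -> (b <= d)%N ->
  pmu a b = pmu a e + pmu e b.
Proof.
move=> ca ae eb bd; have H x y := @usum_sub m c d x y.
rewrite /pmu -natrD (H a b) ?(H a e) ?(H e b) -?usum_cat //; lia.
Qed.

Let kappa := invmx AL *m dA.

Lemma kappa_small (a b : 'I_n) : (c <= a)%N -> (a.+1 < b)%N -> (b <= d)%N ->
  vgt w (kappa a b) (- pmu a b).
Proof.
move=> ca ab bd; rewrite /kappa (kappaE HK A_UT T_UT T_sol HD).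
have -> : (invmx Theta *m Om *m Theta) a b =
    ((invmx Theta *m Om *m Theta) a b - Om a b) + Om a b by rewrite subrK.
apply: vgtD => //; last exact: Om_small.
apply: conj_lead => //; [exact: UT_inv|exact: (Omega_low HK A_UT T_UT T_sol HD)|].
move=> l l' al ll' l'b ne.
apply: (@vgt_lt _ _ _ _ (- (pmu a l / p%:R) - pmu l l' - (pmu l' b / p%:R))).
  rewrite -!opprD ltrN2 (@pmu_add a l b) ?(@pmu_add l l' b) //; try lia.
  have le (x y : 'I_n) : pmu x y / p%:R <= pmu x y.
    by rewrite ler_piMr ?ler0n // invf_le1 ?ler1n ?ltr0n prime_gt0.
  have lt (x y : 'I_n) : (x < y)%N -> pmu x y / p%:R < pmu x y.
    move=> xy; rewrite gtr_pMr ?ltr0n ?pathmax_gt0 // invf_lt1 ?ltr1n ?ltr0n ?prime_gt1 //.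
    exact: prime_gt0.
  rewrite addrA; have [alt|] := ltnP a l.
    by apply: ltr_leD => //; apply: ltr_leD => //; apply: lt.
  move=> la; have E : l = a by apply/val_inj/eqP; rewrite /= eqn_leq la al.
  apply: ler_ltD; first exact: lerD.
  apply: lt; rewrite ltn_neqAle l'b andbT.
  by apply: contraNN ne => /eqP/val_inj->; rewrite E.
apply: vgeM => //; last by apply: (@T_grp a b _ _ l'b) => //; lia.
apply: vgeM => //; first by apply: (@Ti_grp a b _ _ al) => //; lia.
by apply: (@Omega_gr a b) => //; apply: ltnW.
Qed.

Lemma kappa_low (a b : 'I_n) : (b <= a)%N -> kappa a b = 0.
Proof.
move=> ba; rewrite /kappa (kappaE HK A_UT T_UT T_sol HD).
by apply: sandwich_low => //; [exact: UT_inv|exact: (Omega_low HK A_UT T_UT T_sol HD)].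
Qed.

Lemma dA_kappa : dA = AL *m kappa.
Proof. by rewrite /kappa mulmxA mulmxV ?mul1mx //; apply: UT_unit; apply: AL_UT. Qed.

Lemma kappa_step (a b : 'I_n) : b = a.+1 :> nat -> kappa a b = dA a b.
Proof.
move=> E; have [a0 a1] := @AL_UT _ L _ _ A_UT.
rewrite dA_kappa [RHS]mxE [RHS](bigD1 a) //= a1 mul1r big1 ?addr0 // => x xa.
have [lt|le] := ltnP x a; first by rewrite a0 // mul0r.
rewrite kappa_low ?mulr0 // E ltn_neqAle le andbT eq_sym; exact: xa.
Qed.

(** In [dA = A kappa] the sum for column [z] keeps only the term through [z - 1]; the others contain
    an entry of [kappa] at distance at least two. *)
Lemma dA_lead (z' z : 'I_n) : z = z'.+1 :> nat -> (c < z')%N -> (z <= d)%N ->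
  vgt w (dA c z - AL c z' * dA z' z) (- pmu c z).
Proof.
move=> E cz zd; rewrite {1}dA_kappa mxE (bigD1 z') //= kappa_step // [_ * _ + _]addrC addrK.
apply: vgt_sum => // x xz; have [a0 a1] := A_UT.
have [lt|le] := ltnP x c; first by rewrite mxE a0 // rmorph0 mul0r.
have [zx|xz'] := leqP z x; first by rewrite kappa_low // mulr0.
have xz'' : (x < z')%N by rewrite ltn_neqAle xz /= -ltnS -E.
rewrite (@pmu_add c x z) // 1?ltnW // opprD; apply: vgtMr => //; last first.
  by apply: kappa_small => //; rewrite E.
have [cx|xc] := ltnP c x.
  by rewrite mxE; apply: (vge_algA HL); apply: (@A_pmu c x).
have -> : x = c by apply/val_inj/eqP; rewrite /= eqn_leq xc le.
by rewrite mxE a1 rmorph1 /pmu pathmax0 // oppr0; right; rewrite val1.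
Qed.

Lemma alg_vgt x r : vgt w (x%:A : L) r -> vgt v x r.
Proof.
have [->|x0] := eqVneq x 0; first by left.
have xL : (x%:A : L) != 0 by rewrite scaler_eq0 negb_or x0 oner_neq0.
by move/(vgtE xL) => h; right; rewrite -(tg_ext HL).
Qed.

Lemma dK_gt (a b : 'I_n) : (a < b)%N -> vgt v (A a b) (- pmu a b) -> vgt w (dA a b) (- pmu a b).
Proof.
move=> ab; have [[E _] _|[Aab vA _] h] := A_pole ab.
  by rewrite !mxE E (dK0 HK) rmorph0; left.
have [d0 vd] := dA_val ab Aab; right; rewrite vd -vA; exact: vgtE h.
Qed.

(** The weight from [c] to [d] is divisible by [p] whereas the pole order of [A c d] is not, so
    [A c d] falls short of this weight. By [dA_lead] the deficiency passes from column [z + 1] to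
    column [z], down to [A c (c + 1)], which attains its weight. *)
Lemma additive_absurd : False.
Proof.
have top : vgt v (A c d) (- pmu c d).
  have cd' : (c < d)%N by apply: ltnW.
  have [[-> _]|[Acd vA nd]] := A_pole cd'; first by left.
  right; rewrite vA ltrN2 ltr_nat ltn_neqAle pathmax_ge // andbT.
  by apply: contraNN nd => /eqP->.
have main e (z : 'I_n) : z = (d - e)%N :> nat -> (c < z)%N -> vgt v (A c z) (- pmu c z).
  elim: e z => [|e IH] z Ez cz.
    by have -> : z = d by apply/val_inj; rewrite /= Ez subn0.
  have zd : (z < d)%N by lia.
  pose y := Ordinal (leq_ltn_trans zd (ltn_ord d)).
  have yz : y = z.+1 :> nat by [].
  have cy : (c < y)%N by rewrite yz; lia.
  have h := IH y _ cy; have {}h : vgt v (A c y) (- pmu c y) by apply: h; rewrite yz; lia.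
  have h1 := dK_gt cy h.
  have h2 := dA_lead yz cz zd.
  have h3 : vgt w (AL c z * dA z y) (- pmu c y).
    by have := vgtB Hw h1 h2; rewrite opprB addrC subrK.
  have [Azy [vA _ _]] := step_pole yz.
  have [d0 vd] := dA_val (a := z) (b := y) (ltnSn _) Azy.
  have [[E _]|[_ vA' _]] := @A_pole z y (ltnSn _); first by rewrite E eqxx in Azy.
  apply: alg_vgt.
  have -> : (A c z)%:A = AL c z * dA z y * (dA z y)^-1 by rewrite mulfK // mxE.
  have -> : - pmu c z = - pmu c y + pmu z y.
    by rewrite (@pmu_add c z y) // 1?ltnW // opprD addrNK.
  apply: vgtMl => //; right; rewrite valV // vd opprK.
  by rewrite -[pmu z y]opprK -vA vA' opprK.
have c1 : (c.+1 < n)%N by apply: ltn_trans (ltn_ord d).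
have := main (d - c.+1)%N (Ordinal c1); rewrite subKn; last exact: ltnW.
move=> /(_ erefl (ltnSn _)); have [A0 [vA _ _]] := @step_pole c (Ordinal c1) erefl.
by move/(vgtE A0); rewrite vA ltxx.
Qed.

End Additive.

(* In the first case the edge [(i, j)] beats every other path, so that the sum defining
   [Omega i j] has a single dominant term. *)
Lemma Omega_pathmax (i j : 'I_n) (rho : rat) : (i < j)%N -> (j - i <= p.+1)%N -> 0 <= rho ->
  (forall a b : 'I_n, (i <= a)%N -> (a < b)%N -> (b <= j)%N -> (a, b) != (i, j) ->
     vge w (Om a b) (- rho)) ->
  (Om i j != 0 /\ w (Om i j) = - pmu i j) \/ pmu i j <= p%:R * rho.
Proof.
move=> ij jip rho0 Om_rho.
have single_pole (a b : 'I_n) : (a < b)%N -> single m a b -> A a b != 0.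
  move=> ab [Pm Ps]; have [[E m0]|[]//] := A_pole ab.
  by have := pathmax_gt0 ab; rewrite Pm m0.
have single_le a b : (i <= a)%N -> (a < b)%N -> (b <= j)%N -> (a, b) != (i : nat, j : nat) ->
    single m a b -> (pathmax m a b)%:R <= rho.
  move=> ia ab bj ne S.
  have bn : (b < n)%N by apply: leq_ltn_trans (ltn_ord j).
  have an : (a < n)%N by apply: ltn_trans bn.
  pose a' := Ordinal an; pose b' := Ordinal bn.
  have A0 := single_pole a' b' ab S.
  have [O0 vO] := @Omega_single a' b' ab A0 S.
  have ne' : (a', b') != (i, j).
    by move: ne; rewrite !xpair_eqE.
  by have := vgeE O0 (Om_rho a' b' ia ab bj ne'); rewrite vO lerN2.
have [S|le|[Add lt]] := pathmax_trich rho0 single_le ij.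
- left; apply: Omega_single => //; exact: single_pole.
- right; apply: le_trans le _; rewrite ler_wpM2r // ler_nat; lia.
right.
have jE : j = j.-1.+1 :> nat by lia.
have ji1 : (j.-1 < n)%N by apply: leq_ltn_trans (leq_pred _) (ltn_ord j).
have us a b : (i <= a)%N -> (a <= b)%N -> (b <= j)%N -> (usum m a b)%:R <= (b - a)%:R * rho.
  move=> ia ab bj; have [E|ne] := eqVneq (a, b) (i : nat, j : nat); last exact: usum_bound ne.
  case: E => -> ->; rewrite (@usum_cat m i i.+1 j) // natrD.
  have -> : (j - i = 1 + (j - i.+1))%N by lia.
  rewrite natrD mulrDl; apply: lerD.
    rewrite mul1r usum1; apply: single_le => //; last exact: single_step.
    by rewrite xpair_eqE; lia.
  by apply: (usum_bound rho0 single_le) => //; rewrite xpair_eqE; lia.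
have [le|gt] := leqP (j - i)%N p.
  rewrite /pmu Add; apply: le_trans (us i j _ _ _) _ => //; first exact: ltnW.
  by rewrite ler_wpM2r // ler_nat.
(* Only the extremal length is left, where the additive bound is one [rho] too large. A divisible
   stretch among the first [p] steps will save it. *)
have ip : (j = i + p.+1 :> nat)%N by lia.
have p0 : (0 < p)%N by apply: prime_gt0.
have [c [d [ic cd di dc pd]]] : exists c d, [/\ (i <= c)%N, (c.+1 < d)%N, (d <= i + p)%N,
    (d - c <= p)%N & (p %| usum m c d)%N].
  apply: usum_pigeonhole => // x /andP[ix xi].
  have xn : (x.+1 < n)%N by have := ltn_ord j; lia.
  have [_ [_ nd _]] := @step_pole (Ordinal (ltnW xn)) (Ordinal xn) erefl.
  exact: nd.
have dn : (d < n)%N by have := ltn_ord j; lia.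
have cn : (c < n)%N by lia.
have Pcd : pathmax m c d = usum m c d by apply: usum_sub Add => //; lia.
have [a [b [[ca ab bd] h]]] : exists a b : 'I_n, [/\ (c <= a)%N, (a.+1 < b)%N & (b <= d)%N] /\
   ~ vgt w (Om a b) (- pmu a b).
  apply: NNPP => no; apply: (@additive_absurd (Ordinal cn) (Ordinal dn)) => //=.
    by rewrite Pcd.
  move=> a b ca ab bd; apply: NNPP => h; apply: no; exists a, b; split=> //.
have Oab : (pmu a b <= rho).
  have O0 : Om a b != 0 by apply/eqP => O0; apply: h; left.
  have le1 : - rho <= w (Om a b).
    apply: (vgeE O0); apply: Om_rho => //; try lia.
    by apply/eqP => -[E1 E2]; move: ic ca bd di; rewrite E2 ip; lia.
  have le2 : w (Om a b) <= - pmu a b.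
    by rewrite leNgt; apply/negP => hh; apply: h; right.
  by have := le_trans le1 le2; rewrite lerN2.
have Pab : pathmax m a b = usum m a b by apply: usum_sub Add => //; lia.
rewrite /pmu Add (@usum_cat m i a j) ?(@usum_cat m a b j) //; try lia.
rewrite !natrD -Pab.
have H1 := us i a; have H2 := us b j.
have {}H1 : (usum m i a)%:R <= (a - i)%:R * rho by apply: H1; lia.
have {}H2 : (usum m b j)%:R <= (j - b)%:R * rho by apply: H2; lia.
(* The stretch from [a] to [b] has at least two steps but costs a single [rho], so at most [p]
   copies remain. *)
apply: le_trans (lerD H1 (lerD Oab H2)) _.
have -> : (a - i)%:R * rho + (rho + (j - b)%:R * rho) = (a - i + 1 + (j - b))%:R * rho.
  by rewrite !natrD; ring.
by rewrite ler_wpM2r // ler_nat; lia.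
Qed.

End OmegaPathMax.

(** * The matrices W and S over a field containing a solution *)

Lemma map_frobmx (F F' : fieldType) (f : {rmorphism F -> F'}) n m (X : 'M[F]_n) :
  map_mx f (frobmx m X) = frobmx m (map_mx f X).
Proof. by apply/matrixP => a b; rewrite !mxE rmorphXn. Qed.

Lemma frobmx_id (F : fieldType) n (X : 'M[F]_n) : frobmx 1 X = X.
Proof. by apply/matrixP => a b; rewrite mxE. Qed.

Section WMatrix.
Variables (F : fieldType) (n p : nat) (A : 'M[F]_n).

Fixpoint WK (e : nat) : 'M[F]_n :=
  if e is e'.+1 then frobmx (p ^ e') A *m WK e' else 1%:M.

Definition SW (Aj : 'M[F]_n) (N : nat) : 'M[F]_n :=
  invmx (frobmx p (WK N)) *m Aj *m frobmx p (WK N.-1) - 1%:M.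

Hypothesis chp : p \in [pchar F].
Variable Theta : 'M[F]_n.
Hypotheses (A_UT : UT A) (T_UT : UT Theta) (T_sol : frobmx p Theta *m A = Theta).

Let pr0_p e : (0 < p ^ e)%N. Proof. by rewrite expn_gt0 prime_gt0 ?(pcharf_prime chp). Qed.

Lemma WK_UT e : UT (WK e).
Proof.
elim: e => [|e IH] /=; first exact: UT1.
by apply: UT_mul => //; apply: frobmx_UT.
Qed.

Lemma frob_sol e : frobmx (p ^ e.+1) Theta *m frobmx (p ^ e) A = frobmx (p ^ e) Theta.
Proof. by rewrite -{2}T_sol (frobmxM chp) frobmx_comp -expnS. Qed.

Let fT_unit e : frobmx (p ^ e) Theta \in unitmx.
Proof. by apply: UT_unit; apply: frobmx_UT. Qed.

(** The product of Frobenius twists of [A] telescopes through [frob_sol]. *)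
Lemma WK_Theta e : WK e = invmx (frobmx (p ^ e) Theta) *m Theta.
Proof.
elim: e => [|e IH] /=; first by rewrite expn0 frobmx_id mulVmx // UT_unit.
rewrite IH -{1}(mulKmx (fT_unit e.+1) (frobmx (p ^ e) A)) frob_sol.
by rewrite -!mulmxA [frobmx _ _ *m (invmx _ *m _)]mulmxA mulmxV ?fT_unit // mul1mx.
Qed.

Lemma frobWK e : frobmx p (WK e) = invmx (frobmx (p ^ e.+1) Theta) *m frobmx p Theta.
Proof. by rewrite WK_Theta (frobmxMp chp) (frobmxVp chp) frobmx_comp -expnSr. Qed.

Lemma frobWK_inv e :
  invmx (frobmx p (WK e)) = invmx (frobmx p Theta) *m frobmx (p ^ e.+1) Theta.
Proof.
rewrite frobWK; have u1 := fT_unit e.+1; have u2 := fT_unit 1; rewrite expn1 in u2.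
set X := invmx _ *m _; set Y := invmx _ *m _.
have uX : X \in unitmx by rewrite unitmx_mul unitmx_inv u1.
have XY : X *m Y = 1%:M by rewrite /X /Y !mulmxA mulmxK // mulVmx.
by rewrite -[RHS](mulKmx uX) XY mulmx1.
Qed.

(** Trades the powers of [A] for those of Theta: up to conjugation by [Theta^(p)], the matrix in the
    middle is multiplied by [Theta^(p^(N+1))] on the left and by the inverse of [Theta^(p^N)] on the
    right. *)
Lemma sandwich_W Q N : (0 < N)%N ->
  invmx (frobmx p (WK N)) *m Q *m frobmx p (WK N.-1) =
  invmx (frobmx p Theta) *m (frobmx (p ^ N.+1) Theta *m Q *m invmx (frobmx (p ^ N) Theta))
    *m frobmx p Theta.
Proof.
by case: N => // N _; rewrite frobWK_inv frobWK /= !mulmxA.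
Qed.

(** With the twist of [A] in the middle the sandwich collapses to the identity. Subtracting 1
    therefore replaces [Aj] by [Aj - A^(q)], which is small for the perturbed Frobenius. *)
Lemma SWE Aj N : (0 < N)%N ->
  SW Aj N = invmx (frobmx p (WK N)) *m (Aj - frobmx (p ^ N) A) *m frobmx p (WK N.-1).
Proof.
move=> N0; rewrite mulmxBr mulmxBl /SW; congr (_ - _).
rewrite sandwich_W // frob_sol mulmxV //.
have u2 := fT_unit 1; rewrite expn1 in u2.
by rewrite mulmx1 mulVmx.
Qed.

End WMatrix.

Lemma WK_map (F F' : fieldType) (f : {rmorphism F -> F'}) n p (A : 'M[F]_n) e :
  map_mx f (WK p A e) = WK p (map_mx f A) e.
Proof. by elim: e => [|e IH] /=; rewrite ?map_mx1 // map_mxM IH map_frobmx. Qed.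

Lemma SW_map (F F' : fieldType) (f : {rmorphism F -> F'}) n p (A Aj : 'M[F]_n) N :
  map_mx f (SW p A Aj N) = SW p (map_mx f A) (map_mx f Aj) N.
Proof.
by rewrite /SW map_mxB !map_mxM map_invmx !map_frobmx !WK_map map_mx1.
Qed.

Section Comparison.
Variables (p : nat) (k K : fieldType) (embk : {rmorphism k -> K}).
Variables (v : K -> rat) (t : K).
Hypothesis HK : laurent_field p embk v t.
Variables (L : splittingFieldType K) (w : L -> rat).
Hypothesis HL : totram_galois v w.
Variables (n : nat) (A : 'M[K]_n) (Theta : 'M[L]_n).
Hypotheses (A_UT : UT A) (T_UT : UT Theta).
Hypothesis T_sol : frobmx p Theta *m map_mx (in_alg L) A = Theta.
Variables (D : L -> L) (HD : alg_derivation (dK embk v t) D).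
Variables (N R : nat) (jm : {rmorphism K -> K}) (z lam : K).
Hypotheses (N_gt0 : (0 < N)%N) (Hj : jmap_spec p embk v t N R jm z lam).

Let Hv := lf_val HK.
Let Hw := tg_val HL.
Let pp := lf_prime HK.
Let chK := pcharK HK.
Let chL := pcharL HK L.
Let q := (p ^ N)%N.
Let pe e : (0 < p ^ e)%N. Proof. by rewrite expn_gt0 prime_gt0. Qed.
Local Notation AL := (map_mx (in_alg L) A).
Local Notation d := (dK embk v t).
Local Notation dAK := (map_mx d A).
Local Notation Tp := (frobmx p Theta).

(** The matrix [SR] pulled back to [K] along iota, which sends [WK] to [Wmx] and the image of [A]
    under [jm] to [A] itself (see [SRE]). *)
Definition SK : 'M[K]_n := SW p A (map_mx jm A) N.
Let W := frobmx p (WK p A N).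
Let W' := frobmx p (WK p A N.-1).

Lemma SK_low (a b : 'I_n) : (b <= a)%N -> SK a b = 0.
Proof.
move=> ba; have [W1 W2] : UT W /\ UT W'.
  by split; apply: frobmx_UT; rewrite ?prime_gt0 //; apply: (WK_UT chK).
have [s0 s1] : UT (invmx W *m map_mx jm A *m W').
  by apply: UT_mul => //; apply: UT_mul; [apply: UT_inv|apply: UT_map].
rewrite mxE [X in _ + X]mxE [X in _ - X]mxE -/W -/W'.
move: ba; rewrite leq_eqVlt => /orP[/eqP/val_inj->|ba]; first by rewrite s1 eqxx subrr.
by rewrite s0 // -val_eqE gtn_eqF //= oppr0 addr0.
Qed.

Lemma dmx_frob (X Y : 'M[K]_n) : map_mx d (frobmx p X *m Y) = frobmx p X *m map_mx d Y.
Proof.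
apply/matrixP => a b; rewrite !mxE (dK_sum HK); apply: eq_bigr => c _.
by rewrite !mxE (dKM HK) (dKXp HK) mul0r add0r.
Qed.

Lemma dmx_frobr (X Y : 'M[K]_n) : map_mx d (Y *m frobmx p X) = map_mx d Y *m frobmx p X.
Proof.
apply/matrixP => a b; rewrite !mxE (dK_sum HK); apply: eq_bigr => c _.
by rewrite !mxE (dKM HK) (dKXp HK) mulr0 addr0.
Qed.

(** The outer factors are [p]-th powers, constants for [d]; only the middle is differentiated, by
    the rule [d j = lam j d]. *)
Lemma dSK : map_mx d SK = lam *: (invmx W *m map_mx jm dAK *m W').
Proof.
have -> : map_mx d SK = map_mx d (invmx W *m map_mx jm A *m W').
  apply/matrixP => a b; rewrite /SK /SW mxE [in LHS]mxE [X in _ + X]mxE [X in d (_ - X)]mxE.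
  rewrite -/W -/W' (dKB HK) [RHS]mxE.
  by case: eqP => _; rewrite ?(dK1 HK) ?(dK0 HK) subr0.
rewrite dmx_frobr /W -(frobmxVp chK) dmx_frob scalemxAl scalemxAr.
congr (_ *m _ *m _).
by apply/matrixP => a b; rewrite !mxE (jm_d Hj).
Qed.

Lemma alg_vge x r : vge w (x%:A : L) r -> vge v x r.
Proof.
have [->|x0] := eqVneq x 0; first by left.
have xL : (x%:A : L) != 0 by rewrite alg_eq0.
by move/(vgeE xL) => h; right; rewrite -(tg_ext HL).
Qed.

(** The projection is linear over [p]-th powers, so it passes through the outer factors to the
    entries of [j A - A^(q)], where [jm_pr0] gains [p R]. The outer factors, expressed through
    Theta, cost at most [q] times the weights. *)
Lemma pr0_SK (i j : 'I_n) (mu : 'I_n -> 'I_n -> rat) : superadd i j mu ->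
  (forall a b : 'I_n, (i <= a)%N -> (a < b)%N -> (b <= j)%N -> vge v (A a b) (- mu a b)) ->
  (i <= j)%N -> vge v (pr0 p embk v t (SK i j)) ((p * R)%:R - q%:R * mu i j).
Proof.
move=> mu_sup A_bnd ij; have [m0 mge msup] := mu_sup.
have q0 : 0 <= q%:R :> rat by rewrite ler0n.
have Tb (a b : 'I_n) : (i <= a)%N -> (a <= b)%N -> (b <= j)%N -> vge w (Theta a b) (- (mu a b / p%:R)).
  exact: (Theta_bnd HK HL A_UT T_UT T_sol mu_sup A_bnd).
pose nu a b := mu a b * q%:R.
have nu_sup : superadd i j nu := superadd_scale q0 mu_sup.
have gQ := bndQ_graded Hw nu_sup.
have Te e : (e <= N)%N -> mxgr (bndQ w i j nu) (frobmx (p ^ e.+1) Theta).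
  move=> eN a b ab ia bj; rewrite mxE.
  apply: vge_le (vgeX Hw _ (Tb _ _ ia ab bj)).
  have -> : (p ^ e.+1)%:R * - (mu a b / p%:R) = - (mu a b * (p ^ e)%:R) :> rat.
    by rewrite expnS natrM; field; rewrite pnatr_eq0 -lt0n prime_gt0.
  by rewrite lerN2 /nu ler_wpM2l ?mge // ler_nat leq_pexp2l ?prime_gt0.
have Te_UT e : UT (frobmx (p ^ e) Theta) by apply: frobmx_UT.
have g1 : mxgr (bndQ w i j nu) (map_mx (in_alg L) (invmx W)).
  rewrite map_invmx map_frobmx WK_map (frobWK_inv chL T_UT T_sol).
  have [t0 _] := Te_UT N.+1; have [u0 _] := UT_inv (Te_UT 1); rewrite expn1 in u0.
  apply: mxgr_mul => //; last exact: Te.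
  apply: mxgr_inv => //; first by rewrite -[X in frobmx X]expn1.
  by have := Te 0%N isT; rewrite expn1.
have g2 : mxgr (bndQ w i j nu) (map_mx (in_alg L) W').
  rewrite map_frobmx WK_map (frobWK chL T_UT T_sol) prednK //.
  have [t0 _] := UT_inv (Te_UT N); have [u0 _] := Te_UT 1%N; rewrite expn1 in u0.
  apply: mxgr_mul => //; last by have := Te 0%N isT; rewrite expn1.
  apply: mxgr_inv => //; have := Te N.-1; rewrite prednK // => h; apply: h; exact: leq_pred.
rewrite /SK; have -> : SW p A (map_mx jm A) N = invmx W *m (map_mx jm A - frobmx q A) *m W'.
  apply: (map_mx_inj (f := in_alg L)).
  rewrite SW_map (SWE chL T_UT T_sol) //.
  by rewrite !map_mxM map_invmx !map_frobmx !WK_map map_mxB map_frobmx.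
rewrite mxE (pr0_sum HK); apply: vge_sum => // b _.
rewrite mxE mulr_suml (pr0_sum HK); apply: vge_sum => // a _.
have [[w0 w1] [w0' w1']] : UT (invmx W) /\ UT W'.
  split; [apply: UT_inv|]; apply: frobmx_UT; rewrite ?prime_gt0 //; exact: (WK_UT chK).
set x := (map_mx jm A - frobmx q A) a b.
have -> : pr0 p embk v t (invmx W i a * x * W' b j) =
    invmx W i a * (pr0 p embk v t x * W' b j).
  have -> : invmx W i a = invmx (WK p A N) i a ^+ p by rewrite /W -(frobmxVp chK) mxE.
  rewrite [W' b j]mxE mulrAC -exprMn (pr0_Xp HK) exprMn; ring.
have [ai|ia] := ltnP a i; first by rewrite w0 // mul0r.
have [jb|bj] := ltnP j b; first by rewrite w0' // !mulr0.
have x_low : (b <= a)%N -> x = 0.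
  move=> ba; rewrite /x !mxE; case: A_UT => a0 a1.
  move: ba; rewrite leq_eqVlt => /orP[/eqP/val_inj->|ba].
    by rewrite a1 rmorph1 expr1n subrr.
  by rewrite a0 // rmorph0 expr0n gtn_eqF ?pe // subrr.
have [ba|ab] := leqP b a.
  rewrite x_low // /pr0; have -> : iter p.-1 (dK embk v t) 0 = 0.
    by elim: p.-1 => //= m ->; rewrite (dK0 HK).
  by rewrite subrr mul0r mulr0.
have h := jm_pr0 Hj (A_bnd _ _ ia ab bj).
have hx : vge v (pr0 p embk v t x) (q%:R * - mu a b + (p * R)%:R) by rewrite /x !mxE.
have hW : vge v (invmx W i a) (- nu i a).
  by have := g1 i a ia (leqnn _) (leq_trans (ltnW ab) bj); rewrite mxE => /alg_vge.
have hW' : vge v (W' b j) (- nu b j).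
  by have := g2 b j bj (leq_trans ia (ltnW ab)) (leqnn _); rewrite mxE => /alg_vge.
apply: vge_le (vgeM Hv hW (vgeM Hv hx hW')).
have h1 := msup i a b (leqnn _) ia (ltnW ab) bj.
have h2 := msup i b j (leqnn _) (leq_trans ia (ltnW ab)) bj (leqnn _).
have h3 : q%:R * (mu i a + mu a b + mu b j) <= q%:R * mu i j.
  by rewrite ler_wpM2l //; apply: le_trans h2; rewrite lerD2r.
rewrite /nu; move: h3; rewrite !mulrDr [mu i a * _]mulrC [mu b j * _]mulrC mulrN => h3.
have -> : forall u1 u2 u3 u4 : rat, - u1 + (- u2 + u4 - u3) = u4 - (u1 + u2 + u3) by move=> *; ring.
by rewrite lerD2l lerN2.
Qed.

End Comparison.

(** * Comparison of S with Omega below the corner *)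

Lemma invmx_mul (F : fieldType) n (X Y : 'M[F]_n) : X \in unitmx -> Y \in unitmx ->
  invmx (X *m Y) = invmx Y *m invmx X.
Proof.
move=> uX uY; have uXY : X *m Y \in unitmx by rewrite unitmx_mul uX.
have E : X *m Y *m (invmx Y *m invmx X) = 1%:M.
  by rewrite mulmxA mulmxK // mulmxV.
by rewrite -[RHS](mulKmx uXY) E mulmx1.
Qed.

Fact gap_arith (q R rho dc ji mA : rat) : 0 <= mA -> dc <= ji -> q * rho + ji * mA < R ->
  0 < R - q * rho - dc * mA.
Proof. by move=> m0 le h; nra. Qed.

Fact gap_arith2 (q R rho x y z dc mA : rat) : x + y + z = dc ->
  - (x * mA) + (R - q * rho - y * mA) + - (z * mA) = R - q * rho - dc * mA.
Proof. by move=> <-; ring. Qed.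

Fact gap_arith3 (q rho x y z mA : rat) :
  0 <= mA -> 0 <= y -> - (q * rho) - (x + y + z) * mA <= - (x * mA) + q * - rho + - (z * mA).
Proof. by move=> m0 y0; nra. Qed.

Fact gap_arith4 (q R rho dc mA p : rat) : 0 <= mA -> 0 <= dc -> 0 < R - q * rho -> 1 <= p ->
  R - q * rho - dc * mA <= p * R - q * (p * rho).
Proof. by move=> m0 y0; nra. Qed.

Definition lmu n (mA : rat) (a b : 'I_n) : rat := (b - a)%:R * mA.

Lemma lmu_sup n (mA : rat) (lo hi : nat) : 0 <= mA -> superadd lo hi (@lmu n mA).
Proof.
move=> mA_ge0; split=> [a|a b _ _ _|a c b _ ac cb _]; rewrite /lmu ?subnn ?mul0r //.
  by rewrite mulr_ge0.
by rewrite -mulrDl -natrD ler_wpM2r // ler_nat; lia.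
Qed.

Section ComparisonX.
Variables (p : nat) (k K : fieldType) (embk : {rmorphism k -> K}).
Variables (v : K -> rat) (t : K).
Hypothesis HK : laurent_field p embk v t.
Variables (L : splittingFieldType K) (w : L -> rat).
Hypothesis HL : totram_galois v w.
Variables (n : nat) (A : 'M[K]_n) (Theta : 'M[L]_n).
Hypotheses (A_UT : UT A) (T_UT : UT Theta).
Hypothesis T_sol : frobmx p Theta *m map_mx (in_alg L) A = Theta.
Variables (D : L -> L) (HD : alg_derivation (dK embk v t) D).
Variables (N R : nat) (jm : {rmorphism K -> K}) (z lam : K).
Hypotheses (N_gt0 : (0 < N)%N) (Hj : jmap_spec p embk v t N R jm z lam).
Variables (Om : fieldType) (emb0 : {rmorphism K -> Om}) (vO : Om -> rat).
Hypotheses (vO_val : is_valuation vO).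
Hypothesis vO_ext : forall a : K, a != 0 -> vO (emb0 a) = v a.
Variables Phi J : {rmorphism L -> Om}.
Hypotheses (PhiK : forall a : K, Phi a%:A = emb0 a) (JK : forall a : K, J a%:A = emb0 (jm a)).
Hypothesis Phi_val : forall x, x != 0 -> vO (Phi x) = w x.
Hypothesis J_val : forall x, x != 0 -> vO (J x) = (p ^ N)%:R * w x.

Let Hv := lf_val HK.
Let Hw := tg_val HL.
Let pp := lf_prime HK.
Let chO : p \in [pchar Om]. Proof. exact: (rmorph_pchar emb0 (pcharK HK)). Qed.
Let q := (p ^ N)%N.
Let pe e : (0 < p ^ e)%N. Proof. by rewrite expn_gt0 prime_gt0. Qed.
Local Notation d := (dK embk v t).
Local Notation Ome := (Omega Theta D).
Local Notation S := (SK p A N jm).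

Let T0 := map_mx Phi Theta.
Let JT := map_mx J Theta.
Let Aj := map_mx emb0 (map_mx jm A).
Let Tp0 := frobmx p T0.
(** Measures how far [J] is from the [q]-Frobenius on Theta; it would be the identity if they
    agreed. *)
Definition XO : 'M[Om]_n := JT *m invmx (frobmx q T0).
Let X := XO.
(** The conjugate of [S] for which [XB] holds: [X] solves a matrix Artin-Schreier equation with
    coefficients [1 + B]. *)
Definition BO : 'M[Om]_n := Tp0 *m map_mx emb0 S *m invmx Tp0.
Let B := BO.

Let T0_UT : UT T0. Proof. exact: UT_map. Qed.
Let JT_UT : UT JT. Proof. exact: UT_map. Qed.
Let T0e_UT e : UT (frobmx (p ^ e) T0). Proof. exact: frobmx_UT. Qed.
Let Tp0_UT : UT Tp0. Proof. by have := T0e_UT 1; rewrite expn1. Qed.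
Let X_UT : UT X. Proof. by apply: UT_mul => //; apply: UT_inv; apply: T0e_UT. Qed.
Let Xp_UT : UT (frobmx p X). Proof. by apply: frobmx_UT => //; apply: prime_gt0. Qed.

Lemma T0_sol : frobmx p T0 *m map_mx emb0 A = T0.
Proof.
rewrite -{2}/(map_mx Phi Theta) /T0 -{2}T_sol map_mxM map_frobmx; congr (_ *m _).
by apply/matrixP => a b; rewrite !mxE PhiK.
Qed.

Lemma JT_sol : frobmx p JT *m Aj = JT.
Proof.
rewrite /JT -{2}T_sol map_mxM map_frobmx; congr (_ *m _).
by apply/matrixP => a b; rewrite !mxE JK.
Qed.

Lemma frobX : frobmx p X = frobmx p JT *m invmx (frobmx (p ^ N.+1) T0).
Proof. by rewrite (frobmxMp chO) (frobmxVp chO) frobmx_comp -expnSr. Qed.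

Lemma BOE : 1%:M + B = frobmx (p ^ N.+1) T0 *m Aj *m invmx (frobmx q T0).
Proof.
have uT := UT_unit Tp0_UT.
have E : map_mx emb0 S = invmx Tp0 *m
    (frobmx (p ^ N.+1) T0 *m Aj *m invmx (frobmx q T0)) *m Tp0 - 1%:M.
  by rewrite /SK SW_map /SW (sandwich_W chO T0_UT T0_sol).
rewrite /B /BO E mulmxBr mulmxBl mulmx1 mulmxV // [1%:M + _]addrC subrK.
by rewrite !mulmxA mulmxV // mul1mx mulmxK.
Qed.

Lemma XB : frobmx p X *m (1%:M + B) = X.
Proof.
rewrite BOE frobX !mulmxA mulmxKV; last exact: UT_unit.
by rewrite JT_sol.
Qed.

(** Inserts into [dSK] the image under [J] of [dA = (Theta^(p))^-1 Omega Theta]. Writing [J Theta]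
    as [X Theta^(q)] cancels the high powers of Theta hidden in [W]. *)
Lemma dS_O : map_mx emb0 (map_mx d S) =
  emb0 lam *: (invmx (frobmx p X *m Tp0) *m map_mx J Ome *m (X *m Tp0)).
Proof.
rewrite (dSK HK A (lam := lam) (R := R) (N := N) (z := z)) //.
have EQ : map_mx emb0 (map_mx jm (map_mx d A)) =
    invmx (frobmx p JT) *m map_mx J Ome *m JT.
  have := congr1 (map_mx J) (dAE HK T_UT T_sol HD); rewrite !map_mxM map_invmx map_frobmx => <-.
  by apply/matrixP => a b; rewrite !mxE JK.
rewrite map_mxZ; congr (_ *: _); move: EQ; move: (map_mx J Ome) => O EQ.
rewrite !map_mxM map_invmx !map_frobmx !WK_map EQ (sandwich_W chO T0_UT T0_sol) //.
have uJ : frobmx p JT \in unitmx by apply: UT_unit; apply: frobmx_UT; rewrite ?prime_gt0.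
have uT := UT_unit Tp0_UT; have uX := UT_unit Xp_UT; have uTe := UT_unit (T0e_UT N.+1).
rewrite invmx_mul // frobX invmx_mul ?unitmx_inv // invmxK /X /XO.
by rewrite !mulmxA.
Qed.

Lemma vge_Phi x r : vge w x r -> vge vO (Phi x) r.
Proof.
have [->|x0] := eqVneq x 0; first by rewrite rmorph0; left.
by move/(vgeE x0) => h; right; rewrite Phi_val.
Qed.

Lemma vge_J x r : vge w x r -> vge vO (J x) (q%:R * r).
Proof.
have [->|x0] := eqVneq x 0; first by rewrite rmorph0; left.
by move/(vgeE x0) => h; right; rewrite J_val // ler_wpM2l.
Qed.

Lemma vge_emb0 x r : vge v x r -> vge vO (emb0 x) r.
Proof.
have [->|x0] := eqVneq x 0; first by rewrite rmorph0; left.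
by move/(vgeE x0) => h; right; rewrite vO_ext.
Qed.

Lemma emb0_vge x r : vge vO (emb0 x) r -> vge v x r.
Proof.
have [->|x0] := eqVneq x 0; first by left.
have xL : emb0 x != 0 by rewrite fmorph_eq0.
by move/(vgeE xL) => h; right; rewrite -vO_ext.
Qed.

Section Block.
Variables (i j : 'I_n) (mA rho : rat).
Hypothesis mA_ge0 : 0 <= mA.
Hypothesis A_mA : forall a b : 'I_n, (i <= a)%N -> (a < b)%N -> (b <= j)%N ->
  vge v (A a b) (- ((b - a)%:R * mA)).
Hypothesis rho_ge0 : 0 <= rho.
Hypothesis Om_rho : forall a b : 'I_n, (i <= a)%N -> (a < b)%N -> (b <= j)%N ->
  (a, b) != (i, j) -> vge w (Ome a b) (- rho).
Hypothesis pr_low : forall a b : 'I_n, (i <= a)%N -> (a < b)%N -> (b <= j)%N ->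
  (a, b) != (i, j) -> vge v (pr0 p embk v t (S a b)) ((p * R)%:R - q%:R * (p%:R * rho)).
Hypothesis R_gap : q%:R * rho + (j - i)%:R * mA < R%:R.

Let mu := @lmu n mA.
Let lmu_sup lo hi : superadd lo hi mu := @lmu_sup n mA lo hi mA_ge0.

Let Tp_bnd : mxgr (bndQ w i j mu) (frobmx p Theta) :=
  Theta_p_gr HK HL A_UT T_UT T_sol (lmu_sup i j) A_mA.

Lemma Tp0_gr (lo hi : nat) : (i <= lo)%N -> (hi <= j)%N -> mxgr (bndQ vO lo hi mu) Tp0.
Proof.
move=> ilo hij a b ab la bh; have := vge_Phi (Tp_bnd ab (leq_trans ilo la) (leq_trans bh hij)).
by rewrite !mxE rmorphXn.
Qed.

Lemma Tp0_inv_gr (lo hi : nat) : (i <= lo)%N -> (hi <= j)%N ->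
  mxgr (bndQ vO lo hi mu) (invmx Tp0).
Proof. by move=> h1 h2; apply: mxgr_inv => //; [exact: bndQ_graded (lmu_sup _ _)|exact: Tp0_gr]. Qed.

Definition Xint (lo hi : nat) : Prop := forall a b : 'I_n, (lo <= a)%N -> (a <= b)%N -> (b <= hi)%N ->
  vge vO (X a b) 0.

Lemma XT_gr lo hi : (i <= lo)%N -> (hi <= j)%N -> Xint lo hi -> mxgr (bndQ vO lo hi mu) (X *m Tp0).
Proof.
move=> h1 h2 XI; have [x0 x1] := X_UT; have [t0 t1] := Tp0_UT.
have [_ mge _] := lmu_sup lo hi.
apply: mxgr_mul => //; [exact: bndQ_graded (lmu_sup _ _)| |exact: Tp0_gr].
by move=> a b ab la bh; apply: vge_le (XI _ _ la ab bh); rewrite oppr_le0 mge.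
Qed.

Lemma XpT_gr lo hi : (i <= lo)%N -> (hi <= j)%N -> Xint lo hi ->
  mxgr (bndQ vO lo hi mu) (invmx (frobmx p X *m Tp0)).
Proof.
move=> h1 h2 XI; have [x0 x1] := Xp_UT; have [t0 t1] := Tp0_UT.
have [_ mge _] := lmu_sup lo hi; have gQ := bndQ_graded vO_val (lmu_sup lo hi).
apply: mxgr_inv => //; first exact: UT_mul.
apply: mxgr_mul => //; last exact: Tp0_gr.
move=> a b ab la bh; apply: (@vge_le _ _ _ _ 0); first by rewrite oppr_le0 mge.
by rewrite mxE; apply: vgeX0 => //; apply: XI.
Qed.

(** All terms of the conjugation other than the corner contain a lower entry of Omega, at least
    [- q rho] after [J], and outer factors whose poles total at most [(e - c) mA]. These factors
    only meet [X] on the two maximal proper sub-blocks. *)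
Lemma dS_lead (c e : 'I_n) : (i <= c)%N -> (c < e)%N -> (e <= j)%N ->
  Xint c e.-1 -> Xint c.+1 e ->
  vge vO (emb0 (d (S c e)) - emb0 lam * J (Ome c e)) (R%:R - q%:R * rho - (e - c)%:R * mA).
Proof.
move=> ic ce ej X1 X2.
have -> : emb0 (d (S c e)) - emb0 lam * J (Ome c e) = emb0 lam *
   ((invmx (frobmx p X *m Tp0) *m map_mx J Ome *m (X *m Tp0)) c e - map_mx J Ome c e).
  have := congr1 (fun M : 'M_n => M c e) dS_O.
  rewrite mxE [X in emb0 X]mxE [X in _ = X -> _]mxE => ->.
  by rewrite [map_mx J _ c e]mxE mulrBr.
have -> : R%:R - q%:R * rho - (e - c)%:R * mA = R%:R + (- (q%:R * rho) - (e - c)%:R * mA).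
  by rewrite addrA.
apply: vgeM => //.
  by apply: vge_emb0; right; rewrite (jm_lam Hj).
apply: conj_lead_ge => //.
- by apply: UT_inv; apply: UT_mul.
- exact: UT_mul.
- by move=> a b ba; rewrite mxE (Omega_low HK A_UT T_UT T_sol HD) ?rmorph0.
move=> l l' cl ll' l'e ne.
have eE : (e - c = (l - c) + (l' - l) + (e - l'))%N by lia.
apply: (@vge_le _ _ _ _ (- mu c l + q%:R * - rho + - mu l' e)).
  by rewrite eE !natrD /mu /lmu; apply: gap_arith3.
apply: vgeM => //; last first.
  by apply: (@XT_gr c.+1 e) => //; [apply: leqW|apply: leq_ltn_trans cl ll'].
apply: vgeM => //.
  by apply: (@XpT_gr c e.-1) => //; lia.
rewrite mxE; apply: vge_J; apply: Om_rho => //; try lia.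
apply: contraNN ne; rewrite !xpair_eqE -!val_eqE /= => /andP[/eqP E1 /eqP E2].
by apply/andP; split; apply/eqP; lia.
Qed.

Lemma B_sum (c e : 'I_n) : (i <= c)%N -> (e <= j)%N ->
  (forall a b : 'I_n, (c <= a)%N -> (a < b)%N -> (b <= e)%N ->
     vge v (S a b) (R%:R - q%:R * rho - (b - a)%:R * mA)) ->
  vge vO (B c e) (R%:R - q%:R * rho - (e - c)%:R * mA).
Proof.
move=> ic ej SI.
have {1}-> : B c e = \sum_b \sum_a Tp0 c a * emb0 (S a b) * invmx Tp0 b e.
  rewrite /B /BO mxE; apply: eq_bigr => b _; rewrite mxE mulr_suml.
  by apply: eq_bigr => a _; rewrite [map_mx emb0 _ _ _]mxE.
have [t0 t1] := Tp0_UT; have [u0 u1] := UT_inv Tp0_UT.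
apply: vge_sum => // b _; apply: vge_sum => // a _.
have [ac|ca] := ltnP a c; first by rewrite t0 // !mul0r; left.
have [ba|ab] := leqP b a; first by rewrite (SK_low HK A_UT) // rmorph0 mulr0 mul0r; left.
have [eb|be] := ltnP e b; first by rewrite u0 // mulr0; left.
rewrite -(@gap_arith2 _ _ _ (a - c)%:R (b - a)%:R (e - b)%:R); last first.
  by rewrite -!natrD; congr (_%:R); lia.
apply: vgeM => //; last by apply: (@Tp0_inv_gr c e) => //; lia.
apply: vgeM => //; first by apply: (@Tp0_gr c e) => //; lia.
by apply: vge_emb0; apply: SI.
Qed.

Lemma X_rec (c e : 'I_n) : X c e - X c e ^+ p = \sum_(l : 'I_n | (c <= l < e)%N) X c l ^+ p * B l e.
Proof.
have B_low (a b : 'I_n) : (b <= a)%N -> B a b = 0.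
  move=> ba; apply: sandwich_low => //; first exact: UT_inv.
  by move=> x y yx; rewrite mxE (SK_low HK A_UT) // rmorph0.
have E : X = frobmx p X + frobmx p X *m B by rewrite -{1}XB mulmxDr mulmx1.
have -> : X c e - X c e ^+ p = (frobmx p X *m B) c e.
  by rewrite {1}E mxE [frobmx p X c e]mxE [_ + (_ c e)]addrC addrK.
rewrite mxE [RHS]big_mkcond; apply: eq_bigr => l _; rewrite mxE.
have [lc|cl] := ltnP l c.
  by case: X_UT => x0 _; rewrite x0 //= expr0n gtn_eqF ?prime_gt0 // mul0r.
by have [//|el] := ltnP l e; rewrite B_low ?mulr0.
Qed.

(** Induction on [e - c]: [pr_low] and [dS_lead] bound [S], conjugation bounds [B], and [X c e] is
    integral since [x - x ^+ p] is, by [X_rec]. Positivity of the bound is [R_gap]. *)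
Lemma low_bounds (c e : 'I_n) : (i <= c)%N -> (c <= e)%N -> (e <= j)%N -> (c, e) != (i, j) ->
  [/\ vge vO (X c e) 0, vge vO (B c e) (R%:R - q%:R * rho - (e - c)%:R * mA) &
      vge v (S c e) (R%:R - q%:R * rho - (e - c)%:R * mA)].
Proof.
have [g] := ubnP (e - c); elim: g c e => // g IH c e ceg ic ce ej ne.
have p1 : 1 <= p%:R :> rat by rewrite ler1n prime_gt0.
have cej : ((e - c)%:R <= (j - i)%:R :> rat) by rewrite ler_nat leq_sub_chain.
have Rq : 0 < R%:R - q%:R * rho.
  by have := @gap_arith q%:R R%:R rho 0 (j - i)%:R mA mA_ge0 (ler0n _ _) R_gap; rewrite mul0r subr0.
move: ce; rewrite leq_eqVlt => /orP[/eqP/val_inj E|ce].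
  subst e; case: X_UT => _ x1; rewrite x1 (SK_low HK A_UT) //.
  split; [by right; rewrite val1| |by left].
  apply: B_sum => // a b ca ab bc.
  by have := leq_trans (leq_ltn_trans ca ab) bc; rewrite ltnn.
have rec (a b : 'I_n) : (c <= a)%N -> (a <= b)%N -> (b <= e)%N -> (a, b) != (c, e) ->
    [/\ vge vO (X a b) 0, vge vO (B a b) (R%:R - q%:R * rho - (b - a)%:R * mA) &
      vge v (S a b) (R%:R - q%:R * rho - (b - a)%:R * mA)].
  move=> ca ab be ne'; apply: IH => //; last exact: sub_ne ic ej ne ca be.
  - exact: leq_trans (sub_lt ca ab be ne') ceg.
  - exact: leq_trans ca.
  - exact: leq_trans ej.
have X1 : Xint c e.-1.
  move=> a b ca ab be; have be' := pred_lt (leq_ltn_trans (leq0n _) ce) be.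
  have ne' : (a, b) != (c, e) by rewrite xpair_eqE -!val_eqE /= (ltn_eqF be') andbF.
  by have [] := rec a b ca ab (ltnW be') ne'.
have X2 : Xint c.+1 e.
  move=> a b ca ab be.
  have ne' : (a, b) != (c, e) by rewrite xpair_eqE -!val_eqE /= (gtn_eqF ca).
  by have [] := rec a b (ltnW ca) ab be ne'.
have Sce : vge v (S c e) (R%:R - q%:R * rho - (e - c)%:R * mA).
  apply: (vge_pr0_dK HK).
    apply: vge_le (pr_low ic ce ej ne); rewrite natrM; exact: gap_arith4.
  apply: emb0_vge; rewrite -[emb0 _](subrK (emb0 lam * J (Ome c e))).
  apply: vgeD => //; first exact: dS_lead.
  apply: (@vge_le _ _ _ _ (R%:R + q%:R * - rho)).
    by rewrite mulrN lerBlDr lerDl mulr_ge0.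
  apply: vgeM => //; first by apply: vge_emb0; right; rewrite (jm_lam Hj).
  by apply: vge_J; apply: Om_rho.
have Bl (l : 'I_n) : (c <= l)%N -> (l < e)%N ->
    vge vO (B l e) (R%:R - q%:R * rho - (e - l)%:R * mA).
  move=> cl le; move: (cl); rewrite leq_eqVlt => /orP[/eqP/val_inj E|lt].
    rewrite -E; apply: B_sum => // a b ca ab be.
    have [E'|ne'] := eqVneq (a, b) (c, e); first by case: E' => -> ->.
    by have [] := rec a b ca (ltnW ab) be ne'.
  by have [] := rec l e cl (ltnW le) (leqnn _) (ne_right _ lt).
split=> //; last exact: Bl.
apply: (@wp_bound0 _ _ vO_val _ p); first exact: prime_gt1.
rewrite X_rec; apply: vge_sum => // l /andP[cl le].
apply: vgeZl => //.
  by apply: vgeX0 => //; have [] := rec c l (leqnn _) cl (ltnW le) (ne_left _ le).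
apply: vge_le (Bl l cl le); apply: ltW.
by apply: gap_arith R_gap => //; rewrite ler_nat leq_sub_chain // (leq_trans ic).
Qed.

End Block.
End ComparisonX.

(** * Extensions close to the Frobenius *)

Section ArtinSchreier.
Variables (p : nat) (F : fieldType) (w : F -> rat) (S : F -> Prop).
Hypotheses (chp : p \in [pchar F]) (Hw : is_valuation w).
Hypotheses (S_sub : is_subfield S) (S_complete : v_complete w S).

(* The solution is the series b + b^p + b^(p^2) + ... *)
Lemma AS_solve b : S b -> vgt w b 0 -> exists2 l, S l & l - l ^+ p = b.
Proof.
move=> Sb [->|b0].
  by exists 0; [case: S_sub|rewrite expr0n gtn_eqF ?subr0 // prime_gt0 ?(pcharf_prime chp)].
have pp := pcharf_prime chp.
have large (M : rat) : exists n : nat, M <= n%:R * w b.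
  exists `|(Num.floor (M / w b) + 1)%R|%N; rewrite -ler_pdivrMr //.
  apply: le_trans (ltW (floorD1_gt _)) _.
  by rewrite -[X in _ <= X]/((Posz _)%:~R); rewrite ler_int; apply: lez_abs.
pose u m := \sum_(i < m) b ^+ (p ^ i).
have term i : vge w (b ^+ (p ^ i)) (i%:R * w b).
  apply: vge_le (vgeX Hw (p ^ i) (vge_val w b)).
  by rewrite ler_pM2r // ler_nat ltnW // ltn_expl // prime_gt1.
have uu a c : (a <= c)%N -> vge w (u a - u c) (a%:R * w b).
  move=> ac; rewrite -opprB; apply: vgeN => //; rewrite -(subnKC ac) /u big_split_ord /=.
  rewrite [_ + \sum_(_ < _) _]addrC addrK; apply: vge_sum => // i _.
  by apply: vge_le (term _); rewrite ler_pM2r // ler_nat leq_addr.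
have [||l [Sl lP]] := S_complete (u := u).
- move=> m; apply: (big_ind S); first by case: S_sub.
    by move=> x y; apply: (subD S_sub).
  by move=> i _; apply: (subX S_sub).
- move=> M; have [N0 hN] := large M; exists N0 => a c na nc.
  wlog ac : a c na nc / (a <= c)%N => [H|].
    have [|/ltnW ca] := leqP a c; first exact: H.
    by rewrite -opprB; apply: vgeN => //; apply: H.
  apply: vge_le (uu _ _ ac); apply: le_trans hN _; by rewrite ler_pM2r // ler_nat.
exists l => //; apply/eqP; rewrite -subr_eq0; apply/eqP; apply: (vge_all_eq0 (v := w)) => // M.
pose M' := Num.max M 0.
have M'M : M <= M' by rewrite le_max lexx.
have M'0 : 0 <= M' by rewrite le_max lexx orbT.
apply: (vge_le M'M); have [N0 hN] := large M'; have [N1 hN1] := lP M'.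
pose m := maxn N0 N1; have h1 := hN1 m (leq_maxr _ _).
have uE : u m - u m ^+ p = b - b ^+ (p ^ m).
  elim: m {h1} => [|m IH].
    by rewrite /u big_ord0 expr0n gtn_eqF ?prime_gt0 // expn0 expr1 !subrr.
  have -> : u m.+1 = u m + b ^+ (p ^ m) by rewrite /u big_ord_recr.
  have pD x y : (x + y) ^+ p = x ^+ p + y ^+ p :> F.
    by have := @exprpD p F chp 1 x y; rewrite expn1.
  rewrite pD -exprM -expnSr.
  have -> : u m + b ^+ (p ^ m) - (u m ^+ p + b ^+ (p ^ m.+1)) =
    (u m - u m ^+ p) + b ^+ (p ^ m) - b ^+ (p ^ m.+1) by ring.
  by rewrite IH subrK.
have -> : l - l ^+ p - b = - (u m - l) + (u m - l) ^+ p - b ^+ (p ^ m).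
  have -> : (u m - l) ^+ p = u m ^+ p - l ^+ p.
    by have := @exprpB p F chp 1 (u m) l; rewrite expn1.
  have -> : l - l ^+ p - b = - (u m - l) + (u m ^+ p - l ^+ p) + ((u m - u m ^+ p) - b) by ring.
  by rewrite uE; ring.
apply: vgeB => //; last first.
  apply: vge_le (term m); apply: le_trans hN _; by rewrite ler_pM2r // ler_nat leq_maxl.
apply: vgeD => //; first exact: vgeN.
apply: vge_le (vgeX Hw p h1); rewrite ler_peMl // ler1n prime_gt0 //.
Qed.

End ArtinSchreier.

Lemma adjoin_seq_ind (K : fieldType) (L : splittingFieldType K) (Z : L -> Prop) (s : seq L) :
  (forall a : K, Z a%:A) -> (forall x y, Z x -> Z y -> Z (x + y)) ->
  (forall x y, Z x -> Z y -> Z (x * y)) -> (forall x, x \in s -> Z x) ->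
  forall x, x \in <<1%AS & s>>%VS -> Z x.
Proof.
move=> ZK ZD ZM; elim/last_ind: s => [|s y IH] Zs x.
  by rewrite Fadjoin_nil => /vlineP [a ->].
rewrite adjoin_rcons => /Fadjoin_polyP [P /polyOverP PK ->].
have {}IH : forall x, x \in <<1%AS & s>>%VS -> Z x.
  by apply: IH => u us; apply: Zs; rewrite mem_rcons inE us orbT.
have Zy : Z y by apply: Zs; rewrite mem_rcons inE eqxx.
rewrite horner_coef; apply: (big_ind Z) => //; first by have := ZK 0; rewrite scale0r.
move=> i _; apply: (ZM); first by apply: IH; apply: PK.
elim: (i : nat) => [|m IHm]; first by have := ZK 1; rewrite scale1r expr0.
by rewrite exprS; apply: ZM.
Qed.

Fact closest_arith (R q S c e dl : rat) : R + q <= c + S -> S = q * dl + q - q * e ->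
  R - q * dl + q * e <= c.
Proof. lra. Qed.

Fact closest_arith2 (q a i wp C R : rat) : C <= R ->
  q * (a + i * wp) + C <= q * a + R + i * (q * wp).
Proof. lra. Qed.

Section Closest.
Variables (p : nat) (k K : fieldType) (embk : {rmorphism k -> K}).
Variables (v : K -> rat) (t : K).
Hypothesis HK : laurent_field p embk v t.
Variables (L : splittingFieldType K) (w : L -> rat).
Hypothesis HL : totram_galois v w.
Hypothesis dim_p : p.-nat (\dim {:L}).
Variables (D : L -> L) (HD : alg_derivation (dK embk v t) D).
Variables (N R : nat) (jm : {rmorphism K -> K}) (z lam : K).
Hypothesis Hj : jmap_spec p embk v t N R jm z lam.
Variables (Om : fieldType) (emb0 : {rmorphism K -> Om}) (vO : Om -> rat).
Hypotheses (vO_val : is_valuation vO).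
Hypothesis vO_ext : forall a : K, a != 0 -> vO (emb0 a) = v a.
Variables Phi : {rmorphism L -> Om}.
Hypothesis PhiK : forall a : K, Phi a%:A = emb0 a.
Hypothesis Phi_val : forall x, x != 0 -> vO (Phi x) = w x.

Let Hv := lf_val HK.
Let Hw := tg_val HL.
Let pp := lf_prime HK.
Let chO : p \in [pchar Om]. Proof. exact: (rmorph_pchar emb0 (pcharK HK)). Qed.
Let q := (p ^ N)%N.
Let q_gt0 : 0 < q%:R :> rat. Proof. by rewrite ltr0n expn_gt0 prime_gt0. Qed.

Definition over_j (J : L -> Om) : Prop :=
  (forall a : K, J a%:A = emb0 (jm a)) /\ (forall x, x != 0 -> vO (J x) = q%:R * w x).

Lemma vge_emb x r : vge v x r -> vge vO (emb0 x) r.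
Proof.
have [->|x0] := eqVneq x 0; first by rewrite rmorph0; left.
by move/(vgeE x0) => h; right; rewrite vO_ext.
Qed.

(** Differentiate the minimal equation of [x] and its transform under [jm], which [y] satisfies. The
    coefficients differ by the factor [lam], and separability lets the common derivative of the
    polynomial be cancelled. *)
Lemma deriv_over_j (J : {rmorphism L -> Om}) x y : over_j J -> Phi y = J x ->
  Phi (D y) = emb0 lam * J (D x).
Proof.
move=> [JK _] yx; have [Q [_ Q0 _ Qd]] := minpolK HL x.
pose QL := map_poly (in_alg L) Q; pose Qj := map_poly (in_alg L) (map_poly jm Q).
have PhiQ (P : {poly K}) : (map_poly Phi (map_poly (in_alg L) (map_poly jm P))) =
    map_poly J (map_poly (in_alg L) P).
  by apply/polyP => i; rewrite !coef_map /= PhiK JK.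
have Qj0 : Qj.[y] = 0.
  apply: (fmorph_inj Phi); rewrite rmorph0 -horner_map yx PhiQ horner_map Q0 rmorph0.
  by [].
have e1 := D_horner HK HD QL x; rewrite Q0 (D0 HD) in e1.
have e2 := D_horner HK HD Qj y; rewrite Qj0 (D0 HD) in e2.
have sz : size Qj = size QL by rewrite !size_map_poly.
have := congr1 Phi e2; have := congr1 J e1; rewrite !rmorph0 !rmorphD !rmorphM.
have -> : Phi Qj^`().[y] = J QL^`().[x].
  by rewrite -!horner_map -!deriv_map PhiQ yx.
have -> : Phi (\sum_(i < size Qj) D Qj`_i * y ^+ i) =
    emb0 lam * J (\sum_(i < size QL) D QL`_i * x ^+ i).
  rewrite !rmorph_sum mulr_sumr sz; apply: eq_bigr => i _.
  rewrite !rmorphM !rmorphXn yx !coef_map /= !(adK HD) PhiK JK (jm_d Hj) rmorphM.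
  by rewrite mulrA.
move=> h1 h2; have Qd' : J QL^`().[x] != 0 by rewrite fmorph_eq0 /QL deriv_map.
apply: (mulfI Qd'); apply/eqP; rewrite -subr_eq0; apply/eqP.
have -> : J QL^`().[x] * Phi (D y) - J QL^`().[x] * (emb0 lam * J (D x)) =
  (emb0 lam * J (\sum_(i < size QL) D QL`_i * x ^+ i) + J QL^`().[x] * Phi (D y)) -
  emb0 lam * (J (\sum_(i < size QL) D QL`_i * x ^+ i) + J QL^`().[x] * J (D x)) by ring.
by rewrite -h1 -h2; ring.
Qed.

Section Field.
Variables (M : {subfield L}) (gM : galois 1 M).
Let pi := pif w M.
Let e := \dim M.
Let U := pifP HK HL M.
Let pi0 : pi != 0. Proof. by case: U. Qed.
Let wpi : w pi = e%:R^-1. Proof. by case: U. Qed.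
Let G := 'Gal(M / 1%VS)%g.
Let Pi := Phi pi ^+ q.

(** The product is the [J]-transform of the minimal polynomial of [pi], evaluated at [Pi], where the
    [q]-Frobenius transform vanishes. The coefficients of the two differ by [R] more than expected;
    the term [q] is the Eisenstein property. *)
Lemma conj_prod_ge (J : {rmorphism L -> Om}) : over_j J ->
  vge vO (\prod_(h in G) (Pi - J (h pi))) (R%:R + q%:R).
Proof.
move=> [JK Jv]; pose P := relpol w 1%AS M.
have Pin i : exists b : K, P`_i = b%:A.
  by have /vlineP [b ->] := relpol_in HK HL (F := 1%AS) gM i; exists b.
have ev : \prod_(h in G) (Pi - J (h pi)) =
    \sum_(i < size P) (J P`_i - Phi P`_i ^+ q) * Pi ^+ i.
  have -> : \prod_(h in G) (Pi - J (h pi)) = (map_poly J P).[Pi].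
    rewrite /P /relpol rmorph_prod horner_prod; apply: eq_bigr => h _ /=.
    by rewrite map_polyXsubC hornerXsubC.
  have -> : (map_poly J P).[Pi] = \sum_(i < size P) J P`_i * Pi ^+ i.
    by rewrite horner_coef size_map_poly; apply: eq_bigr => i _; rewrite coef_map.
  have r0 : \sum_(i < size P) Phi P`_i ^+ q * Pi ^+ i = 0.
    have := congr1 (fun x => Phi x ^+ q) (relpol_root w 1%AS M).
    rewrite rmorph0 expr0n gtn_eqF ?expn_gt0 ?prime_gt0 // mulr0n horner_coef rmorph_sum => E0; rewrite -[RHS]E0.
    rewrite -[RHS](frobqE chO) rmorph_sum.
    apply: eq_bigr => i _.
    by rewrite /= rmorphM rmorphXn exprMn /Pi -!exprM mulnC.
  rewrite -[LHS]subr0 -[X in _ - X = _]r0 -sumrB.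
  by apply: eq_bigr => i _; rewrite mulrBl.
have szP : size P = e.+1 by rewrite relpol_size (card_galE gM).
have Pm : P`_e = 1.
  by have /monicP := relpol_monic w 1%AS M; rewrite /lead_coef -/P szP.
have cge (i : 'I_e) : vge w (P`_i * pi ^+ i) 1.
  have [b bE] : exists b : 'I_e -> K, forall i : 'I_e, P`_i = (b i)%:A.
    exists (fun i : 'I_e => sval (constructive_indefinite_description _ (Pin i))) => i'.
    by case: constructive_indefinite_description.
  have h : @ucomb K L M pi (fun i => - b i) = pi ^+ e.
    have := relpol_root w 1%AS M; rewrite -/P horner_coef szP big_ord_recr /= Pm mul1r addrC.
    move/eqP; rewrite addr_eq0 => /eqP ->; rewrite ucombE -sumrN.
    by apply: eq_bigr => i' _; rewrite bE scaleNr mulNr.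
  have := ucomb_ge HK Hw (tg_ext HL) U (c := fun i => - b i) (r := 1).
  rewrite h => /(_ _ i) h'; have {}h' := h' _; rewrite bE.
  have : vge w ((- b i)%:A * pi ^+ i) 1.
    apply: h'; right; rewrite valX // wpi divff //.
    by rewrite pnatr_eq0 -lt0n adim_gt0.
  by move/(vgeN Hw); rewrite scaleNr mulNr opprK.
rewrite ev szP; apply: vge_sum => // i _.
have [ie|ei] := ltnP i e; last first.
  have -> : i = e :> nat by apply/eqP; rewrite eqn_leq ei -ltnS ltn_ord.
  by rewrite Pm !rmorph1 expr1n subrr mul0r; left.
have [b bE] := Pin i; have := cge (Ordinal ie) => /=; rewrite bE.
have [->|b0] := eqVneq b 0.
  move=> _; rewrite scale0r !rmorph0.
  by rewrite expr0n gtn_eqF ?expn_gt0 ?prime_gt0 // mulr0n subr0 mul0r; left.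
have bL : (b%:A : L) != 0 by rewrite alg_eq0.
have bp : b%:A * pi ^+ i != 0 by rewrite mulf_neq0 ?expf_neq0.
move=> /(vgeE bp); rewrite valM ?expf_neq0 // (tg_ext HL) // valX // => h.
rewrite JK PhiK -rmorphXn -rmorphB.
apply: vge_le (vgeM vO_val (vge_emb (jm_close Hj (vge_val v b))) (vgeX vO_val i (vge_val vO Pi))).
rewrite /Pi valX ?fmorph_eq0 // Phi_val // [_ + R%:R]addrC -addrA lerD2l mulrCA -mulrDr.
by rewrite -[X in X <= _]mulr1 ler_pM2l.
Qed.

Lemma over_j_aut (J : {rmorphism L -> Om}) (h : 'AEnd(L)) : over_j J -> over_j (J \o h).
Proof.
move=> [JK Jv]; split=> [a|x x0] /=; first by rewrite linearZ rmorph1 JK.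
by rewrite Jv ?fmorph_eq0 // (val_aut HK HL).
Qed.

(** A Krasner argument: among the conjugates of [J] take the one closest to [Pi]. Every other factor
    of the product is no closer than the distance between two conjugates, and these distances add up
    to the different. *)
Lemma closest_on_pi (J : {rmorphism L -> Om}) : over_j J ->
  exists2 J' : {rmorphism L -> Om}, over_j J' &
  vge vO (J' pi - Pi) (R%:R - q%:R * del w D M + q%:R * w pi).
Proof.
move=> HJ; have [JK Jv] := HJ.
have [/existsP [h /andP[_ /eqP h0]]|/existsPn nz] := boolP [exists h : gal_of M, (h \in G) && (Pi - J (h pi) == 0)].
  exists (J \o (h : 'AEnd(L)) : {rmorphism L -> Om}); first exact: over_j_aut.
  by rewrite -opprB h0 oppr0; left.
have {}nz (h : gal_of M) : h \in G -> Pi - J (h pi) != 0.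
  by move=> hG; have := nz h; rewrite hG.
case: (@Order.TotalTheory.arg_maxP _ _ _ (1%g : gal_of M) (fun h : gal_of M => h \in G)
   (fun h : gal_of M => vO (Pi - J (h pi))) (group1 _)) => s sG smax.
exists (J \o (s : 'AEnd(L)) : {rmorphism L -> Om}); first exact: over_j_aut.
rewrite -opprB; apply: vgeN => //=; right.
have le (h : gal_of M) : h \in G -> h != s -> vO (Pi - J (h pi)) <= q%:R * (ibr w M (h * s^-1)%g + w pi).
  move=> hG hs; have ne : h pi - s pi != 0.
    rewrite subr_eq0; apply: contra hs => /eqP E.
    have h1 : (h * s^-1)%g == 1%g.
      apply: contraT => /(gal_moves HK HL); rewrite galM ?(pif_in HK HL) // -/pi E.
      by rewrite -galM ?(pif_in HK HL) // mulgV gal_id eqxx.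
    by rewrite -(mulgK s h) -mulgA -[h](mulgKV s) (eqP h1) mul1g mulgV mulg1.
  have -> : q%:R * (ibr w M (h * s^-1)%g + w pi) = vO (J (h pi - s pi)).
    rewrite Jv // /ibr subrK galM ?(pif_in HK HL) // -/pi; congr (_ * _).
    have spi : pi = (s^-1)%g (s pi) by rewrite -galM ?(pif_in HK HL) // mulgV gal_id.
    by rewrite {2}spi -rmorphB (val_aut HK HL).
  rewrite leNgt; apply/negP => lt.
  have hJ : J (h pi - s pi) != 0 by rewrite fmorph_eq0.
  have E : J (h pi - s pi) = (Pi - J (s pi)) - (Pi - J (h pi)).
    by rewrite rmorphB; ring.
  have : vgt vO (J (h pi - s pi)) (vO (J (h pi - s pi))).
    rewrite {1}E; apply: vgtB => //; right=> //.
    apply: lt_le_trans lt _; exact: smax.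
  by move/(vgtE hJ); rewrite ltxx.
have prod0 : \prod_(h in G) (Pi - J (h pi)) != 0 by apply/prodf_neq0.
have := vgeE prod0 (conj_prod_ge HJ).
rewrite -big_enum (val_prod vO_val); last by move=> h; rewrite mem_enum; apply: nz.
rewrite big_enum (bigD1 s) //= => hsum.
apply: (@closest_arith _ _ (\sum_(h in G | h != s) q%:R * (ibr w M (h * s^-1)%g + w pi))).
  apply: le_trans hsum _; rewrite lerD2l; apply: ler_sum => h /andP[hG hs]; exact: le.
rewrite -mulr_sumr big_split /=.
rewrite (reindex_inj (mulIg s)) /=.
have [_ ->] := del_gal HK HL dim_p HD gM.
have -> : \sum_(h in G | h != s) w pi = 1 - w pi.
  have : \sum_(h in G) w pi = 1.
    by rewrite sumr_const (card_galE gM) wpi -[_ *+ _]mulr_natl divff // pnatr_eq0 -lt0n adim_gt0.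
  by rewrite (bigD1 s) //= => <-; rewrite addrC addrK.
rewrite mulrDr mulrBr mulr1 addrA; congr (_ * _ + _ - _).
apply: eq_big => [h|h _]; last by rewrite mulgK.
by rewrite groupMr // -{2}(mul1g s) (inj_eq (mulIg s)).
Qed.

(** The difference of [J] and the [q]-Frobenius is additive, so the estimate at [pi] and [jm_close]
    on [K] settle it on monomials. *)
Lemma closest_extend (J : {rmorphism L -> Om}) : over_j J ->
  vge vO (J pi - Pi) (R%:R - q%:R * del w D M + q%:R * w pi) ->
  forall x, x \in M -> vge vO (J x - Phi x ^+ q) (q%:R * w x + (R%:R - q%:R * del w D M)).
Proof.
move=> [JK Jv] Hpi x xM; set C := R%:R - _ in Hpi *.
have Jge y : vge vO (J y) (q%:R * w y).
  by have [->|y0] := eqVneq y 0; [rewrite rmorph0; left|right; rewrite Jv].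
have Pge y : vge vO (Phi y ^+ q) (q%:R * w y).
  have [->|y0] := eqVneq y 0; last by right; rewrite valX ?fmorph_eq0 // Phi_val.
  by rewrite rmorph0 expr0n gtn_eqF ?expn_gt0 ?prime_gt0 //; left.
have [C0|C0] := leP C 0.
  by apply: (@vge_le _ _ _ _ (q%:R * w x)); [rewrite gerDl|apply: vgeB].
apply: (unif_op_ge HK Hw (tg_ext HL) U vO_val (D := fun x => J x - Phi x ^+ q)) => //.
  by move=> a b _ _; rewrite !rmorphD (exprpD chO); ring.
move=> a i a0 ie; have aL : (a%:A : L) != 0 by rewrite alg_eq0.
have dlt0 : C <= R%:R.
  have [_ dl0 _] := del_ok_gal HK HL dim_p HD gM.
  by rewrite gerBl mulr_ge0 // ltW.
pose ee := (J pi - Pi) / Pi.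
have Pi0 : Pi != 0 by rewrite expf_neq0 // fmorph_eq0.
have hee : vge vO ee C.
  have := vgeM vO_val Hpi (vge_val vO Pi^-1).
  rewrite valV // /Pi valX ?fmorph_eq0 // Phi_val // addrK.
  by [].
have JpiE : J pi = Pi * (1 + ee) by rewrite /ee mulrDr mulr1 mulrCA divff // mulr1 [_ + (_ - _)]addrC subrK.
rewrite /= [J (_ * _)]rmorphM [J (_ ^+ _)]rmorphXn [Phi (_ * _)]rmorphM [Phi (_ ^+ _)]rmorphXn.
rewrite JK PhiK exprMn -[(Phi _ ^+ _) ^+ _]exprM mulnC exprM -/Pi.
have -> : emb0 (jm a) * J pi ^+ i - emb0 a ^+ q * Pi ^+ i =
   emb0 (jm a - a ^+ q) * J pi ^+ i + emb0 a ^+ q * (Pi ^+ i * ((1 + ee) ^+ i - 1)).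
  rewrite rmorphB rmorphXn mulrBl mulrBr mulr1 -exprMn -JpiE; ring.
have wE : w (a%:A * pi ^+ i) = v a + i%:R * w pi.
  by rewrite valM ?expf_neq0 // valX // (tg_ext HL).
rewrite wE; apply: vgeD => //.
  apply: vge_le (vgeM vO_val (vge_emb (jm_close Hj (vge_val v a))) (vgeX vO_val i (Jge pi))).
  exact: closest_arith2.
have h1 : vge vO (emb0 a ^+ q) (q%:R * v a).
  by apply: vgeX => //; apply: vge_emb; apply: vge_val.
have h2 : vge vO (Pi ^+ i) (i%:R * (q%:R * w pi)) by apply: vgeX => //; apply: Pge.
have h3 := vge_expr1D vO_val i (ltW C0) hee.
apply: vge_le (vgeM vO_val h1 (vgeM vO_val h2 h3)).
by rewrite mulrDr -addrA [i%:R * (q%:R * _)]mulrCA.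
Qed.

End Field.
End Closest.

Section LowGraded.
Variables (n : nat) (F : fieldType) (Z : F -> Prop) (i j : 'I_n).
Hypotheses (Z0 : Z 0) (Z1 : Z 1).
Hypotheses (ZD : forall x y, Z x -> Z y -> Z (x + y)) (ZN : forall x, Z x -> Z (- x)).
Hypothesis ZM : forall x y, Z x -> Z y -> Z (x * y).

(** No condition is put on the corner. A chain inside a proper sub-block never meets it, so the
    family is still graded. *)
Definition lowQ (a b : 'I_n) (y : F) : Prop :=
  (i <= a)%N -> (b <= j)%N -> (a, b) != (i, j) -> Z y.

Lemma lowQ_graded : graded lowQ.
Proof.
split.
- by move=> a _ _ _; apply: (Z1).
- by move=> a b _ _ _; apply: (Z0).
- by move=> a b x y hx hy ia bj ne; apply: (ZD); [apply: hx|apply: hy].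
- by move=> a b x hx ia bj ne; apply: (ZN); apply: hx.
move=> a c b x y ac cb hx hy ia bj ne; apply: (ZM); [apply: hx|apply: hy] => //.
- exact: leq_trans bj.
- apply: contraNN ne; rewrite !xpair_eqE -!val_eqE /= => /andP[/eqP E1 /eqP E2].
  by apply/andP; split; apply/eqP; lia.
- exact: leq_trans ac.
apply: contraNN ne; rewrite !xpair_eqE -!val_eqE /= => /andP[/eqP E1 /eqP E2].
by apply/andP; split; apply/eqP; lia.
Qed.
End LowGraded.

Fact core_arith (T m1 dl p : rat) : 2 <= p -> 0 <= dl -> 2 * dl < m1 -> m1 <= T ->
  - T < - (T / p) - dl.
Proof.
move=> p2 d0 dm mT; have T0 : 0 <= T by lra.
have h : T / p <= T / 2 by rewrite ler_wpM2l // lef_pV2 ?posrE //; lra.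
lra.
Qed.

Fact top_arith1 (R qr jm qo : rat) : qr + jm < qo -> R - qo < R - qr - jm.
Proof. lra. Qed.

Fact top_arith2 (R qr jm : rat) : 0 <= jm -> qr + jm < R -> 0 < R - qr.
Proof. lra. Qed.

Fact top_arith3 (R p qo : rat) : 0 < R -> 2 <= p -> R - qo < p * R - qo.
Proof. move=> R0 p2; nra. Qed.

Fact top_arith4 (R p q rho jm qo P : rat) : 0 <= q -> 0 < R - q * rho -> 0 <= jm -> 2 <= p ->
  P <= p * rho -> q * rho + jm < qo -> R - qo < p * R - q * P.
Proof.
move=> q0 Rq jm0 p2 le h; have h1 : q * P <= q * (p * rho) by rewrite ler_wpM2l.
have h2 : R - q * rho <= p * (R - q * rho) by rewrite ler_peMl //; lra.
lra.
Qed.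

Fact top_arith5 (R p q om r : rat) : 0 <= q -> 0 <= R -> 2 <= p -> om <= r ->
  R - q * r <= p * R - q * om.
Proof.
move=> q0 R0 p2 le; have h1 : q * om <= q * r by rewrite ler_wpM2l.
nra.
Qed.

Fact top_arith6 (R p q rho P T : rat) : 0 <= q -> 0 < R - q * rho -> 2 <= p ->
  P <= p * rho -> 0 <= T -> - T <= p * R - q * P.
Proof.
move=> q0 Rq p2 le T0; have h1 : q * P <= q * (p * rho) by rewrite ler_wpM2l.
have h2 : R - q * rho <= p * (R - q * rho) by rewrite ler_peMl //; lra.
lra.
Qed.

Fact top_arith7 (R q r wa dl : rat) : - r = wa - dl ->
  - (q * r - R) <= q * wa + (R - q * dl).
Proof.
move=> h; have -> : r = dl - wa by lra.
lra.
Qed.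

Fact top_arith8 (R q r : rat) : R + q * - r = - (q * r - R).
Proof. ring. Qed.

Fact top_arith9 (R qr qo : rat) : 0 < qr - R -> qr < qo -> R < qo.
Proof. lra. Qed.

Fact top_arith10 (R q r o : rat) : q * - r <= q * o -> - (q * r - R) <= R + q * o.
Proof. lra. Qed.

Fact top_arith11 (R q r o : rat) : - (q * r - R) = R + q * o -> q * o = q * - r.
Proof. lra. Qed.

(** * The top entry of a block *)

Section TopEntry.
Variables (p : nat) (k K : fieldType) (embk : {rmorphism k -> K}).
Variables (v : K -> rat) (t : K).
Hypothesis HK : laurent_field p embk v t.
Variables (L : splittingFieldType K) (w : L -> rat).
Hypothesis HL : totram_galois v w.
Variable n0 : nat.
Local Notation n := n0.+1.
Hypothesis L_gal_UT : (('Gal({:L} / 1%VS))%g \isog UTset n p)%g.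
Variables (A : 'M[K]_n) (Theta : 'M[L]_n).
Hypotheses (A_UT : UT A) (T_UT : UT Theta).
Hypothesis T_sol : frobmx p Theta *m map_mx (in_alg L) A = Theta.
Variables (D : L -> L) (HD : alg_derivation (dK embk v t) D).
Variables (N R : nat) (jm : {rmorphism K -> K}) (z lam : K).
Hypotheses (N_gt0 : (0 < N)%N) (Hj : jmap_spec p embk v t N R jm z lam).
Variables (Om : fieldType) (emb0 : {rmorphism K -> Om}) (vO : Om -> rat).
Hypotheses (vO_val : is_valuation vO).
Hypothesis vO_ext : forall a : K, a != 0 -> vO (emb0 a) = v a.
Variables Phi J : {rmorphism L -> Om}.
Hypothesis PhiK : forall a : K, Phi a%:A = emb0 a.
Hypothesis Phi_val : forall x, x != 0 -> vO (Phi x) = w x.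
Hypothesis HJ : over_j p w N jm emb0 vO J.

Let Hv := lf_val HK.
Let Hw := tg_val HL.
Let pp := lf_prime HK.
Let dim_p := dimL_p HK HL L_gal_UT.
Let chO : p \in [pchar Om]. Proof. exact: (rmorph_pchar emb0 (pcharK HK)). Qed.
Let q := (p ^ N)%N.
Let q_gt0 : 0 < q%:R :> rat. Proof. by rewrite ltr0n expn_gt0 prime_gt0. Qed.
Local Notation d := (dK embk v t).
Local Notation Ome := (Omega Theta D).
Local Notation S := (SK p A N jm).
Local Notation X := (XO p Theta N Phi J).
Local Notation B := (BO p A Theta N jm emb0 Phi).

Variables (i j : 'I_n) (mA rho : rat).
Hypotheses (ij : (i < j)%N) (mA_ge0 : 0 <= mA).
Hypothesis A_mA : forall a b : 'I_n, (i <= a)%N -> (a < b)%N -> (b <= j)%N ->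
  vge v (A a b) (- ((b - a)%:R * mA)).
Hypothesis rho_ge0 : 0 <= rho.
Hypothesis Om_rho : forall a b : 'I_n, (i <= a)%N -> (a < b)%N -> (b <= j)%N ->
  (a, b) != (i, j) -> vge w (Ome a b) (- rho).
Hypothesis pr_low : forall a b : 'I_n, (i <= a)%N -> (a < b)%N -> (b <= j)%N ->
  (a, b) != (i, j) -> vge v (pr0 p embk v t (S a b)) ((p * R)%:R - q%:R * (p%:R * rho)).
Hypothesis R_gap : q%:R * rho + (j - i)%:R * mA < R%:R.

Let JK : forall a : K, J a%:A = emb0 (jm a) := proj1 HJ.
Let J_val : forall x, x != 0 -> vO (J x) = (p ^ N)%:R * w x := proj2 HJ.
Let low_b := low_bounds HK HL A_UT T_UT T_sol HD N_gt0 Hj vO_val vO_ext PhiK JK Phi_val J_val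
  mA_ge0 A_mA rho_ge0 Om_rho pr_low R_gap.
Let Xrec := X_rec HK A_UT T_UT T_sol N_gt0 PhiK JK.

Lemma gap_pos (b a : 'I_n) : (i <= a)%N -> (b <= j)%N ->
  0 < R%:R - q%:R * rho - (b - a)%:R * mA.
Proof. by move=> ia bj; apply: gap_arith R_gap => //; rewrite ler_nat leq_sub_chain. Qed.

Lemma dS_top : vge vO (emb0 (d (S i j)) - emb0 lam * J (Ome i j))
  (R%:R - q%:R * rho - (j - i)%:R * mA).
Proof.
apply: (dS_lead HK HL A_UT T_UT T_sol HD N_gt0 Hj vO_val vO_ext PhiK JK Phi_val J_val
  mA_ge0 A_mA rho_ge0 Om_rho R_gap) => //.
  move=> a b ia ab bj; have bj' := pred_lt (leq_ltn_trans (leq0n _) ij) bj.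
  have ne : (a, b) != (i, j) by rewrite xpair_eqE -!val_eqE /= (ltn_eqF bj') andbF.
  by have [] := low_b (c := a) (e := b) ia ab (ltnW bj') ne.
move=> a b ia ab bj; have ne : (a, b) != (i, j) by rewrite xpair_eqE -!val_eqE /= (gtn_eqF ia).
by have [] := low_b (c := a) (e := b) (ltnW ia) ab bj ne.
Qed.

Variable P : rat.
Hypothesis pr_top : vge v (pr0 p embk v t (S i j)) ((p * R)%:R - q%:R * P).
Hypothesis P_top : (Ome i j != 0 /\ w (Ome i j) = - P) \/ P <= p%:R * rho.

Let lamJ_val : Ome i j != 0 ->
  emb0 lam * J (Ome i j) != 0 /\ vO (emb0 lam * J (Ome i j)) = R%:R + q%:R * w (Ome i j).
Proof.
move=> O0; have l0 : emb0 lam != 0 by rewrite fmorph_eq0 (jm_lam0 Hj).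
have J0 : J (Ome i j) != 0 by rewrite fmorph_eq0.
by rewrite mulf_neq0 // valM // vO_ext ?(jm_lam0 Hj) // (jm_lam Hj) J_val.
Qed.

Let emb0_val x r : emb0 x != 0 -> vO (emb0 x) = r -> x != 0 /\ v x = r.
Proof. by rewrite fmorph_eq0 => x0 <-; rewrite vO_ext. Qed.

Let p2 : 2 <= p%:R :> rat. Proof. by rewrite (ler_nat _ 2) prime_gt1. Qed.

Lemma dS_value om : Ome i j != 0 -> w (Ome i j) = - om ->
  q%:R * rho + (j - i)%:R * mA < q%:R * om ->
  d (S i j) != 0 /\ v (d (S i j)) = R%:R - q%:R * om.
Proof.
move=> O0 Ov h; have [nz vn] := lamJ_val O0; rewrite Ov mulrN in vn.
have [h0 hv] : emb0 (d (S i j)) != 0 /\ vO (emb0 (d (S i j))) = vO (emb0 lam * J (Ome i j)).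
  apply: (val_subl vO_val nz); rewrite -opprB; apply: vgtN => //; apply: vgt_lt dS_top.
  by rewrite vn; exact: top_arith1.
by apply: emb0_val => //; rewrite hv.
Qed.

(** The derivative already has the announced valuation. The part killed by [d] is of larger
    valuation: it gains [p R] against [R], while its pole is at most [q om] or [q p rho], and [rho]
    is controlled by [R_gap]. *)
Lemma S_value om : Ome i j != 0 -> w (Ome i j) = - om -> 0 < R%:R :> rat ->
  q%:R * rho + (j - i)%:R * mA < q%:R * om ->
  S i j != 0 /\ v (S i j) = R%:R - q%:R * om.
Proof.
move=> O0 Ov R0 h; have [nz vn] := dS_value O0 Ov h.
rewrite -vn; apply: (val_dK_pr0 HK) => //; rewrite vn; apply: vgt_lt pr_top.
have ji0 : 0 <= (j - i)%:R * mA by rewrite mulr_ge0.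
have Rq : 0 < R%:R - q%:R * rho by apply: top_arith2 R_gap.
rewrite natrM; case: P_top => [[_ E]|le].
  have -> : P = om by apply: oppr_inj; rewrite -E.
  exact: top_arith3.
exact: top_arith4 (ltW q_gt0) Rq ji0 p2 le h.
Qed.

Local Notation M := (fgen Theta (lowpairs i j)).
Definition InM (y : Om) : Prop := exists2 x, x \in M & Phi x = y.

Lemma InM_Phi x : x \in M -> InM (Phi x). Proof. by exists x. Qed.
Lemma InM_emb0 a : InM (emb0 a).
Proof. by exists a%:A => //; rewrite rpredZ ?rpred1. Qed.
Lemma InM0 : InM 0. Proof. by exists 0; rewrite ?rpred0 ?rmorph0. Qed.
Lemma InM1 : InM 1. Proof. by exists 1; rewrite ?rpred1 ?rmorph1. Qed.
Lemma InMD x y : InM x -> InM y -> InM (x + y).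
Proof. by move=> [a aM <-] [b bM <-]; exists (a + b); rewrite ?rpredD ?rmorphD. Qed.
Lemma InMN x : InM x -> InM (- x).
Proof. by move=> [a aM <-]; exists (- a); rewrite ?rpredN ?rmorphN. Qed.
Lemma InMB x y : InM x -> InM y -> InM (x - y).
Proof. by move=> hx hy; apply: InMD => //; apply: InMN. Qed.
Lemma InMM x y : InM x -> InM y -> InM (x * y).
Proof. by move=> [a aM <-] [b bM <-]; exists (a * b); rewrite ?rpredM ?rmorphM. Qed.
Lemma InMX x m : InM x -> InM (x ^+ m).
Proof. by move=> [a aM <-]; exists (a ^+ m); rewrite ?rpredX ?rmorphXn. Qed.

Let lQ := lowQ InM i j.
Let gQ : graded lQ := lowQ_graded i j InM0 InM1 InMD InMN InMM.

Lemma T0_low m : mxgr lQ (frobmx m (map_mx Phi Theta)).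
Proof.
move=> a b ab ia bj ne; rewrite !mxE; apply: InMX; apply: InM_Phi.
exact: Theta_in_low.
Qed.

Let T0m_UT m : (0 < m)%N -> UT (frobmx m (map_mx Phi Theta)).
Proof. by move=> m0; apply: frobmx_UT => //; apply: UT_map. Qed.
Let p_gt0 : (0 < p)%N. Proof. exact: prime_gt0. Qed.
Let qn_gt0 : (0 < q)%N. Proof. by rewrite expn_gt0 p_gt0. Qed.

Lemma T0_inv_low m : (0 < m)%N -> mxgr lQ (invmx (frobmx m (map_mx Phi Theta))).
Proof. by move=> m0; apply: mxgr_inv => //; [apply: T0m_UT|apply: T0_low]. Qed.

Let S_low0 (a b : 'I_n) : (b <= a)%N -> map_mx emb0 S a b = 0.
Proof. by move=> ba; rewrite mxE (SK_low HK A_UT) // rmorph0. Qed.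

Lemma B_low : mxgr lQ B.
Proof.
have [t0 t1] := T0m_UT p_gt0; have [u0 u1] := UT_inv (T0m_UT p_gt0).
have s0 (a b : 'I_n) : (b < a)%N -> map_mx emb0 S a b = 0 by move=> /ltnW; apply: S_low0.
apply: mxgr_mul => //; last exact: T0_inv_low.
  move=> a b ba; rewrite mxE big1 // => c _; have [ca|ac] := ltnP c a.
    by rewrite t0 // mul0r.
  by rewrite s0 ?mulr0 //; apply: leq_trans ac.
apply: mxgr_mul => //; first exact: T0_low.
by move=> a b _ _ _ _; rewrite mxE; apply: InM_emb0.
Qed.

Lemma B_top : InM (B i j - emb0 (S i j)).
Proof.
have -> : emb0 (S i j) = map_mx emb0 S i j by rewrite [RHS]mxE.
apply: (@conj_diff _ _ InM) => //; [exact: InM0|exact: InMD|exact: T0m_UT|by apply: UT_inv; apply: T0m_UT|].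
move=> l l' il ll' l'j ne.
apply: InMM; [apply: InMM|].
- by apply: (T0_low p il) => //; [apply: ltnW (leq_trans ll' l'j)|apply: ne_left (leq_trans ll' l'j)].
- by rewrite mxE; apply: InM_emb0.
by apply: (T0_inv_low p_gt0 l'j) => //; [apply: leq_trans il (ltnW ll')|apply: ne_right (leq_ltn_trans il ll')].
Qed.

Let Xp0 (c : 'I_n) : X c c = 1.
Proof.
have [_ h] : UT X; last exact: h.
by apply: UT_mul; [apply: UT_map|apply: UT_inv; apply: T0m_UT].
Qed.

Lemma vgt_Phi x r : vgt vO (Phi x) r -> vgt w x r.
Proof.
have [->|x0] := eqVneq x 0; first by left.
have xL : Phi x != 0 by rewrite fmorph_eq0.
by move/(vgtE xL) => h; right; rewrite -Phi_val.
Qed.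

(** By induction [X c e - X c e ^+ p] lies in the image of [M] and has positive valuation, so
    [AS_solve] finds a solution in the complete field [M]. Two solutions differ by an element of the
    prime field. *)
Lemma X_low : mxgr lQ X.
Proof.
move=> c e; have [g] := ubnP (e - c); elim: g c e => // g IH c e ceg ce ic ej ne.
move: (ce); rewrite leq_eqVlt => /orP[/eqP/val_inj->|lt]; first by rewrite Xp0; apply: InM1.
have sub (a b : 'I_n) : (c <= a)%N -> (b <= e)%N -> (a, b) != (i, j) := sub_ne ic ej ne.
have := Xrec c e; set b := (X in _ = X) => bE.
have bM : InM b.
  apply: (big_ind InM); [exact: InM0|exact: InMD|move=> l /andP[cl le]].
  apply: InMM; first by apply: InMX; apply: IH => //; [exact: leq_trans (ltn_sub2r lt le) _|exact: leq_trans (ltnW le) ej|exact: sub (leqnn _) (ltnW le)].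
  by apply: B_low => //; [exact: ltnW|exact: leq_trans cl|exact: sub].
have b0 : vgt vO b 0.
  apply: vgt_sum => // l /andP[cl le].
  have [X0 _ _] : [/\ vge vO (X c l) 0, vge vO (B c l) (R%:R - q%:R * rho - (l - c)%:R * mA) &
      vge v (S c l) (R%:R - q%:R * rho - (l - c)%:R * mA)].
    by apply: low_b => //; [exact: leq_trans (ltnW le) ej|exact: sub (leqnn _) (ltnW le)].
  have [_ B0 _] : [/\ vge vO (X l e) 0, vge vO (B l e) (R%:R - q%:R * rho - (e - l)%:R * mA) &
      vge v (S l e) (R%:R - q%:R * rho - (e - l)%:R * mA)].
    by apply: low_b => //; [exact: leq_trans cl|exact: ltnW|exact: sub].
  rewrite -[0]addr0; apply: vgtMr => //; first exact: vgeX0.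
  by apply: vgt_lt B0; apply: gap_pos => //; apply: leq_trans cl.
have [bb bbM Ebb] := bM; rewrite -Ebb in b0.
have [l lM lE] : exists2 l, l \in M & l - l ^+ p = bb.
  apply: (AS_solve (pcharL HK L) Hw (S := fun x => x \in M)) => //; last exact: vgt_Phi.
    split; first exact: rpred0.
    split; first exact: rpred1.
    split; last by move=> x xM; rewrite rpredV.
    by move=> x y xM yM; rewrite rpredB ?rpredM.
  exact: (unif_complete HK Hw (tg_ext HL) (pifP HK HL M)).
have [m mE] : exists m : nat, X c e - Phi l = m%:R.
  apply: (frob_fixed chO); have := @exprpB p Om chO 1 (X c e) (Phi l); rewrite expn1 => ->.
  have h : X c e - X c e ^+ p = Phi l - Phi l ^+ p by rewrite bE -Ebb -lE rmorphB rmorphXn.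
  have -> : X c e ^+ p - Phi l ^+ p = (X c e - Phi l) - ((X c e - X c e ^+ p) - (Phi l - Phi l ^+ p)) by ring.
  by rewrite h subrr subr0.
exists (l + m%:R); first by rewrite rpredD ?rpred_nat.
by rewrite rmorphD rmorph_nat -mE addrC subrK.
Qed.

Lemma JT_low : mxgr lQ (map_mx J Theta).
Proof.
have uT := UT_unit (T0m_UT qn_gt0).
have -> : map_mx J Theta = X *m frobmx q (map_mx Phi Theta) by rewrite mulmxKV.
have [t0 _] := T0m_UT qn_gt0.
have [x0 _] : UT X by apply: UT_mul; [apply: UT_map|apply: UT_inv; apply: T0m_UT].
by apply: mxgr_mul => //; [exact: X_low|exact: T0_low].
Qed.

(** Since [J Theta = X Theta^(q)], the generators of [M] are mapped into the image of [M]. This is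
    what allows [J al] to be read back in [M] and differentiated there. *)
Lemma J_low x : x \in M -> InM (J x).
Proof.
apply: (@adjoin_seq_ind K L (fun x => InM (J x))).
- by move=> a; rewrite JK; apply: InM_emb0.
- by move=> a b ha hb; rewrite rmorphD; apply: InMD.
- by move=> a b ha hb; rewrite rmorphM; apply: InMM.
move=> y /mapP [[a b] ab ->] /=; move: ab; rewrite mem_lowpairs => /and4P[ia ab bj ne].
by have := JT_low (ltnW ab) ia bj ne; rewrite mxE.
Qed.

Lemma eps_top : exists2 e0, e0 \in M &
  X i j - X i j ^+ p = emb0 (S i j) + Phi e0 /\ vgt w e0 0.
Proof.
have E : X i j - X i j ^+ p - emb0 (S i j) =
  (B i j - emb0 (S i j)) + \sum_(l : 'I_n | (i < l < j)%N) X i l ^+ p * B l j.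
  rewrite Xrec (bigD1 i) /=; last by rewrite leqnn ij.
  rewrite Xp0 expr1n mul1r addrAC; congr (_ + _); apply: eq_bigl => l.
  by rewrite -val_eqE /= range_ne_left.
have eM : InM (X i j - X i j ^+ p - emb0 (S i j)).
  rewrite E; apply: InMD; first exact: B_top.
  apply: (big_ind InM); [exact: InM0|exact: InMD|move=> l /andP[il lj]].
  apply: InMM; first by apply: InMX; apply: (X_low (ltnW il)) => //; [exact: ltnW|exact: ne_left].
  by apply: (B_low (ltnW lj)) => //; [exact: ltnW|exact: ne_right].
have [e0 e0M e0E] := eM; exists e0 => //; split; first by rewrite e0E [RHS]addrC subrK.
apply: vgt_Phi; rewrite e0E E; apply: vgtD => //.
  have -> : emb0 (S i j) = map_mx emb0 S i j by rewrite [RHS]mxE.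
  apply: conj_lead => //; [exact: T0m_UT|by apply: UT_inv; apply: T0m_UT|].
  move=> l l' il ll' l'j ne.
  have := @gap_arith2 q%:R R%:R rho (l - i)%:R (l' - l)%:R (j - l')%:R (j - i)%:R mA.
  rewrite -!natrD => gE; apply: (@vgt_lt _ _ _ _ (R%:R - q%:R * rho - (j - i)%:R * mA)).
    exact: gap_pos.
  rewrite -gE; last by rewrite subn_chain.
  have Tb := Tp0_gr HK HL A_UT T_UT T_sol Phi_val mA_ge0 A_mA (leqnn i) (leqnn j).
  have Tib := Tp0_inv_gr HK HL A_UT T_UT T_sol vO_val Phi_val mA_ge0 A_mA (leqnn i) (leqnn j).
  apply: vgeM => //; last by apply: Tib => //; apply: leq_trans il (ltnW ll').
  apply: vgeM => //; first by apply: Tb => //; apply: ltnW (leq_trans ll' l'j).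
  rewrite mxE; apply: (vge_emb0 vO_ext).
  by have [] := low_b (c := l) (e := l') il (ltnW ll') l'j ne.
apply: vgt_sum => // l /andP[il lj].
have [X0 _ _] := low_b (c := i) (e := l) (leqnn _) (ltnW il) (ltnW lj) (ne_left _ lj).
have [_ B0 _] := low_b (c := l) (e := j) (ltnW il) (ltnW lj) (leqnn _) (ne_right _ il).
rewrite -[0]addr0; apply: vgtMr => //; first exact: vgeX0.
by apply: vgt_lt B0; apply: gap_pos => //; exact: ltnW.
Qed.

(** The corner of [X] is [J (Theta i j)] plus the corner of the inverse of [Theta^(q)], up to lower
    entries; the latter is [- Theta i j ^+ q] up to lower entries. Replacing [Theta i j] by
    [Theta i j - y0] changes only elements of [M]. *)
Lemma X_approx y0 : y0 \in M -> InM (X i j - (J (Theta i j - y0) - Phi (Theta i j - y0) ^+ q)).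
Proof.
move=> y0M; pose iT := invmx (frobmx q (map_mx Phi Theta)).
have [u0 u1] := UT_inv (T0m_UT qn_gt0); rewrite -/iT in u0 u1.
have [x0 x1] : UT (map_mx J Theta) by apply: UT_map.
have h1 : InM (X i j - J (Theta i j) - iT i j).
  rewrite mxE (bigD1 i) //= x1 mul1r (bigD1 j) /=; last by rewrite -val_eqE gtn_eqF.
  rewrite -/iT u1 mulr1 [map_mx J _ i j]mxE.
  set s := \sum_(l | _) _; have -> : iT i j + (J (Theta i j) + s) - J (Theta i j) - iT i j = s by ring.
  apply: (big_ind InM); [exact: InM0|exact: InMD|move=> l /andP[li lj]].
  have [lt|ge] := ltnP l i; first by rewrite x0 // mul0r; apply: InM0.
  have [lt|le] := ltnP j l; first by rewrite u0 // mulr0; apply: InM0.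
  move: li lj; rewrite -!val_eqE /= => li lj.
  apply: InMM; [apply: (JT_low ge)|apply: (T0_inv_low qn_gt0 le)] => //.
    by apply: ne_left; rewrite ltn_neqAle lj.
  by apply: ne_right; rewrite ltn_neqAle eq_sym li.
have h2 : InM (iT i j + Phi (Theta i j) ^+ q).
  rewrite /iT (UT_inv_rec (T0m_UT qn_gt0)) // (bigD1 j) /=; last by rewrite ij leqnn.
  rewrite -/iT u1 mulr1 [frobmx _ _ i j]mxE [map_mx _ _ i j]mxE opprD addrAC addNr add0r.
  apply: InMN; apply: (big_ind InM); [exact: InM0|exact: InMD|move=> l /andP[/andP[il lj] lj']].
  move: lj'; rewrite -!val_eqE /= => lj'.
  apply: InMM; [apply: (T0_low q (ltnW il))|apply: (T0_inv_low qn_gt0 lj)] => //.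
  - by apply: ne_left; rewrite ltn_neqAle lj'.
  - exact: ltnW.
  exact: ne_right.
have -> : X i j - (J (Theta i j - y0) - Phi (Theta i j - y0) ^+ q) =
  (X i j - J (Theta i j) - iT i j) + (iT i j + Phi (Theta i j) ^+ q) + (J y0 - Phi y0 ^+ q).
  rewrite !rmorphB (exprpB chO) -/q; ring.
apply: InMD; first exact: InMD.
by apply: InMB; [apply: J_low|apply: InMX; apply: InM_Phi].
Qed.

(** Apply [x - x ^+ p] to [X i j = (J f - f ^+ q) + y]: the left side is [S i j] up to the small
    [e0], and on the right [f] becomes [al]. *)
Lemma topS_eq y0 al : y0 \in M -> al \in M ->
  al = (Theta i j - y0) - (Theta i j - y0) ^+ p ->
  exists ga e0 y, [/\ [/\ ga \in M, e0 \in M & y \in M], Phi ga = J al - Phi al ^+ q,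
    vgt w e0 0 & (S i j)%:A + e0 = ga + (y - y ^+ p)].
Proof.
move=> y0M alM alE; set f := Theta i j - y0 in alE.
have [e0 e0M [Ee e0_gt]] := eps_top.
have [y yM yE] := X_approx y0M; rewrite -/f in yE.
have [ga gaM gaE] : InM (J al - Phi al ^+ q).
  by apply: InMB; [apply: J_low|apply: InMX; apply: InM_Phi].
exists ga, e0, y; split=> //; apply: (fmorph_inj Phi).
rewrite !rmorphD rmorphN rmorphXn PhiK -Ee gaE yE alE.
set g := J f - Phi f ^+ q.
have pB (x x' : Om) : (x - x') ^+ p = x ^+ p - x' ^+ p.
  by have := @exprpB p Om chO 1 x x'; rewrite expn1.
have -> : J (f - f ^+ p) - Phi (f - f ^+ p) ^+ q = g - g ^+ p.
  rewrite [J (f - _)]rmorphB [Phi (f - _)]rmorphB [J (f ^+ _)]rmorphXn [Phi (f ^+ _)]rmorphXn /g pB (exprpB chO) -!exprM [(q * p)%N]mulnC.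
  ring.
by rewrite [(_ - g) ^+ p]pB; ring.
Qed.

Let gM : galois 1 M := low_galois HK HL A_UT T_UT T_sol i j.
Let Mok := del_ok_gal HK HL dim_p HD gM.
Let dl := del w D M.
Let dl_ge0 : 0 <= dl. Proof. by case: Mok. Qed.

Lemma D_vge x r : x \in M -> vge w x r -> vge w (D x) (r - dl).
Proof.
move=> xM; have [->|x0] := eqVneq x 0; first by rewrite (D0 HD); left.
move/(vgeE x0) => h; apply: vge_le (D_ge HK HL HD Mok xM); by rewrite lerD2r.
Qed.

(** [D] kills [y ^+ p], and [y] has a pole of order at most [T / p], so [D y] has one of order at
    most [T / p + dl]. As [2 dl < m1 <= T] and [p >= 2], this is below [T] and cannot affect the
    leading term. *)
Lemma topS_core T m1 ga e0 y : ga \in M -> e0 \in M -> y \in M ->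
  (S i j)%:A + e0 = ga + (y - y ^+ p) -> vgt w e0 0 -> vge w ga (- m1) ->
  2 * dl < m1 -> m1 <= T -> vge v (S i j) (- T) ->
  vgt w ((d (S i j))%:A - D ga) (- T).
Proof.
move=> gaM eM yM E e_gt ga_ge dm mT S_ge.
have m1_ge0 : 0 <= m1 by apply: le_trans (ltW dm); rewrite mulr_ge0.
have T_ge0 := le_trans m1_ge0 mT.
have y_ge : vge w y (- (T / p%:R)).
  apply: (wp_bound Hw (prime_gt1 pp)) => //.
  have -> : y - y ^+ p = (S i j)%:A + e0 - ga by rewrite E addrAC subrr add0r.
  apply: vgeB => //; last by apply: vge_le ga_ge; rewrite lerN2.
  apply: vgeD => //; first exact: (vge_algA HL).
  by apply: vge_le (vgeW e_gt); rewrite oppr_le0.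
have DE : (d (S i j))%:A + D e0 = D ga + D y.
  have := congr1 D E; rewrite !(adD HD) (adK HD).
  have DN x : D (- x) = - D x by apply/eqP; rewrite -addr_eq0 -(adD HD) addNr (D0 HD).
  by rewrite DN (DXp HK HD) oppr0 addr0.
have -> : (d (S i j))%:A - D ga = D y - D e0.
  have -> : D y = (d (S i j))%:A + D e0 - D ga by rewrite DE addrAC subrr add0r.
  by ring.
apply: vgt_lt (core_arith p2 dl_ge0 dm mT) _; apply: vgeB => //; first exact: D_vge.
apply: (@vge_le _ _ _ _ (0 - dl)); first by rewrite lerD2r oppr_le0 divr_ge0.
by apply: D_vge => //; apply: vgeW.
Qed.

(** Two computations of the leading term of [d (S i j)]: it is that of [D ga], of valuation
    [R - q r] by [deriv_over_j], and that of [lam * J (Omega i j)]. The choice of [R] keeps this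
    valuation negative, beyond the error terms. *)
Lemma Omega_top r y0 al z0 : y0 \in M -> al \in M ->
  al = (Theta i j - y0) - (Theta i j - y0) ^+ p ->
  al != 0 -> w al = z0%:~R / (\dim M)%:R -> ~~ (p%:Z %| z0)%Z -> w (D al) = - r ->
  vge vO (J al - Phi al ^+ q) (q%:R * w al + (R%:R - q%:R * dl)) ->
  2 * dl < q%:R * r - R%:R -> Ome i j != 0 /\ w (Ome i j) = - r.
Proof.
move=> y0M alM alE al0 wal pz wDal close gap.
have [Dal0 wDal'] := D_eq HK HL dim_p HD Mok alM al0 wal pz.
rewrite wDal in wDal'.
have [ga [e0 [y [[gaM eM yM] gaE e_gt E]]]] := topS_eq y0M alM alE.
set m1 := q%:R * r - R%:R in gap.
have m1_gt0 : 0 < m1 by apply: le_lt_trans gap; rewrite mulr_ge0.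
have ga_ge : vge w ga (- m1).
  have : vge vO (Phi ga) (- m1).
    rewrite gaE; apply: vge_le close; rewrite /m1; exact: top_arith7 wDal'.
  have [->|g0] := eqVneq ga 0; first by left.
  have gL : Phi ga != 0 by rewrite fmorph_eq0.
  by move/(vgeE gL); rewrite Phi_val // => h; right.
have [Dga0 wDga] : D ga != 0 /\ w (D ga) = - m1.
  have [ya yaM yaE] := J_low alM.
  have DE := deriv_over_j HK HL HD Hj PhiK HJ yaE.
  have gE : ga = ya - al ^+ q by apply: (fmorph_inj Phi); rewrite rmorphB rmorphXn yaE.
  have DgaE : D ga = D ya.
    have h : ga + al ^+ q = ya by rewrite gE subrK.
    have := congr1 D h; rewrite (adD HD).
    have -> : al ^+ q = (al ^+ (p ^ N.-1)) ^+ p by rewrite -exprM -expnSr prednK.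
    by rewrite (DXp HK HD) addr0.
  have n1 : Phi (D ga) != 0.
    by rewrite DgaE DE mulf_neq0 ?fmorph_eq0 // (jm_lam0 Hj).
  have Dga0 : D ga != 0 by move: n1; rewrite fmorph_eq0.
  split=> //; rewrite -Phi_val // DgaE DE valM ?fmorph_eq0 ?(jm_lam0 Hj) //.
  rewrite vO_ext ?(jm_lam0 Hj) // (jm_lam Hj) J_val // wDal /m1; exact: top_arith8.
have R_ge0 : 0 <= R%:R :> rat by rewrite ler0n.
have ji0 : 0 <= (j - i)%:R * mA by rewrite mulr_ge0.
have Rq : 0 < R%:R - q%:R * rho by apply: top_arith2 R_gap.
have core T := topS_core (T := T) gaM eM yM E e_gt ga_ge gap.
have dS0 : vge vO (emb0 (d (S i j)) - emb0 lam * J (Ome i j)) 0.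
  by apply: vge_le dS_top; apply: ltW; apply: gap_pos.
(* A larger pole of Omega would give [d (S i j)] a pole of order [T > m1], whereas [topS_core] with
   this [T] leaves no term of that size. *)
have step1 : vge w (Ome i j) (- r).
  apply: NNPP => /vgeNt [O0 lt]; pose om := - w (Ome i j).
  have Ov : w (Ome i j) = - om by rewrite opprK.
  have rom : r < om by rewrite /om ltrNr.
  have qom : q%:R * r < q%:R * om by rewrite ltr_pM2l.
  have big : q%:R * rho + (j - i)%:R * mA < q%:R * om.
    by apply: lt_trans R_gap _; apply: top_arith9 m1_gt0 qom.
  have [dS_n0 dSv] := dS_value O0 Ov big.
  pose T := q%:R * om - R%:R.
  have m1T : m1 <= T by rewrite lerD2r ltW.
  have S_ge : vge v (S i j) (- T).
    apply: (vge_pr0_dK HK); last by right; rewrite dSv /T opprB.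
    apply: vge_le pr_top; rewrite natrM; case: P_top => [[_ EP]|le].
      have -> : P = om by rewrite /om EP opprK.
      by rewrite /T opprB; apply: top_arith5 => //; apply: ltW.
    by apply: (top_arith6 (ltW q_gt0) Rq p2 le); apply: le_trans m1T; apply: ltW.
  have h := core T m1T S_ge.
  have dSL : ((d (S i j))%:A : L) != 0 by rewrite alg_eq0.
  have : vgt w (d (S i j))%:A (- T).
    rewrite -[X in vgt w X](subrK (D ga)); apply: vgtD => //; right; rewrite wDga ltrN2.
    by rewrite ltrD2r.
  by move/(vgtE dSL); rewrite (tg_ext HL) // dSv /T opprB ltxx.
have om_le : Ome i j != 0 -> - w (Ome i j) <= r.
  by move=> O0; rewrite lerNl; apply: vgeE step1.
have lamO_ge : vge vO (emb0 lam * J (Ome i j)) (- m1).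
  have [->|O0] := eqVneq (Ome i j) 0; first by rewrite rmorph0 mulr0; left.
  have [n1 vn] := lamJ_val O0; right; rewrite vn.
  have h : q%:R * - r <= q%:R * w (Ome i j) by rewrite ler_pM2l //; apply: vgeE step1.
  exact: top_arith10.
have S_ge : vge v (S i j) (- m1).
  apply: (vge_pr0_dK HK).
    apply: vge_le pr_top; rewrite natrM; case: P_top => [[O0 EP]|le].
      have -> : - m1 = R%:R - q%:R * r by rewrite /m1 opprB.
      by apply: top_arith5 => //; have := om_le O0; rewrite EP opprK.
    by apply: (top_arith6 (ltW q_gt0) Rq p2 le); apply: ltW.
  apply: (emb0_vge vO_ext); rewrite -[emb0 _](subrK (emb0 lam * J (Ome i j))).
  apply: vgeD => //; apply: vge_le dS0; by rewrite oppr_le0 ltW.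
have h := core m1 (lexx _) S_ge.
have [dSL dSv] : (d (S i j))%:A != 0 :> L /\ w (d (S i j))%:A = - m1.
  rewrite -wDga; apply: val_subl => //; rewrite wDga -opprB; exact: vgtN.
rewrite alg_eq0 in dSL; rewrite (tg_ext HL) // in dSv.
have dSO : emb0 (d (S i j)) != 0 by rewrite fmorph_eq0.
have [n1 vn] : emb0 lam * J (Ome i j) != 0 /\ vO (emb0 lam * J (Ome i j)) = - m1.
  have -> : - m1 = vO (emb0 (d (S i j))) by rewrite vO_ext.
  apply: val_subl => //; apply: vgt_lt dS0; by rewrite vO_ext // dSv oppr_lt0.
have O0 : Ome i j != 0.
  by apply: contraNneq n1 => ->; rewrite rmorph0 mulr0.
split=> //; have [_] := lamJ_val O0; rewrite vn => h'.
apply: (mulfI (lt0r_neq0 q_gt0)); exact: top_arith11 h'.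
Qed.

End TopEntry.

(** * The valuation of Omega, and the values of S and of the first-order term over K *)

(** One of the two integers that follow the integer part of [lo] is prime to [p]. *)
Lemma coprime_between (p : nat) (lo hi : rat) : prime p -> 0 <= lo -> lo + p%:R < hi ->
  exists R : nat, [/\ (0 < R)%N, coprime R p, lo < R%:R & R%:R < hi].
Proof.
move=> pp lo0 lohi; have p1 := prime_gt1 pp.
have [f fE] : exists f : nat, Num.floor lo = f%:Z.
  have : 0 <= Num.floor lo by rewrite floor_ge0.
  by case: (Num.floor lo) => // f _; exists f.
have h1 : lo < f%:R + 1.
  by have := floorD1_gt lo; rewrite fE intrD.
have h2 : f%:R <= lo by have := floor_le_tmp lo; rewrite fE.
have p2 : 2 <= p%:R :> rat by rewrite (ler_nat _ 2).
have [c|nc] := boolP (coprime f.+1 p).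
  by exists f.+1; split=> //; rewrite -natr1 //; lra.
exists f.+2; split=> //; rewrite -?natr1; try lra.
move: nc; rewrite ![coprime _ p]coprime_sym !prime_coprime // negbK => d1.
by rewrite -addn1 (dvdn_addr _ d1) dvdn1 gtn_eqF.
Qed.

Lemma is_valuation_comp (F F' : fieldType) (f : {rmorphism F -> F'}) (w : F' -> rat) (c : rat) :
  is_valuation w -> 0 <= c -> is_valuation (fun x => w (f x) * c).
Proof.
move=> Hw c0; split=> x y x0 y0.
  by rewrite rmorphM valM ?fmorph_eq0 // mulrDl.
move=> s0; rewrite rmorphD -minr_pMl // ler_wpM2r //.
by apply: (Hw.2); rewrite -?rmorphD fmorph_eq0.
Qed.

Fact gapN_arith (q e0i e0 n ji mA p rE : rat) : 0 <= mA -> 0 <= q -> ji <= n -> 0 <= ji -> 0 <= e0 ->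
  n * (e0 + 1) * mA + p < q * e0i -> e0i <= rE ->
  ji * mA + (e0 * ji * mA + p) < q * rE.
Proof.
move=> m0 q0 jn j0 e00 h le; have h1 : q * e0i <= q * rE by rewrite ler_wpM2l.
have h2 : ji * mA <= n * mA by rewrite ler_wpM2r.
have h3 : e0 * (ji * mA) <= e0 * (n * mA) by rewrite ler_wpM2l.
lra.
Qed.

Fact gapN_arith2 (q r e ji mA dl x p : rat) : ji * mA + (x + p) < q * e -> 2 * dl <= x ->
  q * (r - e) + ji * mA + p < q * r - 2 * dl.
Proof. lra. Qed.

Fact gapN_arith3 (dl dM e0 ji mA p : rat) : 0 <= ji -> 0 <= mA -> 2 <= p -> 0 <= dM -> dM <= e0 ->
  dl <= dM * (ji * mA / p) -> 2 * dl <= e0 * ji * mA.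
Proof.
move=> j0 m0 p2 d0 de h; have x0 : 0 <= ji * mA by rewrite mulr_ge0.
have h1 : ji * mA / p <= ji * mA / 2 by rewrite ler_wpM2l // lef_pV2 ?posrE //; lra.
have h2 : dM * (ji * mA / p) <= dM * (ji * mA / 2) by rewrite ler_wpM2l.
have h3 : dM * (ji * mA / 2) <= e0 * (ji * mA / 2) by rewrite ler_wpM2r //; lra.
lra.
Qed.

Fact gapN_arith4 (q e e0i n e0 mA p rho r ji mB : rat) : 0 <= mB -> mB <= mA -> 0 <= q -> 0 <= ji ->
  ji <= n -> 0 <= e0 -> 0 < p -> n * (e0 + 1) * mA + p < q * e0i -> e0i <= e -> rho + e <= r ->
  q * rho + ji * mB < q * r.
Proof.
move=> b0 ba q0 j0 jn e00 p0 h le hr; have m0 := le_trans b0 ba.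
have h1 : q * e0i <= q * e by rewrite ler_wpM2l.
have h2 : q * (rho + e) <= q * r by rewrite ler_wpM2l.
have h3 : ji * mB <= ji * mA by rewrite ler_wpM2l.
have h4 : ji * mA <= n * mA by rewrite ler_wpM2r.
have h5 : 0 <= e0 * (n * mA) by rewrite !mulr_ge0 //; apply: le_trans jn.
lra.
Qed.

Fact YK_arith (q rho x y z ji mB r : rat) : 0 <= y -> 0 <= mB -> x + y + z = ji ->
  q * rho + ji * mB < q * r -> - (q * r) < - (x * mB) - q * rho - z * mB.
Proof. by move=> y0 m0 <- h; have := mulr_ge0 y0 m0; lra. Qed.

Section Values.
Variables (p : nat) (k K : fieldType) (embk : {rmorphism k -> K}).
Variables (v : K -> rat) (t : K).
Hypothesis HK : laurent_field p embk v t.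
Variables (L : splittingFieldType K) (w : L -> rat).
Hypothesis HL : totram_galois v w.
Variable n0 : nat.
Local Notation n := n0.+1.
Hypothesis L_gal_UT : (('Gal({:L} / 1%VS))%g \isog UTset n p)%g.
Variables (A : 'M[K]_n) (Theta : 'M[L]_n).
Hypotheses (A_UT : UT A) (T_UT : UT Theta).
Hypothesis T_sol : frobmx p Theta *m map_mx (in_alg L) A = Theta.
Hypothesis L_gen : Lsub Theta 0 n.-1 = fullv.
Variables (D : L -> L) (HD : alg_derivation (dK embk v t) D).
Variable m : nat -> nat -> nat.
Hypothesis A_pole : pole_orders p v A m.
Variables (Om : closedFieldType) (emb0 : {rmorphism K -> Om}) (vO : Om -> rat).
Hypotheses (vO_val : is_valuation vO).
Hypothesis vO_ext : forall a : K, a != 0 -> vO (emb0 a) = v a.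
Variables (N : nat) (N_gt0 : (0 < N)%N) (mA : rat).
Hypothesis mA_ge0 : 0 <= mA.
Hypothesis A_mA : forall a b : 'I_n, (a < b)%N -> vge v (A a b) (- ((b - a)%:R * mA)).
Let q := (p ^ N)%N.
Let e0 := \dim {:L}.
Hypothesis N_big : n%:R * (e0%:R + 1) * mA + p%:R < q%:R / e0%:R :> rat.

Let Hv := lf_val HK.
Let Hw := tg_val HL.
Let pp := lf_prime HK.
Let dim_p := dimL_p HK HL L_gal_UT.
Let q_gt0 : 0 < q%:R :> rat. Proof. by rewrite ltr0n expn_gt0 prime_gt0. Qed.
Let p2 : 2 <= p%:R :> rat. Proof. by rewrite (ler_nat _ 2) prime_gt1. Qed.
Local Notation Ome := (Omega Theta D).
Local Notation r := (rbr w Theta).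
Local Notation blk i j := (fgen Theta (pairs_in n i j)).
Local Notation low i j := (fgen Theta (lowpairs i j)).

Lemma Theta_moved (a b : 'I_n) : (a < b)%N -> exists s : 'AEnd(L), s (Theta a b) != Theta a b.
Proof.
move=> ab; have [s sE] := elem_aut HK L_gal_UT A_UT T_UT T_sol L_gen ab.
exists s; rewrite sE eqxx; case: T_UT => _ ->.
by rewrite -subr_eq0 [_ + 1]addrC addrK oner_neq0.
Qed.

Lemma Theta_neq0 (a b : 'I_n) : (a < b)%N -> Theta a b != 0.
Proof.
by move=> /Theta_moved [s]; apply: contraNneq => ->; rewrite linear0.
Qed.

(** If this entry vanished, [Theta a b] would be fixed by Frobenius, hence in the prime field,
    although some automorphism moves it. *)
Lemma A_super (a b : 'I_n) : b = a.+1 :> nat -> A a b != 0.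
Proof.
move=> E; have ab : (a < b)%N by rewrite E.
have [s sE] := Theta_moved ab; apply: contra sE => /eqP A0.
have h : Theta a b - Theta a b ^+ p = 0.
  rewrite (Theta_rec A_UT T_sol) big1 // => l lb.
  have [la|al] := ltnP l a.
    by case: T_UT => t0 _; rewrite t0 // expr0n gtn_eqF ?prime_gt0 // mul0r.
  have [bl|lb'] := ltnP b l; first by case: A_UT => a0 _; rewrite a0 // scale0r mulr0.
  have -> : l = a.
    apply/val_inj/eqP; rewrite /= eqn_leq al andbT -ltnS -E ltn_neqAle lb' andbT.
    by move: lb; rewrite -val_eqE.
  by rewrite A0 scale0r mulr0.
have [x xE] : exists x : nat, Theta a b = x%:R.
  by apply: (frob_fixed (pcharL HK L)); apply/esym/eqP; rewrite -subr_eq0 h.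
by rewrite xE rmorph_nat.
Qed.

(** Any extension of [emb0] will do: the pullback of [vO] is [w] by uniqueness of the extended
    valuation. [J_exists] repeats this after division by [q]. *)
Lemma Phi_exists : exists2 Phi : {rmorphism L -> Om}, (forall a : K, Phi a%:A = emb0 a) &
  forall x, x != 0 -> vO (Phi x) = w x.
Proof.
have [Phi PhiK] := hom_extends HK HL emb0; exists Phi => // x x0.
have := val_ext_uniq HK HL (is_valuation_comp Phi vO_val ler01) _ x0.
rewrite mulr1; apply=> a a0; by rewrite mulr1 PhiK vO_ext.
Qed.

Lemma J_exists R (jm : {rmorphism K -> K}) z lam : jmap_spec p embk v t N R jm z lam ->
  exists J : {rmorphism L -> Om}, over_j p w N jm emb0 vO J.
Proof.
move=> Hj; have [J JK] := hom_extends HK HL (emb0 \o jm : {rmorphism K -> Om}).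
exists J; split=> // x x0; have qi : 0 <= q%:R^-1 :> rat by rewrite invr_ge0 ltW.
have := val_ext_uniq HK HL (is_valuation_comp J vO_val qi) _ x0.
move=> h; rewrite -{}h; first by rewrite mulrCA divff ?mulr1 // gt_eqF.
move=> a a0; rewrite JK /= vO_ext ?fmorph_eq0 // (jm_val Hj) //.
by rewrite mulrAC divff ?mul1r // gt_eqF.
Qed.

(** Makes [rho = r i j - e] nonnegative in [omega_value]. *)
Lemma rbr_ge_inv (i j : 'I_n) : (i < j)%N -> (\dim (blk i j))%:R^-1 <= r i j.
Proof.
move=> ij; rewrite /rbr ij LsubE.
have gE : galois 1 (blk i j) := Lsub_galois HK HL A_UT T_UT T_sol i j.
have E1 := blk_dim_neq1 HK L_gal_UT A_UT T_UT T_sol L_gen ij.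
have [s [sG sm _ ->]] := ubreakE HK HL dim_p HD gE E1.
have [x xE] := ibr_int HK HL dim_p sm (memv_gal _ (pif_in HK HL (blk i j))).
have := ibr_gt0 HK HL dim_p sm; have [_ dl0 _] := del_ok_gal HK HL dim_p HD gE.
rewrite xE => x0; apply: ler_wpDr => //.
have b0 : 0 < (\dim (blk i j))%:R^-1 :> rat by rewrite invr_gt0 dim_gt0.
by move: x0; rewrite pmulr_lgt0 // ltr0n => x0; rewrite ler_peMl ?ler1n // ltW.
Qed.

Lemma invdim_le (E : {subfield L}) : e0%:R^-1 <= (\dim E)%:R^-1 :> rat.
Proof.
by rewrite lef_pV2 ?posrE ?dim_gt0 // ler_nat dimvS // subvf.
Qed.

Section Step.
Variables (i j : 'I_n).
Hypotheses (ij : (i < j)%N) (jip : (j - i <= p.+1)%N).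
Hypothesis IH : forall a b : 'I_n, (i <= a)%N -> (a < b)%N -> (b <= j)%N -> (a, b) != (i, j) ->
  Ome a b != 0 /\ w (Ome a b) = - r a b.
Variable rho : rat.
Hypothesis rho_ge0 : 0 <= rho.
Hypothesis rho_ge : forall a b : 'I_n, (i <= a)%N -> (a < b)%N -> (b <= j)%N -> (a, b) != (i, j) ->
  r a b <= rho.

Lemma step_Om (a b : 'I_n) : (i <= a)%N -> (a < b)%N -> (b <= j)%N -> (a, b) != (i, j) ->
  vge w (Ome a b) (- rho).
Proof. by move=> ia ab bj ne; have [_ E] := IH ia ab bj ne; right; rewrite E lerN2 rho_ge. Qed.

Lemma step_P (a b : 'I_n) : (i <= a)%N -> (a < b)%N -> (b <= j)%N -> (a, b) != (i, j) ->
  pmu m a b <= p%:R * rho.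
Proof.
move=> ia ab bj ne.
have bap : (b - a <= p.+1)%N by apply: leq_trans jip; apply: leq_sub_chain.
have sub (c d : 'I_n) : (a <= c)%N -> (c < d)%N -> (d <= b)%N -> (c, d) != (a, b) ->
    vge w (Ome c d) (- rho).
  move=> ac cd db _; apply: step_Om => //; [exact: leq_trans ac|exact: leq_trans bj|].
  exact: sub_ne ia bj ne ac db.
have [[_ E]|//] := Omega_pathmax HK HL A_UT T_UT T_sol HD A_pole A_super ab bap rho_ge0 sub.
have [_ E'] := IH ia ab bj ne.
have -> : pmu m a b = r a b by apply: oppr_inj; rewrite -E -E'.
apply: le_trans (rho_ge ia ab bj ne) _; rewrite ler_peMl // ler1n prime_gt0 //.
Qed.

Lemma step_top : (Ome i j != 0 /\ w (Ome i j) = - pmu m i j) \/ pmu m i j <= p%:R * rho.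
Proof. exact: (Omega_pathmax HK HL A_UT T_UT T_sol HD A_pole A_super ij jip rho_ge0 step_Om). Qed.

Variables (R : nat) (jm : {rmorphism K -> K}) (z lam : K).
Hypothesis Hj : jmap_spec p embk v t N R jm z lam.
Local Notation S := (SK p A N jm).

Lemma step_pr (a b : 'I_n) : (a <= b)%N ->
  vge v (pr0 p embk v t (S a b)) ((p * R)%:R - q%:R * pmu m a b).
Proof.
move=> ab; have sup := @pmu_sup n m a b.
apply: (pr0_SK HK HL A_UT T_UT T_sol N_gt0 Hj sup) => // c d ac cd db.
exact: (A_pmu A_pole ac cd db).
Qed.

Lemma step_pr_low (a b : 'I_n) : (i <= a)%N -> (a < b)%N -> (b <= j)%N -> (a, b) != (i, j) ->
  vge v (pr0 p embk v t (S a b)) ((p * R)%:R - q%:R * (p%:R * rho)).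
Proof.
move=> ia ab bj ne; apply: vge_le (step_pr (ltnW ab)).
by rewrite lerD2l lerN2 ler_pM2l // step_P.
Qed.

Lemma step_B mB : 0 <= mB -> (forall a b : 'I_n, (i <= a)%N -> (a < b)%N -> (b <= j)%N ->
    vge v (A a b) (- ((b - a)%:R * mB))) ->
  q%:R * rho + (j - i)%:R * mB < R%:R -> q%:R * rho + (j - i)%:R * mB < q%:R * r i j ->
  Ome i j != 0 -> w (Ome i j) = - r i j -> S i j != 0 /\ v (S i j) = R%:R - q%:R * r i j.
Proof.
move=> mB0 A_mB gap gap2 O0 Ov.
have [Phi PhiK Phi_val] := Phi_exists; have [J HJ] := J_exists Hj.
have R0 : 0 < R%:R :> rat.
  by apply: le_lt_trans gap; rewrite addr_ge0 ?mulr_ge0.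
exact: (S_value HK HL A_UT T_UT T_sol HD N_gt0 Hj vO_val vO_ext PhiK Phi_val HJ ij mB0 A_mB
  rho_ge0 step_Om step_pr_low gap (step_pr (ltnW ij)) step_top O0 Ov R0 gap2).
Qed.

End Step.

Lemma del_low_bound (i j : 'I_n) : (i < j)%N ->
  2 * del w D (low i j) <= e0%:R * (j - i)%:R * mA.
Proof.
move=> ij; pose C := (j - i)%:R * mA / p%:R.
have C0 : 0 <= C by rewrite divr_ge0 ?mulr_ge0.
have bnd (a b : 'I_n) : (i <= a)%N -> (a < b)%N -> (b <= j)%N -> - C <= w (Theta a b).
  move=> ia ab bj.
  have := @Theta_bnd _ _ _ _ _ _ HK _ _ HL _ _ _ A_UT T_UT T_sol i j _ (@lmu_sup n mA i j mA_ge0)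
    (fun a b _ ab _ => A_mA ab) _ _ ia (ltnW ab) bj.
  move/(vgeE (Theta_neq0 ab)); apply: le_trans; rewrite lerN2 /C /lmu ler_wpM2r ?invr_ge0 //.
  by rewrite ler_wpM2r // ler_nat leq_sub_chain.
have := del_low_le HK HL L_gal_UT A_UT T_UT T_sol HD bnd C0.
apply: gapN_arith3 => //; rewrite ler_nat dimvS // subvf //.
Qed.

Lemma omega_value (i j : 'I_n) : (i < j)%N -> (j - i <= p.+1)%N ->
  Ome i j != 0 /\ w (Ome i j) = - r i j.
Proof.
have [g] := ubnP (j - i); elim: g i j => // g IHg i j jig ij jip.
have IH (a b : 'I_n) : (i <= a)%N -> (a < b)%N -> (b <= j)%N -> (a, b) != (i, j) ->
    Ome a b != 0 /\ w (Ome a b) = - r a b.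
  move=> ia ab bj ne; apply: IHg => //; last by apply: leq_trans jip; apply: leq_sub_chain.
  rewrite -ltnS; apply: leq_trans jig; rewrite ltnS.
  by move: ne; rewrite xpair_eqE -!val_eqE /= => ne; lia.
(* By [rbr_lt] the breaks of all proper sub-blocks are at most [rho], one step below [r i j]; the
   step [e], multiplied by [q], is the room for the auxiliary exponent. *)
pose e := (\dim (blk i j))%:R^-1 : rat; pose rho := r i j - e.
have rho0 : 0 <= rho by rewrite subr_ge0 rbr_ge_inv.
have rho_ge (a b : 'I_n) : (i <= a)%N -> (a < b)%N -> (b <= j)%N -> (a, b) != (i, j) ->
    r a b <= rho.
  move=> ia ab bj ne; rewrite /rho lerBrDr.
  exact: (rbr_lt HK HL L_gal_UT A_UT T_UT T_sol L_gen HD ia ab bj ne).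
have gap := gapN_arith (ji := (j - i)%:R) mA_ge0 (ltW q_gt0) _ _ _ N_big (invdim_le (blk i j)).
have {}gap : (j - i)%:R * mA + (e0%:R * (j - i)%:R * mA + p%:R) < q%:R * e.
  by apply: gap => //; rewrite ler_nat; apply: leq_trans (leq_subr _ _) (ltnW (ltn_ord j)).
have gap2 := gapN_arith2 (r i j) gap (del_low_bound ij).
have lo0 : 0 <= q%:R * rho + (j - i)%:R * mA by rewrite addr_ge0 ?mulr_ge0.
(* The lower bound on [R] is [R_gap], the upper one is the condition [2 dl < q r - R] of
   [Omega_top]. *)
have [R [R0 Rc Rlo Rhi]] := coprime_between pp lo0 gap2.
have [jm [z [lam Hj]]] := jmap_exists HK N_gt0 R0 Rc.
have [Phi PhiK Phi_val] := Phi_exists; have [J0 HJ0] := J_exists Hj.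
have gM : galois 1 (low i j) := low_galois HK HL A_UT T_UT T_sol i j.
have [J HJ Jpi] := closest_on_pi HK HL dim_p HD Hj vO_val vO_ext PhiK Phi_val gM HJ0.
have close := closest_extend HK HL dim_p HD Hj vO_val vO_ext PhiK Phi_val gM HJ Jpi.
have [y [al [z0 [yM alM alE [al0 wal pz] [_ wDal]]]]] :=
  best_approx HK HL L_gal_UT A_UT T_UT T_sol L_gen HD ij.
apply: (Omega_top HK HL L_gal_UT A_UT T_UT T_sol HD N_gt0 Hj vO_val vO_ext PhiK Phi_val HJ ij
  mA_ge0 (fun a b _ ab _ => A_mA ab) rho0 (step_Om IH rho_ge) (step_pr_low jip IH rho0 rho_ge Hj) Rlo
  (step_pr Hj (ltnW ij)) (step_top ij jip IH rho0 rho_ge) yM alM alE al0 wal pz wDal (close al alM)).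
by rewrite ltrBrDr -ltrBrDl.
Qed.

(** The first-order term [s1] pulled back to [K] along iota, without its common factor [a1c] (see
    [s1E]). *)
Definition YK : 'M[K]_n :=
  invmx (frobmx p (WK p A N)) *m frobmx q (map_mx (dK embk v t) A) *m frobmx p (WK p A N.-1).

Lemma YK_L : map_mx (in_alg L) YK =
  invmx (frobmx p Theta) *m frobmx q Ome *m frobmx p Theta.
Proof.
have chL := pcharL HK L.
rewrite !map_mxM map_invmx !map_frobmx !WK_map (sandwich_W chL T_UT T_sol) //.
congr (_ *m _ *m _); rewrite (OmegaE HK T_sol HD) !(frobmxM chL) (frobmxV chL) frobmx_comp.
by rewrite -expnS.
Qed.

(** Over [L] this matrix is the conjugate of [Omega^(q)] by [Theta^(p)], so [omega_value] gives the
    corner, and the gap makes the lower entries negligible. *)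
Lemma YK_value (i j : 'I_n) rho mB : (i < j)%N -> (j - i <= p.+1)%N ->
  (forall a b : 'I_n, (i <= a)%N -> (a < b)%N -> (b <= j)%N -> (a, b) != (i, j) -> r a b <= rho) ->
  0 <= mB -> (forall a b : 'I_n, (i <= a)%N -> (a < b)%N -> (b <= j)%N ->
    vge v (A a b) (- ((b - a)%:R * mB))) ->
  ((i.+1 < j)%N -> q%:R * rho + (j - i)%:R * mB < q%:R * r i j) ->
  YK i j != 0 /\ v (YK i j) = - (q%:R * r i j).
Proof.
move=> ij jip rho_ge mB0 A_mB gap; have [O0 Ov] := omega_value ij jip.
have Q0 : frobmx q Ome i j != 0 by rewrite mxE expf_neq0.
have Qv : w (frobmx q Ome i j) = - (q%:R * r i j) by rewrite mxE valX // Ov mulrN.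
have Tp_UT := Theta_p_UT HK T_UT.
have h : vgt w ((YK i j)%:A - frobmx q Ome i j) (- (q%:R * r i j)).
  have -> : (YK i j)%:A = (map_mx (in_alg L) YK) i j by rewrite [RHS]mxE.
  rewrite YK_L; apply: conj_lead => //; first exact: UT_inv.
    move=> a b ba; rewrite mxE (Omega_low HK A_UT T_UT T_sol HD) //.
    by rewrite expr0n gtn_eqF // expn_gt0 prime_gt0.
  move=> l l' il ll' l'j ne.
  have lj : (i.+1 < j)%N := proper_gap il ll' l'j ne.
  have bap : (l' - l <= p.+1)%N by apply: leq_trans jip; apply: leq_sub_chain.
  have [_ Ov'] := omega_value ll' bap.
  have T1 := Theta_p_inv_gr HK HL A_UT T_UT T_sol (@lmu_sup n mB i j mB0) A_mB il (leqnn _)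
    (leq_trans (ltnW ll') l'j).
  have T2 := Theta_p_gr HK HL A_UT T_UT T_sol (@lmu_sup n mB i j mB0) A_mB l'j
    (leq_trans il (ltnW ll')) (leqnn _).
  have T3 : vge w (frobmx q Ome l l') (- (q%:R * rho)).
    rewrite mxE -mulrN; apply: vgeX => //; right.
    by rewrite Ov' lerN2 rho_ge.
  apply: vgt_lt (vgeM Hw (vgeM Hw T1 T3) T2).
  rewrite /lmu; apply: (@YK_arith _ _ _ (l' - l)%:R) (gap lj); rewrite //.
  by rewrite -!natrD subn_chain.
have [n1 Yv] : (YK i j)%:A != 0 :> L /\ w (YK i j)%:A = w (frobmx q Ome i j).
  by apply: val_subl => //; rewrite Qv -opprB; apply: vgtN.
by move: n1 Yv; rewrite alg_eq0 => n1; rewrite (tg_ext HL) // Qv.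
Qed.

(** Blocks of length one are separate because they have no proper sub-block: the bound [rho] of the
    theorem is then -1, from the convention [rbr i i = -1], and the general argument needs
    [rho >= 0]. Here [d (S i j)] is exactly [lam * jm (d (A i j))]. *)
Lemma S_step1 (i j : 'I_n) R (jm : {rmorphism K -> K}) z lam : j = i.+1 :> nat -> (0 < R)%N ->
  jmap_spec p embk v t N R jm z lam ->
  SK p A N jm i j != 0 /\ v (SK p A N jm i j) = R%:R - q%:R * r i j.
Proof.
move=> E R0 Hj; have ij : (i < j)%N by rewrite E.
have jip : (j - i <= p.+1)%N by rewrite E subSnn.
have A0 := A_super E.
have [_ Om1] : Ome i j != 0 /\ w (Ome i j) = - (pathmax m i j)%:R.
  apply: (Omega_single HK HL A_UT T_UT T_sol HD A_pole ij A0).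
  by rewrite E; apply: single_step.
have [_ Om2] := omega_value ij jip.
have rE : r i j = (pathmax m i j)%:R by apply: oppr_inj; rewrite -Om1 -Om2.
have Pm : pathmax m i j = m i j by rewrite E; case: (single_step m i).
have [[E0 _]|[_ vA nd]] := A_pole ij; first by rewrite E0 eqxx in A0.
have [d0 vd] : dK embk v t (A i j) != 0 /\ v (dK embk v t (A i j)) = - (m i j)%:R.
  have [] := val_dK HK A0 (l := - (m i j)%:Z); first by rewrite vA rmorphN.
    by rewrite rpredN.
  by move=> d0 ->; rewrite rmorphN.
have dS : dK embk v t (SK p A N jm i j) = lam * jm (dK embk v t (A i j)).
  have := congr1 (fun M : 'M_n => M i j) (dSK HK A (N := N) Hj).
  rewrite mxE => ->; rewrite [LHS]mxE; congr (_ * _).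
  have -> : jm (dK embk v t (A i j)) = map_mx jm (map_mx (dK embk v t) A) i j by rewrite !mxE.
  apply/eqP; rewrite -subr_eq0; apply/eqP.
  have WU e : UT (frobmx p (WK p A e)).
    by apply: frobmx_UT; rewrite ?prime_gt0 //; apply: (WK_UT (pcharK HK)).
  apply: (@conj_diff _ _ (fun x => x = 0)) => //.
  - by move=> x y -> ->; rewrite addr0.
  - by apply: UT_inv; apply: WU.
  - move=> a b ba; rewrite !mxE; case: A_UT => a0 a1.
    move: ba; rewrite leq_eqVlt => /orP[/eqP/val_inj->|ba].
      by rewrite a1 (dK1 HK) rmorph0.
    by rewrite a0 // (dK0 HK) rmorph0.
  move=> l l' il ll' l'j ne; have := proper_gap il ll' l'j ne.
  by rewrite E ltnn.
have n1 : dK embk v t (SK p A N jm i j) != 0.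
  by rewrite dS mulf_neq0 ?fmorph_eq0 // (jm_lam0 Hj).
have v1 : v (dK embk v t (SK p A N jm i j)) = R%:R - q%:R * r i j.
  rewrite dS valM ?fmorph_eq0 ?(jm_lam0 Hj) // (jm_lam Hj) (jm_val Hj) // vd rE Pm.
  by rewrite mulrN.
rewrite -v1; apply: (val_dK_pr0 HK) => //; rewrite v1.
apply: vgt_lt (step_pr Hj (ltnW ij)); rewrite natrM /pmu -rE; apply: top_arith3 => //.
by rewrite ltr0n.
Qed.

Lemma S_final (i j : 'I_n) rho mB R (jm : {rmorphism K -> K}) z lam :
  (i < j)%N -> (j - i <= p.+1)%N ->
  (forall a b : 'I_n, (i <= a)%N -> (a < b)%N -> (b <= j)%N -> (a, b) != (i, j) ->
     r a b <= rho /\ rho + (\dim (blk i j))%:R^-1 <= r i j) ->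
  0 <= mB <= mA -> (forall a b : 'I_n, (i <= a)%N -> (a < b)%N -> (b <= j)%N ->
    vge v (A a b) (- ((b - a)%:R * mB))) ->
  q%:R * rho + (j - i)%:R * mB < R%:R -> (0 < R)%N ->
  jmap_spec p embk v t N R jm z lam ->
  [/\ SK p A N jm i j != 0, v (SK p A N jm i j) = R%:R - q%:R * r i j,
      YK i j != 0 & v (YK i j) = - (q%:R * r i j)].
Proof.
move=> ij jip rho_ge /andP[mB0 mBA] A_mB Rgap R0 Hj.
have rg (a b : 'I_n) : (i <= a)%N -> (a < b)%N -> (b <= j)%N -> (a, b) != (i, j) -> r a b <= rho.
  by move=> ia ab bj ne; case: (rho_ge a b ia ab bj ne).
have gap : (i.+1 < j)%N -> 0 <= rho /\ q%:R * rho + (j - i)%:R * mB < q%:R * r i j.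
  move=> ij1; have i1n : (i.+1 < n)%N by apply: ltn_trans (ltn_ord j).
  have ne : (i, Ordinal i1n) != (i, j) by apply: ne_left.
  have [h1 h2] := rho_ge i (Ordinal i1n) (leqnn _) (ltnSn _) (ltnW ij1) ne.
  split; first by apply: le_trans h1; apply: rbr_ge0.
  apply: gapN_arith4 mB0 mBA (ltW q_gt0) _ _ _ _ N_big (invdim_le (blk i j)) h2 => //.
    by rewrite ler_nat; apply: leq_trans (leq_subr _ _) (ltnW (ltn_ord j)).
  by rewrite ltr0n prime_gt0.
have [Y0 Yv] : YK i j != 0 /\ v (YK i j) = - (q%:R * r i j).
  by apply: YK_value rg mB0 A_mB _ => // /gap [].
suff [S0 Sv] : SK p A N jm i j != 0 /\ v (SK p A N jm i j) = R%:R - q%:R * r i j by [].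
have [E|ne] := eqVneq (j : nat) i.+1; first exact: S_step1 Hj.
have lt : (i.+1 < j)%N by rewrite ltn_neqAle eq_sym ne.
have [rho0 gap2] := gap lt; have [O0 Ov] := omega_value ij jip.
apply: (step_B ij jip _ rho0 rg Hj mB0 A_mB Rgap gap2 O0 Ov) => a b ia ab bj _.
by apply: omega_value => //; apply: leq_trans jip; apply: leq_sub_chain.
Qed.

End Values.

(** * The field K_R and transport along iota *)

Lemma dist_mod1 (q R i j : nat) (z : int) : coprime R q -> (i < q)%N -> (j < q)%N -> i != j ->
  i%:R * (- (R%:R / q%:R)) - j%:R * (- (R%:R / q%:R)) != z%:~R :> rat.
Proof.
move=> co iq jq; wlog ij : i j iq jq z / (i < j)%N => [H|] ne.
  have [lt|gt|E] := ltngtP i j; [exact: H| |by rewrite E eqxx in ne].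
  rewrite -[_ - _]opprB -[z]opprK rmorphN eqr_opp; apply: H => //.
  by rewrite eq_sym.
have q0 : 0 < q%:R :> rat by rewrite ltr0n; apply: leq_trans iq.
apply/eqP => h.
have {}h : ((j - i)%:Z * R%:Z) = z * q%:Z.
  apply: (@intr_inj rat); rewrite !rmorphM /= -h -subzn ?(ltnW ij) // rmorphB /=.
  by field; rewrite gt_eqF.
have : (q%:Z %| (j - i)%:Z * R%:Z)%Z by rewrite h dvdz_mull.
rewrite Gauss_dvdzl; last by rewrite /coprimez /gcdz /= gcdnC; move: co; rewrite /coprime => /eqP->.
by rewrite /dvdz /= => /dvdn_leq; rewrite subn_gt0 => /(_ ij); lia.
Qed.

Lemma vgen_eq (F : fieldType) (v : F -> rat) (S : F -> Prop) (d : rat) :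
  is_vgen v S d -> vgen v S = d.
Proof.
move=> Hd; have : is_vgen v S (vgen v S) by apply: epsilon_spec; exists d.
case: Hd => d0 [dz [x [Sx [x0 vx]]]] [e0 [ez [y [Sy [y0 vy]]]]].
have [z hz] := dz y Sy y0; have [z' hz'] := ez x Sx x0; rewrite vy in hz; rewrite vx in hz'.
have zz : z' * z = 1.
  apply: (@intr_inj rat); apply: (mulIf (lt0r_neq0 d0)).
  by rewrite rmorphM /= mul1r -mulrA -hz -hz'.
have z0 : 0 < z by move: e0; rewrite hz pmulr_lgt0 // ltr0z.
rewrite hz (_ : z = 1) ?mul1r //.
have : (z %| 1)%Z by apply/dvdzP; exists z'; rewrite zz.
by rewrite dvdz1 => /eqP; move: z0; clear; lia.
Qed.

Section KR.
Variables (p : nat) (k : closedFieldType) (K : fieldType) (embk : {rmorphism k -> K}).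
Variables (v : K -> rat) (t : K).
Hypothesis HK : laurent_field p embk v t.
Variables (Om : closedFieldType) (emb0 : {rmorphism K -> Om}) (vO : Om -> rat).
Hypotheses (vO_val : is_valuation vO).
Hypothesis vO_ext : forall a : K, a != 0 -> vO (emb0 a) = v a.
Hypothesis Om_alg : forall x : Om, exists P : {poly K}, P != 0 /\ root (map_poly emb0 P) x.
Variables (N R : nat).
Hypotheses (N_gt0 : (0 < N)%N) (R_gt0 : (0 < R)%N) (R_cop : coprime R p).
Let q := (p ^ N)%N.
Variables T tq tR : Om.
Hypothesis T_eq : T ^+ q + T ^+ q.-1 = emb0 t ^+ R.
Hypothesis tq_eq : tq ^+ q = emb0 t.
Hypothesis tR_eq : tR ^+ (q * R) = emb0 t ^+ R * (1 + T^-1)^-1.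
Hypothesis tR_cong : tR = tq \/ vO tq < vO (tR - tq).

Let pp := lf_prime HK.
Let chO : p \in [pchar Om]. Proof. exact: (rmorph_pchar emb0 (pcharK HK)). Qed.
Let chk := lf_pchar HK.
Let q_gt1 : (1 < q)%N. Proof. by rewrite -(exp1n N) ltn_exp2r // prime_gt1. Qed.
Let q_gt0 : (0 < q)%N. Proof. exact: ltnW. Qed.
Let qr_gt0 : 0 < q%:R :> rat. Proof. by rewrite ltr0n. Qed.
Let qr_neq0 : q%:R != 0 :> rat. Proof. by rewrite gt_eqF. Qed.
Let R_copq : coprime R q. Proof. by rewrite coprimeXr. Qed.

Let t_neq0 : emb0 t != 0. Proof. by rewrite fmorph_eq0 (lf_t_neq0 HK). Qed.
Let vt : vO (emb0 t) = -1. Proof. by rewrite vO_ext ?(lf_t_neq0 HK) // (lf_vt HK). Qed.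

Lemma T_neq0 : T != 0.
Proof.
apply/eqP => T0; have := T_eq; rewrite T0 !expr0n !gtn_eqF ?addr0 //; last by rewrite -ltnS prednK.
by move/eqP; rewrite eq_sym expf_eq0 (negPf t_neq0) andbF.
Qed.

Let TE : T ^+ q.-1 * (T + 1) = emb0 t ^+ R.
Proof. by rewrite mulrDr mulr1 -exprSr prednK. Qed.

Lemma vT : vO T = - (R%:R / q%:R).
Proof.
have T0 := T_neq0; have tR0 : emb0 t ^+ R != 0 by rewrite expf_neq0.
have one0 : vge vO (1 : Om) 0 by right; rewrite val1.
have vTn : vO T < 0.
  rewrite ltNge; apply/negP => h; have hT : vge vO T 0 by right.
  have : vge vO (emb0 t ^+ R) 0.
    by rewrite -TE; apply: vgeZl => //; [apply: vgeX0|apply: vgeD].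
  by move/(vgeE tR0); rewrite valX // vt mulrN1 oppr_ge0 lern0 -leqn0 leqNgt R_gt0.
have [s0 sv] : T + 1 != 0 /\ vO (T + 1) = vO T.
  by apply: val_addl => //; right; rewrite val1.
have := congr1 vO TE; rewrite valM ?expf_neq0 // sv !valX // vt.
have -> : q%:R = q.-1%:R + 1 :> rat by rewrite natr1 prednK.
have q1 : 0 <= q.-1%:R :> rat by rewrite ler0n.
move=> h; apply/eqP; rewrite -subr_eq0 opprK; apply/eqP; move: h q1.
set x := vO T; set a := q.-1%:R => h a0.
have -> : R%:R = - (a * x + x) by rewrite h mulrN1 opprK.
by field; rewrite gt_eqF // ltr_wpDl.
Qed.

Lemma tR_pow : tR ^+ R = T.
Proof.
apply: (exprp_inj chO (N := N)); rewrite -exprM mulnC tR_eq.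
have T0 := T_neq0.
have h : T ^+ q * (1 + T^-1) = emb0 t ^+ R.
  by rewrite -T_eq mulrDr mulr1; congr (_ + _); rewrite -{1}(prednK q_gt0) exprSr mulfK.
have n0 : 1 + T^-1 != 0.
  by apply: contra_eq_neq h => ->; rewrite mulr0 eq_sym expf_neq0.
by rewrite -h mulfK.
Qed.

Lemma tR_neq0 : tR != 0.
Proof. by apply: contraNneq T_neq0 => E; rewrite -tR_pow E expr0n gtn_eqF. Qed.

Lemma v_tR : vO tR = - q%:R^-1.
Proof.
have := congr1 vO tR_pow; rewrite valX ?tR_neq0 // vT => h.
have R0 : R%:R != 0 :> rat by rewrite pnatr_eq0 -lt0n.
by apply: (mulfI R0); rewrite h mulrN.
Qed.

Let tq_neq0 : tq != 0.
Proof. by apply: contraNneq t_neq0 => E; rewrite -tq_eq E expr0n gtn_eqF. Qed.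

(* [eta] is the R-th root of [1 + T^-1] congruent to 1, with [t = tR^q eta]. *)
Definition eta : Om := emb0 t / tR ^+ q.

Lemma eta_pow : eta ^+ R = 1 + tR ^- R.
Proof.
have T0 := T_neq0; have n0 : tR ^+ (q * R) != 0 by rewrite expf_neq0 // tR_neq0.
have u0 : 1 + T^-1 != 0.
  by apply: contraNneq n0 => E; rewrite tR_eq E invr0 mulr0.
rewrite /eta expr_div_n -exprM tR_eq tR_pow invfM invrK mulrA divff ?mul1r //.
by rewrite expf_neq0.
Qed.

Lemma eta_cong : vgt vO (eta - 1) 0.
Proof.
have h : vgt vO (tq / tR - 1) 0.
  have -> : tq / tR - 1 = - ((tR - tq) / tR).
    by rewrite mulrBl divff ?tR_neq0 // opprB.
  apply: vgtN => //; case: tR_cong => [->|lt]; first by rewrite subrr mul0r; left.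
  have [d0|d0] := eqVneq (tR - tq) 0; first by rewrite d0 mul0r; left.
  have E : vO tR = vO tq.
    have := @val_addl _ _ vO_val tq (tR - tq) tq_neq0; rewrite [tq + _]addrC subrK.
    by case; [right|].
  by right; rewrite val_div ?tR_neq0 // subr_gt0 E.
have -> : eta - 1 = (tq / tR - 1) ^+ q.
  by rewrite (exprpB chO) expr1n expr_div_n tq_eq.
by have := vgtX vO_val q_gt0 h; rewrite mulr0.
Qed.

Let Tpw (i : 'I_q) : Om := T ^+ i.
(** A concrete model of [K(T)]: since [R] is prime to [q], the first [q] powers of [T] have
    valuations distinct modulo the integers, and completeness is an instance of [comb_complete]. *)
Definition KR (y : Om) : Prop := exists x : 'I_q -> K, y = comb emb0 Tpw x.

Let Tpw_neq0 i : Tpw i != 0. Proof. by rewrite expf_neq0 // T_neq0. Qed.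
Let Tpw_dist (i j : 'I_q) : i != j -> forall z : int, vO (Tpw i) - vO (Tpw j) != z%:~R.
Proof.
by move=> ij z; rewrite !valX ?T_neq0 // vT; apply: dist_mod1 => //; apply: ltn_ord.
Qed.

Lemma KR_complete : v_complete vO KR.
Proof.
exact: (comb_complete vO_val (lf_int HK) vO_ext Tpw_neq0 Tpw_dist (lf_complete HK)).
Qed.

Lemma KR_sub0 x y : KR x -> KR y -> KR (x - y).
Proof. by move=> [a ->] [b ->]; exists (fun i => a i - b i); rewrite combB. Qed.

Lemma KR0 : KR 0.
Proof. by exists (fun _ => 0); rewrite /comb big1 // => i _; rewrite rmorph0 mul0r. Qed.

Lemma KRD x y : KR x -> KR y -> KR (x + y).
Proof.
move=> hx hy; rewrite -[y]opprK; apply: KR_sub0 => //.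
by rewrite -sub0r; apply: KR_sub0 => //; apply: KR0.
Qed.

Lemma KR_mono a i : KR (emb0 a * T ^+ i).
Proof.
have [g] := ubnP i; elim: g i a => // g IH i a ig.
have [iq|qi] := ltnP i q.
  exists (fun l : 'I_q => if l == Ordinal iq then a else 0).
  rewrite /comb (bigD1 (Ordinal iq)) //= eqxx big1 ?addr0 // => l /negPf ->.
  by rewrite rmorph0 mul0r.
have -> : emb0 a * T ^+ i = emb0 (a * t ^+ R) * T ^+ (i - q) - emb0 a * T ^+ (i.-1).
  have Tq : T ^+ q = emb0 t ^+ R - T ^+ q.-1 by rewrite -T_eq addrK.
  rewrite -{1}(subnKC qi) exprD Tq rmorphM rmorphXn mulrBl mulrBr mulrA; congr (_ - _).
  by rewrite -exprD; congr (_ * _ ^+ _); move: qi q_gt0; clear; lia.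
apply: KR_sub0; apply: IH; move: ig qi q_gt0; clear; lia.
Qed.

Lemma KR_emb a : KR (emb0 a). Proof. by have := KR_mono a 0; rewrite expr0 mulr1. Qed.
Lemma KR_T : KR T. Proof. by have := KR_mono 1 1; rewrite rmorph1 mul1r expr1. Qed.

Lemma KR_sum (I : Type) (s : seq I) (G : I -> Om) :
  (forall i, KR (G i)) -> KR (\sum_(i <- s) G i).
Proof. by move=> h; apply: (big_ind KR) => //; [exact: KR0|exact: KRD]. Qed.

Lemma KRM x y : KR x -> KR y -> KR (x * y).
Proof.
move=> [a ->] [b ->]; rewrite /comb mulr_suml; apply: KR_sum => i.
rewrite mulr_sumr; apply: KR_sum => j; rewrite /Tpw mulrACA -rmorphM -exprD.
exact: KR_mono.
Qed.

Lemma KRX x m : KR x -> KR (x ^+ m).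
Proof.
move=> h; elim: m => [|m IH]; first by rewrite expr0 -(rmorph1 emb0); apply: KR_emb.
by rewrite exprS; apply: KRM.
Qed.

(** An algebraic relation for [x], divided by powers of [X] until its constant term is nonzero,
    expresses the inverse as a polynomial in [x]. *)
Lemma KR_inv x : KR x -> KR x^-1.
Proof.
move=> hx; have [->|x0] := eqVneq x 0; first by rewrite invr0; apply: KR0.
have [P [P0 /rootP Px]] := Om_alg x.
have [g] := ubnP (size P); elim: g P P0 Px => // g IH P P0 Px sg.
have [c0|c0] := eqVneq P`_0 0.
  have [Q E] : exists Q, P = Q * 'X.
    have : root P 0 by rewrite rootE horner_coef0 c0.
    by move/factor_theorem => [Q ->]; exists Q; rewrite subr0.
  have Q0 : Q != 0 by apply: contraNneq P0 => Q0; rewrite E Q0 mul0r.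
  apply: (IH Q) => //.
    move: Px; rewrite E rmorphM /= hornerM map_polyX hornerX => /eqP.
    by rewrite mulf_eq0 (negPf x0) orbF => /eqP.
  by move: sg; rewrite E size_mulX.
have sP : (0 < size P)%N by rewrite lt0n size_poly_eq0.
have : emb0 P`_0 + x * \sum_(i < (size P).-1) emb0 P`_i.+1 * x ^+ i = 0.
  rewrite -[RHS]Px (@horner_coef_wide _ (size P).-1.+1); last by rewrite size_map_poly prednK.
  rewrite big_ord_recl coef_map expr0 mulr1.
  congr (_ + _); rewrite mulr_sumr; apply: eq_bigr => i _.
  by rewrite coef_map /= exprS mulrCA.
set s := \sum_(i < _) _ => /eqP; rewrite addr_eq0 => /eqP h.
have e0 : emb0 P`_0 != 0 by rewrite fmorph_eq0.
have -> : x^-1 = - (emb0 (P`_0)^-1 * s).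
  apply: (mulfI x0); rewrite divff // mulrN mulrCA fmorphV.
  by rewrite -[x * s]opprK -h mulrN mulVf // opprK.
rewrite -sub0r; apply: KR_sub0; first exact: KR0.
apply: KRM; first exact: KR_emb.
by apply: KR_sum => i; apply: KRM; [apply: KR_emb|apply: KRX].
Qed.

Lemma KR_subfield : is_subfield KR.
Proof.
split; first exact: KR0.
split; first by rewrite -(rmorph1 emb0); apply: KR_emb.
split; last exact: KR_inv.
by move=> x y hx hy; split; [apply: KR_sub0|apply: KRM].
Qed.

(** Completeness provides a root of [1 + T^-1] congruent to 1 inside the field, and such a root is
    unique. *)
Lemma KR_eta : KR eta.
Proof.
have T0 := T_neq0.
have vTi : 0 < vO T^-1 by rewrite valV // vT opprK divr_gt0 ?ltr0n.
have [z [zS zR z1]] := root1D_exists chO vO_val KR_subfield KR_complete R_cop R_gt0 vTi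
  (KR_inv KR_T) (vge_val vO T^-1).
suff -> : eta = z by [].
apply: (root1D_uniq chO vO_val R_cop R_gt0) => //; first exact: eta_cong.
  exact: vgt_lt z1.
by rewrite eta_pow zR tR_pow.
Qed.

(** Bezout: with [a R = 1 + b q], the element [tR] is the quotient of [tR ^+ (R a) = T ^+ a] by a
    power of [tR ^+ q = t / eta]. *)
Lemma KR_tR : KR tR.
Proof.
have /(coprimeP _ R_gt0) [[a b] /= ab] : coprime R q by [].
have nz m : tR ^+ m != 0 by rewrite expf_neq0 // tR_neq0.
have tqE : tR ^+ q = emb0 t / eta.
  rewrite /eta invfM invrK mulrA divff ?mul1r //.
have -> : tR = T ^+ a / (emb0 t / eta) ^+ b.
  rewrite -tqE -tR_pow -!exprM; apply: (mulIf (nz (q * b)%N)); rewrite mulfVK //.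
  by rewrite -exprS; congr (_ ^+ _); move: ab; clear; lia.
apply: KRM; first by apply: KRX; apply: KR_T.
apply: KR_inv; apply: KRX; apply: KRM; [exact: KR_emb|apply: KR_inv; exact: KR_eta].
Qed.

Lemma vgen_KR : vgen vO (gen_subfield emb0 T) = q%:R^-1.
Proof.
apply: vgen_eq; split; first by rewrite invr_gt0.
split.
  move=> x hx x0; have [c E] := hx KR KR_subfield KR_emb KR_T.
  have [i0 ci0] : exists i, c i != 0.
    apply: NNPP => no; case/negP: x0; rewrite E /comb big1 // => i _.
    have [->|ci] := eqVneq (c i) 0; first by rewrite rmorph0 mul0r.
    by case: no; exists i.
  have [l [cl _ vl _]] := comb_lead vO_val (lf_int HK) vO_ext Tpw_neq0 Tpw_dist ci0.
  have [z hz] := lf_int HK cl.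
  exists (z * q%:Z - l%:Z * R%:Z).
  rewrite E vl valM ?fmorph_eq0 // vO_ext // valX ?T_neq0 // vT hz rmorphB !rmorphM /=.
  by field.
have /(coprimeP _ R_gt0) [[a b] /= ab] : coprime R q by [].
exists (T ^- a * emb0 t ^+ b); split; last first.
  have T0 := T_neq0; rewrite mulf_neq0 ?invr_neq0 ?expf_neq0 //; split=> //.
  rewrite valM ?invr_neq0 ?expf_neq0 // valV ?expf_neq0 // !valX // vt vT.
  have -> : - (a%:R * - (R%:R / q%:R)) + b%:R * -1 = ((a * R)%:R - (b * q)%:R) / q%:R :> rat.
    by rewrite !natrM; field.
  have le : (b * q <= a * R)%N by move: ab; clear; lia.
  by rewrite -natrB // ab mul1r.
move=> S S_sub SK ST; have [S0 [S1 [SB SV]]] := S_sub.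
by apply: (subM S_sub); [apply: SV; apply: (subX S_sub)|apply: (subX S_sub)].
Qed.

Lemma qroot_pow a : qroot q a ^+ q = a :> k.
Proof.
apply: (epsilon_spec (inhabits (0 : k)) (fun b => b ^+ q = a)).
have [x xE] := solve_monicpoly (fun i => if i == 0%N then a else 0) q_gt0; exists x.
rewrite xE (bigD1 (Ordinal q_gt0)) //= expr0 mulr1 big1 ?addr0 // => i.
by rewrite -val_eqE /= => /negPf->; rewrite mul0r.
Qed.

Let pk_inj (a b : k) : a ^+ q = b ^+ q -> a = b. Proof. exact: (exprp_inj chk (N := N)). Qed.

Definition qrootm : {rmorphism k -> k}.
apply: (@mk_rmorph _ _ (qroot q)).
- abstract (by move=> a b; apply: pk_inj; rewrite (exprpB chk) !qroot_pow).
- abstract (by apply: pk_inj; rewrite qroot_pow expr1n).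
- abstract (by move=> a b; apply: pk_inj; rewrite exprMn !qroot_pow).
Defined.

Let phi : {rmorphism k -> Om} := emb0 \o (embk \o qrootm).

Let phi_in a : KR (phi a). Proof. exact: KR_emb. Qed.
Let phi_ge a : vge vO (phi a) 0.
Proof.
have [->|a0] := eqVneq a 0; first by rewrite rmorph0; left.
have b0 : qrootm a != 0 by rewrite fmorph_eq0.
by right; rewrite /= vO_ext ?fmorph_eq0 // (lf_unit HK).
Qed.
Let v_tR_lt0 : vO tR < 0. Proof. by rewrite v_tR oppr_lt0 invr_gt0. Qed.

(** Convertible to [iotaR] as a function, which [WmxE] relies on; as a morphism it commutes with the
    matrix operations. *)
Definition iota : {rmorphism K -> Om} :=
  lhom HK vO_val KR_subfield KR_complete phi_in phi_ge KR_tR tR_neq0 v_tR_lt0.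

Lemma iota_lmono a l : iota (lmono embk t a l) = emb0 (embk (qroot q a)) * tR ^ (- l).
Proof. exact: (lhom_lmono HK vO_val KR_subfield KR_complete phi_in phi_ge KR_tR tR_neq0 v_tR_lt0). Qed.

Lemma val_iota x : x != 0 -> vO (iota x) = v x / q%:R.
Proof.
move=> x0; rewrite (val_lhom HK vO_val KR_subfield KR_complete phi_in phi_ge KR_tR tR_neq0 v_tR_lt0) //.
by rewrite v_tR opprK mulrC.
Qed.

Lemma iota_embk a : iota (embk a) = emb0 (embk (qroot q a)).
Proof.
have -> : embk a = lmono embk t a 0 by rewrite /lmono oppr0 expr0z mulr1.
by rewrite iota_lmono oppr0 expr0z mulr1.
Qed.

Lemma iota_t : iota t = tR.
Proof.
have -> : t = lmono embk t 1 (-1) by rewrite /lmono rmorph1 mul1r opprK expr1z.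
rewrite iota_lmono opprK expr1z (_ : qroot q 1 = 1) ?rmorph1 ?mul1r //.
exact: (rmorph1 qrootm).
Qed.

Lemma vge_iota x r : vge v x r -> vge vO (iota x) (r / q%:R).
Proof.
have [->|x0] := eqVneq x 0; first by rewrite rmorph0; left.
by move/(vgeE x0) => h; right; rewrite val_iota // ler_pM2r ?invr_gt0.
Qed.

(** Uniqueness of the root gives [iota z = eta], so [iota] sends [t ^+ q * z] to
    [tR ^+ q * eta = t]. The perturbed Frobenius is thus the inclusion of [K] seen through
    [iota]. *)
Lemma iota_jmap (jm : {rmorphism K -> K}) z lam : jmap_spec p embk v t N R jm z lam ->
  forall x, iota (jm x) = emb0 x.
Proof.
move=> Hj.
have iz : iota z = eta.
  apply: (root1D_uniq chO vO_val R_cop R_gt0); last first.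
  - by rewrite -rmorphXn (jm_z Hj) rmorphD rmorph1 fmorphV rmorphXn iota_t eta_pow.
  - exact: eta_cong.
  rewrite -(rmorph1 iota) -rmorphB; apply: vgt_lt (vge_iota (jm_z1 Hj)).
  by rewrite divr_gt0 // ltr0n.
suff h x : iota (jm x) - emb0 x = 0 by move=> x; apply/eqP; rewrite -subr_eq0 h.
apply: (laurent_eq0 HK vO_val (h := fun x => iota (jm x) - emb0 x) (C := 0) _ ltr01) => {x}.
- by move=> x y; rewrite !rmorphD; ring.
- move=> x r hx; rewrite mul1r addr0; have [->|x0] := eqVneq x 0.
    by rewrite !rmorph0 subr0; left.
  have rx := vgeE x0 hx; apply: vgeB => //; right; last by rewrite vO_ext.
  by rewrite val_iota ?fmorph_eq0 // (jm_val Hj) // mulrAC divff // mul1r.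
move=> a l; rewrite (jm_mono Hj) rmorphM iota_embk fmorphXz rmorphM rmorphXn iota_t iz.
have -> : qroot q (a ^+ q) = a by apply: pk_inj; rewrite qroot_pow.
have -> : tR ^+ q * eta = emb0 t by rewrite /eta mulrCA divff ?mulr1 // expf_neq0 // tR_neq0.
by rewrite /lmono rmorphM fmorphXz subrr.
Qed.

Definition a1c : Om := emb0 (embk R%:R^-1) * tR ^- R.

Let Rk_neq0 : (R%:R : k) != 0.
Proof. by rewrite -(dvdn_pcharf chk) -prime_coprime // coprime_sym. Qed.

Lemma a1c_val : a1c != 0 /\ vO a1c = R%:R / q%:R.
Proof.
have r0 : (R%:R^-1 : k) != 0 by rewrite invr_neq0.
have c0 : embk R%:R^-1 != 0 by rewrite fmorph_eq0.
have t0 : tR ^+ R != 0 by rewrite expf_neq0 // tR_neq0.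
split; first by rewrite mulf_neq0 ?invr_neq0 // fmorph_eq0.
rewrite /a1c.
have e0 : emb0 (embk R%:R^-1) != 0 by rewrite fmorph_eq0.
rewrite valM ?invr_neq0 // vO_ext // (lf_unit HK) // add0r.
by rewrite valV // tR_pow vT opprK.
Qed.

(** On monomials, the [q]-th power undoes the root taken on coefficients and turns [tR ^ (- l)] into
    [tR ^ (- q l)]; the factor [- l] is the one introduced by [dK], and [R^-1 * tR ^- R] is common
    to all terms. *)
Lemma a1E a : a1 embk v t emb0 vO q R tR a = a1c * iota (dK embk v t a) ^+ q.
Proof.
pose g (l : int) (x : k) : Om := emb0 (embk (x * ((- l)%:~R / R%:R))) * tR ^ (- (q%:Z * l) - R%:Z).
have tR0 := tR_neq0.
have gS l x : KR (g l x).
  apply: KRM; first exact: KR_emb.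
  case: (- _ - _) => m; first by apply: KRX; apply: KR_tR.
  by rewrite NegzE -exprnN; apply: KR_inv; apply: KRX; apply: KR_tR.
have gD l x y : g l (x + y) = g l x + g l y by rewrite /g mulrDl !rmorphD mulrDl.
have g_ge l x : vge vO (g l x) (1 * l%:~R + R%:R / q%:R).
  rewrite -[X in vge _ _ X]add0r; apply: vgeM => //.
    set y := x * _; have [->|y0] := eqVneq y 0; first by rewrite !rmorph0; left.
    by right; rewrite vO_ext ?fmorph_eq0 // (lf_unit HK).
  right; rewrite valXz // v_tR rmorphB rmorphN rmorphM /= mul1r le_eqVlt; apply/orP; left.
  by apply/eqP; field.
have [c0 vc] := a1c_val.
suff h x : lsum embk v t vO g x - a1c * iota (dK embk v t x) ^+ q = 0.
  by apply/eqP; rewrite -subr_eq0; apply/eqP; exact: (h a).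
apply: (laurent_eq0 HK vO_val
  (h := fun x => lsum embk v t vO g x - a1c * iota (dK embk v t x) ^+ q)
  (C := R%:R / q%:R) _ ltr01) => {x}.
- move=> x y; rewrite (lsumD HK vO_val KR_subfield KR_complete ltr01 gS gD g_ge).
  by rewrite (dKD HK) rmorphD (exprpD chO) mulrDr opprD addrACA.
- move=> x r hx; apply: vgeB => //.
    exact: (lsum_ge HK vO_val KR_subfield KR_complete ltr01 gS gD g_ge).
  rewrite addrC; apply: vgeM => //; first by right; rewrite vc.
  have := vgeX vO_val q (vge_iota (dK_ge HK hx)).
  by rewrite mulrCA divff // mulr1 mul1r.
move=> x l; rewrite (lsum_lmono HK vO_val KR_subfield KR_complete ltr01 gS gD g_ge).
rewrite (dK_lmono HK) iota_lmono exprMn -!rmorphXn qroot_pow /g /a1c !rmorphM /=.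
apply/eqP; rewrite subr_eq0; apply/eqP.
have -> : tR ^ (- (q%:Z * l) - R%:Z) = (tR ^ (- l)) ^+ q * tR ^- R.
  rewrite expfzDr // exprnN; congr (_ * _).
  by rewrite [RHS]exprnP exprz_exp mulNr mulrC.
by rewrite !fmorphV; ring.
Qed.

Section Matrices.
Variables (n : nat) (A : 'M[K]_n).

Lemma WmxE e : Wmx embk v t emb0 vO p A q tR e = map_mx iota (WK p A e).
Proof.
elim: e => [|e IH]; first by symmetry; apply: (map_mx1 iota).
have -> : WK p A e.+1 = frobmx (p ^ e) A *m WK p A e by [].
rewrite (map_mxM iota) (map_frobmx iota) -IH.
by [].
Qed.

Lemma SRE (jm : {rmorphism K -> K}) z lam : jmap_spec p embk v t N R jm z lam ->
  SR embk v t emb0 vO p A q tR N = map_mx iota (SK p A N jm).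
Proof.
move=> Hj; rewrite /SR !WmxE /SK /SW map_mxB map_mx1 !map_mxM map_invmx !map_frobmx.
congr (_ *m _ *m _ - _); apply/matrixP => a b; rewrite !mxE.
by rewrite (iota_jmap Hj).
Qed.

Lemma s1E (i j : 'I_n) : UT A -> s1 embk v t emb0 vO p A q R tR N i j =
  a1c * iota ((invmx (frobmx p (WK p A N)) *m frobmx q (map_mx (dK embk v t) A)
               *m frobmx p (WK p A N.-1)) i j).
Proof.
move=> A_UT; have chK := pcharK HK.
have WU e : UT (WK p A e) by apply: (WK_UT chK).
set W := WK p A N; set W' := WK p A N.-1; have [w0 _] := UT_inv (WU N); have [w0' _] := WU N.-1.
have -> : s1 embk v t emb0 vO p A q R tR N i j =
  \sum_(i' : 'I_n | (i <= i')%N) \sum_(j' : 'I_n | (i' < j')%N && (j' <= j)%N)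
    a1c * iota ((invmx W i i') ^+ p * (dK embk v t (A i' j') ^+ q) * (W' j' j) ^+ p).
  apply: eq_bigr => i' _; apply: eq_bigr => j' _.
  rewrite a1E !WmxE -map_invmx !mxE !rmorphM !rmorphXn; ring.
rewrite -(frobmxVp chK) mxE rmorph_sum mulr_sumr.
under [RHS]eq_bigr => j' _ do rewrite mxE mulr_suml rmorph_sum mulr_sumr.
rewrite [RHS]exchange_big [LHS]big_mkcond; apply: eq_bigr => i' _.
case: leqP => ii'; last first.
  rewrite big1 // => j' _; rewrite !mxE w0 // expr0n gtn_eqF ?prime_gt0 //.
  by rewrite !mul0r rmorph0 mulr0.
rewrite big_mkcond; apply: eq_bigr => j' _; rewrite !mxE.
case: ifP => // h; have [lt|ge] := ltnP i' j'.
  have jj : (j < j')%N by rewrite ltnNge; apply: contraFN h => ->; rewrite lt.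
  by rewrite w0' // expr0n gtn_eqF ?prime_gt0 // mulr0 rmorph0 mulr0.
have -> : dK embk v t (A i' j') = 0.
  case: A_UT => a0 a1; move: ge; rewrite leq_eqVlt => /orP[/eqP/val_inj->|lt].
    by rewrite a1 (dK1 HK).
  by rewrite a0 // (dK0 HK).
by rewrite expr0n gtn_eqF // mulr0 mul0r rmorph0 mulr0.
Qed.

Lemma KR_values (i j : 'I_n) (jm : {rmorphism K -> K}) z lam (r : rat) : UT A ->
  jmap_spec p embk v t N R jm z lam ->
  let Y := (invmx (frobmx p (WK p A N)) *m frobmx q (map_mx (dK embk v t) A)
            *m frobmx p (WK p A N.-1)) i j in
  [/\ SK p A N jm i j != 0, v (SK p A N jm i j) = R%:R - q%:R * r,
      Y != 0 & v Y = - (q%:R * r)] ->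
  let vKR := nval vO (gen_subfield emb0 T) in
  let s := SR embk v t emb0 vO p A q tR N i j in
  let s' := s1 embk v t emb0 vO p A q R tR N i j in
  s != 0 /\ s' != 0 /\ vKR s = - q%:R * r + R%:R /\ vKR s' = - q%:R * r + R%:R.
Proof.
move=> A_UT Hj Y [S0 Sv Y0 Yv] vKR s s'.
have sE : s = iota (SK p A N jm i j) by rewrite /s (SRE Hj) [LHS]mxE.
have s'E : s' = a1c * iota Y by rewrite /s' s1E.
have [c0 vc] := a1c_val.
rewrite /vKR /nval vgen_KR invrK sE s'E mulf_neq0 ?fmorph_eq0 //.
split=> //; split=> //; split.
  by rewrite val_iota // Sv divfK // mulNr addrC.
by rewrite valM ?fmorph_eq0 // vc val_iota // Yv -mulrDl divfK // mulNr addrC.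
Qed.

End Matrices.
End KR.

(** * Degenerate cases, pole orders and the conclusion *)

Lemma maxl_ge (s : seq rat) x : x \in s -> x <= maxl s.
Proof.
rewrite /maxl; move: (head 0 s) => c; elim: s => //= a s IH; rewrite inE => /orP[/eqP->|/IH h].
  by rewrite le_max lexx.
by rewrite le_max h orbT.
Qed.

Lemma maxl_le (s : seq rat) c : 0 <= c -> (forall x, x \in s -> x <= c) -> maxl s <= c.
Proof.
move=> c0 h; rewrite /maxl.
have : head 0 s <= c by case: s h => //= a s h; apply: h; rewrite inE eqxx.
move: (head 0 s) => d dc; elim: s h => //= a s IH h.
rewrite ge_max h ?inE ?eqxx //= IH // => x xs.
by apply: h; rewrite inE xs orbT.
Qed.

Lemma maxl_ge0 (s : seq rat) : (forall x, x \in s -> 0 <= x) -> 0 <= maxl s.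
Proof.
case: s => [|a s] h; first by rewrite /maxl /=.
by apply: le_trans (maxl_ge (mem_head a s)); apply: h; rewrite mem_head.
Qed.

Section Degenerate.
Variables (k K : fieldType) (embk : {rmorphism k -> K}) (v : K -> rat).

(* [v 0] is a junk value, so [v t = -1] does not by itself exclude [t = 0]. *)
Lemma expands_t0 x (c : int -> k) : expands embk v 0 x c -> x = embk (c 0).
Proof.
move=> [l0 [c0 h]]; apply/eqP; rewrite -subr_eq0; apply/eqP; apply: (vge_all_eq0 (v := v)) => M.
have mono (l : int) : embk (c l) * 0 ^ (- l) = if l == 0 then embk (c 0) else 0.
  case: eqP => [->|/eqP l0']; first by rewrite oppr0 expr0z mulr1.
  by rewrite exp0rz oppr_eq0 (negPf l0') mulr0.
pose m := `|(Num.floor (M - l0%:~R) + 1)%R|%N.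
have mM : M <= (l0 + m%:Z)%:~R.
  rewrite rmorphD /= -lerBlDl; apply: le_trans (ltW (floorD1_gt _)) _.
  by rewrite ler_int /m; apply: lez_abs.
pose m' := (m + `|l0|.+1)%N.
suff E : \sum_(i < m') embk (c (l0 + i%:Z)) * 0 ^ (- (l0 + i%:Z)) = embk (c 0).
  have := h m'; rewrite E; apply: vge_le.
  by apply: le_trans mM _; rewrite ler_int /m'; lia.
have [lpos|lneg] := ltP 0 l0.
  rewrite c0 // rmorph0 big1 // => i _; rewrite mono c0 // rmorph0.
  by case: ifP.
have lm : (`|l0| < m')%N by rewrite /m' addnS ltnS leq_addl.
rewrite (bigD1 (Ordinal lm)) //= mono.
have -> : l0 + `|l0|%N%:Z == 0 by lia.
rewrite big1 ?addr0 // => i; rewrite -val_eqE /= => il; rewrite mono.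
by have -> : (l0 + i%:Z == 0) = false by lia.
Qed.
End Degenerate.

(** With [t = 0] every element would equal its coefficient of index 0, which vanishes for the
    entries of [A] above the diagonal. Then [A = 1], the entries of Theta lie in the prime field and
    [L] is trivial. *)
Lemma t_neq0_of_wild (p : nat) (k K : fieldType) (embk : {rmorphism k -> K}) (v : K -> rat) (t : K)
    (L : splittingFieldType K) (n : nat) (A : 'M[K]_n) (Theta : 'M[L]_n) :
  prime p -> p \in [pchar k] ->
  (forall x : K, exists c : int -> k, expands embk v t x c) ->
  (p %| \dim {:L})%N -> UT A ->
  (forall (i j : 'I_n) (l : int), (i < j)%N -> ((p%:Z %| l)%Z || (0 <= l)) ->
     coef embk v t (A i j) l = 0) ->
  frobmx p Theta *m map_mx (in_alg L) A = Theta -> Lsub Theta 0 n.-1 = fullv -> t != 0.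
Proof.
move=> pp chk K_exp wild A_UT A_coef T_sol L_gen; apply/eqP => t0.
have A1 : A = 1%:M.
  have [a0 a1] := A_UT; apply/matrixP => i j; rewrite mxE.
  have [E|ne] := eqVneq i j; first by rewrite E a1.
  have [lt|ge] := ltnP i j; last by rewrite a0 // ltn_neqAle ge eq_sym ne.
  have : expands embk v t (A i j) (coef embk v t (A i j)).
    by apply: epsilon_spec; apply: K_exp.
  have := A_coef i j 0 lt; rewrite dvdz0 /= => /(_ isT); move: (coef _ _ _ _) => c c0.
  by rewrite t0 => /expands_t0 ->; rewrite c0 rmorph0.
have chL : p \in [pchar L].
  exact: (rmorph_pchar (in_alg L) (rmorph_pchar embk chk)).
have L1 : ({:L} <= 1)%VS.
  rewrite -L_gen; apply/(@Fadjoin_seqP _ _ 1%AS); split=> // x /mapP [ab _ ->].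
  have [m ->] : exists m : nat, Theta ab.1 ab.2 = m%:R.
    apply: (frob_fixed chL); have := congr1 (fun M : 'M_n => M ab.1 ab.2) T_sol.
    by rewrite A1 map_mx1 mulmx1 mxE.
  exact: rpred_nat.
have : \dim {:L} = 1%N.
  apply/eqP; rewrite eqn_leq; apply/andP; split; last exact: (adim_gt0 {:L}%AS).
  by have := dimvS L1; rewrite dimv1.
by move=> E; move: wild; rewrite E dvdn1 gtn_eqF // prime_gt1.
Qed.

Section PoleOrders.
Variables (p : nat) (k K : fieldType) (embk : {rmorphism k -> K}).
Variables (v : K -> rat) (t : K).
Hypothesis HK : laurent_field p embk v t.
Variables (n0 : nat).
Local Notation n := n0.+1.
Variable A : 'M[K]_n.
Hypothesis A_coef : forall (i j : 'I_n) (l : int), (i < j)%N ->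
  ((p%:Z %| l)%Z || (0 <= l)) -> coef embk v t (A i j) l = 0.

(** Indexed by natural numbers to feed [pathmax]; zero entries are treated apart because [v 0] is a
    junk value. *)
Definition pole_order (a b : nat) : nat :=
  if A (inord a) (inord b) == 0 then 0 else `|Num.floor (v (A (inord a) (inord b)))|%N.

Lemma pole_orderP : pole_orders p v A pole_order.
Proof.
move=> a b ab; rewrite /pole_order !inord_val.
have [->|A0] := eqVneq (A a b) 0; [by left|right; split=> //].
  have [l vl] := lf_int HK A0; rewrite vl intrKfloor.
  have [l0 _] : l < 0 /\ ~~ (p%:Z %| l)%Z.
    apply/andP; rewrite -[l < 0]negbK -leNgt -negb_or orbC.
    apply/negP => h; have c0 := A_coef ab h.
    have hl : vge v (A a b) l%:~R by right; rewrite vl.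
    have [_ /(_ 1%N)] := lcoef_at HK hl.
    rewrite /ltrunc big_ord1 addr0 c0 /lmono rmorph0 mul0r subr0 => /(vgeE A0).
    by rewrite vl ler_int; lia.
  have E : l = - `|l|%N%:Z by move: l0; clear; lia.
  by rewrite {1}E rmorphN.
have [l vl] := lf_int HK A0; rewrite vl intrKfloor.
apply/negP => pl; have pl' : (p%:Z %| l)%Z by rewrite /dvdz.
have c0 := A_coef (l := l) ab; rewrite pl' /= in c0; have {}c0 := c0 isT.
have hl : vge v (A a b) l%:~R by right; rewrite vl.
have [_ /(_ 1%N)] := lcoef_at HK hl.
rewrite /ltrunc big_ord1 addr0 c0 /lmono rmorph0 mul0r subr0 => /(vgeE A0).
by rewrite vl ler_int; lia.
Qed.

Let mem_mA (a b : nat) x : x \in [seq - v (A lm.1 lm.2) / ((lm.2 : nat) - lm.1)%:R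
    | lm <- pairs_in n a b & A lm.1 lm.2 != 0] <->
  exists c d : 'I_n, [/\ (a <= c)%N, (c < d)%N, (d <= b)%N, A c d != 0 &
    x = - v (A c d) / (d - c)%:R].
Proof.
split=> [/mapP [[c d]]|[c [d [ac cd db A0 ->]]]].
  rewrite mem_filter mem_pairs_in /= => /and4P[A0 ac cd db] ->.
  by exists c, d.
apply/mapP; exists (c, d) => //; rewrite mem_filter A0 mem_pairs_in ac cd db //.
Qed.

Lemma mAab_ge0 a b : 0 <= mAab v A a b.
Proof.
apply: maxl_ge0 => x /mem_mA [c [d [_ cd _ A0 ->]]].
have [[E _]|[_ -> _]] := pole_orderP cd; first by rewrite E eqxx in A0.
by rewrite opprK divr_ge0.
Qed.

Lemma A_mAab (i j : nat) (a b : 'I_n) : (i <= a)%N -> (a < b)%N -> (b <= j)%N ->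
  vge v (A a b) (- ((b - a)%:R * mAab v A i j)).
Proof.
move=> ia ab bj; have [->|A0] := eqVneq (A a b) 0; first by left.
have ba : 0 < (b - a)%:R :> rat by rewrite ltr0n subn_gt0.
have : - v (A a b) / (b - a)%:R <= mAab v A i j.
  by apply: maxl_ge; apply/mem_mA; exists a, b.
by rewrite ler_pdivrMr // mulrC => h; right; rewrite lerNl.
Qed.

Lemma mAab_le i j i' j' : (i' <= i)%N -> (j <= j')%N -> mAab v A i j <= mAab v A i' j'.
Proof.
move=> ii jj; apply: maxl_le; first exact: mAab_ge0.
move=> x /mem_mA [c [d [ac cd db A0 ->]]]; apply: maxl_ge; apply/mem_mA.
exists c, d; split=> //; [exact: leq_trans ac|exact: leq_trans jj].
Qed.

End PoleOrders.

Theorem theorem1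
  (* the prime p and the algebraically closed residue field k *)
  (p : nat) (p_prime : prime p)
  (k : closedFieldType) (chark : p \in [pchar k])
  (* K complete discretely valued, normalized valuation v, v(t) = -1,
     k embedded in K as coefficient field, every x has a t-adic expansion *)
  (K : fieldType) (v : K -> rat) (v_val : is_valuation v)
  (v_int : forall x : K, x != 0 -> exists z : int, v x = z%:~R)
  (K_complete : v_complete v (fun _ => True))
  (embk : {rmorphism k -> K})
  (embk_unit : forall a : k, a != 0 -> v (embk a) = 0)
  (t : K) (vt : v t = -1)
  (K_exp : forall x : K, exists c : int -> k, expands embk v t x c)
  (* the Galois extension L/K, with its valuation w extending v *)
  (L : splittingFieldType K) (w : L -> rat) (w_val : is_valuation w)
  (w_ext : forall a : K, a != 0 -> w (a%:A) = v a)
  (n : nat) (n_ge2 : (2 <= n)%N)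
  (L_galois : galois 1%VS {:L})
  (L_gal_UT : (('Gal({:L} / 1%VS))%g \isog UTset n p)%g)
  (L_totram : exists x : L, x != 0 /\ w x * (\dim {:L})%:R = 1)
  (L_wild : (p %| \dim {:L})%N)
  (* an algebraic closure Om of K (via emb0), with valuation vO extending v *)
  (Om : closedFieldType) (emb0 : {rmorphism K -> Om})
  (vO : Om -> rat) (vO_val : is_valuation vO)
  (vO_ext : forall a : K, a != 0 -> vO (emb0 a) = v a)
  (Om_alg : forall x : Om, exists P : {poly K}, P != 0 /\ root (map_poly emb0 P) x)
  (* the matrix A and the solution Theta of X^(p) A = X generating L *)
  (A : 'M[K]_n) (A_UT : UTb A)
  (A_coef : forall (i j : 'I_n) (l : int), (i < j)%N ->
      ((p%:Z %| l)%Z || (0 <= l)) -> coef embk v t (A i j) l = 0)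
  (Theta : 'M[L]_n) (Theta_UT : UTb Theta)
  (Theta_sol : frobmx p Theta *m map_mx (in_alg L) A = Theta)
  (L_gen : Lsub Theta 0 n.-1 = fullv)
  (* the integer N, q = p^N *)
  (N : nat)
  (N_big : n%:R * ((p%:R : rat) ^+ (n * n.-1)./2 + 1) * mA v A + p%:R
           < (p%:R : rat) ^ (N%:Z - ((n * n.-1)./2)%:Z))
  (* the indices i < j with j - i <= p + 1 (0-based) *)
  (i j : 'I_n) (lt_ij : (i < j)%N) (jip : (j - i <= p.+1)%N)
  (* the integer R > R_{i,j} prime to p *)
  (R : nat) (R_pos : (0 < R)%N) (R_cop : coprime R p)
  (R_big : Rij v w A Theta (p ^ N) i j < R%:R)
  (* K_R = K(T) with T^q + T^(q-1) = t^R, and t_R *)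
  (T : Om) (T_eq : T ^+ (p ^ N) + T ^+ (p ^ N).-1 = emb0 t ^+ R)
  (tq : Om) (tq_eq : tq ^+ (p ^ N) = emb0 t)
  (tR : Om) (tR_eq : tR ^+ (p ^ N * R) = emb0 t ^+ R * (1 + T^-1)^-1)
  (tR_cong : tR = tq \/ vO tq < vO (tR - tq)) :
  let vKR := nval vO (gen_subfield emb0 T) in
  let s := SR embk v t emb0 vO p A (p ^ N) tR N i j in
  let s1' := s1 embk v t emb0 vO p A (p ^ N) R tR N i j in
  s != 0 /\ s1' != 0 /\
  vKR s = - (p ^ N)%:R * rbr w Theta i j + R%:R /\
  vKR s1' = - (p ^ N)%:R * rbr w Theta i j + R%:R.
Proof.
have A_UT' := UTbP A_UT; have T_UT := UTbP Theta_UT.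
have t_neq0 := t_neq0_of_wild p_prime chark K_exp L_wild A_UT' A_coef Theta_sol L_gen.
have HK : laurent_field p embk v t by [].
have HL : totram_galois v w by [].
case: n n_ge2 L_gal_UT A A_UT A_coef Theta Theta_UT Theta_sol L_gen N_big i j lt_ij jip R_big A_UT' T_UT
  => // n0 _ L_gal A' _ A_coef' Th _ T_sol L_gen' N_big' i' j' ij jip' R_big' A_UT' T_UT.
have [D HD] := deriv_extends HK HL.
have A_pole := pole_orderP HK A_coef'.
have dimE := dimL HK HL L_gal.
have p_gt0 : (0 < p)%N by apply: prime_gt0.
have p0 : (p%:R : rat) != 0 by rewrite pnatr_eq0 -lt0n.
have mA_ge0 : 0 <= mA v A' by apply: (mAab_ge0 HK A_coef').
(* For [N = 0] the right side of the bound is at most 1, while the left side is at least [p]. *)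
have N_gt0 : (0 < N)%N.
  rewrite lt0n; apply/eqP => N0; move: N_big'; rewrite N0 sub0r -exprnN ltNge => /negP[].
  have d1 : (p%:R ^+ (n0.+1 * n0.+1.-1)./2)^-1 <= 1 :> rat.
    by rewrite invf_le1 ?exprn_gt0 ?ltr0n // exprn_ege1 // ler1n.
  apply: (le_trans d1); apply: (@le_trans _ _ p%:R); first by rewrite ler1n.
  by rewrite lerDr !mulr_ge0 // addr_ge0 // exprn_ge0.
have N_big2 : n0.+1%:R * ((\dim {:L})%:R + 1) * mA v A' + p%:R < (p ^ N)%:R / (\dim {:L})%:R :> rat.
  by rewrite dimE !natrX; move: N_big'; rewrite expfzDr // -exprnN -exprnP.
have A_mA (a b : 'I_n0.+1) : (a < b)%N -> vge v (A' a b) (- ((b - a)%:R * mA v A')).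
  by move=> ab; apply: A_mAab => //; rewrite -ltnS ltn_ord.
have [jm [z [lam Hj]]] := jmap_exists HK N_gt0 R_pos R_cop.
apply: (KR_values HK vO_val vO_ext Om_alg N_gt0 R_pos R_cop T_eq tq_eq tR_eq tR_cong A_UT' Hj).
pose rho := Num.max (rbr w Th i' j'.-1) (rbr w Th i'.+1 j').
apply: (S_final HK HL L_gal A_UT' T_UT T_sol L_gen' HD A_pole vO_val vO_ext N_gt0 mA_ge0 A_mA N_big2
  (rho := rho) (mB := mAab v A' i' j') (z := z) (lam := lam) ij jip' _ _ _ R_big' R_pos Hj).
- move=> a b ia ab bj ne.
  (* A proper sub-block exists, so the blocks [(i, j - 1)] and [(i + 1, j)] are nonempty and their
     breaks are genuine, not the default -1. *)
  have lt2 : (i'.+1 < j')%N by move: ne; rewrite xpair_eqE -!val_eqE /=; move: ia ab bj; clear; lia.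
  have jn : (j'.-1 < n0.+1)%N by apply: leq_ltn_trans (leq_pred _) (ltn_ord j').
  have inn : (i'.+1 < n0.+1)%N by apply: ltn_trans (ltn_ord j').
  pose j1 := Ordinal jn; pose i1 := Ordinal inn.
  have rlt c d := @rbr_lt _ _ _ _ _ _ HK _ _ HL _ L_gal _ _ A_UT' T_UT T_sol L_gen' _ HD i' j' c d.
  have ij1 : (i' < j1)%N by rewrite /= ; move: lt2; clear; lia.
  have i1j : (i1 < j')%N by [].
  have j1j : (j1 < j')%N by rewrite /=; move: lt2; clear; lia.
  have h1 : rbr w Th i' j1 + (\dim (fgen Th (pairs_in n0.+1 i' j')))%:R^-1 <= rbr w Th i' j'.
    by apply: rlt => //; [apply: ltnW|apply: ne_left].
  have h2 : rbr w Th i1 j' + (\dim (fgen Th (pairs_in n0.+1 i' j')))%:R^-1 <= rbr w Th i' j'.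
    by apply: rlt => //; apply: ne_right.
  have le (x y c d : 'I_n0.+1) : (x <= c)%N -> (c < d)%N -> (d <= y)%N -> rbr w Th c d <= rbr w Th x y.
    move=> xc cd dy; have [[-> ->]//|ne'] := eqVneq (c, d) (x, y).
    apply: le_trans (rbr_lt HK HL L_gal A_UT' T_UT T_sol L_gen' HD xc cd dy ne').
    by rewrite lerDl invr_ge0.
  split; last by rewrite /rho; case: (leP (rbr w Th i' j'.-1)) => _.
  rewrite /rho le_max; apply/orP.
  (* Every proper sub-block lies in one of these two, and breaks increase with the block. *)
  have [bj1|jb] := leqP b j1; first by left; apply: (le i' j1).
  right; apply: (le i1 j') => //=; rewrite ltn_neqAle ia andbT.
  apply: contraNneq ne => E; rewrite xpair_eqE -!val_eqE /= -E eqxx /=.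
  by move: jb bj lt2; rewrite /=; clear; lia.
- rewrite (mAab_ge0 HK A_coef') /=; apply: (mAab_le HK A_coef') => //.
  by rewrite -ltnS ltn_ord.
move=> a b; exact: A_mAab.
Qed.
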